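(* Let $N$ be a positive integer and let $s$ be an arbitrary complex number such that $s\neq 1$ and $\Re(s) > 1 - 2N$. Let $a$ be a nonzero complex number. Then $$R_N(s,a) = (-1)^{N+1}\frac{2}{\Gamma(s)}\frac{1}{(2\pi a)^{2N}}\int_0^{+\infty}\frac{t^{s+2N-2}}{1+(t/2\pi a)^2}\operatorname{Li}_{1-s}(e^{-t})\,dt$$ provided $|\arg a|<\frac{\pi}{2}$, and $$R_N(s,a) = (-1)^{N+1}\,2\,\frac{(s)_{2N-1}}{(2\pi a)^{2N}}\sum_{k=1}^\infty \frac{\Pi_{s+2N-1}(2\pi a k)}{k^{2N}},$$ $$R_N(s,a) = \frac{(s)_{2N}}{(2N)!}\,a^{s-1}\int_0^{+\infty}\frac{B_{2N}-B_{2N}(t-\lfloor t\rfloor)}{(t+a)^{s+2N}}\,dt$$ provided $|\arg a|<\pi$.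
   Context: All complex powers and $\arg$ are taken with their principal values for $|\arg a|<\pi$. $\zeta(s,a)$ is the Hurwitz zeta function: $\zeta(s,a)=\sum_{n=0}^\infty (n+a)^{-s}$ for $\Re(s)>1$, $a\notin\mathbb{Z}_{\le 0}$, continued meromorphically in $s$ (only a simple pole at $s=1$), and, for fixed $s\ne 1$, analytic in $a$ for $|\arg a|<\pi$. $B_{2n}$ are the even-order Bernoulli numbers, $B_{2N}(t)$ the even-order Bernoulli polynomials, and $(w)_p=\Gamma(w+p)/\Gamma(w)$ is the Pochhammer symbol (for integer $p\ge1$ it is the polynomial $w(w+1)\cdots(w+p-1)$). $1/\Gamma(s)$ is understood as an entire function. For $|\arg a|<\pi$, $s\neq 1$ and a positive integer $N$, the remainder $R_N(s,a)$ is defined by $$\zeta(s,a)=\frac12 a^{-s}+\frac{a^{1-s}}{s-1}+a^{1-s}\left(\sum_{n=1}^{N-1}\frac{B_{2n}}{(2n)!}\frac{(s)_{2n-1}}{a^{2n}}+R_N(s,a)\right),$$ empty sums being zero. The basic terminant is $$\Pi_p(w)=\frac{w^p}{2}\left(e^{\frac{\pi}{2}ip}e^{iw}\,\Gamma(1-p,we^{\frac{\pi}{2}i})+e^{-\frac{\pi}{2}ip}e^{-iw}\,\Gamma(1-p,we^{-\frac{\pi}{2}i})\right),$$ where $\Gamma(1-p,\cdot)$ is the (upper) incomplete gamma function. It is a multivalued function of $w$ (a function on the Riemann surface of the logarithm, with $\arg(we^{\pm\frac{\pi}{2}i})=\arg w\pm\frac{\pi}{2}$ and the incomplete gamma function continued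 analytically from its principal branch), and for fixed $w$ it is entire in $p$. The polylogarithm is $\operatorname{Li}_p(w)=\sum_{n=1}^\infty w^n/n^p$ for $|w|<1$, $p\in\mathbb{C}$. *)

(* Defs.v *)
From Stdlib Require Export Reals Factorial.
From Stdlib Require Import List Lra Lia ClassicalEpsilon.
From Coquelicot Require Export Coquelicot.

Open Scope R_scope.
Open Scope C_scope.

(** * Elementary functions of a complex variable *)

Definition Cexp (z : C) : C := (exp (Re z) * cos (Im z), exp (Re z) * sin (Im z))%R.

(* Values in (-PI, PI]; the negative real axis is sent to PI. *)
Definition Carg (z : C) : R :=
  if Rle_dec 0 (Im z) then acos (Re z / Cmod z) else (- acos (Re z / Cmod z))%R.

Definition Clog (z : C) : C := (ln (Cmod z), Carg z).

Definition Cpower (z w : C) : C := Cexp (w * Clog z).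

(** * Limits, series and improper integrals with values in C *)

Definition Clim_seq (u : nat -> C) : C :=
  iota (T := C_CompleteNormedModule) (fun l : C => filterlim u eventually (locally l)).

Definition is_Cseries (u : nat -> C) (l : C) : Prop :=
  is_series (K := C_AbsRing) (V := C_NormedModule) u l.

Definition Cseries (u : nat -> C) : C :=
  iota (T := C_CompleteNormedModule) (is_Cseries u).

Definition is_CRInt_gen (f : R -> C) (Fa Fb : (R -> Prop) -> Prop) (l : C) : Prop :=
  is_RInt_gen (V := C_R_NormedModule) f Fa Fb l.

Definition CRInt_gen (f : R -> C) (Fa Fb : (R -> Prop) -> Prop) : C :=
  RInt_gen (V := C_R_CompleteNormedModule) f Fa Fb.

(** * Analytic continuation *)

Definition analytic_at (f : C -> C) (z0 : C) : Prop :=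
  exists (c : nat -> C) (r : R), (0 < r)%R /\
    forall z : C, (Cmod (z - z0) < r)%R ->
      is_pseries (K := C_AbsRing) (V := C_NormedModule) c (z - z0) (f z).

(* [g] continues [f] from the open set [U] to the connected open set [D]
   containing [U]; by the identity theorem [g] is then unique on [D]. *)
Definition is_analytic_continuation (U D : C -> Prop) (f g : C -> C) : Prop :=
  (forall z : C, U z -> g z = f z) /\ (forall z : C, D z -> analytic_at g z).

Definition analytic_continuation (U D : C -> Prop) (f : C -> C) : C -> C :=
  epsilon (inhabits f) (is_analytic_continuation U D f).

(** * Bernoulli numbers and polynomials, Pochhammer symbol, 1 / Gamma *)

(* [B_0; ...; B_n], from sum_(k <= m) C(m+1, k) B_k = 0 for m >= 1. *)
Fixpoint bernoulli_list (n : nat) : list R :=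
  match n with
  | O => 1%R :: nil
  | S m =>
      let l := bernoulli_list m in
      l ++ (- / INR (m + 2) *
            sum_f_R0 (fun k => Binomial.C (m + 2) k * nth k l 0) m)%R :: nil
  end.

Definition bernoulli (n : nat) : R := nth n (bernoulli_list n) 0%R.

Definition bernoulli_poly (n : nat) (t : R) : R :=
  sum_f_R0 (fun k => Binomial.C n k * bernoulli k * t ^ (n - k))%R n.

Fixpoint pochhammer (w : C) (p : nat) : C :=
  match p with
  | O => 1
  | S q => pochhammer w q * (w + INR q)
  end.

(* Gauss's product for the entire function 1 / Gamma. *)
Definition rGamma (s : C) : C :=
  Clim_seq (fun n => pochhammer s (S n) / (INR (fact n) * Cpower (INR n) s)).

(** * Hurwitz zeta function and polylogarithm *)

Definition hurwitz_series (a s : C) : C :=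
  Cseries (fun n => Cpower (INR n + a) (- s)).

(* Intended for [a <> 0] with [Rabs (Carg a) < PI] and [s <> 1]. *)
Definition hurwitz_zeta (s a : C) : C :=
  analytic_continuation (fun z => (1 < Re z)%R) (fun z => z <> 1)
    (hurwitz_series a) s.

Definition polylog (p w : C) : C :=
  Cseries (fun n => w ^ S n / Cpower (INR (S n)) p).

(** * Incomplete gamma function and the basic terminant *)

(* Principal branch of Gamma(alpha, z) for [z <> 0], [Rabs (Carg z) < PI]: the
   integral of u^(alpha-1) e^(-u) along the ray u = z + t, which avoids the cut. *)
Definition inc_gamma (alpha z : C) : C :=
  CRInt_gen (fun t : R => Cpower (z + t) (alpha - 1) * Cexp (- (z + t)))
    (at_point 0%R) (Rbar_locally p_infty).

(* Points of the Riemann surface of the logarithm are represented by their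
   logarithm [L], so that [Im L] is the argument of [Cexp L]; the strip
   [Rabs (Im L) < PI] is the principal sheet. *)
Definition inc_gamma_log (alpha L : C) : C :=
  analytic_continuation (fun z => (Rabs (Im z) < PI)%R) (fun _ => True)
    (fun z => inc_gamma alpha (Cexp z)) L.

(* Pi_p(w) for the point w of the Riemann surface with logarithm [L]. *)
Definition terminant_log (p L : C) : C :=
  let w := Cexp L in
  let h := Ci * (PI / 2)%R in
  Cexp (p * L) / 2 *
    (Cexp (h * p) * Cexp (Ci * w) * inc_gamma_log (1 - p) (L + h) +
     Cexp (- h * p) * Cexp (- Ci * w) * inc_gamma_log (1 - p) (L - h)).

Definition terminant (p w : C) : C := terminant_log p (Clog w).

(** * The remainder of the large-[a] expansion *)

Definition hurwitz_sum (N : nat) (s a : C) : C :=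
  sum_n_m (G := C_AbelianMonoid)
    (fun n => (bernoulli (2 * n) / INR (fact (2 * n)))%R *
              (pochhammer s (2 * n - 1) / a ^ (2 * n)))
    1 (N - 1).

Definition hurwitz_remainder (N : nat) (s a : C) : C :=
  (hurwitz_zeta s a - / 2 * Cpower a (- s) - Cpower a (1 - s) / (s - 1))
    / Cpower a (1 - s)
  - hurwitz_sum N s a.

Lemma Cexp_neq_0 (z : C) : Cexp z <> 0.
Proof.
intros H. injection H as H1 H2.
assert (He := exp_pos (Re z)). assert (Hs := sin2_cos2 (Im z)).
unfold Rsqr in Hs.
assert (cos (Im z) = 0)%R
  by (destruct (Rmult_integral _ _ H1); [lra | assumption]).
assert (sin (Im z) = 0)%R
  by (destruct (Rmult_integral _ _ H2); [lra | assumption]).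
nra.
Qed.

(* The equation that defines the remainder. *)
Lemma hurwitz_remainder_spec (N : nat) (s a : C) :
  hurwitz_zeta s a =
    / 2 * Cpower a (- s) + Cpower a (1 - s) / (s - 1)
    + Cpower a (1 - s) * (hurwitz_sum N s a + hurwitz_remainder N s a).
Proof.
unfold hurwitz_remainder.
assert (H := Cexp_neq_0 ((1 - s) * Clog a) : Cpower a (1 - s) <> 0).
set (q := Cpower a (1 - s) / (s - 1)).
field. exact H.
Qed.

(* Main.v *)
Require Import Defs.
From Stdlib Require Import Lra Lia ClassicalEpsilon List.

(** All three formulas are forms of one Euler-Maclaurin remainder, and the work
    lies in passing from one form to the next.  Throughout, [p = s + 2 N - 1], so
    that [Re p > 0].

    Third formula.  Integrating by parts on unit intervals turns the partial sums
    of [sum (n + a)^(-s)] into explicit boundary terms plus an integral of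
    [B_2N - B_2N (t - floor t)] against [(t + a)^(-s-2N)].  Because the constant
    [B_2N] stays in the numerator, the numerator vanishes at the integers and the
    boundary terms stop at [B_(2N-2)], which is where the definition of the
    remainder truncates.  The integral converges as soon as [Re s > 1 - 2 N]
    ([em_I_correct]) and is analytic in [s] ([em_I_analytic]).  Together with the
    boundary terms it does not depend on [N], being the limit of the corrected
    partial sums ([em_limit], [em_value_S]).  These totals, one for each half-plane, therefore glue to an
    analytic function off [1] that agrees with the Dirichlet series for
    [Re s > 1]; by the identity theorem it is the Hurwitz zeta function
    ([hurwitz_zeta_em]), and the third formula is what remains after subtracting
    the boundary terms.

    Second formula.  The numerator is [c_N sum_k (1 - cos (2 pi k t)) / (2 pi k)^(2N)]
    ([bernoulli_gap_series]), proved for [N = 1] with the Dirichlet kernel and then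
    by induction on [N].  Termwise integration reduces the claim to the evaluation
    of the integral of [(1 - cos (om t)) (t + a)^(-p-1)] as
    [Pi_p (om a) / (p a^p)] ([terminant_ray]).  For that, the two incomplete gamma
    functions inside the terminant are followed along the ray [om (t + a)]: as
    functions of the logarithm [L] they are entire with the elementary derivative
    [- e^((1-p) L - e^L)] ([inc_gamma_log_spec]), and half of
    their sum, added to [(1 - cos (om t)) (om (t + a))^(-p)], is up to a constant
    factor a primitive of the integrand.  When
    [Re a <= 0] the points [om a e^(+-i pi/2)] may lie off the principal sheet,
    but for large [t] the ray is back on it, and there the Stieltjes form
    [e^(-z) z^(1-p) / Gamma p * int t^(p-1) e^(-t) / (t + z) dt] of the incomplete
    gamma function ([inc_gamma_eq]) shows that the primitive tends to zero.

    First formula.  For [Re w > 0] both incomplete gamma functions are on the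
    principal sheet, and the sum of the two Stieltjes integrals is
    [Gamma p * Pi_p w = int t^(p-1) e^(-t) / (1 + (t/w)^2) dt] ([terminant_right]).
    Taking [w = 2 pi a k], replacing [t] by [k t] and summing over [k] produces the
    polylogarithm under the integral ([polylog_integral]).  The factor
    [(s)_(2N-1) / Gamma p] is then [1 / Gamma s]; since the latter is given by
    Gauss's product, this needs Gauss's limit for Euler's integral
    ([Gamma_gauss]), obtained from the concentration of the density
    [t^n e^(-t) / n!] near [t = n].

    Apart from rational factors, analyticity comes from a Taylor bound for the
    exponential that is geometric in the order ([Cexp_taylor]): series and integrals
    of exponentials inherit it with the same majorant ([analytic_exp_series],
    [analytic_exp_integral]). *)

Open Scope R_scope.
Open Scope C_scope.

(** * Complex numbers *)

Lemma Ceq (x y : C) : Re x = Re y -> Im x = Im y -> x = y.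
Proof. destruct x, y. simpl. intros; subst; reflexivity. Qed.

Lemma Cmod_minus_sym (x y : C) : Cmod (x - y) = Cmod (y - x).
Proof. rewrite <- Cmod_opp. f_equal. ring. Qed.

Lemma Cmod_triangle_rev (x y : C) : (Cmod x - Cmod y <= Cmod (x + y))%R.
Proof.
assert (H := Cmod_triangle (x + y) (- y)).
replace (x + y + - y) with x in H by ring. rewrite Cmod_opp in H. lra.
Qed.

Lemma im_le_Cmod (z : C) : (Rabs (Im z) <= Cmod z)%R.
Proof. eapply Rle_trans; [apply Rmax_r | apply (Rmax_Cmod z)]. Qed.

Lemma Cmod_le_sum (z : C) : (Cmod z <= Rabs (Re z) + Rabs (Im z))%R.
Proof.
replace z with (RtoC (Re z) + Ci * RtoC (Im z)) at 1
  by (apply Ceq; simpl; ring).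
eapply Rle_trans; [apply Cmod_triangle|].
rewrite Cmod_mult, Cmod_Ci, !Cmod_R. lra.
Qed.

Lemma Cmod_small_eq (x y : C) :
  (forall e : R, (0 < e)%R -> (Cmod (x - y) <= e)%R) -> x = y.
Proof.
intros H.
assert (E : Cmod (x - y) = 0%R).
{ destruct (Rle_lt_dec (Cmod (x - y)) 0) as [h|h].
  - assert (h2 := Cmod_ge_0 (x - y)). lra.
  - specialize (H (Cmod (x - y) / 2)%R ltac:(lra)). lra. }
apply Cmod_eq_0 in E. replace x with (x - y + y) by ring. rewrite E. ring.
Qed.

(** * Limits of complex-valued functions *)

(** Convergence stated through the modulus, the form in which estimates produce it. *)
Definition Clim {T : Type} (F : (T -> Prop) -> Prop) (f : T -> C) (l : C) : Prop :=
  forall e : R, (0 < e)%R -> F (fun x => (Cmod (f x - l) < e)%R).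

Lemma Clim_filterlim {T : Type} (F : (T -> Prop) -> Prop) {FF : Filter F} f l :
  Clim F f l <-> filterlim f F (locally l).
Proof.
split.
- intros H. apply filterlim_locally. intros eps.
  generalize (H eps (cond_pos eps)). apply filter_imp. intros x Hx.
  apply C_NormedModule_mixin_compat1. exact Hx.
- intros H e He.
  assert (Hs : (0 < sqrt 2)%R) by (apply sqrt_lt_R0; lra).
  assert (He2 : (0 < e / sqrt 2)%R) by (apply Rdiv_lt_0_compat; lra).
  assert (H' := proj1 (filterlim_locally f l) H (mkposreal _ He2)).
  revert H'. apply filter_imp. intros x Hx.
  apply C_NormedModule_mixin_compat2 in Hx. simpl in Hx.
  replace e with (sqrt 2 * (e / sqrt 2))%R by (field; lra). exact Hx.
Qed.

Lemma norm_C_R (z : C) : @norm R_AbsRing C_R_NormedModule z = Cmod z.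
Proof.
destruct z as [x y]. unfold norm. simpl. unfold prod_norm, Cmod, norm. simpl.
unfold abs. simpl. f_equal. rewrite !Rmult_1_r.
rewrite <- !Rabs_mult. rewrite !Rabs_right; [reflexivity| |];
  apply Rle_ge, Rle_0_sqr.
Qed.

Lemma scal_C_R (x : R) (z : C) : @scal R_AbsRing C_R_NormedModule x z = x * z.
Proof. destruct z as [a b]. apply Ceq; simpl; unfold scal; simpl; unfold mult; simpl; ring. Qed.

Section ClimRules.
Context {T : Type} (F : (T -> Prop) -> Prop) {FF : Filter F}.

Lemma Clim_const (l : C) : Clim F (fun _ => l) l.
Proof.
intros e He. apply filter_forall. intros _.
replace (l - l) with (RtoC 0) by ring. rewrite Cmod_0. exact He.
Qed.

Lemma Clim_ext_loc (f g : T -> C) l : F (fun x => f x = g x) -> Clim F f l -> Clim F g l.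
Proof.
intros Hfg Hf e He. generalize (filter_and (F:=F) _ _ Hfg (Hf e He)).
apply filter_imp. intros x [<- h]. exact h.
Qed.

Lemma Clim_ext (f g : T -> C) l : (forall x, f x = g x) -> Clim F f l -> Clim F g l.
Proof. intros H. apply Clim_ext_loc. apply filter_forall. exact H. Qed.

Lemma Clim_plus f g lf lg :
  Clim F f lf -> Clim F g lg -> Clim F (fun x => f x + g x) (lf + lg).
Proof.
intros Hf Hg e He.
generalize (filter_and (F:=F) _ _ (Hf (e/2)%R ltac:(lra)) (Hg (e/2)%R ltac:(lra))).
apply filter_imp. intros x [h1 h2].
replace (f x + g x - (lf + lg)) with ((f x - lf) + (g x - lg)) by ring.
eapply Rle_lt_trans; [apply Cmod_triangle|]. lra.
Qed.

Lemma Clim_squeeze0 f (g : T -> R) :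
  F (fun x => (Cmod (f x) <= g x)%R) -> filterlim g F (locally 0%R) -> Clim F f 0.
Proof.
intros H Hg e He.
assert (Hg' := proj1 (filterlim_locally g 0%R) Hg (mkposreal e He)).
generalize (filter_and (F:=F) _ _ H Hg'). apply filter_imp. intros x [h1 h2].
replace (f x - 0) with (f x) by ring.
unfold ball in h2; simpl in h2; unfold AbsRing_ball, abs, minus, plus, opp in h2; simpl in h2.
apply Rabs_def2 in h2. lra.
Qed.

Lemma Clim_scal (c : C) f lf : Clim F f lf -> Clim F (fun x => c * f x) (c * lf).
Proof.
intros Hf e He.
assert (Hc := Cmod_ge_0 c).
assert (He' : (0 < e / (Cmod c + 1))%R) by (apply Rdiv_lt_0_compat; lra).
generalize (Hf _ He'). apply filter_imp. intros x h.
replace (c * f x - c * lf) with (c * (f x - lf)) by ring. rewrite Cmod_mult.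
assert (h0 := Cmod_ge_0 (f x - lf)).
apply Rle_lt_trans with ((Cmod c + 1) * Cmod (f x - lf))%R; [nra|].
apply (Rmult_lt_compat_l (Cmod c + 1)) in h; [|lra].
replace ((Cmod c + 1) * (e / (Cmod c + 1)))%R with e in h by (field; lra). exact h.
Qed.

Lemma Clim_mult f g lf lg :
  Clim F f lf -> Clim F g lg -> Clim F (fun x => f x * g x) (lf * lg).
Proof.
intros Hf Hg.
assert (H0 : Clim F (fun x => (f x - lf) * (g x - lg)) 0).
{ intros e He.
  generalize (filter_and (F:=F) _ _ (Hf e He) (Hg 1%R ltac:(lra))).
  apply filter_imp. intros x [h1 h2].
  replace ((f x - lf) * (g x - lg) - 0) with ((f x - lf) * (g x - lg)) by ring.
  rewrite Cmod_mult. assert (h3 := Cmod_ge_0 (f x - lf)).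
  assert (h4 := Cmod_ge_0 (g x - lg)). nra. }
assert (H := Clim_plus _ _ _ _ (Clim_plus _ _ _ _ H0 (Clim_scal lg _ _ Hf))
               (Clim_plus _ _ _ _ (Clim_scal lf _ _ Hg) (Clim_const (- (lf * lg))))).
replace (lf * lg) with (0 + lg * lf + (lf * lg + - (lf * lg))) by ring.
revert H. apply Clim_ext. intros x. ring.
Qed.

Lemma Clim_opp f l : Clim F f l -> Clim F (fun x => - f x) (- l).
Proof.
intros H. replace (- l) with (- (1) * l) by ring.
apply Clim_ext with (fun x => - (1) * f x); [intros; ring|]. now apply Clim_scal.
Qed.

Lemma Clim_minus f g lf lg :
  Clim F f lf -> Clim F g lg -> Clim F (fun x => f x - g x) (lf - lg).
Proof. intros Hf Hg. apply Clim_plus; [exact Hf | now apply Clim_opp]. Qed.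

Lemma Clim_inv f (l : C) : l <> 0 -> Clim F f l -> Clim F (fun x => / f x) (/ l).
Proof.
intros Hl Hf e He.
assert (Hm : (0 < Cmod l)%R) by (apply (proj1 (Cmod_gt_0 l)); exact Hl).
assert (He' : (0 < e * Cmod l * Cmod l / 2)%R) by (apply Rdiv_lt_0_compat; [repeat apply Rmult_lt_0_compat; lra|lra]).
generalize (filter_and (F:=F) _ _ (Hf _ He') (Hf (Cmod l / 2)%R ltac:(lra))).
apply filter_imp. intros x [h1 h2].
assert (h3 : (Cmod l / 2 < Cmod (f x))%R).
{ assert (h := Cmod_triangle_rev l (f x - l)).
  replace (l + (f x - l)) with (f x) in h by ring. lra. }
assert (h4 : f x <> 0) by (intros E; rewrite E, Cmod_0 in h3; lra).
replace (/ f x - / l) with (- (f x - l) / (f x * l)) by (field; split; auto).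
rewrite Cmod_div, Cmod_opp, Cmod_mult by (apply Cmult_neq_0; auto).
apply Rmult_lt_reg_r with (Cmod (f x) * Cmod l)%R; [apply Rmult_lt_0_compat; lra|].
unfold Rdiv. rewrite Rmult_assoc, Rinv_l by (apply Rgt_not_eq, Rmult_lt_0_compat; lra).
rewrite Rmult_1_r. eapply Rlt_le_trans; [exact h1|].
assert (0 < e * Cmod l)%R by (apply Rmult_lt_0_compat; lra). nra.
Qed.

Lemma Clim_RtoC (f : T -> R) (l : R) :
  filterlim f F (locally l) -> Clim F (fun x => RtoC (f x)) l.
Proof.
intros Hf e He. assert (H := proj1 (filterlim_locally f l) Hf (mkposreal e He)).
revert H. apply filter_imp. intros x h. rewrite <- RtoC_minus, Cmod_R. exact h.
Qed.

Lemma Clim_Cmod f l : Clim F f l -> filterlim (fun x => Cmod (f x)) F (locally (Cmod l)).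
Proof.
intros H. apply filterlim_locally. intros eps. generalize (H eps (cond_pos eps)).
apply filter_imp. intros x h.
unfold ball; simpl; unfold AbsRing_ball, abs, minus, plus, opp; simpl.
assert (h1 := Cmod_triangle_rev (f x) (- l)). assert (h2 := Cmod_triangle_rev l (- f x)).
rewrite !Cmod_opp in *. assert (h3 := Cmod_minus_sym (f x) l). unfold Cminus in *.
apply Rabs_def1; lra.
Qed.

End ClimRules.

Lemma Clim_le {T} (F : (T -> Prop) -> Prop) {FF : ProperFilter F} f l (B : R) :
  F (fun x => (Cmod (f x) <= B)%R) -> Clim F f l -> (Cmod l <= B)%R.
Proof.
intros H1 H2. apply Rnot_lt_le. intros h.
destruct (filter_ex _ (filter_and (F:=F) _ _ H1 (H2 (Cmod l - B)%R ltac:(lra)))) as [x [h1 h2]].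
assert (h3 := Cmod_triangle_rev l (f x - l)). replace (l + (f x - l)) with (f x) in h3 by ring.
lra.
Qed.

Lemma Clim_unique {T} (F : (T -> Prop) -> Prop) {FF : ProperFilter F} f l1 l2 :
  Clim F f l1 -> Clim F f l2 -> l1 = l2.
Proof.
intros H1 H2. apply Cmod_small_eq. intros e He.
apply (Clim_le F (fun x => f x - f x)); [|now apply Clim_minus; [apply filter_filter| |]].
apply filter_forall. intros x. replace (f x - f x) with (RtoC 0) by ring. rewrite Cmod_0. lra.
Qed.

Lemma Clim_comp {T U} (F : (T -> Prop) -> Prop) (G : (U -> Prop) -> Prop) (g : T -> U) f l :
  filterlim g F G -> Clim G f l -> Clim F (fun x => f (g x)) l.
Proof. intros Hg Hf e He. apply (Hg _ (Hf e He)). Qed.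

(** * Derivatives in a complex and in a real variable *)

Lemma locally_R (P : R -> Prop) (t d : R) :
  (0 < d)%R -> (forall y : R, (Rabs (y - t) < d)%R -> P y) -> locally t P.
Proof. intros Hd H. exists (mkposreal d Hd). intros y Hy. apply H. exact Hy. Qed.

Lemma locally_Cmod (P : C -> Prop) (z : C) (d : R) :
  (0 < d)%R -> (forall y : C, (Cmod (y - z) < d)%R -> P y) -> locally z P.
Proof.
intros Hd H.
assert (Hid : Clim (locally z) (fun x => x) z)
  by (apply Clim_filterlim; [apply locally_filter | apply filterlim_id]).
generalize (Hid _ Hd). apply filter_imp. exact H.
Qed.

Definition Cder (f : C -> C) (z l : C) : Prop :=
  forall e : R, (0 < e)%R -> exists d : R, (0 < d)%R /\
    forall h : C, (Cmod h < d)%R -> (Cmod (f (z + h)%C - f z - l * h) <= e * Cmod h)%R.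

Definition Rder (f : R -> C) (t : R) (l : C) : Prop :=
  forall e : R, (0 < e)%R -> exists d : R, (0 < d)%R /\
    forall h : R, (Rabs h < d)%R -> (Cmod (f (t + h)%R - f t - l * h) <= e * Rabs h)%R.

Lemma Rder_is_derive f t l :
  Rder f t l -> is_derive (K := R_AbsRing) (V := C_R_NormedModule) f t l.
Proof.
intros H. split; [apply is_linear_scal_l|].
intros x Hx. assert (x = t) by (symmetry; apply is_filter_lim_locally_unique; exact Hx). subst x.
intros eps. destruct (H eps (cond_pos eps)) as [d [Hd Hf]].
apply locally_R with d; [exact Hd|]. intros y Hy.
specialize (Hf (y - t)%R Hy). replace (t + (y - t))%R with y in Hf by ring.
rewrite norm_C_R. rewrite scal_C_R.
change (Cmod (f y - f t - RtoC (y - t) * l) <= eps * Rabs (y - t))%R.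
replace (f y - f t - RtoC (y - t) * l) with (f y - f t - l * RtoC (y - t)) by ring.
exact Hf.
Qed.

Lemma Rder_pair (f : R -> C) t (l : C) :
  is_derive (fun x => fst (f x)) t (fst l) -> is_derive (fun x => snd (f x)) t (snd l) -> Rder f t l.
Proof.
intros [_ H1] [_ H2] e He.
assert (He2 : (0 < e / 2)%R) by lra.
destruct (H1 t (fun P h => h) (mkposreal _ He2)) as [d1 h1].
destruct (H2 t (fun P h => h) (mkposreal _ He2)) as [d2 h2].
exists (Rmin d1 d2). split; [apply Rmin_glb_lt; [apply d1 | apply d2]|].
intros h Hh.
assert (B1 : ball t d1 (t + h)%R).
{ unfold ball; simpl; unfold AbsRing_ball, abs, minus, plus, opp; simpl.
  replace (t + h + - t)%R with h by ring. eapply Rlt_le_trans; [exact Hh | apply Rmin_l]. }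
assert (B2 : ball t d2 (t + h)%R).
{ unfold ball; simpl; unfold AbsRing_ball, abs, minus, plus, opp; simpl.
  replace (t + h + - t)%R with h by ring. eapply Rlt_le_trans; [exact Hh | apply Rmin_r]. }
specialize (h1 _ B1). specialize (h2 _ B2).
unfold norm, scal, minus, plus, opp in h1, h2; simpl in h1, h2. unfold abs, mult in h1, h2; simpl in h1, h2.
replace (t + h + - t)%R with h in h1, h2 by ring.
eapply Rle_trans; [apply Cmod_le_sum|].
destruct l as [l1 l2]. simpl in *.
match goal with |- (Rabs ?a + Rabs ?b <= _)%R =>
  replace a with (fst (f (t + h)%R) + - fst (f t) + - (h * l1))%R by (unfold Re, Im; simpl; ring);
  replace b with (snd (f (t + h)%R) + - snd (f t) + - (h * l2))%R by (unfold Re, Im; simpl; ring) end.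
lra.
Qed.

Lemma Rder_Re f t l : Rder f t l -> is_derive (fun x => Re (f x)) t (Re l).
Proof.
intros H. split; [apply is_linear_scal_l|].
intros x Hx. assert (x = t) by (symmetry; apply is_filter_lim_locally_unique; exact Hx). subst x.
intros eps. destruct (H eps (cond_pos eps)) as [d [Hd Hf]].
apply locally_R with d; [exact Hd|]. intros y Hy.
specialize (Hf (y - t)%R Hy). replace (t + (y - t))%R with y in Hf by ring.
unfold norm, scal, minus, plus, opp; simpl. unfold abs, mult; simpl.
eapply Rle_trans; [|exact Hf].
eapply Rle_trans; [|apply re_le_Cmod]. right. f_equal.
destruct l, (f y), (f t). unfold Re; simpl. ring.
Qed.

Lemma Cder_is_cont f z l : Cder f z l -> Clim (locally z) f (f z).
Proof.
intros H e He. destruct (H 1%R ltac:(lra)) as [d [Hd Hf]].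
assert (Hl := Cmod_ge_0 l).
assert (Hd' : (0 < Rmin d (e / (Cmod l + 2)))%R).
{ apply Rmin_glb_lt; [exact Hd | apply Rdiv_lt_0_compat; lra]. }
apply locally_Cmod with (1 := Hd'). intros x Hx.
assert (h1 : (Cmod (x - z) < d)%R) by (eapply Rlt_le_trans; [exact Hx | apply Rmin_l]).
assert (h2 : (Cmod (x - z) < e / (Cmod l + 2))%R) by (eapply Rlt_le_trans; [exact Hx | apply Rmin_r]).
specialize (Hf _ h1). replace (z + (x - z)) with x in Hf by ring.
replace (f x - f z) with ((f x - f z - l * (x - z)) + l * (x - z)) by ring.
eapply Rle_lt_trans; [apply Cmod_triangle|]. rewrite Cmod_mult.
apply (Rmult_lt_compat_l (Cmod l + 2)) in h2; [|lra].
replace ((Cmod l + 2) * (e / (Cmod l + 2)))%R with e in h2 by (field; lra).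
assert (h3 := Cmod_ge_0 (x - z)). nra.
Qed.

Lemma Rder_cont f t l : Rder f t l -> Clim (locally t) f (f t).
Proof.
intros H e He. destruct (H 1%R ltac:(lra)) as [d [Hd Hf]].
assert (Hl := Cmod_ge_0 l).
assert (Hd' : (0 < Rmin d (e / (Cmod l + 2)))%R).
{ apply Rmin_glb_lt; [exact Hd | apply Rdiv_lt_0_compat; lra]. }
apply locally_R with (1 := Hd'). intros x Hx.
assert (h1 : (Rabs (x - t) < d)%R) by (eapply Rlt_le_trans; [exact Hx | apply Rmin_l]).
assert (h2 : (Rabs (x - t) < e / (Cmod l + 2))%R) by (eapply Rlt_le_trans; [exact Hx | apply Rmin_r]).
specialize (Hf _ h1). replace (t + (x - t))%R with x in Hf by ring.
replace (f x - f t) with ((f x - f t - l * (x - t)%R) + l * (x - t)%R) by ring.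
eapply Rle_lt_trans; [apply Cmod_triangle|]. rewrite Cmod_mult, Cmod_R.
apply (Rmult_lt_compat_l (Cmod l + 2)) in h2; [|lra].
replace ((Cmod l + 2) * (e / (Cmod l + 2)))%R with e in h2 by (field; lra).
assert (h3 := Rabs_pos (x - t)). nra.
Qed.

Lemma Rder_ext_loc f g t l : locally t (fun x => f x = g x) -> Rder f t l -> Rder g t l.
Proof.
intros [d1 H1] H e He. destruct (H e He) as [d [Hd Hf]].
exists (Rmin d d1). split; [apply Rmin_glb_lt; [exact Hd | apply d1]|].
intros h Hh. rewrite <- (H1 (t + h)%R), <- (H1 t).
- apply Hf. eapply Rlt_le_trans; [exact Hh | apply Rmin_l].
- apply ball_center.
- unfold ball; simpl; unfold AbsRing_ball, abs, minus, plus, opp; simpl.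
  replace (t + h + - t)%R with h by ring. eapply Rlt_le_trans; [exact Hh | apply Rmin_r].
Qed.

Lemma Rder_ext f g t l : (forall x, f x = g x) -> Rder f t l -> Rder g t l.
Proof. intros H. apply Rder_ext_loc. apply filter_forall. exact H. Qed.

Lemma Cder_ext f g z l : (forall x, f x = g x) -> Cder f z l -> Cder g z l.
Proof. intros H Hf e He. destruct (Hf e He) as [d [Hd h]]. exists d. split; [exact Hd|].
intros k Hk. rewrite <- !H. now apply h. Qed.

Lemma Rder_Cder (F : C -> C) (g : R -> C) t l v :
  Cder F (g t) l -> Rder g t v -> Rder (fun x => F (g x)) t (l * v).
Proof.
intros HF Hg e He.
assert (Hl := Cmod_ge_0 l). assert (Hv := Cmod_ge_0 v).
set (e1 := (e / (Cmod v + 2) / 2)%R).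
assert (He1 : (0 < e1)%R) by (unfold e1; repeat apply Rdiv_lt_0_compat; lra).
destruct (HF e1 He1) as [d1 [Hd1 h1]].
set (e2 := Rmin 1 (e / (Cmod l + 1) / 2)).
assert (He2 : (0 < e2)%R) by (unfold e2; apply Rmin_glb_lt; [lra | repeat apply Rdiv_lt_0_compat; lra]).
destruct (Hg e2 He2) as [d2 [Hd2 h2]].
exists (Rmin d2 (d1 / (Cmod v + 2))).
split; [apply Rmin_glb_lt; [exact Hd2 | apply Rdiv_lt_0_compat; lra]|].
intros h Hh.
assert (Hh2 : (Rabs h < d2)%R) by (eapply Rlt_le_trans; [exact Hh | apply Rmin_l]).
assert (Hh1 : (Rabs h < d1 / (Cmod v + 2))%R) by (eapply Rlt_le_trans; [exact Hh | apply Rmin_r]).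
specialize (h2 h Hh2).
assert (Hah := Rabs_pos h).
set (k := g (t + h)%R - g t) in *.
assert (Hk0 : (Cmod k <= Cmod v * Rabs h + Rabs h)%R).
{ replace k with ((k - v * h) + v * h) by ring.
  eapply Rle_trans; [apply Cmod_triangle|]. rewrite Cmod_mult, Cmod_R.
  assert (e2 <= 1)%R by apply Rmin_l. nra. }
assert (Hk : (Cmod k < d1)%R).
{ apply (Rmult_lt_compat_l (Cmod v + 2)) in Hh1; [|lra].
  replace ((Cmod v + 2) * (d1 / (Cmod v + 2)))%R with d1 in Hh1 by (field; lra). nra. }
specialize (h1 k Hk).
replace (g t + k) with (g (t + h)%R) in h1 by (unfold k; ring).
replace (F (g (t + h)%R) - F (g t) - l * v * h) with
  ((F (g (t + h)%R) - F (g t) - l * k) + l * (k - v * h)) by ring.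
eapply Rle_trans; [apply Cmod_triangle|]. rewrite Cmod_mult.
assert (A1 : (e1 * Cmod k <= e / 2 * Rabs h)%R).
{ apply Rle_trans with (e1 * ((Cmod v + 2) * Rabs h))%R; [apply Rmult_le_compat_l; [lra|nra]|].
  unfold e1. right. field. lra. }
assert (A2 : (Cmod l * (e2 * Rabs h) <= e / 2 * Rabs h)%R).
{ assert (e2 <= e / (Cmod l + 1) / 2)%R by apply Rmin_r.
  apply Rle_trans with ((Cmod l + 1) * (e / (Cmod l + 1) / 2 * Rabs h))%R.
  - apply Rmult_le_compat; try lra; [apply Rmult_le_pos; lra|]. apply Rmult_le_compat_r; lra.
  - right. field. lra. }
assert (A3 : (Cmod l * Cmod (k - v * h) <= Cmod l * (e2 * Rabs h))%R) by (apply Rmult_le_compat_l; lra).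
lra.
Qed.

Lemma Cder_comp (F g : C -> C) z l v :
  Cder F (g z) l -> Cder g z v -> Cder (fun x => F (g x)) z (l * v).
Proof.
intros HF Hg e He.
assert (Hl := Cmod_ge_0 l). assert (Hv := Cmod_ge_0 v).
set (e1 := (e / (Cmod v + 2) / 2)%R).
assert (He1 : (0 < e1)%R) by (unfold e1; repeat apply Rdiv_lt_0_compat; lra).
destruct (HF e1 He1) as [d1 [Hd1 h1]].
set (e2 := Rmin 1 (e / (Cmod l + 1) / 2)).
assert (He2 : (0 < e2)%R) by (unfold e2; apply Rmin_glb_lt; [lra | repeat apply Rdiv_lt_0_compat; lra]).
destruct (Hg e2 He2) as [d2 [Hd2 h2]].
exists (Rmin d2 (d1 / (Cmod v + 2))).
split; [apply Rmin_glb_lt; [exact Hd2 | apply Rdiv_lt_0_compat; lra]|].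
intros h Hh.
assert (Hh2 : (Cmod h < d2)%R) by (eapply Rlt_le_trans; [exact Hh | apply Rmin_l]).
assert (Hh1 : (Cmod h < d1 / (Cmod v + 2))%R) by (eapply Rlt_le_trans; [exact Hh | apply Rmin_r]).
specialize (h2 h Hh2).
assert (Hah := Cmod_ge_0 h).
set (k := g (z + h) - g z) in *.
assert (Hk0 : (Cmod k <= Cmod v * Cmod h + Cmod h)%R).
{ replace k with ((k - v * h) + v * h) by ring.
  eapply Rle_trans; [apply Cmod_triangle|]. rewrite Cmod_mult.
  assert (e2 <= 1)%R by apply Rmin_l. nra. }
assert (Hk : (Cmod k < d1)%R).
{ apply (Rmult_lt_compat_l (Cmod v + 2)) in Hh1; [|lra].
  replace ((Cmod v + 2) * (d1 / (Cmod v + 2)))%R with d1 in Hh1 by (field; lra). nra. }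
specialize (h1 k Hk).
replace (g z + k) with (g (z + h)) in h1 by (unfold k; ring).
replace (F (g (z + h)) - F (g z) - l * v * h) with
  ((F (g (z + h)) - F (g z) - l * k) + l * (k - v * h)) by ring.
eapply Rle_trans; [apply Cmod_triangle|]. rewrite Cmod_mult.
assert (A1 : (e1 * Cmod k <= e / 2 * Cmod h)%R).
{ apply Rle_trans with (e1 * ((Cmod v + 2) * Cmod h))%R; [apply Rmult_le_compat_l; [lra|nra]|].
  unfold e1. right. field. lra. }
assert (A2 : (Cmod l * (e2 * Cmod h) <= e / 2 * Cmod h)%R).
{ assert (e2 <= e / (Cmod l + 1) / 2)%R by apply Rmin_r.
  apply Rle_trans with ((Cmod l + 1) * (e / (Cmod l + 1) / 2 * Cmod h))%R.
  - apply Rmult_le_compat; try lra; [apply Rmult_le_pos; lra|]. apply Rmult_le_compat_r; lra.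
  - right. field. lra. }
assert (A3 : (Cmod l * Cmod (k - v * h) <= Cmod l * (e2 * Cmod h))%R) by (apply Rmult_le_compat_l; lra).
lra.
Qed.

Lemma Cder_const c z : Cder (fun _ => c) z 0.
Proof.
intros e He. exists 1%R. split; [lra|]. intros h _.
replace (c - c - 0 * h) with (RtoC 0) by ring. rewrite Cmod_0.
apply Rmult_le_pos; [lra | apply Cmod_ge_0].
Qed.

Lemma Cder_id z : Cder (fun x => x) z 1.
Proof.
intros e He. exists 1%R. split; [lra|]. intros h _.
replace (z + h - z - 1 * h) with (RtoC 0) by ring. rewrite Cmod_0.
apply Rmult_le_pos; [lra | apply Cmod_ge_0].
Qed.

Lemma Cder_scal c z : Cder (fun x => c * x) z c.
Proof.
intros e He. exists 1%R. split; [lra|]. intros h _.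
replace (c * (z + h) - c * z - c * h) with (RtoC 0) by ring. rewrite Cmod_0.
apply Rmult_le_pos; [lra | apply Cmod_ge_0].
Qed.

Lemma Cder_plus f g z lf lg :
  Cder f z lf -> Cder g z lg -> Cder (fun x => f x + g x) z (lf + lg).
Proof.
intros Hf Hg e He.
destruct (Hf (e/2)%R ltac:(lra)) as [d1 [Hd1 h1]].
destruct (Hg (e/2)%R ltac:(lra)) as [d2 [Hd2 h2]].
exists (Rmin d1 d2). split; [now apply Rmin_glb_lt|].
intros h Hh. specialize (h1 h (Rlt_le_trans _ _ _ Hh (Rmin_l _ _))).
specialize (h2 h (Rlt_le_trans _ _ _ Hh (Rmin_r _ _))).
replace (f (z + h) + g (z + h) - (f z + g z) - (lf + lg) * h) with
  ((f (z + h) - f z - lf * h) + (g (z + h) - g z - lg * h)) by ring.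
eapply Rle_trans; [apply Cmod_triangle|]. lra.
Qed.

(** The product rule follows from this case by polarization. *)
Lemma Cder_sqr z : Cder (fun x => x * x) z (2 * z).
Proof.
intros e He. exists e. split; [lra|]. intros h Hh.
replace ((z + h) * (z + h) - z * z - 2 * z * h) with (h * h) by ring.
rewrite Cmod_mult. apply Rmult_le_compat_r; [apply Cmod_ge_0 | lra].
Qed.

Lemma Cder_mult f g z lf lg :
  Cder f z lf -> Cder g z lg -> Cder (fun x => f x * g x) z (lf * g z + f z * lg).
Proof.
intros Hf Hg.
assert (Hs := Cder_plus _ _ _ _ _ Hf Hg).
assert (H1 := Cder_comp (fun x => x * x) (fun x => f x + g x) _ _ _ (Cder_sqr (f z + g z)) Hs).
assert (H2 := Cder_comp (fun x => - (1) * x) (fun x => f x * f x) _ _ _ (Cder_scal (- (1)) (f z * f z))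
                (Cder_comp (fun x => x * x) f _ _ _ (Cder_sqr (f z)) Hf)).
assert (H3 := Cder_comp (fun x => - (1) * x) (fun x => g x * g x) _ _ _ (Cder_scal (- (1)) (g z * g z))
                (Cder_comp (fun x => x * x) g _ _ _ (Cder_sqr (g z)) Hg)).
assert (H4 := Cder_plus _ _ _ _ _ H1 (Cder_plus _ _ _ _ _ H2 H3)).
assert (H5 := Cder_comp (fun x => / 2 * x) _ z _ _ (Cder_scal (/ 2) _) H4).
assert (N2 : RtoC 2 <> 0) by (intros E; apply (f_equal fst) in E; simpl in E; lra).
replace (lf * g z + f z * lg) with
  (/ 2 * (2 * (f z + g z) * (lf + lg) + (- (1) * (2 * f z * lf) + - (1) * (2 * g z * lg)))) by (field; exact N2).
revert H5. apply Cder_ext. intros x. field.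
Qed.

Lemma Rder_id t : Rder (fun x => RtoC x) t 1.
Proof.
intros e He. exists 1%R. split; [lra|]. intros h _.
rewrite RtoC_plus. replace (t + h - t - 1 * h) with (RtoC 0) by ring. rewrite Cmod_0.
apply Rmult_le_pos; [lra | apply Rabs_pos].
Qed.

Lemma Rder_const c t : Rder (fun _ => c) t 0.
Proof.
intros e He. exists 1%R. split; [lra|]. intros h _.
replace (c - c - 0 * h) with (RtoC 0) by ring. rewrite Cmod_0.
apply Rmult_le_pos; [lra | apply Rabs_pos].
Qed.

Lemma Rder_RtoC (f : R -> R) t l : is_derive f t l -> Rder (fun x => RtoC (f x)) t l.
Proof.
intros H. apply Rder_pair; simpl; [exact H|].
apply (is_derive_const (K := R_AbsRing) (V := R_NormedModule)).
Qed.

Lemma Rder_plus f g t lf lg :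
  Rder f t lf -> Rder g t lg -> Rder (fun x => f x + g x) t (lf + lg).
Proof.
intros Hf Hg e He.
destruct (Hf (e/2)%R ltac:(lra)) as [d1 [Hd1 h1]].
destruct (Hg (e/2)%R ltac:(lra)) as [d2 [Hd2 h2]].
exists (Rmin d1 d2). split; [now apply Rmin_glb_lt|].
intros h Hh. specialize (h1 h (Rlt_le_trans _ _ _ Hh (Rmin_l _ _))).
specialize (h2 h (Rlt_le_trans _ _ _ Hh (Rmin_r _ _))).
replace (f (t + h)%R + g (t + h)%R - (f t + g t) - (lf + lg) * h) with
  ((f (t + h)%R - f t - lf * h) + (g (t + h)%R - g t - lg * h)) by ring.
eapply Rle_trans; [apply Cmod_triangle|]. lra.
Qed.

Lemma Rder_scal c f t l : Rder f t l -> Rder (fun x => c * f x) t (c * l).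
Proof. intros H. exact (Rder_Cder (fun x => c * x) f t c l (Cder_scal c _) H). Qed.

Lemma Rder_opp f t l : Rder f t l -> Rder (fun x => - f x) t (- l).
Proof.
intros H. replace (- l) with (- (1) * l) by ring.
apply Rder_ext with (fun x => - (1) * f x); [intros; ring | now apply Rder_scal].
Qed.

Lemma Rder_minus f g t lf lg :
  Rder f t lf -> Rder g t lg -> Rder (fun x => f x - g x) t (lf - lg).
Proof. intros Hf Hg. apply Rder_plus; [exact Hf | now apply Rder_opp]. Qed.

Lemma Rder_mult f g t lf lg :
  Rder f t lf -> Rder g t lg -> Rder (fun x => f x * g x) t (lf * g t + f t * lg).
Proof.
intros Hf Hg.
assert (Hs := Rder_plus _ _ _ _ _ Hf Hg).
assert (H1 := Rder_Cder (fun x => x * x) _ _ _ _ (Cder_sqr (f t + g t)) Hs).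
assert (H2 := Rder_Cder (fun x => x * x) _ _ _ _ (Cder_sqr (f t)) Hf).
assert (H3 := Rder_Cder (fun x => x * x) _ _ _ _ (Cder_sqr (g t)) Hg).
assert (H4 := Rder_scal (/ 2) _ _ _ (Rder_minus _ _ _ _ _ (Rder_minus _ _ _ _ _ H1 H2) H3)).
assert (N2 : RtoC 2 <> 0) by (intros E; apply (f_equal fst) in E; simpl in E; lra).
replace (lf * g t + f t * lg) with
  (/ 2 * (2 * (f t + g t) * (lf + lg) - 2 * f t * lf - 2 * g t * lg)) by (field; exact N2).
revert H4. apply Rder_ext. intros x. field.
Qed.

(** Comparison form of the mean value inequality: project onto the direction of
    [f b - f a] to reduce to real functions. *)
Lemma Rder_compare (f : R -> C) (g : R -> R) (f' : R -> C) (g' : R -> R) (a b : R) :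
  (a <= b)%R ->
  (forall t, (a <= t <= b)%R -> Rder f t (f' t)) ->
  (forall t, (a <= t <= b)%R -> is_derive g t (g' t)) ->
  (forall t, (a <= t <= b)%R -> (Cmod (f' t) <= g' t)%R) ->
  (Cmod (f b - f a) <= g b - g a)%R.
Proof.
intros Hab Hf Hg Hle.
set (v := f b - f a). set (m := Cmod v).
destruct (Req_dec m 0) as [Hm|Hm].
- destruct (MVT_gen g a b g') as [c [Hc E]].
  + intros x Hx. apply Hg. rewrite Rmin_left, Rmax_right in Hx; lra.
  + intros x Hx. rewrite Rmin_left, Rmax_right in Hx by lra.
    apply continuity_pt_filterlim. apply (ex_derive_continuous (K := R_AbsRing) (V := R_NormedModule)).
    exists (g' x). apply Hg. lra.
  + rewrite Rmin_left, Rmax_right in Hc by lra.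
    rewrite Hm, E. apply Rmult_le_pos; [|lra].
    eapply Rle_trans; [apply Cmod_ge_0 | apply Hle; lra].
- assert (Hm0 : (0 < m)%R) by (assert (H := Cmod_ge_0 v); unfold m in *; lra).
  (* Were the claim false, [h] would increase; its derivative is nonpositive. *)
  set (h := fun t => (Re (Cconj v * f t) - m * g t)%R).
  destruct (MVT_gen h a b (fun t => (Re (Cconj v * f' t) - m * g' t)%R)) as [c [Hc E]].
  + intros x Hx. rewrite Rmin_left, Rmax_right in Hx by lra.
    apply (is_derive_minus (K := R_AbsRing) (V := R_NormedModule)).
    * apply (Rder_Re (fun x => Cconj v * f x)). apply Rder_scal. apply Hf. lra.
    * apply is_derive_scal. apply Hg. lra.
  + intros x Hx. rewrite Rmin_left, Rmax_right in Hx by lra.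
    apply continuity_pt_filterlim. apply (ex_derive_continuous (K := R_AbsRing) (V := R_NormedModule)).
    eexists. apply (is_derive_minus (K := R_AbsRing) (V := R_NormedModule)).
    * apply (Rder_Re (fun x => Cconj v * f x)). apply Rder_scal. apply Hf. lra.
    * apply is_derive_scal. apply Hg. lra.
  + rewrite Rmin_left, Rmax_right in Hc by lra.
    assert (H1 : (Re (Cconj v * f' c) <= m * g' c)%R).
    { eapply Rle_trans; [apply Rle_abs|]. eapply Rle_trans; [apply re_le_Cmod|].
      rewrite Cmod_mult, Cmod_conj. apply Rmult_le_compat_l; [apply Cmod_ge_0 | apply Hle; lra]. }
    assert (H2 : (h b - h a <= 0)%R).
    { rewrite E. rewrite <- (Rmult_0_l (b - a)). apply Rmult_le_compat_r; lra. }
    assert (H3 : (h b - h a = m * m - m * (g b - g a))%R).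
    { assert (E3 : (m * m = Re v * Re v + Im v * Im v)%R).
      { generalize (Cmod2_alt v). unfold m. simpl. intros E'. rewrite !Rmult_1_r in E'. exact E'. }
      rewrite E3. unfold h, v. destruct (f a), (f b). unfold Re, Im. simpl. ring. }
    nra.
Qed.

Lemma Rder_zero_const (f : R -> C) a b :
  (a <= b)%R -> (forall t, (a <= t <= b)%R -> Rder f t 0) -> f b = f a.
Proof.
intros Hab H. apply Cmod_small_eq. intros e He.
eapply Rle_trans; [apply (Rder_compare f (fun _ => 0%R) (fun _ => RtoC 0) (fun _ => 0%R)); auto|].
- intros t _. apply (is_derive_const (K := R_AbsRing) (V := R_NormedModule)).
- intros t _. rewrite Cmod_0. lra.
- lra.
Qed.

Lemma RtoC_neq_0 (x : R) : x <> 0%R -> RtoC x <> 0.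
Proof. intros H E. apply H. exact (f_equal fst E). Qed.

(** * Finite sums and series *)

Fixpoint Csum (u : nat -> C) (n : nat) : C :=
  match n with O => 0 | S m => Csum u m + u m end.

Fixpoint Rsum (u : nat -> R) (n : nat) : R :=
  match n with O => 0%R | S m => (Rsum u m + u m)%R end.

Lemma Csum_sum_n (u : nat -> C) n : sum_n (G := C_AbelianMonoid) u n = Csum u (S n).
Proof.
induction n as [|n IH].
- rewrite sum_O. simpl. ring.
- rewrite sum_Sn, IH. reflexivity.
Qed.

Lemma Rsum_sum_n (u : nat -> R) n : sum_n (G := R_AbelianMonoid) u n = Rsum u (S n).
Proof.
induction n as [|n IH].
- rewrite sum_O. simpl. ring.
- rewrite sum_Sn, IH. reflexivity.
Qed.

Lemma eventually_S (P : nat -> Prop) : eventually (fun n => P (S n)) <-> eventually P.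
Proof.
split; intros [N H].
- exists (S N). intros [|n] Hn; [lia|]. apply H. lia.
- exists N. intros n Hn. apply H. lia.
Qed.

Lemma is_Cseries_Clim (u : nat -> C) l : is_Cseries u l <-> Clim eventually (Csum u) l.
Proof.
split; intros H.
- assert (H' := proj2 (Clim_filterlim eventually (sum_n (G := C_AbelianMonoid) u) l) H).
  intros e He. apply eventually_S. generalize (H' e He).
  apply filter_imp. intros n. now rewrite Csum_sum_n.
- apply (proj1 (Clim_filterlim eventually (sum_n (G := C_AbelianMonoid) u) l)).
  intros e He. generalize (proj2 (eventually_S _) (H e He)).
  apply filter_imp. intros n. now rewrite Csum_sum_n.
Qed.

Lemma is_series_Rsum (u : nat -> R) l : is_series u l <-> filterlim (Rsum u) eventually (locally l).
Proof.
split; intros H; apply filterlim_locally; intros eps.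
- generalize (proj1 (filterlim_locally _ _) H eps). intros H'.
  apply eventually_S. revert H'. apply filter_imp. intros n. now rewrite Rsum_sum_n.
- generalize (proj2 (eventually_S _) (proj1 (filterlim_locally _ _) H eps)).
  apply filter_imp. intros n. now rewrite Rsum_sum_n.
Qed.

Lemma Csum_ext u v n : (forall k, (k < n)%nat -> u k = v k) -> Csum u n = Csum v n.
Proof. induction n; simpl; intros H; [reflexivity|]. rewrite IHn, H; auto. Qed.

Lemma Csum_scal c u n : Csum (fun k => c * u k) n = c * Csum u n.
Proof. induction n; simpl; [ring|]. rewrite IHn. ring. Qed.

Lemma Csum_plus u v n : Csum (fun k => u k + v k) n = Csum u n + Csum v n.
Proof. induction n; simpl; [ring|]. rewrite IHn. ring. Qed.

Lemma Csum_diff_le u (v : nat -> R) n m :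
  (forall k, (Cmod (u k) <= v k)%R) -> (n <= m)%nat ->
  (Cmod (Csum u m - Csum u n) <= Rsum v m - Rsum v n)%R.
Proof.
intros H. induction 1 as [|m Hm IH]; simpl.
- replace (Csum u n - Csum u n) with (RtoC 0) by ring. rewrite Cmod_0. lra.
- replace (Csum u m + u m - Csum u n) with ((Csum u m - Csum u n) + u m) by ring.
  eapply Rle_trans; [apply Cmod_triangle|]. specialize (H m). lra.
Qed.

Lemma Rsum_incr v n m : (forall k, (0 <= v k)%R) -> (n <= m)%nat -> (Rsum v n <= Rsum v m)%R.
Proof. intros H. induction 1; simpl; [lra|]. specialize (H m). lra. Qed.

Lemma Rsum_le_series (v : nat -> R) (V : R) n : (forall k, (0 <= v k)%R) -> is_series v V -> (Rsum v n <= V)%R.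
Proof.
intros H HV. apply is_series_Rsum in HV.
apply Rnot_lt_le. intros h.
assert (He : (0 < Rsum v n - V)%R) by lra.
destruct (proj1 (filterlim_locally _ _) HV (mkposreal _ He)) as [N HN].
specialize (HN (n + N)%nat ltac:(lia)).
assert (h1 := Rsum_incr v n (n + N) H ltac:(lia)).
unfold ball in HN; simpl in HN; unfold AbsRing_ball, abs, minus, plus, opp in HN; simpl in HN.
apply Rabs_def2 in HN. lra.
Qed.

Lemma Rsum_tail (v : nat -> R) (V : R) :
  is_series v V -> filterlim (fun n => (V - Rsum v n)%R) eventually (locally 0%R).
Proof.
intros H. apply is_series_Rsum in H.
apply filterlim_locally. intros eps.
generalize (proj1 (filterlim_locally _ _) H eps). apply filter_imp. intros n Hn.
unfold ball in *; simpl in *; unfold AbsRing_ball, abs, minus, plus, opp in *; simpl in *.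
rewrite <- Rabs_Ropp. replace (- (V - Rsum v n + - 0))%R with (Rsum v n + - V)%R by ring. exact Hn.
Qed.

(** Weierstrass: a series dominated by a convergent real series converges, with
    the tail of the latter as error bound. *)
Lemma Cseries_dominated (u : nat -> C) (v : nat -> R) (V : R) :
  (forall k, (Cmod (u k) <= v k)%R) -> is_series v V ->
  exists l, is_Cseries u l /\ forall n, (Cmod (l - Csum u n) <= V - Rsum v n)%R.
Proof.
intros H HV.
assert (Hv : forall k, (0 <= v k)%R) by (intros k; eapply Rle_trans; [apply Cmod_ge_0 | apply H]).
assert (HC : forall n m, (n <= m)%nat -> (Cmod (Csum u m - Csum u n) <= V - Rsum v n)%R).
{ intros n m Hnm. eapply Rle_trans; [apply Csum_diff_le; eassumption|].
  assert (h := Rsum_le_series v V m Hv HV). lra. }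
assert (Ht := Rsum_tail v V HV).
destruct (proj1 (filterlim_locally_cauchy (U := CompleteNormedModule.CompleteSpace _ C_R_CompleteNormedModule) (F := eventually) (Csum u))) as [l Hl].
{ intros eps. assert (He : (0 < eps / 2)%R) by (destruct eps; simpl; lra).
  destruct (proj1 (filterlim_locally _ _) Ht (mkposreal _ He)) as [N HN].
  exists (fun n => (N <= n)%nat). split; [exists N; auto|].
  specialize (HN N ltac:(lia)).
  unfold ball in HN; simpl in HN; unfold AbsRing_ball, abs, minus, plus, opp in HN; simpl in HN.
  apply Rabs_def2 in HN.
  intros n m Hn Hm. apply C_NormedModule_mixin_compat1.
  change (Cmod (Csum u m - Csum u n) < eps)%R.
  replace (Csum u m - Csum u n) with ((Csum u m - Csum u N) + - (Csum u n - Csum u N)) by ring.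
  eapply Rle_lt_trans; [apply Cmod_triangle|]. rewrite Cmod_opp.
  assert (h1 := HC N n Hn). assert (h2 := HC N m Hm). lra. }
assert (Hl' : Clim eventually (Csum u) l) by (apply Clim_filterlim; [apply eventually_filter | exact Hl]).
exists l. split; [now apply is_Cseries_Clim|].
intros n. apply (Clim_le eventually (fun m => Csum u m - Csum u n)).
- exists n. intros m Hm. now apply HC.
- apply Clim_minus; [apply eventually_filter | exact Hl' | apply Clim_const; apply eventually_filter].
Qed.

Lemma is_Cseries_unique u l1 l2 : is_Cseries u l1 -> is_Cseries u l2 -> l1 = l2.
Proof.
intros H1 H2. apply is_Cseries_Clim in H1. apply is_Cseries_Clim in H2.
exact (Clim_unique eventually _ _ _ H1 H2).
Qed.

Lemma Cseries_correct u l : is_Cseries u l -> Cseries u = l.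
Proof.
intros H. apply (is_Cseries_unique u); [|exact H].
apply (iota_correct (V := C_CompleteNormedModule) (is_Cseries u)). exists l. split; [exact H|]. intros l' H'. now apply (is_Cseries_unique u).
Qed.

Lemma is_Cseries_scal c u l : is_Cseries u l -> is_Cseries (fun n => c * u n) (c * l).
Proof.
rewrite !is_Cseries_Clim. intros H.
apply Clim_ext with (fun n => c * Csum u n); [apply eventually_filter | | apply Clim_scal; [apply eventually_filter | exact H]].
intros n. now rewrite Csum_scal.
Qed.

Lemma is_Cseries_plus u v lu lv :
  is_Cseries u lu -> is_Cseries v lv -> is_Cseries (fun n => u n + v n) (lu + lv).
Proof.
rewrite !is_Cseries_Clim. intros H1 H2.
apply Clim_ext with (fun n => Csum u n + Csum v n); [apply eventually_filter | | apply Clim_plus; [apply eventually_filter | exact H1 | exact H2]].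
intros n. now rewrite Csum_plus.
Qed.

Lemma is_Cseries_ext u v l : (forall n, u n = v n) -> is_Cseries u l -> is_Cseries v l.
Proof.
rewrite !is_Cseries_Clim. intros H. apply Clim_ext; [apply eventually_filter|].
intros n. apply Csum_ext. auto.
Qed.

(** * The exponential *)

Lemma Cexp_plus a b : Cexp (a + b) = Cexp a * Cexp b.
Proof.
destruct a as [a1 a2], b as [b1 b2].
apply Ceq; simpl; rewrite exp_plus, ?cos_plus, ?sin_plus; ring.
Qed.

Lemma Cexp_0 : Cexp 0 = 1.
Proof. apply Ceq; simpl; rewrite exp_0, ?cos_0, ?sin_0; ring. Qed.

Lemma Cexp_opp a : Cexp (- a) = / Cexp a.
Proof.
assert (H : Cexp (- a) * Cexp a = 1).
{ rewrite <- Cexp_plus. replace (- a + a) with (RtoC 0) by ring. apply Cexp_0. }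
replace (/ Cexp a) with (Cexp (- a) * Cexp a * / Cexp a) by (rewrite H; ring).
field. apply Cexp_neq_0.
Qed.

Lemma Cmod_Cexp z : Cmod (Cexp z) = exp (Re z).
Proof.
unfold Cmod, Cexp. simpl.
replace (exp (Re z) * cos (Im z) * (exp (Re z) * cos (Im z) * 1) +
  exp (Re z) * sin (Im z) * (exp (Re z) * sin (Im z) * 1))%R with
  (exp (Re z) * exp (Re z) * (Rsqr (sin (Im z)) + Rsqr (cos (Im z))))%R by (unfold Rsqr; ring).
rewrite sin2_cos2, Rmult_1_r. apply sqrt_square. left. apply exp_pos.
Qed.

Lemma Cexp_RtoC x : Cexp (RtoC x) = RtoC (exp x).
Proof. apply Ceq; simpl; rewrite ?cos_0, ?sin_0; ring. Qed.

Lemma Cexp_pow z n : Cexp z ^ n = Cexp (INR n * z).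
Proof.
induction n as [|n IH].
- simpl. replace (0 * z) with (RtoC 0) by ring. now rewrite Cexp_0.
- rewrite S_INR, RtoC_plus. simpl. rewrite IH, <- Cexp_plus. f_equal. ring.
Qed.

Lemma Rder_Cexp_line z t : Rder (fun x : R => Cexp (x * z)) t (z * Cexp (t * z)).
Proof.
destruct z as [a b].
assert (E : forall x : R, Cexp (x * (a, b)) = (exp (x * a) * cos (x * b), exp (x * a) * sin (x * b))%R).
{ intros x. unfold Cexp. simpl.
  replace (x * a - 0 * b)%R with (x * a)%R by ring.
  replace (x * b + 0 * a)%R with (x * b)%R by ring. reflexivity. }
apply Rder_ext with (fun x : R => (exp (x * a) * cos (x * b), exp (x * a) * sin (x * b))%R : C);
  [intros x; now rewrite E|].
rewrite E.
apply Rder_pair; simpl.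
- auto_derive; [auto|]. ring.
- auto_derive; [auto|]. ring.
Qed.

Lemma Cder_pow n z : Cder (fun x => x ^ S n) z (INR (S n) * z ^ n).
Proof.
induction n as [|n IH].
- simpl. apply Cder_ext with (fun x => x); [intros; ring|].
  replace (1 * 1) with (RtoC 1) by ring. apply Cder_id.
- apply Cder_ext with (fun x => x * x ^ S n); [reflexivity|].
  replace (INR (S (S n)) * z ^ S n) with (1 * z ^ S n + z * (INR (S n) * z ^ n)).
  + apply (Cder_mult (fun x => x) (fun x => x ^ S n)); [apply Cder_id | exact IH].
  + rewrite (S_INR (S n)), RtoC_plus. simpl (z ^ S n). ring.
Qed.

Definition exp_term (z : C) (m : nat) : C := z ^ m / INR (fact m).

Lemma INR_fact_C m : RtoC (INR (fact m)) <> 0.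
Proof. apply RtoC_neq_0. apply INR_fact_neq_0. Qed.

Lemma Rder_exp_term_line z m t :
  Rder (fun x : R => exp_term (x * z) (S m)) t (z * exp_term (t * z) m).
Proof.
unfold exp_term.
assert (H1 : Rder (fun x : R => x * z) t z).
{ apply Rder_ext with (fun x : R => z * x); [intros; ring|].
  assert (H := Rder_scal z _ _ _ (Rder_id t)). now replace (z * 1) with z in H by ring. }
assert (H2 := Rder_Cder (fun y => y ^ S m) (fun x : R => x * z) t _ _ (Cder_pow m (t * z)) H1).
assert (H3 := Rder_scal (/ INR (fact (S m))) _ _ _ H2).
replace (z * ((t * z) ^ m / INR (fact m))) with (/ INR (fact (S m)) * (INR (S m) * (t * z) ^ m * z)).
- revert H3. apply Rder_ext. intros x. field. apply INR_fact_C.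
- change (fact (S m)) with (S m * fact m)%nat. rewrite mult_INR, RtoC_mult.
  field. split; [apply INR_fact_C|]. apply RtoC_neq_0. apply not_0_INR. lia.
Qed.

Lemma Csum_exp_term_0 M : Csum (exp_term 0) (S M) = 1.
Proof.
induction M as [|M IH].
- unfold exp_term. simpl. field.
- change (Csum (exp_term 0) (S M) + exp_term 0 (S M) = 1). rewrite IH.
  unfold exp_term. simpl (0 ^ S M). field. apply INR_fact_C.
Qed.

(** Taylor bound with a free scale [k]: the comparison functions
    [k ^ M exp (t |z| / k)] form a chain under differentiation, as the Taylor
    remainders do.  A small [k] trades the rate of decay in [M] for the size of
    the exponential. *)
Lemma Cexp_taylor M z k :
  (0 < k <= 1)%R ->
  (Cmod (Cexp z - Csum (exp_term z) M) <= k ^ M * exp (Cmod z / k))%R.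
Proof.
intros Hk.
assert (Hz := Cmod_ge_0 z).
assert (G : forall t, (0 <= t)%R ->
  (Cmod (Cexp (t * z) - Csum (exp_term (t * z)) M) <= k ^ M * exp (t * (Cmod z / k)))%R).
{ induction M as [|M IH]; intros t Ht.
  - simpl. replace (Cexp (t * z) - 0) with (Cexp (t * z)) by ring.
    rewrite Cmod_Cexp, Rmult_1_l.
    assert (h : (Re (t * z) <= t * (Cmod z / k))%R).
    { eapply Rle_trans; [apply Rle_abs|]. eapply Rle_trans; [apply re_le_Cmod|].
      rewrite Cmod_mult, Cmod_R, Rabs_pos_eq by lra.
      apply Rmult_le_compat_l; [lra|].
      apply Rmult_le_reg_r with k; [lra|]. replace (Cmod z / k * k)%R with (Cmod z) by (field; lra). nra. }
    destruct h as [h|h]; [left; now apply exp_increasing | rewrite h; lra].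
  - set (f := fun x : R => Cexp (x * z) - Csum (exp_term (x * z)) (S M)).
    (* Differentiating [g] gives [|z|] times the bound for [M]. *)
    set (g := fun x : R => (k ^ S M * exp (x * (Cmod z / k)))%R).
    assert (H := Rder_compare f g (fun x => z * (Cexp (x * z) - Csum (exp_term (x * z)) M))
      (fun x => (Cmod z * (k ^ M * exp (x * (Cmod z / k))))%R) 0 t Ht).
    assert (f0 : f 0%R = 0).
    { unfold f. replace (RtoC 0 * z) with (RtoC 0) by ring. rewrite Csum_exp_term_0, Cexp_0. ring. }
    rewrite f0 in H.
    assert (g0 : (0 <= g 0)%R).
    { unfold g. apply Rmult_le_pos; [apply pow_le; lra | left; apply exp_pos]. }
    change (Cmod (f t) <= g t)%R.
    replace (f t) with (f t - 0) by ring.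
    eapply Rle_trans; [apply H | lra].
    + intros x _. unfold f.
      replace (z * (Cexp (x * z) - Csum (exp_term (x * z)) M)) with
        (z * Cexp (x * z) - z * Csum (exp_term (x * z)) M) by ring.
      apply Rder_minus; [apply Rder_Cexp_line|].
      clear. induction M as [|M IH].
      * simpl. replace (z * 0) with (RtoC 0) by ring.
        apply Rder_ext with (fun _ => 1); [|apply Rder_const].
        intros y. unfold exp_term. simpl. field.
      * replace (z * Csum (exp_term (x * z)) (S M)) with
          (z * Csum (exp_term (x * z)) M + z * exp_term (x * z) M) by (simpl; ring).
        apply (Rder_plus (fun y : R => Csum (exp_term (y * z)) (S M)) (fun y : R => exp_term (y * z) (S M)) x _ _ IH).
        apply Rder_exp_term_line.
    + intros x _. unfold g. auto_derive; [auto|]. simpl. field. lra.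
    + intros x Hx. rewrite Cmod_mult. apply Rmult_le_compat_l; [lra|]. apply IH. lra. }
specialize (G 1%R ltac:(lra)).
replace (RtoC 1 * z) with z in G by ring. now rewrite Rmult_1_l in G.
Qed.

Lemma Cder_Cexp z : Cder Cexp z (Cexp z).
Proof.
intros e He.
set (B := (exp 1 * (Cmod (Cexp z)))%R).
assert (HB : (0 < B)%R).
{ unfold B. rewrite Cmod_Cexp. apply Rmult_lt_0_compat; apply exp_pos. }
exists (Rmin 1 (e / B)). split; [apply Rmin_glb_lt; [lra | now apply Rdiv_lt_0_compat]|].
intros h Hh.
assert (H1 : (Cmod h < 1)%R) by (eapply Rlt_le_trans; [exact Hh | apply Rmin_l]).
assert (H2 : (Cmod h < e / B)%R) by (eapply Rlt_le_trans; [exact Hh | apply Rmin_r]).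
rewrite Cexp_plus.
replace (Cexp z * Cexp h - Cexp z - Cexp z * h) with (Cexp z * (Cexp h - Csum (exp_term h) 2))
  by (unfold exp_term; simpl; field).
rewrite Cmod_mult.
destruct (Req_dec (Cmod h) 0) as [E|E].
- rewrite (Cmod_eq_0 _ E). rewrite Csum_exp_term_0, Cexp_0.
  replace (1 - 1) with (RtoC 0) by ring. rewrite Cmod_0. lra.
- assert (Hh0 := Cmod_ge_0 h).
  assert (H3 := Cexp_taylor 2 h (Cmod h) ltac:(lra)).
  replace (Cmod h / Cmod h)%R with 1%R in H3 by (field; lra).
  apply Rle_trans with (Cmod (Cexp z) * (Cmod h ^ 2 * exp 1))%R.
  + apply Rmult_le_compat_l; [apply Cmod_ge_0 | exact H3].
  + replace (Cmod (Cexp z) * (Cmod h ^ 2 * exp 1))%R with (B * Cmod h * Cmod h)%R by (unfold B; ring).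
    apply Rmult_le_compat_r; [lra|].
    apply (Rmult_lt_compat_l B) in H2; [|lra].
    replace (B * (e / B))%R with e in H2 by (field; lra). lra.
Qed.

Lemma Rder_Cexp (g : R -> C) t v : Rder g t v -> Rder (fun x => Cexp (g x)) t (Cexp (g t) * v).
Proof. intros H. exact (Rder_Cder Cexp g t _ _ (Cder_Cexp _) H). Qed.

(** * The logarithm on the slit plane *)

Definition slit (z : C) : Prop := (0 < Re z)%R \/ Im z <> 0%R.

Lemma slit_neq_0 (z : C) : slit z -> z <> 0.
Proof. intros [H|H] E; rewrite E in H; simpl in H; lra. Qed.

Lemma Cmod_sqr z : (Cmod z * Cmod z = Re z * Re z + Im z * Im z)%R.
Proof. generalize (Cmod2_alt z). simpl. rewrite !Rmult_1_r. auto. Qed.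

Lemma polar_Cmod r th : (0 < r)%R -> Cmod (r * cos th, r * sin th)%R = r.
Proof.
intros Hr. unfold Cmod. simpl.
replace (r * cos th * (r * cos th * 1) + r * sin th * (r * sin th * 1))%R with
  (r * r * (Rsqr (sin th) + Rsqr (cos th)))%R by (unfold Rsqr; ring).
rewrite sin2_cos2, Rmult_1_r. apply sqrt_square. lra.
Qed.

Lemma Carg_polar r th :
  (0 < r)%R -> (- PI < th <= PI)%R -> Carg (r * cos th, r * sin th)%R = th.
Proof.
intros Hr Hth. unfold Carg. rewrite polar_Cmod by exact Hr. simpl.
replace (r * cos th / r)%R with (cos th) by (field; lra).
destruct (Rle_dec 0 (r * sin th)) as [H|H].
- destruct (Rle_lt_dec 0 th) as [h|h]; [apply acos_cos; lra|].
  exfalso.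
  assert (h1 := sin_gt_0 (- th) ltac:(lra) ltac:(lra)). rewrite sin_neg in h1. nra.
- destruct (Rle_lt_dec 0 th) as [h|h].
  + exfalso. apply H. assert (h1 := sin_ge_0 th h ltac:(lra)). nra.
  + rewrite <- (cos_neg th). rewrite acos_cos by lra. ring.
Qed.

Lemma Carg_bound z : (- PI <= Carg z <= PI)%R.
Proof.
unfold Carg. assert (H := acos_bound (Re z / Cmod z)). destruct (Rle_dec 0 (Im z)); lra.
Qed.

Lemma Clog_Cexp L : (- PI < Im L <= PI)%R -> Clog (Cexp L) = L.
Proof.
intros H. unfold Clog, Cexp.
rewrite polar_Cmod, Carg_polar by (try apply exp_pos; assumption).
rewrite ln_exp. now destruct L.
Qed.

Lemma Cexp_Clog (z : C) : z <> 0 -> Cexp (Clog z) = z.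
Proof.
intros Hz. assert (Hm : (0 < Cmod z)%R) by (apply (proj1 (Cmod_gt_0 z)); exact Hz).
assert (Hs := Cmod_sqr z).
assert (Hb : (-1 <= Re z / Cmod z <= 1)%R).
{ assert (h := re_le_Cmod z). apply Rabs_le_between in h.
  split; apply Rmult_le_reg_r with (Cmod z); try exact Hm;
  replace (Re z / Cmod z * Cmod z)%R with (Re z) by (field; lra); lra. }
assert (Hsq : (sqrt (1 - Rsqr (Re z / Cmod z)) = Rabs (Im z) / Cmod z)%R).
{ rewrite <- (sqrt_Rsqr (Rabs (Im z) / Cmod z)).
  - f_equal. unfold Rsqr.
    replace (Rabs (Im z) / Cmod z * (Rabs (Im z) / Cmod z))%R with
      ((Rabs (Im z) * Rabs (Im z)) / (Cmod z * Cmod z))%R by (field; lra).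
    rewrite <- Rabs_mult, (Rabs_pos_eq (Im z * Im z)) by apply Rle_0_sqr.
    replace (Im z * Im z)%R with (Cmod z * Cmod z - Re z * Re z)%R by lra.
    field. lra.
  - apply Rdiv_le_0_compat; [apply Rabs_pos | exact Hm]. }
unfold Cexp, Clog. simpl. rewrite exp_ln by exact Hm.
unfold Carg. destruct (Rle_dec 0 (Im z)) as [h|h].
- rewrite cos_acos, sin_acos by exact Hb. rewrite Hsq, Rabs_pos_eq by exact h.
  apply Ceq; simpl; field; lra.
- rewrite cos_neg, sin_neg. rewrite cos_acos, sin_acos by exact Hb.
  rewrite Hsq, Rabs_left by lra. apply Ceq; simpl; field; lra.
Qed.

Lemma Carg_slit (z : C) : z <> 0 -> (Rabs (Carg z) < PI)%R -> slit z.
Proof.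
intros Hz H. destruct (Req_dec (Im z) 0) as [E|E]; [|now right]. left.
assert (H1 := Cexp_Clog z Hz). apply (f_equal Im) in H1 as H2. apply (f_equal Re) in H1.
unfold Cexp, Clog in H1, H2. simpl in H1, H2.
assert (Hm : (0 < Cmod z)%R) by (apply (proj1 (Cmod_gt_0 z)); exact Hz).
rewrite exp_ln in H1, H2 by exact Hm. rewrite E in H2.
assert (Hs : sin (Carg z) = 0%R) by (destruct (Rmult_integral _ _ H2); lra).
apply Rabs_def2 in H.
assert (Hc : Carg z = 0%R).
{ destruct (Rtotal_order (Carg z) 0) as [h|[h|h]]; [|exact h|].
  - assert (h1 := sin_gt_0 (- Carg z) ltac:(lra) ltac:(lra)). rewrite sin_neg in h1. lra.
  - assert (h1 := sin_gt_0 (Carg z) ltac:(lra) ltac:(lra)). lra. }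
rewrite Hc, cos_0 in H1. lra.
Qed.

(** The half-angle formula is one expression on the whole slit plane, so that the
    continuity of the argument needs no case distinction. *)
Lemma Carg_atan z : slit z -> Carg z = (2 * atan (Im z / (Cmod z + Re z)))%R.
Proof.
intros Hz. assert (Hz0 := slit_neq_0 z Hz).
assert (Hm : (0 < Cmod z)%R) by (apply (proj1 (Cmod_gt_0 z)); exact Hz0).
assert (Hs := Cmod_sqr z).
assert (Hp : (0 < Cmod z + Re z)%R).
{ destruct Hz as [h|h]; [lra|].
  assert (0 < Im z * Im z)%R by (apply Rsqr_pos_lt; exact h).
  destruct (Rle_lt_dec (Cmod z + Re z) 0); [nra|lra]. }
set (q := (Im z / (Cmod z + Re z))%R).
assert (Hb := atan_bound q).
assert (Hq : (1 + q * q = 2 * Cmod z / (Cmod z + Re z))%R).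
{ assert (E : (q * (Cmod z + Re z) = Im z)%R) by (unfold q; field; lra).
  apply Rmult_eq_reg_r with ((Cmod z + Re z) * (Cmod z + Re z))%R; [|nra].
  replace (2 * Cmod z / (Cmod z + Re z) * ((Cmod z + Re z) * (Cmod z + Re z)))%R
    with (2 * (Cmod z * Cmod z) + 2 * (Cmod z * Re z))%R by (field; lra).
  replace ((1 + q * q) * ((Cmod z + Re z) * (Cmod z + Re z)))%R with
    ((Cmod z + Re z) * (Cmod z + Re z) + (q * (Cmod z + Re z)) * (q * (Cmod z + Re z)))%R by ring.
  rewrite E. lra. }
assert (Hq0 : (0 < 1 + q * q)%R) by nra.
assert (Hsq : (sqrt (1 + q * q) * sqrt (1 + q * q) = 1 + q * q)%R) by (apply sqrt_sqrt; lra).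
assert (Hsp : (0 < sqrt (1 + q * q))%R) by (apply sqrt_lt_R0; exact Hq0).
assert (C1 : cos (atan q) = (1 / sqrt (1 + q * q))%R) by (rewrite cos_atan; unfold Rsqr; reflexivity).
assert (S1 : sin (atan q) = (q / sqrt (1 + q * q))%R) by (rewrite sin_atan; unfold Rsqr; reflexivity).
assert (Hc : (cos (2 * atan q) = (1 - q * q) / (1 + q * q))%R).
{ rewrite cos_2a, C1, S1. clear C1 S1. set (r := sqrt (1 + q * q)) in *. rewrite <- Hsq. field. lra. }
assert (Hsn : (sin (2 * atan q) = 2 * q / (1 + q * q))%R).
{ rewrite sin_2a, C1, S1. clear C1 S1 Hc. set (r := sqrt (1 + q * q)) in *. rewrite <- Hsq. field. lra. }
rewrite <- (Carg_polar (Cmod z) (2 * atan q)) by lra.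
f_equal. apply Ceq; simpl.
- rewrite Hc, Hq. replace (1 - q * q)%R with (2 - (1 + q * q))%R by ring. rewrite Hq. field. lra.
- rewrite Hsn, Hq. unfold q. field. lra.
Qed.

Lemma slit_Carg z : slit z -> (Rabs (Carg z) < PI)%R.
Proof.
intros H. rewrite (Carg_atan z H). set (q := (_ / _)%R). assert (h := atan_bound q).
apply Rabs_def1; lra.
Qed.

Lemma slit_open z : slit z -> locally z slit.
Proof.
intros [H|H].
- apply locally_Cmod with (Re z); [exact H|]. intros y Hy. left.
  assert (h := re_le_Cmod (y - z)). assert (h1 := Rle_abs (- Re (y - z))). rewrite Rabs_Ropp in h1.
  destruct y, z. simpl in *. lra.
- apply locally_Cmod with (Rabs (Im z)); [now apply Rabs_pos_lt|]. intros y Hy. right. intros E.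
  assert (h := im_le_Cmod (y - z)).
  replace (Im (y - z)) with (- Im z)%R in h by (destruct y, z; simpl in *; lra).
  rewrite Rabs_Ropp in h. lra.
Qed.

Lemma Clog_cont z : slit z -> Clim (locally z) Clog (Clog z).
Proof.
intros Hz. assert (Hz0 := slit_neq_0 z Hz).
assert (Hm : (0 < Cmod z)%R) by (apply (proj1 (Cmod_gt_0 z)); exact Hz0).
assert (Hp : (0 < Cmod z + Re z)%R).
{ assert (Hs := Cmod_sqr z). destruct Hz as [h|h]; [lra|].
  assert (0 < Im z * Im z)%R by (apply Rsqr_pos_lt; exact h).
  destruct (Rle_lt_dec (Cmod z + Re z) 0); [nra|lra]. }
assert (Kid : Clim (locally z) (fun x : C => x) z) by (apply Clim_filterlim; [apply locally_filter | apply filterlim_id]).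
assert (Kmod : continuous (T := C_UniformSpace) (U := R_UniformSpace) Cmod z)
  by (apply (Clim_Cmod (locally z) (fun x => x)); exact Kid).
assert (Kre : continuous (T := C_UniformSpace) (U := R_UniformSpace) Re z).
{ destruct z. apply (continuous_fst (U := R_UniformSpace) (V := R_UniformSpace)). }
assert (Kim : continuous (T := C_UniformSpace) (U := R_UniformSpace) Im z).
{ destruct z. apply (continuous_snd (U := R_UniformSpace) (V := R_UniformSpace)). }
assert (K1 : continuous (T := C_UniformSpace) (U := R_UniformSpace) (fun y => ln (Cmod y)) z).
{ apply (continuous_comp Cmod ln); [exact Kmod|].
  apply continuity_pt_filterlim. apply derivable_continuous_pt. exists (/ Cmod z)%R. now apply derivable_pt_lim_ln. }
assert (K2 : continuous (T := C_UniformSpace) (U := R_UniformSpace)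
  (fun y => (2 * atan (Im y * / (Cmod y + Re y)))%R) z).
{ apply (continuous_scal_r (K := R_AbsRing) (V := R_NormedModule) 2%R).
  apply (continuous_comp (fun y : C => (Im y * / (Cmod y + Re y))%R) atan).
  - apply (continuous_mult (K := R_AbsRing)); [exact Kim|].
    apply (continuous_comp (fun y : C => (Cmod y + Re y)%R) Rinv).
    + apply (continuous_plus (K := R_AbsRing) (V := R_NormedModule)); [exact Kmod | exact Kre].
    + apply continuity_pt_filterlim.
      apply (continuity_pt_inv (fun x => x)); [apply continuity_pt_id | lra].
  - apply continuity_pt_filterlim. apply derivable_continuous_pt. apply derivable_pt_atan. }
intros e He. assert (He2 : (0 < e / 2)%R) by lra.
assert (L1 := proj1 (filterlim_locally _ _) K1 (mkposreal _ He2)).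
assert (L2 := proj1 (filterlim_locally _ _) K2 (mkposreal _ He2)).
generalize (filter_and (F := locally z) _ _ (slit_open z Hz) (filter_and _ _ L1 L2)).
apply filter_imp. intros y [Hy [h1 h2]].
eapply Rle_lt_trans; [apply Cmod_le_sum|]. change (Rabs (ln (Cmod y) - ln (Cmod z)) + Rabs (Carg y - Carg z) < e)%R.
rewrite (Carg_atan y Hy), (Carg_atan z Hz).
change (Rabs (ln (Cmod y) - ln (Cmod z)) < e / 2)%R in h1.
change (Rabs (2 * atan (Im y * / (Cmod y + Re y)) - 2 * atan (Im z * / (Cmod z + Re z))) < e / 2)%R in h2.
unfold Rdiv. lra.
Qed.

(** Put [k = Clog (z + h) - Clog z].  Then [Cexp k = 1 + h / z], and [k] is small
    by continuity, so the derivative of [Cexp] at [0] compares [k] with [h / z]. *)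
Lemma Cder_Clog z : slit z -> Cder Clog z (/ z).
Proof.
intros Hz e He. assert (Hz0 := slit_neq_0 z Hz).
assert (Hm : (0 < Cmod z)%R) by (apply (proj1 (Cmod_gt_0 z)); exact Hz0).
set (e1 := Rmin (/ 2) (e * Cmod z / 2)).
assert (He1 : (0 < e1)%R) by (apply Rmin_glb_lt; [lra | apply Rdiv_lt_0_compat; [nra|lra]]).
destruct (Cder_Cexp 0 e1 He1) as [d1 [Hd1 h1]].
assert (Hc : locally z (fun y => slit y /\ (Cmod (Clog y - Clog z) < d1)%R)).
{ apply filter_and; [now apply slit_open | apply (Clog_cont z Hz); exact Hd1]. }
destruct Hc as [d Hd].
exists d. split; [apply d|]. intros h Hh.
assert (Hb : ball z d (z + h)).
{ apply C_NormedModule_mixin_compat1. change (Cmod (z + h - z) < d)%R.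
  now replace (z + h - z) with h by ring. }
destruct (Hd _ Hb) as [Hs Hk]. clear Hd Hb.
set (k := Clog (z + h) - Clog z) in *.
specialize (h1 k Hk).
assert (Ek : Cexp k = 1 + h / z).
{ unfold k, Cminus. rewrite Cexp_plus, Cexp_opp, !Cexp_Clog; [field; exact Hz0 | exact Hz0 | now apply slit_neq_0]. }
replace (0 + k) with k in h1 by ring. rewrite Ek, Cexp_0 in h1.
replace (1 + h / z - 1 - 1 * k) with (h / z - k) in h1 by ring.
assert (h2 : (Cmod k <= 2 * (Cmod h / Cmod z))%R).
{ assert (e1 <= / 2)%R by apply Rmin_l. assert (Hk0 := Cmod_ge_0 k).
  assert (h3 := Cmod_triangle_rev k (h / z - k)).
  replace (k + (h / z - k)) with (h / z) in h3 by ring.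
  rewrite Cmod_div in h3 by exact Hz0. nra. }
replace (k - / z * h) with (- (h / z - k)) by (unfold Cdiv; ring). rewrite Cmod_opp.
eapply Rle_trans; [exact h1|].
assert (e1 <= e * Cmod z / 2)%R by apply Rmin_r.
apply Rle_trans with (e * Cmod z / 2 * (2 * (Cmod h / Cmod z)))%R.
- apply Rmult_le_compat; [lra | apply Cmod_ge_0 | lra | lra].
- right. field. lra.
Qed.

Lemma Clog_pos x : (0 < x)%R -> Clog (RtoC x) = RtoC (ln x).
Proof.
intros H. rewrite <- (exp_ln x) at 1 by exact H. rewrite <- Cexp_RtoC. apply Clog_Cexp.
simpl. assert (h := PI_RGT_0). lra.
Qed.

Lemma Clog_scale (x : R) (z : C) : (0 < x)%R -> z <> 0 -> Clog (RtoC x * z) = RtoC (ln x) + Clog z.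
Proof.
intros Hx Hz.
assert (Hm : (0 < Cmod z)%R) by (apply (proj1 (Cmod_gt_0 z)); exact Hz).
unfold Clog. rewrite Cmod_mult, Cmod_R, Rabs_pos_eq by lra. rewrite ln_mult by assumption.
apply Ceq; simpl; [reflexivity|]. unfold Carg.
rewrite Cmod_mult, Cmod_R, Rabs_pos_eq by lra.
replace (Re (RtoC x * z)) with (x * Re z)%R by (destruct z; simpl; ring).
replace (Im (RtoC x * z)) with (x * Im z)%R by (destruct z; simpl; ring).
replace (x * Re z / (x * Cmod z))%R with (Re z / Cmod z)%R by (field; lra).
destruct (Rle_dec 0 (x * Im z)), (Rle_dec 0 (Im z)); try ring; exfalso; nra.
Qed.

(** * Powers *)

Lemma Cpower_neq_0 z w : Cpower z w <> 0.
Proof. apply Cexp_neq_0. Qed.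

Lemma Cpower_plus z v w : Cpower z (v + w) = Cpower z v * Cpower z w.
Proof. unfold Cpower. rewrite <- Cexp_plus. f_equal. ring. Qed.

Lemma Cpower_opp z w : Cpower z (- w) = / Cpower z w.
Proof. unfold Cpower. rewrite <- Cexp_opp. f_equal. ring. Qed.

Lemma Cpower_minus z v w : Cpower z (v - w) = Cpower z v / Cpower z w.
Proof. unfold Cminus. rewrite Cpower_plus, Cpower_opp. reflexivity. Qed.

Lemma Cpower_0 z : Cpower z 0 = 1.
Proof. unfold Cpower. replace (0 * Clog z) with (RtoC 0) by ring. apply Cexp_0. Qed.

Lemma Cpower_1 (z : C) : z <> 0 -> Cpower z 1 = z.
Proof. intros H. unfold Cpower. replace (1 * Clog z) with (Clog z) by ring. now apply Cexp_Clog. Qed.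

Lemma Cpower_INR (z : C) n : z <> 0 -> Cpower z (INR n) = z ^ n.
Proof. intros H. unfold Cpower. rewrite <- Cexp_pow, Cexp_Clog; auto. Qed.

Lemma Cmod_Cpower z w : Cmod (Cpower z w) = exp (Re w * ln (Cmod z) - Im w * Carg z).
Proof. unfold Cpower. rewrite Cmod_Cexp. reflexivity. Qed.

Lemma Cmod_Cpower_le (z w : C) :
  z <> 0 -> (Cmod (Cpower z w) <= exp (PI * Rabs (Im w)) * Rpower (Cmod z) (Re w))%R.
Proof.
intros Hz. rewrite Cmod_Cpower. unfold Rpower. rewrite <- exp_plus.
assert (h : (Re w * ln (Cmod z) - Im w * Carg z <= PI * Rabs (Im w) + Re w * ln (Cmod z))%R).
{ assert (H := Carg_bound z).
  assert (H1 : (Rabs (Carg z) <= PI)%R) by (apply Rabs_le; lra).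
  assert (H2 := Rle_abs (- (Im w * Carg z))). rewrite Rabs_Ropp, Rabs_mult in H2.
  assert (H3 := Rabs_pos (Im w)). nra. }
destruct h as [h|h]; [left; now apply exp_increasing | rewrite h; lra].
Qed.

Lemma Cmod_Cpower_pos x w : (0 < x)%R -> Cmod (Cpower (RtoC x) w) = Rpower x (Re w).
Proof.
intros H. unfold Cpower. rewrite Clog_pos by exact H. rewrite Cmod_Cexp. unfold Rpower.
f_equal. destruct w. simpl. ring.
Qed.

Lemma Cpower_scale (x : R) (z w : C) : (0 < x)%R -> z <> 0 -> Cpower (RtoC x * z) w = Cpower x w * Cpower z w.
Proof.
intros Hx Hz. unfold Cpower. rewrite Clog_scale, Clog_pos by assumption.
rewrite <- Cexp_plus. f_equal. ring.
Qed.

Lemma Cder_Cpower z w : slit z -> Cder (fun y => Cpower y w) z (w * Cpower z (w - 1)).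
Proof.
intros Hz. assert (Hz0 := slit_neq_0 z Hz). unfold Cpower at 1.
replace (w * Cpower z (w - 1)) with (Cexp (w * Clog z) * (w * / z)).
- apply (Cder_comp Cexp (fun y => w * Clog y)); [apply Cder_Cexp|].
  apply (Cder_comp (fun y => w * y) Clog); [apply Cder_scal | now apply Cder_Clog].
- rewrite Cpower_minus, Cpower_1 by exact Hz0. unfold Cpower, Cdiv. ring.
Qed.

Lemma Rder_shift a t : Rder (fun x => RtoC x + a) t 1.
Proof.
assert (H := Rder_plus _ _ _ _ _ (Rder_id t) (Rder_const a t)).
now replace (1 + 0) with (RtoC 1) in H by ring.
Qed.

Lemma Rder_Cpower_shift (a w : C) (t : R) :
  slit (t + a) -> Rder (fun x : R => Cpower (x + a) w) t (w * Cpower (t + a) (w - 1)).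
Proof.
intros H. assert (h := Rder_Cder (fun y => Cpower y w) _ _ _ _ (Cder_Cpower _ w H) (Rder_shift a t)).
cbv beta in h. now replace (w * Cpower (t + a) (w - 1) * 1) with (w * Cpower (t + a) (w - 1)) in h by ring.
Qed.

Lemma slit_pos x : (0 < x)%R -> slit (RtoC x).
Proof. now left. Qed.

Lemma slit_shift a t : slit a -> (0 <= t)%R -> slit (RtoC t + a).
Proof. intros [H|H] Ht; destruct a as [x y]; simpl in *; [left; simpl; lra | right; simpl; lra]. Qed.

Lemma Rder_Cpower_real (w : C) (t : R) :
  (0 < t)%R -> Rder (fun x : R => Cpower x w) t (w * Cpower t (w - 1)).
Proof.
intros H. assert (h := Rder_Cder (fun y => Cpower y w) _ _ _ _ (Cder_Cpower _ w (slit_pos t H)) (Rder_id t)).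
cbv beta in h. now replace (w * Cpower t (w - 1) * 1) with (w * Cpower t (w - 1)) in h by ring.
Qed.

(** * Improper integrals *)

Definition Ccont (f : R -> C) (t : R) : Prop := Clim (locally t) f (f t).

Lemma Ccont_continuous (f : R -> C) t :
  Ccont f t <-> continuous (T := R_UniformSpace) (U := C_UniformSpace) f t.
Proof. apply Clim_filterlim. apply locally_filter. Qed.

Lemma Rder_Ccont f t l : Rder f t l -> Ccont f t.
Proof. apply Rder_cont. Qed.

Lemma Ccont_RtoC (g : R -> R) t : Ccont (fun x => RtoC (g x)) t <-> continuous g t.
Proof.
split; intros H.
- apply filterlim_locally. intros eps. generalize (H eps (cond_pos eps)).
  apply filter_imp. intros x Hx. rewrite <- RtoC_minus, Cmod_R in Hx. exact Hx.
- apply Clim_RtoC; [typeclasses eauto | exact H].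
Qed.

Lemma Ccont_mult f g t : Ccont f t -> Ccont g t -> Ccont (fun x => f x * g x) t.
Proof. apply Clim_mult. apply locally_filter. Qed.

Lemma Ccont_plus f g t : Ccont f t -> Ccont g t -> Ccont (fun x => f x + g x) t.
Proof. apply Clim_plus. apply locally_filter. Qed.

Lemma Ccont_minus f g t : Ccont f t -> Ccont g t -> Ccont (fun x => f x - g x) t.
Proof. apply Clim_minus. apply locally_filter. Qed.

Lemma Ccont_const c t : Ccont (fun _ => c) t.
Proof. apply Clim_const. apply locally_filter. Qed.

Lemma Ccont_scal c f t : Ccont f t -> Ccont (fun x => c * f x) t.
Proof. apply Clim_scal. apply locally_filter. Qed.

Lemma Ccont_inv (f : R -> C) t : f t <> 0 -> Ccont f t -> Ccont (fun x => / f x) t.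
Proof. intros H. apply Clim_inv; [apply locally_filter | exact H]. Qed.

Lemma Ccont_ext f g t : (forall x, f x = g x) -> Ccont f t -> Ccont g t.
Proof. intros H. unfold Ccont. rewrite <- H. apply Clim_ext; [apply locally_filter | exact H]. Qed.

Lemma Ccont_Cmod f t : Ccont f t -> Ccont (fun x => RtoC (Cmod (f x))) t.
Proof. intros H. apply Ccont_RtoC. apply (Clim_Cmod (locally t) f (f t) H). Qed.

Lemma Ccont_Csum (u : nat -> R -> C) n t :
  (forall k, Ccont (u k) t) -> Ccont (fun x => Csum (fun k => u k x) n) t.
Proof.
intros H. induction n as [|n IH]; simpl; [apply Ccont_const | now apply Ccont_plus].
Qed.

Definition CInt (f : R -> C) (a b : R) : C := RInt (V := C_R_CompleteNormedModule) f a b.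

(** Typed in plain reals rather than in the carrier of a normed module, so that
    the arithmetic tactics apply to its values. *)
Definition RI (g : R -> R) (a b : R) : R := RInt (V := R_CompleteNormedModule) g a b.

Definition is_CInt (f : R -> C) (a b : R) (l : C) : Prop := is_RInt (V := C_R_NormedModule) f a b l.

Lemma is_CInt_scal (c : C) f a b l : is_CInt f a b l -> is_CInt (fun x => c * f x) a b (c * l).
Proof.
intros H. destruct c as [c1 c2].
assert (H1 := is_RInt_fct_extend_fst (U := R_NormedModule) (V := R_NormedModule) f a b l H).
assert (H2 := is_RInt_fct_extend_snd (U := R_NormedModule) (V := R_NormedModule) f a b l H).
destruct l as [l1 l2]. simpl in H1, H2.
apply (is_RInt_fct_extend_pair (U := R_NormedModule) (V := R_NormedModule)); simpl.
- apply (is_RInt_minus (V := R_NormedModule) (fun x => (c1 * fst (f x))%R) (fun x => (c2 * snd (f x))%R));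
    now apply (is_RInt_scal (V := R_NormedModule)).
- apply (is_RInt_plus (V := R_NormedModule) (fun x => (c1 * snd (f x))%R) (fun x => (c2 * fst (f x))%R));
    now apply (is_RInt_scal (V := R_NormedModule)).
Qed.

Lemma is_CInt_RtoC g a b (l : R) : is_RInt g a b l -> is_CInt (fun x => RtoC (g x)) a b (RtoC l).
Proof.
intros H. apply (is_RInt_fct_extend_pair (U := R_NormedModule) (V := R_NormedModule)); simpl; [exact H|].
assert (E := is_RInt_const (V := R_NormedModule) a b 0%R).
change (scal (b - a)%R 0%R) with ((b - a) * 0)%R in E. rewrite Rmult_0_r in E. exact E.
Qed.

Section Segment.
Context (a b : R) (Hab : (a <= b)%R).

Lemma seg_bounds x : (Rmin a b <= x <= Rmax a b)%R -> (a <= x <= b)%R.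
Proof. rewrite Rmin_left, Rmax_right by exact Hab. auto. Qed.

Lemma CInt_correct f : (forall t, (a <= t <= b)%R -> Ccont f t) -> is_CInt f a b (CInt f a b).
Proof.
intros H. apply (RInt_correct (V := C_R_CompleteNormedModule)).
apply (ex_RInt_continuous (V := C_R_CompleteNormedModule)).
intros z Hz. apply Ccont_continuous. apply H. now apply seg_bounds.
Qed.

Lemma is_CInt_unique f l : is_CInt f a b l -> CInt f a b = l.
Proof. apply (is_RInt_unique (V := C_R_CompleteNormedModule)). Qed.

Lemma RInt_correct_cont g : (forall t, (a <= t <= b)%R -> Ccont (fun x => RtoC (g x)) t) ->
  is_RInt g a b (RI g a b).
Proof.
intros H. apply (RInt_correct (V := R_CompleteNormedModule)).
apply (ex_RInt_continuous (V := R_CompleteNormedModule)).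
intros z Hz. apply Ccont_RtoC. apply H. now apply seg_bounds.
Qed.

Lemma CInt_RtoC g : (forall t, (a <= t <= b)%R -> Ccont (fun x => RtoC (g x)) t) ->
  CInt (fun x => RtoC (g x)) a b = RtoC (RI g a b).
Proof. intros H. apply is_CInt_unique. apply is_CInt_RtoC. now apply RInt_correct_cont. Qed.

Lemma is_RI_unique g (l : R) : is_RInt g a b l -> RI g a b = l.
Proof. apply (is_RInt_unique (V := R_CompleteNormedModule)). Qed.

Lemma CInt_le f g :
  (forall t, (a <= t <= b)%R -> Ccont f t) ->
  (forall t, (a <= t <= b)%R -> Ccont (fun x => RtoC (g x)) t) ->
  (forall t, (a <= t <= b)%R -> (Cmod (f t) <= g t)%R) ->
  (Cmod (CInt f a b) <= RI g a b)%R.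
Proof.
intros Hf Hg H. rewrite <- norm_C_R.
apply (norm_RInt_le (V := C_R_NormedModule) f g a b); [exact Hab | | now apply CInt_correct | now apply RInt_correct_cont].
intros x Hx. rewrite norm_C_R. now apply H.
Qed.

Lemma is_CInt_derive f f' :
  (forall t, (a <= t <= b)%R -> Rder f t (f' t)) ->
  (forall t, (a <= t <= b)%R -> Ccont f' t) -> is_CInt f' a b (f b - f a).
Proof.
intros H H'. apply (is_RInt_derive (V := C_R_CompleteNormedModule)).
- intros x Hx. apply Rder_is_derive. apply H. now apply seg_bounds.
- intros x Hx. apply Ccont_continuous. apply H'. now apply seg_bounds.
Qed.

End Segment.

Lemma CInt_Chasles f a b c :
  (a <= b)%R -> (b <= c)%R -> (forall t, (a <= t <= c)%R -> Ccont f t) ->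
  CInt f a b + CInt f b c = CInt f a c.
Proof.
intros H1 H2 H. apply (RInt_Chasles (V := C_R_CompleteNormedModule));
  eexists; apply CInt_correct; auto; intros t Ht; apply H; lra.
Qed.

Lemma RI_Chasles g a b c :
  (a <= b)%R -> (b <= c)%R -> (forall t, (a <= t <= c)%R -> Ccont (fun x => RtoC (g x)) t) ->
  (RI g a b + RI g b c = RI g a c)%R.
Proof.
intros H1 H2 H. apply (RInt_Chasles (V := R_CompleteNormedModule));
  eexists; apply RInt_correct_cont; auto; intros t Ht; apply H; lra.
Qed.

(** [D] is the range of integration of the improper integral between the
    filters [Fa] and [Fb]; the second clause says that the segments of
    integration exhaust [D]. *)
Definition int_range (Fa Fb : (R -> Prop) -> Prop) (D : R -> Prop) : Prop :=
  filter_prod Fa Fb (fun ab => (fst ab <= snd ab)%R /\ forall x, (fst ab <= x <= snd ab)%R -> D x) /\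
  forall a b : R, D a -> D b -> filter_prod Fa Fb (fun ab => (fst ab <= a)%R /\ (b <= snd ab)%R).

Lemma int_range_0_infty : int_range (at_point 0%R) (Rbar_locally p_infty) (fun x => (0 <= x)%R).
Proof.
split.
- apply (Filter_prod _ _ _ (fun a => a = 0%R) (fun b => (0 < b)%R)); [reflexivity | exists 0%R; auto |].
  intros x y -> Hy. simpl. split; [lra|]. intros; lra.
- intros a b Ha Hb.
  apply (Filter_prod _ _ _ (fun a => a = 0%R) (fun y => (b < y)%R)); [reflexivity | exists b; auto |].
  intros x y -> Hy. simpl. lra.
Qed.

Lemma int_range_0p_infty : int_range (at_right 0%R) (Rbar_locally p_infty) (fun x => (0 < x)%R).
Proof.
split.
- apply (Filter_prod _ _ _ (fun a => (0 < a < 1)%R) (fun b => (1 < b)%R)); [ | exists 1%R; auto |].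
  + apply locally_R with 1%R; [lra|]. intros y Hy H0. rewrite Rminus_0_r in Hy. apply Rabs_def2 in Hy. lra.
  + intros x y Hx Hy. simpl. split; [lra|]. intros; lra.
- intros a b Ha Hb.
  apply (Filter_prod _ _ _ (fun x => (0 < x < a)%R) (fun y => (b < y)%R)); [ | exists b; auto |].
  + apply locally_R with a; [exact Ha|]. intros y Hy H0. rewrite Rminus_0_r in Hy. apply Rabs_def2 in Hy. lra.
  + intros x y Hx Hy. simpl. lra.
Qed.

Lemma int_range_0_1 : int_range (at_point 0%R) (at_point 1%R) (fun x => (0 <= x <= 1)%R).
Proof.
split.
- apply (Filter_prod _ _ _ (fun a => a = 0%R) (fun b => b = 1%R)); [reflexivity | reflexivity |].
  intros x y -> ->. simpl. split; [lra|]. intros; lra.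
- intros a b Ha Hb.
  apply (Filter_prod _ _ _ (fun a => a = 0%R) (fun b => b = 1%R)); [reflexivity | reflexivity |].
  intros x y -> ->. simpl. lra.
Qed.

Section Improper.
Context (Fa Fb : (R -> Prop) -> Prop) {FFa : ProperFilter Fa} {FFb : ProperFilter Fb}
  (D : R -> Prop) (HD : int_range Fa Fb D).

Lemma is_CRInt_gen_Clim f l :
  (forall t, D t -> Ccont f t) ->
  is_CRInt_gen f Fa Fb l <-> Clim (filter_prod Fa Fb) (fun ab => CInt f (fst ab) (snd ab)) l.
Proof.
intros Hf. split.
- intros H. apply Clim_filterlim; [typeclasses eauto|].
  intros P HP. generalize (H P HP). unfold filtermap, filtermapi. apply filter_imp.
  intros [a b] [y [Hy HPy]]. simpl in *.
  unfold CInt. now rewrite (is_RInt_unique (V := C_R_CompleteNormedModule) f a b y Hy).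
- intros H. assert (H' := proj1 (Clim_filterlim _ _ _) H).
  intros P HP. assert (HH := H' P HP). unfold filtermap in HH.
  generalize (filter_and _ _ (proj1 HD) HH). unfold filtermapi. apply filter_imp.
  intros [a b] [[h1 h2] h3]. simpl in *. exists (CInt f a b). split; [|exact h3].
  apply CInt_correct; auto.
Qed.

Lemma Cint_unique f l1 l2 : is_CRInt_gen f Fa Fb l1 -> is_CRInt_gen f Fa Fb l2 -> l1 = l2.
Proof.
intros H1 H2.
rewrite <- (is_RInt_gen_unique (V := C_R_CompleteNormedModule) f l1 H1).
apply (is_RInt_gen_unique (V := C_R_CompleteNormedModule) f l2 H2).
Qed.

Lemma Cint_FTC f f' la lb :
  (forall t, D t -> Rder f t (f' t)) -> (forall t, D t -> Ccont f' t) ->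
  Clim Fa f la -> Clim Fb f lb -> is_CRInt_gen f' Fa Fb (lb - la).
Proof.
intros H H' Ha Hb. apply is_CRInt_gen_Clim; [exact H'|].
apply Clim_ext_loc with (fun ab : R * R => f (snd ab) - f (fst ab)); [typeclasses eauto | |].
- generalize (proj1 HD). apply filter_imp. intros [a b] [h1 h2]. simpl in *.
  symmetry. apply is_CInt_unique. apply is_CInt_derive; auto.
- apply Clim_minus; [typeclasses eauto | |].
  + apply (Clim_comp _ Fb snd); [apply filterlim_snd | exact Hb].
  + apply (Clim_comp _ Fa fst); [apply filterlim_fst | exact Ha].
Qed.

Lemma Cint_scal c f l : is_CRInt_gen f Fa Fb l -> is_CRInt_gen (fun x => c * f x) Fa Fb (c * l).
Proof.
intros H P HP.
assert (Hid : Clim (locally l) (fun x : C => x) l)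
  by (apply Clim_filterlim; [apply locally_filter | apply filterlim_id]).
assert (Hc := proj1 (Clim_filterlim _ _ _) (Clim_scal (locally l) c _ _ Hid)).
generalize (H _ (Hc P HP)). unfold filtermapi, filtermap. apply filter_imp.
intros [a b] [y [Hy HPy]]. exists (c * y). split; [now apply is_CInt_scal | exact HPy].
Qed.

Lemma Cint_plus f g lf lg :
  is_CRInt_gen f Fa Fb lf -> is_CRInt_gen g Fa Fb lg -> is_CRInt_gen (fun x => f x + g x) Fa Fb (lf + lg).
Proof. apply (is_RInt_gen_plus (V := C_R_NormedModule)). Qed.

Lemma Cint_minus f g lf lg :
  is_CRInt_gen f Fa Fb lf -> is_CRInt_gen g Fa Fb lg -> is_CRInt_gen (fun x => f x - g x) Fa Fb (lf - lg).
Proof. apply (is_RInt_gen_minus (V := C_R_NormedModule)). Qed.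

Lemma Cint_Csum (u : nat -> R -> C) (l : nat -> C) n :
  (forall k, is_CRInt_gen (u k) Fa Fb (l k)) ->
  is_CRInt_gen (fun x => Csum (fun k => u k x) n) Fa Fb (Csum l n).
Proof.
intros H. induction n as [|n IH]; simpl; [|now apply Cint_plus].
assert (h := Cint_scal 0 _ _ (H 0%nat)). replace (0 * l 0%nat) with (RtoC 0) in h by ring.
revert h. apply (is_RInt_gen_ext (V := C_R_NormedModule)).
apply filter_forall. intros [a b] x _. change (0 * u 0%nat x = 0). ring.
Qed.

Lemma Cint_ext f g l : (forall x, D x -> f x = g x) -> is_CRInt_gen f Fa Fb l -> is_CRInt_gen g Fa Fb l.
Proof.
intros H. apply (is_RInt_gen_ext (V := C_R_NormedModule)).
generalize (proj1 HD). apply filter_imp. intros [a b] [h1 h2] x Hx. simpl in *.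
rewrite Rmin_left, Rmax_right in Hx by exact h1. apply H. apply h2. lra.
Qed.

(** The integrals of [f] over nearby segments differ by at most those of its
    majorant [g], so they inherit the Cauchy property. *)
Lemma Cint_dominated f (g : R -> R) (m : R) :
  (forall t, D t -> Ccont f t) -> (forall t, D t -> Ccont (fun x => RtoC (g x)) t) ->
  (forall t, D t -> (Cmod (f t) <= g t)%R) ->
  is_CRInt_gen (fun x => RtoC (g x)) Fa Fb (RtoC m) ->
  exists l, is_CRInt_gen f Fa Fb l /\ (Cmod l <= m)%R.
Proof.
intros Hf Hg Hle Hm.
assert (Hm' := proj1 (is_CRInt_gen_Clim _ _ Hg) Hm).
assert (Key : forall e : R, (0 < e)%R -> exists Qa Qb, Fa Qa /\ Fb Qb /\
   forall a b, Qa a -> Qb b -> (a <= b)%R /\ (forall x, (a <= x <= b)%R -> D x) /\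
     (Rabs (RI g a b - m) < e)%R).
{ intros e He. destruct (filter_and _ _ (proj1 HD) (Hm' e He)) as [Qa Qb Ha Hb H].
  exists Qa, Qb. split; [exact Ha|]. split; [exact Hb|]. intros a b h1 h2.
  destruct (H a b h1 h2) as [[h3 h4] h5]. simpl in *. split; [exact h3|]. split; [exact h4|].
  rewrite (CInt_RtoC a b h3 g) in h5 by auto. rewrite <- RtoC_minus, Cmod_R in h5. exact h5. }
assert (Left : forall a a' b, (a <= a')%R -> (a' <= b)%R -> (forall x, (a <= x <= b)%R -> D x) ->
   (Cmod (CInt f a b - CInt f a' b) <= Rabs (RI g a b - RI g a' b))%R).
{ intros a a' b h1 h2 h3.
  rewrite <- (CInt_Chasles f a a' b h1 h2) by auto.
  rewrite <- (RI_Chasles g a a' b h1 h2) by auto.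
  replace (CInt f a a' + CInt f a' b - CInt f a' b) with (CInt f a a') by ring.
  replace (RI g a a' + RI g a' b - RI g a' b)%R with (RI g a a') by ring.
  eapply Rle_trans; [apply (CInt_le a a' h1 f g); intros; [apply Hf | apply Hg | apply Hle]; apply h3; lra | apply Rle_abs]. }
assert (Right : forall a b b', (a <= b)%R -> (b <= b')%R -> (forall x, (a <= x <= b')%R -> D x) ->
   (Cmod (CInt f a b' - CInt f a b) <= Rabs (RI g a b' - RI g a b))%R).
{ intros a b b' h1 h2 h3.
  rewrite <- (CInt_Chasles f a b b' h1 h2) by auto.
  rewrite <- (RI_Chasles g a b b' h1 h2) by auto.
  replace (CInt f a b + CInt f b b' - CInt f a b) with (CInt f b b') by ring.
  replace (RI g a b + RI g b b' - RI g a b)%R with (RI g b b') by ring.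
  eapply Rle_trans; [apply (CInt_le b b' h2 f g); intros; [apply Hf | apply Hg | apply Hle]; apply h3; lra | apply Rle_abs]. }
(* The end points are moved one at a time, each costing less than [eps / 2]. *)
destruct (proj1 (filterlim_locally_cauchy (U := CompleteNormedModule.CompleteSpace _ C_R_CompleteNormedModule)
   (F := filter_prod Fa Fb) (fun ab => CInt f (fst ab) (snd ab)))) as [l Hl].
{ intros eps. assert (He : (0 < eps / 4)%R) by (destruct eps; simpl; lra).
  destruct (Key _ He) as [Qa [Qb [Ha [Hb H]]]].
  exists (fun ab => Qa (fst ab) /\ Qb (snd ab)). split.
  - apply (Filter_prod _ _ _ Qa Qb Ha Hb). auto.
  - intros [a b] [a' b'] [h1 h2] [h1' h2']. simpl in *.
    apply C_NormedModule_mixin_compat1.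
    change (Cmod (CInt f a' b' - CInt f a b) < eps)%R.
    destruct (H a b h1 h2) as [A1 [A2 A3]].
    destruct (H a' b h1' h2) as [B1 [B2 B3]].
    destruct (H a' b' h1' h2') as [C1 [C2 C3]].
    apply Rabs_def2 in A3. apply Rabs_def2 in B3. apply Rabs_def2 in C3.
    assert (S1 : (Cmod (CInt f a' b - CInt f a b) < eps / 2)%R).
    { destruct (Rle_lt_dec a a') as [h|h].
      - rewrite Cmod_minus_sym. eapply Rle_lt_trans; [apply Left; auto|]. apply Rabs_def1; lra.
      - eapply Rle_lt_trans; [apply Left; auto; lra|]. apply Rabs_def1; lra. }
    assert (S2 : (Cmod (CInt f a' b' - CInt f a' b) < eps / 2)%R).
    { destruct (Rle_lt_dec b b') as [h|h].
      - eapply Rle_lt_trans; [apply Right; auto|]. apply Rabs_def1; lra.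
      - rewrite Cmod_minus_sym. eapply Rle_lt_trans; [apply Right; auto; lra|]. apply Rabs_def1; lra. }
    replace (CInt f a' b' - CInt f a b) with ((CInt f a' b' - CInt f a' b) + (CInt f a' b - CInt f a b)) by ring.
    eapply Rle_lt_trans; [apply Cmod_triangle|]. lra. }
assert (Hl' : Clim (filter_prod Fa Fb) (fun ab => CInt f (fst ab) (snd ab)) l)
  by (apply Clim_filterlim; [typeclasses eauto | exact Hl]).
exists l. split; [now apply is_CRInt_gen_Clim|].
apply Rnot_lt_le. intros h.
assert (He : (0 < Cmod l - m)%R) by lra.
assert (Hb : (Cmod l <= m + (Cmod l - m) / 2)%R).
{ apply (Clim_le (filter_prod Fa Fb) (fun ab => CInt f (fst ab) (snd ab))); [|exact Hl'].
  destruct (Key ((Cmod l - m) / 2)%R ltac:(lra)) as [Qa [Qb [Ha [Hb H]]]].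
  apply (Filter_prod _ _ _ Qa Qb Ha Hb). intros a b h1 h2. simpl.
  destruct (H a b h1 h2) as [A1 [A2 A3]].
  eapply Rle_trans; [apply (CInt_le a b A1 f g); auto|].
  apply Rabs_def2 in A3. lra. }
lra.
Qed.

Lemma Cint_le f (g : R -> R) (l : C) (m : R) :
  (forall t, D t -> Ccont f t) -> (forall t, D t -> Ccont (fun x => RtoC (g x)) t) ->
  (forall t, D t -> (Cmod (f t) <= g t)%R) ->
  is_CRInt_gen f Fa Fb l -> is_CRInt_gen (fun x => RtoC (g x)) Fa Fb (RtoC m) -> (Cmod l <= m)%R.
Proof.
intros Hf Hg Hle Hl Hm.
destruct (Cint_dominated f g m Hf Hg Hle Hm) as [l' [Hl' H]].
now rewrite (Cint_unique _ _ _ Hl Hl').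
Qed.

(** Enlarging the segment increases the integral, and the enlarged ones tend to [m]. *)
Lemma RInt_le_Cint (g : R -> R) (m : R) a b :
  (forall t, D t -> Ccont (fun x => RtoC (g x)) t) -> (forall t, D t -> (0 <= g t)%R) ->
  is_CRInt_gen (fun x => RtoC (g x)) Fa Fb (RtoC m) ->
  (a <= b)%R -> (forall x, (a <= x <= b)%R -> D x) -> (RI g a b <= m)%R.
Proof.
intros Hg Hpos Hm Hab HDab.
assert (Hm' := proj1 (is_CRInt_gen_Clim _ _ Hg) Hm).
apply Rnot_lt_le. intros h. assert (He : (0 < RI g a b - m)%R) by lra.
destruct (filter_ex (F := filter_prod Fa Fb) _ (filter_and (F := filter_prod Fa Fb) _ _ (filter_and (F := filter_prod Fa Fb) _ _ (proj1 HD)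
   (proj2 HD a b (HDab a ltac:(lra)) (HDab b ltac:(lra)))) (Hm' _ He))) as [[a' b'] [[[h1 h2] [h3 h4]] h5]].
simpl in *. rewrite (CInt_RtoC a' b' h1 g) in h5 by auto. rewrite <- RtoC_minus, Cmod_R in h5.
apply Rabs_def2 in h5.
assert (X : forall x y, (a' <= x)%R -> (x <= y)%R -> (y <= b')%R -> is_RInt g x y (RI g x y) /\ (0 <= RI g x y)%R).
{ intros x y k1 k2 k3. split.
  - apply RInt_correct_cont; [exact k2|]. intros; apply Hg; apply h2; lra.
  - apply RInt_ge_0; [exact k2 | exists (RI g x y); apply RInt_correct_cont; [exact k2|]; intros; apply Hg; apply h2; lra|].
    intros; apply Hpos; apply h2; lra. }
destruct (X a' a ltac:(lra) h3 ltac:(lra)) as [I1 P1].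
destruct (X a b ltac:(lra) Hab ltac:(lra)) as [I2 P2].
destruct (X b b' ltac:(lra) ltac:(lra) ltac:(lra)) as [I3 P3].
assert (E1 := RI_Chasles g a' a b' h3 ltac:(lra) ltac:(auto)).
assert (E2 := RI_Chasles g a b b' Hab h4 ltac:(intros; apply Hg; apply h2; lra)). lra.
Qed.

(** Termwise integration.  The weight [w] gives locally uniform convergence, hence
    a continuous sum; the integrable majorants [g k] bound the remainders
    uniformly over all segments, hence the interchange of the two limits. *)
Lemma Cint_series (D' : R -> Prop) (f : R -> C) (u : nat -> R -> C) (l : nat -> C)
  (v : nat -> R) (V B : R) (w : R -> R) (g : nat -> R -> R) (gam : nat -> R) :
  (forall t, D t -> locally t D') ->
  (forall k t, D t -> Ccont (u k) t) ->
  (forall k t, D' t -> (Cmod (u k t) <= v k * w t)%R) ->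
  (forall t, D t -> Ccont (fun x => RtoC (w x)) t) ->
  (forall k, (0 <= v k)%R) -> is_series v V ->
  (forall k t, D t -> (Cmod (u k t) <= g k t)%R) ->
  (forall k t, D t -> Ccont (fun x => RtoC (g k x)) t) ->
  (forall k, is_CRInt_gen (fun x => RtoC (g k x)) Fa Fb (RtoC (gam k))) ->
  (forall k, (gam k <= B * v k)%R) ->
  (forall k, is_CRInt_gen (u k) Fa Fb (l k)) ->
  (forall t, D' t -> is_Cseries (fun k => u k t) (f t)) ->
  exists L, is_Cseries l L /\ is_CRInt_gen f Fa Fb L.
Proof.
intros HD' Hu Hv Hw Hv0 HV Hg Hgc Hgi Hgam Hl Hf.
assert (Htail : forall n t, D' t -> (Cmod (f t - Csum (fun k => u k t) n) <= (V - Rsum v n) * w t)%R).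
{ intros n t Ht.
  assert (HVw : is_series (fun k => v k * w t)%R (V * w t)%R) by (apply is_series_scal_r; exact HV).
  destruct (Cseries_dominated (fun k => u k t) (fun k => (v k * w t)%R) _ (fun k => Hv k t Ht) HVw) as [F [HF1 HF2]].
  rewrite (is_Cseries_unique _ _ _ (Hf t Ht) HF1).
  eapply Rle_trans; [apply HF2|]. right. rewrite Rmult_minus_distr_r. f_equal.
  clear. induction n as [|n IH]; simpl; [ring|]. rewrite IH. ring. }
assert (Ht0 := Rsum_tail v V HV).
assert (HtN : forall e : R, (0 < e)%R -> exists n, (0 <= V - Rsum v n < e)%R).
{ intros e He. destruct (proj1 (filterlim_locally _ _) Ht0 (mkposreal e He)) as [N HN].
  specialize (HN N ltac:(lia)). exists N.
  unfold ball in HN; simpl in HN; unfold AbsRing_ball, abs, minus, plus, opp in HN; simpl in HN.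
  apply Rabs_def2 in HN. assert (h := Rsum_le_series v V N Hv0 HV). lra. }
assert (HDD : forall t, D t -> D' t) by (intros t Ht; exact (locally_singleton _ _ (HD' t Ht))).
(* Continuity of the sum, by the three-term estimate on a neighbourhood where [w] is bounded. *)
assert (Hfc : forall t, D t -> Ccont f t).
{ intros t Ht e He.
  set (W := (Rabs (w t) + 1)%R). assert (HW : (0 < W)%R) by (unfold W; assert (h := Rabs_pos (w t)); lra).
  destruct (HtN (e / 3 / W)%R) as [n Hn]; [apply Rdiv_lt_0_compat; lra|].
  assert (HnW : ((V - Rsum v n) * W < e / 3)%R).
  { replace (e / 3)%R with (e / 3 / W * W)%R by (field; lra). apply Rmult_lt_compat_r; lra. }
  assert (Hc := Ccont_Csum u n t (fun k => Hu k t Ht)).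
  generalize (filter_and (F := locally t) _ _ (HD' t Ht) (filter_and (F := locally t) _ _ (Hc (e / 3)%R ltac:(lra)) (Hw t Ht 1%R ltac:(lra)))).
  apply filter_imp. intros x [Hx1 [Hx2 Hx3]].
  assert (Hwx : (w x <= W)%R).
  { rewrite <- RtoC_minus, Cmod_R in Hx3. apply Rabs_def2 in Hx3. unfold W. assert (h := Rle_abs (w t)). lra. }
  assert (T1 := Htail n x Hx1). assert (T2 := Htail n t (HDD t Ht)).
  assert (Hwt : (w t <= W)%R) by (unfold W; assert (h := Rle_abs (w t)); lra).
  set (S := fun x => Csum (fun k => u k x) n) in *.
  change (Cmod (S x - S t) < e / 3)%R in Hx2.
  change (Cmod (f x - S x) <= (V - Rsum v n) * w x)%R in T1.
  change (Cmod (f t - S t) <= (V - Rsum v n) * w t)%R in T2.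
  replace (f x - f t) with ((f x - S x) + ((S x - S t) + - (f t - S t))) by ring.
  eapply Rle_lt_trans; [apply Cmod_triangle|].
  assert (h := Cmod_triangle (S x - S t) (- (f t - S t))). rewrite Cmod_opp in h.
  assert (U1 : ((V - Rsum v n) * w x <= (V - Rsum v n) * W)%R) by (apply Rmult_le_compat_l; lra).
  assert (U2 : ((V - Rsum v n) * w t <= (V - Rsum v n) * W)%R) by (apply Rmult_le_compat_l; lra).
  lra. }
assert (Hgp : forall k t, D t -> (0 <= g k t)%R) by (intros k t Ht; eapply Rle_trans; [apply Cmod_ge_0 | now apply Hg]).
(* On a fixed segment the remainder integral is bounded independently of the segment:
   pass to the limit in [m] in the bound for the sum from [n] to [m]. *)
assert (Hseg : forall n a b, (a <= b)%R -> (forall x, (a <= x <= b)%R -> D x) ->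
   (Cmod (CInt f a b - CInt (fun x => Csum (fun k => u k x) n) a b) <= B * (V - Rsum v n))%R).
{ intros n a b Hab HDab.
  assert (Step : forall m, (n <= m)%nat ->
     (Cmod (CInt (fun x => Csum (fun k => u k x) m) a b - CInt (fun x => Csum (fun k => u k x) n) a b)
        <= B * (Rsum v m - Rsum v n))%R).
  { induction 1 as [|m Hm IH].
    - match goal with |- context [Cmod (?x - ?x)] => replace (x - x) with (RtoC 0) by ring end.
      rewrite Cmod_0. lra.
    - replace (CInt (fun x => Csum (fun k => u k x) (S m)) a b) with
        (CInt (fun x => Csum (fun k => u k x) m) a b + CInt (u m) a b).
      + match goal with |- context [Cmod (?x + ?y - ?z)] => replace (x + y - z) with ((x - z) + y) by ring end.
        eapply Rle_trans; [apply Cmod_triangle|].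
        assert (h1 : (Cmod (CInt (u m) a b) <= RI (g m) a b)%R) by (apply CInt_le; auto).
        assert (h2 := RInt_le_Cint (g m) (gam m) a b (Hgc m) (Hgp m) (Hgi m) Hab HDab).
        assert (h3 := Hgam m). simpl. lra.
      + symmetry. apply is_CInt_unique. simpl.
        apply (is_RInt_plus (V := C_R_NormedModule)); apply CInt_correct; auto.
        intros t Ht. apply Ccont_Csum. auto. }
  set (Wi := RI w a b).
  assert (Lim : forall m, (Cmod (CInt f a b - CInt (fun x => Csum (fun k => u k x) m) a b) <= (V - Rsum v m) * Wi)%R).
  { intros m.
    replace (CInt f a b - CInt (fun x => Csum (fun k => u k x) m) a b) with
      (CInt (fun x => f x - Csum (fun k => u k x) m) a b).
    - replace ((V - Rsum v m) * Wi)%R with (RI (fun x => (V - Rsum v m) * w x)%R a b).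
      + apply CInt_le; auto.
        * intros t Ht. apply Ccont_minus; [auto|]. apply Ccont_Csum; auto.
        * intros t Ht. apply Ccont_ext with (fun x => RtoC (V - Rsum v m) * RtoC (w x)); [intros; now rewrite RtoC_mult|].
          apply Ccont_scal; auto.
      + apply is_RI_unique.
        apply (is_RInt_scal (V := R_NormedModule)). apply RInt_correct_cont; auto.
    - apply is_CInt_unique. apply (is_RInt_minus (V := C_R_NormedModule)); apply CInt_correct; auto.
      intros t Ht. apply Ccont_Csum. auto. }
  apply Rnot_lt_le. intros h.
  set (gap := (Cmod (CInt f a b - CInt (fun x => Csum (fun k => u k x) n) a b) - B * (V - Rsum v n))%R) in *.
  assert (Hgap : (0 < gap)%R) by (unfold gap; lra).
  assert (HWa := Rabs_pos Wi). assert (HBa := Rabs_pos B).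
  destruct (HtN (gap / (Rabs Wi + Rabs B + 1) / 2)%R) as [m0 Hm0]; [repeat apply Rdiv_lt_0_compat; lra|].
  set (m := (n + m0)%nat).
  assert (Hm : (0 <= V - Rsum v m < gap / (Rabs Wi + Rabs B + 1) / 2)%R).
  { assert (h1 := Rsum_incr v m0 m Hv0 ltac:(unfold m; lia)). assert (h2 := Rsum_le_series v V m Hv0 HV). lra. }
  specialize (Step m ltac:(unfold m; lia)). specialize (Lim m).
  assert (T := Cmod_triangle (CInt f a b - CInt (fun x => Csum (fun k => u k x) m) a b)
     (CInt (fun x => Csum (fun k => u k x) m) a b - CInt (fun x => Csum (fun k => u k x) n) a b)).
  match type of T with context [Cmod (?x - ?y + (?y - ?z))] => replace (x - y + (y - z)) with (x - z) in T by ring end.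
  assert (Q : ((V - Rsum v m) * (Rabs Wi + Rabs B + 1) < gap / 2)%R).
  { replace (gap / 2)%R with (gap / (Rabs Wi + Rabs B + 1) / 2 * (Rabs Wi + Rabs B + 1))%R by (field; lra).
    apply Rmult_lt_compat_r; lra. }
  assert (Q1 : ((V - Rsum v m) * Wi <= (V - Rsum v m) * Rabs Wi)%R) by (apply Rmult_le_compat_l; [lra | apply Rle_abs]).
  assert (Q2 : (- B * (V - Rsum v m) <= Rabs B * (V - Rsum v m))%R)
    by (apply Rmult_le_compat_r; [lra | rewrite <- Rabs_Ropp; apply Rle_abs]).
  unfold gap in *. nra. }
assert (HBV : is_series (fun k => (B * v k)%R) (B * V)%R) by exact (is_series_scal (V := R_NormedModule) B v V HV).
destruct (Cseries_dominated l (fun k => (B * v k)%R) (B * V)%R) as [L [HL1 HL2]].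
{ intros k. eapply Rle_trans; [|apply Hgam]. apply (Cint_le (u k) (g k)); auto. }
{ exact HBV. }
exists L. split; [exact HL1|].
apply is_CRInt_gen_Clim; [exact Hfc|]. intros e He.
assert (HBa := Rabs_pos B).
destruct (HtN (e / 4 / (Rabs B + 1))%R) as [n Hn]; [repeat apply Rdiv_lt_0_compat; lra|].
assert (HB : (B * (V - Rsum v n) < e / 4)%R).
{ apply Rle_lt_trans with ((Rabs B + 1) * (V - Rsum v n))%R.
  - apply Rmult_le_compat_r; [lra|]. assert (h := Rle_abs B). lra.
  - replace (e / 4)%R with ((Rabs B + 1) * (e / 4 / (Rabs B + 1)))%R by (field; lra).
    apply Rmult_lt_compat_l; lra. }
assert (HLn : (Cmod (L - Csum l n) < e / 4)%R).
{ eapply Rle_lt_trans; [apply HL2|]. eapply Rle_lt_trans; [|exact HB]. right.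
  rewrite Rmult_minus_distr_l. f_equal. clear. induction n as [|n IH]; simpl; [ring|]. rewrite IH. ring. }
assert (HS := proj1 (is_CRInt_gen_Clim (fun x => Csum (fun k => u k x) n) (Csum l n)
   (fun t Ht => Ccont_Csum u n t (fun k => Hu k t Ht))) (Cint_Csum u l n Hl)).
generalize (filter_and (F := filter_prod Fa Fb) _ _ (proj1 HD) (HS (e / 4)%R ltac:(lra))). apply filter_imp.
intros [a b] [[h1 h2] h3]. simpl in *. specialize (Hseg n a b h1 h2).
set (I1 := CInt f a b) in *. set (I2 := CInt (fun x => Csum (fun k => u k x) n) a b) in *.
replace (I1 - L) with ((I1 - I2) + ((I2 - Csum l n) + - (L - Csum l n))) by ring.
eapply Rle_lt_trans; [apply Cmod_triangle|].
assert (h4 := Cmod_triangle (I2 - Csum l n) (- (L - Csum l n))). rewrite Cmod_opp in h4. lra.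
Qed.

End Improper.

Lemma Cint_scale (f : R -> C) (k : R) l :
  (0 < k)%R -> is_CRInt_gen f (at_right 0%R) (Rbar_locally p_infty) l ->
  is_CRInt_gen (fun x => RtoC k * f (k * x)%R) (at_right 0%R) (Rbar_locally p_infty) l.
Proof.
intros Hk H P HP. destruct (H P HP) as [Qa Qb Ha Hb HQ].
apply (Filter_prod _ _ _ (fun x => Qa (k * x)%R) (fun x => Qb (k * x)%R)).
- destruct Ha as [d Hd]. apply locally_R with (d / k)%R; [apply Rdiv_lt_0_compat; [apply d | exact Hk]|].
  intros y Hy Hy0. apply Hd; [|nra].
  change (Rabs (k * y - 0) < d)%R. rewrite Rminus_0_r in *.
  rewrite Rabs_mult, (Rabs_pos_eq k) by lra.
  apply (Rmult_lt_compat_l k) in Hy; [|lra]. replace (k * (d / k))%R with (pos d) in Hy by (field; lra). exact Hy.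
- destruct Hb as [M HM]. exists (M / k)%R. intros x Hx. apply HM.
  apply (Rmult_lt_compat_l k) in Hx; [|lra]. replace (k * (M / k))%R with M in Hx by (field; lra). exact Hx.
- intros a b h1 h2. destruct (HQ _ _ h1 h2) as [y [Hy HPy]]. exists y. split; [|exact HPy].
  simpl in *.
  assert (h := is_RInt_comp_lin (V := C_R_NormedModule) f k 0 a b y).
  rewrite !Rplus_0_r in h. specialize (h Hy). revert h.
  apply is_RInt_ext. intros x _. rewrite Rplus_0_r. apply scal_C_R.
Qed.

(** * Analytic functions *)

Lemma pow_n_C (x : C) n : pow_n (K := C_AbsRing) x n = x ^ n.
Proof. induction n as [|n IH]; [reflexivity|]. simpl. rewrite IH. reflexivity. Qed.

Lemma is_pseries_Cseries (c : nat -> C) (x l : C) :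
  is_pseries (K := C_AbsRing) (V := C_NormedModule) c x l <-> is_Cseries (fun m => c m * x ^ m) l.
Proof.
split; intros H.
- apply is_Cseries_ext with (2 := H). intros n. change (pow_n (K := C_AbsRing) x n * c n = c n * x ^ n). rewrite (pow_n_C x n). ring.
- apply (is_Cseries_ext (fun m => c m * x ^ m)); [|exact H].
  intros n. change (c n * x ^ n = pow_n (K := C_AbsRing) x n * c n). rewrite (pow_n_C x n). ring.
Qed.

Lemma is_lim_pow_0 (K q : R) : (0 <= q < 1)%R -> filterlim (fun n => (K * q ^ n)%R) eventually (locally 0%R).
Proof.
intros Hq. assert (H := is_lim_seq_scal_l (fun n => (q ^ n)%R) K 0 (is_lim_seq_geom q ltac:(rewrite Rabs_pos_eq; lra))).
simpl in H. rewrite Rmult_0_r in H. exact H.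
Qed.

Lemma Clim_seq_bound (u : nat -> C) l K q :
  (0 <= q < 1)%R -> (forall n, (Cmod (l - u n) <= K * q ^ n)%R) -> Clim eventually u l.
Proof.
intros Hq H e He. assert (HK := proj1 (filterlim_locally _ _) (is_lim_pow_0 K q Hq) (mkposreal e He)).
revert HK. apply filter_imp. intros n Hn. specialize (H n).
change (Rabs (K * q ^ n - 0) < e)%R in Hn. rewrite Rminus_0_r in Hn. apply Rabs_def2 in Hn.
rewrite Cmod_minus_sym. lra.
Qed.

(** Taylor estimates that improve geometrically as the disc shrinks give both a
    power series and the complex derivative. *)
Lemma analytic_of_bound (f : C -> C) (z0 : C) (c : nat -> C) (r K : R) :
  (0 < r)%R ->
  (forall (h : C) (k : R) (M : nat), (0 < k <= 1)%R -> (Cmod h <= k * r)%R ->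
     (Cmod (f (z0 + h)%C - Csum (fun m => (c m * h ^ m)%C) M) <= K * k ^ M)%R) ->
  analytic_at f z0 /\ Cder f z0 (c 1%nat).
Proof.
intros Hr H. split.
- exists c, (r / 2)%R. split; [lra|]. intros z Hz.
  apply is_pseries_Cseries, is_Cseries_Clim.
  apply (Clim_seq_bound _ _ K (/ 2)); [lra|]. intros n.
  specialize (H (z - z0) (/ 2)%R n ltac:(lra) ltac:(lra)).
  now replace (z0 + (z - z0)) with z in H by ring.
- assert (H0 : f z0 = c 0%nat).
  { apply Cmod_small_eq. intros e He.
    assert (HK := Rabs_pos K).
    (* At [h = 0] every scale [k] is allowed. *)
    set (k := Rmin 1 (e / (Rabs K + 1))).
    assert (Hk : (0 < k <= 1)%R).
    { split; [apply Rmin_glb_lt; [lra | apply Rdiv_lt_0_compat; lra] | apply Rmin_l]. }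
    specialize (H 0 k 1%nat Hk ltac:(rewrite Cmod_0; nra)).
    simpl in H. replace (z0 + 0) with z0 in H by ring.
    replace (f z0 - (0 + c 0%nat * 1)) with (f z0 - c 0%nat) in H by ring.
    eapply Rle_trans; [exact H|]. rewrite Rmult_1_r.
    assert (k <= e / (Rabs K + 1))%R by apply Rmin_r.
    apply Rle_trans with ((Rabs K + 1) * (e / (Rabs K + 1)))%R; [|right; field; lra].
    assert (h := Rle_abs K). apply Rle_trans with ((Rabs K + 1) * k)%R.
    - apply Rmult_le_compat_r; lra.
    - apply Rmult_le_compat_l; lra. }
  intros e He. assert (HK := Rabs_pos K).
  set (B := (Rabs K / (r * r) + 1)%R).
  assert (HB : (0 < B)%R).
  { unfold B. assert (0 <= Rabs K / (r * r))%R by (apply Rdiv_le_0_compat; [lra | nra]). lra. }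
  exists (Rmin r (e / B)). split; [apply Rmin_glb_lt; [lra | now apply Rdiv_lt_0_compat]|].
  intros h Hh.
  assert (H1 : (Cmod h < r)%R) by (eapply Rlt_le_trans; [exact Hh | apply Rmin_l]).
  assert (H2 : (Cmod h < e / B)%R) by (eapply Rlt_le_trans; [exact Hh | apply Rmin_r]).
  assert (Hh0 := Cmod_ge_0 h).
  destruct (Req_dec (Cmod h) 0) as [E|E].
  + rewrite (Cmod_eq_0 _ E). replace (f (z0 + 0) - f z0 - c 1%nat * 0) with (RtoC 0).
    * rewrite Cmod_0. lra.
    * replace (z0 + 0) with z0 by ring. ring.
  + assert (Hk : (0 < Cmod h / r <= 1)%R).
    { split; [apply Rdiv_lt_0_compat; lra|]. apply Rmult_le_reg_r with r; [lra|].
      replace (Cmod h / r * r)%R with (Cmod h) by (field; lra). lra. }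
    (* The scale adapted to [h] makes the second-order remainder quadratic in [h]. *)
    specialize (H h (Cmod h / r)%R 2%nat Hk).
    assert (G : (Cmod h <= Cmod h / r * r)%R) by (right; field; lra). specialize (H G).
    simpl in H. replace (f (z0 + h) - f z0 - c 1%nat * h) with
      (f (z0 + h) - (0 + c 0%nat * 1 + c 1%nat * (h * 1))) by (rewrite H0; ring).
    eapply Rle_trans; [exact H|].
    apply Rle_trans with (B * Cmod h * Cmod h)%R.
    * replace (K * (Cmod h / r * (Cmod h / r * 1)))%R with (K / (r * r) * (Cmod h * Cmod h))%R by (field; lra).
      rewrite Rmult_assoc. apply Rmult_le_compat_r; [nra|].
      unfold B. assert (K / (r * r) <= Rabs K / (r * r))%R.
      { apply Rmult_le_compat_r; [left; apply Rinv_0_lt_compat; nra | apply Rle_abs]. }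
      lra.
    * apply Rmult_le_compat_r; [lra|]. apply (Rmult_lt_compat_l B) in H2; [|lra].
      replace (B * (e / B))%R with e in H2 by (field; lra). lra.
Qed.

Lemma analytic_ext_loc (f g : C -> C) z0 (r : R) :
  (0 < r)%R -> (forall z, (Cmod (z - z0) < r)%R -> f z = g z) -> analytic_at f z0 -> analytic_at g z0.
Proof.
intros Hr H [c [r1 [Hr1 Hc]]]. exists c, (Rmin r r1). split; [now apply Rmin_glb_lt|].
intros z Hz. rewrite <- H by (eapply Rlt_le_trans; [exact Hz | apply Rmin_l]).
apply Hc. eapply Rlt_le_trans; [exact Hz | apply Rmin_r].
Qed.

Lemma analytic_ext (f g : C -> C) z0 : (forall z, f z = g z) -> analytic_at f z0 -> analytic_at g z0.
Proof. intros H. apply (analytic_ext_loc f g z0 1); [lra | auto]. Qed.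

Lemma analytic_plus f g z0 : analytic_at f z0 -> analytic_at g z0 -> analytic_at (fun z => f z + g z) z0.
Proof.
intros [c [r1 [Hr1 Hc]]] [d [r2 [Hr2 Hd]]].
exists (fun m => c m + d m), (Rmin r1 r2). split; [now apply Rmin_glb_lt|].
intros z Hz. apply is_pseries_Cseries.
apply is_Cseries_ext with (fun m => c m * (z - z0) ^ m + d m * (z - z0) ^ m); [intros; ring|].
apply is_Cseries_plus; apply is_pseries_Cseries.
- apply Hc. eapply Rlt_le_trans; [exact Hz | apply Rmin_l].
- apply Hd. eapply Rlt_le_trans; [exact Hz | apply Rmin_r].
Qed.

Lemma analytic_scal a f z0 : analytic_at f z0 -> analytic_at (fun z => a * f z) z0.
Proof.
intros [c [r [Hr Hc]]]. exists (fun m => a * c m), r. split; [exact Hr|].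
intros z Hz. apply is_pseries_Cseries.
apply is_Cseries_ext with (fun m => a * (c m * (z - z0) ^ m)); [intros; ring|].
apply is_Cseries_scal. apply is_pseries_Cseries. auto.
Qed.

Lemma analytic_minus f g z0 : analytic_at f z0 -> analytic_at g z0 -> analytic_at (fun z => f z - g z) z0.
Proof.
intros Hf Hg. apply analytic_ext with (fun z => f z + - (1) * g z); [intros; ring|].
apply analytic_plus; [exact Hf | now apply analytic_scal].
Qed.

Lemma analytic_const a z0 : analytic_at (fun _ => a) z0.
Proof.
exists (fun m => match m with O => a | _ => RtoC 0 end), 1%R. split; [lra|].
intros z _. apply is_pseries_Cseries, is_Cseries_Clim.
apply Clim_ext_loc with (fun _ => a); [apply eventually_filter | | apply Clim_const; apply eventually_filter].
exists 1%nat. intros n Hn. induction Hn as [|n Hn IH]; simpl.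
- ring.
- rewrite <- IH. destruct n; [lia|]. ring.
Qed.

(** Multiplying by [(z - z0) + (z0 + a)] shifts and scales the coefficients. *)
Lemma analytic_mul_linear a f z0 : analytic_at f z0 -> analytic_at (fun z => f z * (z + a)) z0.
Proof.
intros [c [r [Hr Hc]]].
set (d := fun m => match m with O => RtoC 0 | S j => c j end).
exists (fun m => (z0 + a) * c m + d m), r. split; [exact Hr|].
intros z Hz. apply is_pseries_Cseries.
assert (H := proj1 (is_pseries_Cseries _ _ _) (Hc z Hz)).
set (x := z - z0) in *.
replace (f z * (z + a)) with ((z0 + a) * f z + x * f z) by (unfold x; ring).
apply is_Cseries_ext with (fun m => (z0 + a) * (c m * x ^ m) + d m * x ^ m); [intros; ring|].
apply is_Cseries_plus; [now apply is_Cseries_scal|].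
apply is_Cseries_Clim. intros e He. apply eventually_S.
assert (H' := proj1 (is_Cseries_Clim _ _) (is_Cseries_scal x _ _ H)).
generalize (H' e He). apply filter_imp. intros n Hn.
replace (Csum (fun m => (d m * x ^ m)%C) (S n)) with (Csum (fun m => (x * (c m * x ^ m))%C) n); [exact Hn|].
clear Hn. induction n as [|n IH]; [unfold d; simpl; ring|].
simpl. simpl in IH. rewrite IH. ring.
Qed.

Lemma analytic_pochhammer f z0 n : analytic_at f z0 -> analytic_at (fun z => f z * pochhammer z n) z0.
Proof.
intros H. induction n as [|n IH]; simpl.
- apply analytic_ext with f; [intros; ring | exact H].
- apply analytic_ext with (fun z => f z * pochhammer z n * (z + INR n)); [intros; ring|].
  now apply analytic_mul_linear.
Qed.

Lemma Csum_geom (q : C) n : q <> 1 -> Csum (fun m => (q ^ m)%C) n = (1 - q ^ n) / (1 - q).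
Proof.
intros H. assert (1 - q <> 0) by (intros E; apply H; replace q with (1 - (1 - q)) by ring; rewrite E; ring).
induction n as [|n IH]; simpl; [field; assumption|]. rewrite IH. field. assumption.
Qed.

Lemma analytic_inv_linear (b z0 : C) : z0 <> b -> analytic_at (fun z => / (z - b)) z0.
Proof.
intros H. assert (Hk : z0 - b <> 0) by (intros E; apply H; replace z0 with (z0 - b + b) by ring; rewrite E; ring).
set (k := z0 - b) in *.
assert (Hm : (0 < Cmod k)%R) by (apply (proj1 (Cmod_gt_0 k)); exact Hk).
exists (fun m => / k * (- / k) ^ m), (Cmod k). split; [exact Hm|].
intros z Hz. apply is_pseries_Cseries.
set (x := z - z0) in *. set (q := - / k * x).
assert (Hq : (0 <= Cmod q < 1)%R).
{ split; [apply Cmod_ge_0|]. unfold q. rewrite Cmod_mult, Cmod_opp, Cmod_inv by exact Hk.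
  apply Rmult_lt_reg_l with (Cmod k); [exact Hm|]. rewrite <- Rmult_assoc, Rinv_r by lra. lra. }
assert (Hq1 : q <> 1) by (intros E; rewrite E, Cmod_1 in Hq; lra).
assert (Hq2 : 1 - q <> 0) by (intros E; apply Hq1; replace q with (1 - (1 - q)) by ring; rewrite E; ring).
assert (Ek : k * (1 - q) = z - b) by (unfold q, x, k; field; exact Hk).
assert (Hzb : z - b <> 0) by (rewrite <- Ek; now apply Cmult_neq_0).
apply is_Cseries_ext with (fun m => / k * q ^ m).
{ intros m. unfold q. rewrite Cpow_mult_l. ring. }
replace (/ (z - b)) with (/ k * / (1 - q)) by (rewrite <- Ek; field; split; assumption).
apply is_Cseries_scal. apply is_Cseries_Clim.
apply (Clim_seq_bound _ _ (/ Cmod (1 - q)) (Cmod q)); [exact Hq|]. intros n.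
rewrite Csum_geom by exact Hq1.
replace (/ (1 - q) - (1 - q ^ n) / (1 - q)) with (/ (1 - q) * q ^ n) by (field; exact Hq2).
rewrite Cmod_mult, Cmod_inv, Cmod_pow by exact Hq2. lra.
Qed.

Lemma exp_term_pow (h z : C) m : exp_term (h * z) m = exp_term z m * h ^ m.
Proof. unfold exp_term. rewrite Cpow_mult_l. field. apply INR_fact_C. Qed.

(** A term is the difference of two consecutive Taylor remainders. *)
Lemma Cmod_exp_term_le z m : (Cmod (exp_term z m) <= 2 * exp (Cmod z))%R.
Proof.
assert (H1 := Cexp_taylor m z 1 ltac:(lra)). assert (H2 := Cexp_taylor (S m) z 1 ltac:(lra)).
rewrite pow1, Rmult_1_l in H1, H2. unfold Rdiv in H1, H2. rewrite Rinv_1, Rmult_1_r in H1, H2.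
replace (exp_term z m) with ((Cexp z - Csum (exp_term z) m) + - (Cexp z - Csum (exp_term z) (S m))) by (simpl; ring).
eapply Rle_trans; [apply Cmod_triangle|]. rewrite Cmod_opp. lra.
Qed.

Lemma Cexp_taylor_scaled (b h : C) (k r : R) M :
  (0 < k <= 1)%R -> (Cmod h <= k * r)%R ->
  (Cmod (Cexp (h * b) - Csum (fun m => (exp_term b m * h ^ m)%C) M) <= exp (Cmod b * r) * k ^ M)%R.
Proof.
intros Hk Hh.
rewrite (Csum_ext _ (exp_term (h * b))) by (intros; symmetry; apply exp_term_pow).
eapply Rle_trans; [apply (Cexp_taylor M (h * b) k Hk)|].
rewrite Rmult_comm. apply Rmult_le_compat_r; [apply pow_le; lra|].
assert (h1 : (Cmod (h * b) / k <= Cmod b * r)%R).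
{ rewrite Cmod_mult. apply Rmult_le_reg_r with k; [lra|].
  replace (Cmod h * Cmod b / k * k)%R with (Cmod h * Cmod b)%R by (field; lra).
  assert (h2 := Cmod_ge_0 b). nra. }
destruct h1 as [h1|h1]; [left; now apply exp_increasing | rewrite h1; lra].
Qed.

(** The Taylor coefficients of the sum are the sums of the Taylor coefficients, and
    the scaled Taylor bound for each term adds up to one for the sum.  The second
    hypothesis says that the series converges normally on a disc of radius [r]. *)
Lemma analytic_exp_series (b beta : nat -> C) (f : C -> C) (z0 : C) (r K : R) :
  (0 < r)%R ->
  is_series (fun k => (Cmod (b k * Cexp (z0 * beta k)) * (2 * exp (Cmod (beta k) * r)))%R) K ->
  (forall z, is_Cseries (fun k => b k * Cexp (z * beta k)) (f z)) ->
  exists f', is_Cseries (fun k => b k * beta k * Cexp (z0 * beta k)) f' /\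
    analytic_at f z0 /\ Cder f z0 f'.
Proof.
intros Hr HK Hf.
set (v := fun k => (Cmod (b k * Cexp (z0 * beta k)) * (2 * exp (Cmod (beta k) * r)))%R) in *.
assert (Hv : forall k, (0 <= v k)%R).
{ intros k. unfold v. apply Rmult_le_pos; [apply Cmod_ge_0|]. assert (h := exp_pos (Cmod (beta k) * r)). lra. }
assert (Hc : forall m, exists c, is_Cseries (fun k => b k * Cexp (z0 * beta k) * exp_term (beta k) m) c).
{ intros m.
  assert (HV := is_series_scal (V := R_NormedModule) (/ r ^ m)%R v K HK).
  destruct (fun H => Cseries_dominated (fun k => b k * Cexp (z0 * beta k) * exp_term (beta k) m) _ _ H HV) as [c [Hc _]].
  - intros k. change (scal (/ r ^ m)%R (v k)) with (/ r ^ m * v k)%R.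
    rewrite Cmod_mult. unfold v.
    assert (h := Cmod_exp_term_le (r * beta k) m). rewrite exp_term_pow in h.
    rewrite !Cmod_mult, Cmod_pow, Cmod_R, Rabs_pos_eq in h by lra.
    assert (hp : (0 < r ^ m)%R) by (now apply pow_lt).
    apply Rmult_le_reg_l with (r ^ m)%R; [exact hp|].
    rewrite <- (Rmult_assoc (r ^ m) (/ r ^ m)), Rinv_r, Rmult_1_l by lra.
    replace (r ^ m * (Cmod (b k * Cexp (z0 * beta k)) * Cmod (exp_term (beta k) m)))%R with
      (Cmod (b k * Cexp (z0 * beta k)) * (Cmod (exp_term (beta k) m) * r ^ m))%R by ring.
    apply Rmult_le_compat_l; [apply Cmod_ge_0|]. rewrite (Rmult_comm (Cmod (beta k))). lra.
  - now exists c. }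
set (c := fun m => proj1_sig (constructive_indefinite_description _ (Hc m))).
assert (Hcm : forall m, is_Cseries (fun k => b k * Cexp (z0 * beta k) * exp_term (beta k) m) (c m))
  by (intros m; unfold c; apply proj2_sig).
destruct (analytic_of_bound f z0 c r K Hr) as [A1 A2].
- intros h k M Hk Hh.
  assert (HS : is_Cseries (fun j => b j * Cexp (z0 * beta j) * (Cexp (h * beta j) - Csum (fun m => (exp_term (beta j) m * h ^ m)%C) M))
     (f (z0 + h) - Csum (fun m => (c m * h ^ m)%C) M)).
  { apply is_Cseries_ext with (fun j => b j * Cexp ((z0 + h) * beta j) + - (1) * (b j * Cexp (z0 * beta j) * Csum (fun m => (exp_term (beta j) m * h ^ m)%C) M)).
    - intros j. replace ((z0 + h) * beta j) with (z0 * beta j + h * beta j) by ring. rewrite Cexp_plus. ring.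
    - replace (f (z0 + h) - Csum (fun m => (c m * h ^ m)%C) M) with (f (z0 + h) + - (1) * Csum (fun m => (c m * h ^ m)%C) M) by ring.
      apply is_Cseries_plus; [apply Hf|]. apply is_Cseries_scal.
      clear -Hcm. induction M as [|M IH].
      + simpl. apply is_Cseries_ext with (fun j => 0 * (b j * Cexp (z0 * beta j) * exp_term (beta j) 0)); [intros; ring|].
        assert (E := is_Cseries_scal 0 _ _ (Hcm 0%nat)). replace (0 * c 0%nat) with (RtoC 0) in E by ring. exact E.
      + simpl. apply is_Cseries_ext with (fun j => b j * Cexp (z0 * beta j) * Csum (fun m => (exp_term (beta j) m * h ^ m)%C) M
            + h ^ M * (b j * Cexp (z0 * beta j) * exp_term (beta j) M)); [intros; ring|].
        rewrite (Cmult_comm (c M)). apply is_Cseries_plus; [exact IH | apply is_Cseries_scal; apply Hcm]. }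
  destruct (fun H => Cseries_dominated (fun j => b j * Cexp (z0 * beta j) * (Cexp (h * beta j) - Csum (fun m => (exp_term (beta j) m * h ^ m)%C) M)) _ _ H (is_series_scal (V := R_NormedModule) (k ^ M)%R v K HK)) as [l [Hl1 Hl2]].
  + intros j. change (scal (k ^ M)%R (v j)) with (k ^ M * v j)%R. rewrite Cmod_mult. unfold v.
    assert (h1 := Cexp_taylor_scaled (beta j) h k r M Hk Hh).
    assert (h2 := Cmod_ge_0 (b j * Cexp (z0 * beta j))).
    assert (h3 : (0 <= k ^ M)%R) by (apply pow_le; lra). assert (h4 := exp_pos (Cmod (beta j) * r)).
    rewrite (Rmult_comm (k ^ M)), Rmult_assoc. apply Rmult_le_compat_l; [exact h2|]. nra.
  + rewrite (is_Cseries_unique _ _ _ HS Hl1). specialize (Hl2 0%nat). simpl in Hl2.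
    replace (l - 0) with l in Hl2 by ring. eapply Rle_trans; [exact Hl2|].
    change (scal (k ^ M)%R K) with (k ^ M * K)%R. lra.
- exists (c 1%nat). split; [|split; assumption].
  apply is_Cseries_ext with (2 := Hcm 1%nat). intros k. unfold exp_term. simpl. field.
Qed.

(** The continuous analogue: the integrals of the Taylor coefficients of the
    integrand satisfy the scaled Taylor bound with the integral of the majorant. *)
Lemma analytic_exp_integral Fa Fb {FFa : ProperFilter Fa} {FFb : ProperFilter Fb} (D : R -> Prop)
  (phi lam : R -> C) (g : R -> R) (f : C -> C) (s0 : C) (r K : R) :
  int_range Fa Fb D -> (0 < r)%R ->
  (forall t, D t -> Ccont phi t) -> (forall t, D t -> Ccont lam t) ->
  (forall t, D t -> Ccont (fun x => RtoC (g x)) t) ->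
  (forall t, D t -> (Cmod (phi t * Cexp (s0 * lam t)) * exp (Cmod (lam t) * r) <= g t)%R) ->
  is_CRInt_gen (fun t => RtoC (g t)) Fa Fb (RtoC K) ->
  (forall s, (Cmod (s - s0) <= r)%R -> is_CRInt_gen (fun t => phi t * Cexp (s * lam t)) Fa Fb (f s)) ->
  analytic_at f s0.
Proof.
intros HD Hr Hphi Hlam Hg Hle HK Hf.
assert (HexpC : forall s t, D t -> Ccont (fun x => Cexp (s * lam x)) t).
{ intros s t Ht. apply (Clim_comp (locally t) (locally (s * lam t)) (fun x => s * lam x)).
  - apply Clim_filterlim; [apply locally_filter|]. apply Ccont_scal. auto.
  - apply (Cder_is_cont Cexp _ _ (Cder_Cexp _)). }
assert (HetC : forall m t, D t -> Ccont (fun x => exp_term (lam x) m) t).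
{ intros m t Ht. unfold exp_term, Cdiv. apply Ccont_mult; [|apply Ccont_const].
  induction m as [|m IH]; simpl; [apply Ccont_const|]. apply Ccont_mult; auto. }
assert (Hg2 : forall t, D t -> Ccont (fun x => RtoC (2 * g x)) t).
{ intros t Ht. apply Ccont_ext with (fun x => 2 * RtoC (g x)); [intros; now rewrite RtoC_mult|].
  apply Ccont_scal; auto. }
assert (Hc : forall m, exists c, is_CRInt_gen (fun t => phi t * Cexp (s0 * lam t) * exp_term (lam t) m) Fa Fb c).
{ intros m. assert (hp : (0 < r ^ m)%R) by (now apply pow_lt).
  destruct (Cint_dominated Fa Fb D HD (fun t => phi t * Cexp (s0 * lam t) * exp_term (lam t) m)
    (fun t => (/ r ^ m * 2 * g t)%R) (/ r ^ m * 2 * K)%R) as [c [Hc _]].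
  - intros t Ht. apply Ccont_mult; [apply Ccont_mult|]; auto.
  - intros t Ht. apply Ccont_ext with (fun x => RtoC (/ r ^ m * 2) * RtoC (g x)); [intros; now rewrite <- RtoC_mult|].
    apply Ccont_scal; auto.
  - intros t Ht. specialize (Hle t Ht).
    assert (h := Cmod_exp_term_le (r * lam t) m). rewrite exp_term_pow in h.
    rewrite !Cmod_mult, Cmod_pow, Cmod_R, Rabs_pos_eq in h by lra.
    rewrite (Cmod_mult _ (exp_term _ _)).
    apply Rmult_le_reg_l with (r ^ m)%R; [exact hp|].
    replace (r ^ m * (/ r ^ m * 2 * g t))%R with (2 * g t)%R by (field; lra).
    replace (r ^ m * (Cmod (phi t * Cexp (s0 * lam t)) * Cmod (exp_term (lam t) m)))%R with
      (Cmod (phi t * Cexp (s0 * lam t)) * (Cmod (exp_term (lam t) m) * r ^ m))%R by ring.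
    eapply Rle_trans; [apply Rmult_le_compat_l; [apply Cmod_ge_0 | exact h]|].
    rewrite (Rmult_comm r). lra.
  - apply (Cint_ext Fa Fb D HD (fun t => RtoC (/ r ^ m * 2) * RtoC (g t))); [intros; now rewrite <- RtoC_mult|].
    rewrite RtoC_mult with (y := K). now apply Cint_scal.
  - now exists c. }
set (c := fun m => proj1_sig (constructive_indefinite_description _ (Hc m))).
assert (Hcm : forall m, is_CRInt_gen (fun t => phi t * Cexp (s0 * lam t) * exp_term (lam t) m) Fa Fb (c m))
  by (intros m; unfold c; apply proj2_sig).
apply (analytic_of_bound f s0 c r K Hr).
intros h k M Hk Hh.
assert (Hhr : (Cmod h <= r)%R) by nra.
assert (HS : is_CRInt_gen (fun t => phi t * Cexp (s0 * lam t) * (Cexp (h * lam t) - Csum (fun m => (exp_term (lam t) m * h ^ m)%C) M)) Fa Fb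
   (f (s0 + h) - Csum (fun m => (c m * h ^ m)%C) M)).
{ apply (Cint_ext Fa Fb D HD (fun t => phi t * Cexp ((s0 + h) * lam t) - Csum (fun m => (h ^ m * (phi t * Cexp (s0 * lam t) * exp_term (lam t) m))%C) M)).
  - intros t _. replace ((s0 + h) * lam t) with (s0 * lam t + h * lam t) by ring. rewrite Cexp_plus.
    replace (Csum (fun m => (h ^ m * (phi t * Cexp (s0 * lam t) * exp_term (lam t) m))%C) M) with
      (phi t * Cexp (s0 * lam t) * Csum (fun m => (exp_term (lam t) m * h ^ m)%C) M); [ring|].
    rewrite <- Csum_scal. apply Csum_ext. intros; ring.
  - apply Cint_minus; [typeclasses eauto | typeclasses eauto | |].
    + apply Hf. now replace (s0 + h - s0) with h by ring.
    + rewrite (Csum_ext (fun m => c m * h ^ m) (fun m => h ^ m * c m)) by (intros; ring).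
      apply (Cint_Csum Fa Fb (fun m t => h ^ m * (phi t * Cexp (s0 * lam t) * exp_term (lam t) m))).
      intros m. now apply Cint_scal. }
apply (Cint_le Fa Fb D HD (fun t => phi t * Cexp (s0 * lam t) * (Cexp (h * lam t) - Csum (fun m => (exp_term (lam t) m * h ^ m)%C) M))
  (fun t => k ^ M * g t)%R).
- intros t Ht. apply Ccont_mult; [apply Ccont_mult; auto|]. apply Ccont_minus; [auto|].
  apply (Ccont_Csum (fun m x => exp_term (lam x) m * h ^ m)). intros m. apply Ccont_mult; [auto | apply Ccont_const].
- intros t Ht. apply Ccont_ext with (fun x => RtoC (k ^ M) * RtoC (g x)); [intros; now rewrite <- RtoC_mult|].
  apply Ccont_scal; auto.
- intros t Ht. specialize (Hle t Ht). rewrite Cmod_mult.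
  assert (h1 := Cexp_taylor_scaled (lam t) h k r M Hk Hh).
  eapply Rle_trans; [apply Rmult_le_compat_l; [apply Cmod_ge_0 | exact h1]|].
  rewrite <- Rmult_assoc, Rmult_comm. apply Rmult_le_compat_l; [apply pow_le; lra | exact Hle].
- exact HS.
- apply (Cint_ext Fa Fb D HD (fun t => RtoC (k ^ M) * RtoC (g t))); [intros; now rewrite <- RtoC_mult|].
  rewrite (Rmult_comm K), RtoC_mult. now apply Cint_scal.
Qed.

(** * The identity theorem *)

(** If all coefficients below index [n] vanish, zeros accumulating at the centre
    force the coefficient of index [n] to vanish as well. *)
Lemma analytic_zero_loc h z0 :
  analytic_at h z0 ->
  (forall e : R, (0 < e)%R -> exists z, z <> z0 /\ (Cmod (z - z0) < e)%R /\ h z = 0) ->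
  exists r : R, (0 < r)%R /\ forall z, (Cmod (z - z0) < r)%R -> h z = 0.
Proof.
intros [c [r [Hr Hc]]] Hz.
set (rho := (r / 2)%R).
assert (Hrho : (0 < rho)%R) by (unfold rho; lra).
(* Cauchy bounds for the coefficients, from convergence at the point [z0 + rho]. *)
assert (HB : exists B, (0 < B)%R /\ forall m, (Cmod (c m) * rho ^ m <= B)%R).
{ assert (H1 : is_Cseries (fun m => c m * rho ^ m) (h (z0 + rho))).
  { assert (H := Hc (z0 + rho)). replace (z0 + rho - z0) with (RtoC rho) in H by ring.
    rewrite Cmod_R, Rabs_pos_eq in H by lra. specialize (H ltac:(unfold rho; lra)).
    now apply is_pseries_Cseries in H. }
  apply is_Cseries_Clim in H1. destruct (H1 1%R ltac:(lra)) as [N HN].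
  assert (Hfin : exists B, (0 < B)%R /\ forall m, (m < N)%nat -> (Cmod (c m) * rho ^ m <= B)%R).
  { clear. induction N as [|N [B [HB IH]]]; [exists 1%R; split; [lra | intros; lia]|].
    exists (Rmax B (Cmod (c N) * rho ^ N)). split; [eapply Rlt_le_trans; [exact HB | apply Rmax_l]|].
    intros m Hm. destruct (Nat.eq_dec m N) as [->|Hn]; [apply Rmax_r|].
    eapply Rle_trans; [apply IH; lia | apply Rmax_l]. }
  destruct Hfin as [B [HB Hm]]. exists (Rmax B 2). split; [eapply Rlt_le_trans; [exact HB | apply Rmax_l]|].
  intros m. destruct (Nat.lt_ge_cases m N) as [h1|h1].
  - eapply Rle_trans; [now apply Hm | apply Rmax_l].
  - apply Rle_trans with 2%R; [|apply Rmax_r].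
    assert (e1 := HN m h1). assert (e2 := HN (S m) ltac:(lia)). simpl in e2.
    replace (Cmod (c m) * rho ^ m)%R with (Cmod (c m * rho ^ m))
      by (rewrite Cmod_mult, Cmod_pow, Cmod_R, (Rabs_pos_eq rho) by lra; reflexivity).
    set (S1 := Csum (fun m => (c m * rho ^ m)%C) m) in *. set (L := h (z0 + rho)) in *.
    replace (c m * rho ^ m) with ((S1 + c m * rho ^ m - L) + - (S1 - L)) by ring.
    eapply Rle_trans; [apply Cmod_triangle|]. rewrite Cmod_opp. lra. }
destruct HB as [B [HB HBm]].
assert (Htail : forall x n, (Cmod x <= rho / 2)%R ->
  (Cmod (h (z0 + x)%C - Csum (fun m => (c m * x ^ m)%C) n) <= 2 * B * (Cmod x / rho) ^ n)%R).
{ intros x n Hx. assert (Hx0 := Cmod_ge_0 x).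
  set (q := (Cmod x / rho)%R).
  assert (Hq : (0 <= q <= / 2)%R).
  { split; [apply Rdiv_le_0_compat; lra|]. unfold q. apply Rmult_le_reg_r with rho; [lra|].
    replace (Cmod x / rho * rho)%R with (Cmod x) by (field; lra). lra. }
  assert (HV := is_series_scal (V := R_NormedModule) B _ _ (is_series_geom q ltac:(rewrite Rabs_pos_eq; lra))).
  destruct (fun H => Cseries_dominated (fun m => c m * x ^ m) _ _ H HV) as [l [Hl1 Hl2]].
  - intros m. change (scal B (q ^ m)%R) with (B * q ^ m)%R. rewrite Cmod_mult, Cmod_pow.
    replace (Cmod x) with (rho * q)%R by (unfold q; field; lra).
    rewrite Rpow_mult_distr, <- Rmult_assoc. apply Rmult_le_compat_r; [apply pow_le; lra | apply HBm].
  - assert (Hs : is_Cseries (fun m => c m * x ^ m) (h (z0 + x))).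
    { assert (H := Hc (z0 + x)). replace (z0 + x - z0) with x in H by ring.
      specialize (H ltac:(unfold rho in *; lra)). now apply is_pseries_Cseries in H. }
    rewrite (is_Cseries_unique _ _ _ Hs Hl1). eapply Rle_trans; [apply Hl2|].
    change (scal B (/ (1 - q))%R) with (B * / (1 - q))%R.
    change (Rsum _ n) with (Rsum (fun m => (B * q ^ m)%R) n).
    replace (Rsum (fun m => (B * q ^ m)%R) n) with (B * ((1 - q ^ n) / (1 - q)))%R.
    + replace (B * / (1 - q) - B * ((1 - q ^ n) / (1 - q)))%R with (B * / (1 - q) * q ^ n)%R by (field; lra).
      apply Rmult_le_compat_r; [apply pow_le; lra|]. rewrite (Rmult_comm 2). apply Rmult_le_compat_l; [lra|].
      rewrite <- (Rinv_inv 2). apply Rinv_le_contravar; lra.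
    + clear -Hq. induction n as [|n IH]; simpl; [field; lra|]. rewrite <- IH. field. lra. }
assert (Hzero : forall n, c n = 0).
{ intros n. induction n as [n IH] using (well_founded_induction Wf_nat.lt_wf).
  apply Cmod_small_eq. intros e He. replace (c n - 0) with (c n) by ring.
  assert (Hrn : (0 < rho ^ n)%R) by (now apply pow_lt).
  (* At a zero [z0 + x] the leading term [c n x^n] is of the order of the tail, so
     [|c n| <= K |x|] for arbitrarily small [x]. *)
  set (K := (2 * B / (rho ^ n * rho))%R).
  assert (HK : (0 < K)%R) by (unfold K; apply Rdiv_lt_0_compat; [lra | now apply Rmult_lt_0_compat]).
  destruct (Hz (Rmin (rho / 2) (e / K))) as [z [Hne [Hlt Hh]]].
  { apply Rmin_glb_lt; [lra | now apply Rdiv_lt_0_compat]. }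
  set (x := z - z0) in *.
  assert (Hx1 : (Cmod x < rho / 2)%R) by (eapply Rlt_le_trans; [exact Hlt | apply Rmin_l]).
  assert (Hx2 : (Cmod x < e / K)%R) by (eapply Rlt_le_trans; [exact Hlt | apply Rmin_r]).
  assert (Hx0 : (0 < Cmod x)%R).
  { apply (proj1 (Cmod_gt_0 x)). intros E. apply Hne. replace z with (x + z0) by (unfold x; ring). rewrite E. ring. }
  assert (T := Htail x (S n) ltac:(lra)).
  replace (z0 + x) with z in T by (unfold x; ring). rewrite Hh in T. simpl in T.
  replace (Csum (fun m => (c m * x ^ m)%C) n) with (RtoC 0) in T.
  - replace (0 - (0 + c n * x ^ n)) with (- (c n * x ^ n)) in T by ring.
    rewrite Cmod_opp, Cmod_mult, Cmod_pow in T.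
    assert (Hxn : (0 < Cmod x ^ n)%R) by (now apply pow_lt).
    assert (T2 : (Cmod (c n) <= K * Cmod x)%R).
    { apply Rmult_le_reg_r with (Cmod x ^ n)%R; [exact Hxn|]. eapply Rle_trans; [exact T|].
      unfold K, Rdiv. rewrite Rpow_mult_distr, pow_inv. right. field. lra. }
    eapply Rle_trans; [exact T2|]. apply (Rmult_lt_compat_l K) in Hx2; [|exact HK].
    replace (K * (e / K))%R with e in Hx2 by (field; lra). lra.
  - symmetry. clear -IH. assert (G : forall k, (k <= n)%nat -> Csum (fun m => (c m * x ^ m)%C) k = 0).
    { induction k as [|k IHk]; intros Hk; simpl; [reflexivity|]. rewrite IHk, (IH k) by lia. ring. }
    now apply G. }
exists (rho / 2)%R. split; [lra|]. intros z Hlt.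
assert (T := fun n => Htail (z - z0) n ltac:(lra)).
replace (z0 + (z - z0)) with z in T by ring.
apply (Clim_unique eventually (fun n => Csum (fun m => (c m * (z - z0) ^ m)%C) n)).
- apply (Clim_seq_bound _ _ (2 * B) (Cmod (z - z0) / rho)); [|exact T].
  assert (h1 := Cmod_ge_0 (z - z0)). split; [apply Rdiv_le_0_compat; lra|].
  apply Rmult_lt_reg_r with rho; [lra|]. replace (Cmod (z - z0) / rho * rho)%R with (Cmod (z - z0)) by (field; lra). lra.
- apply Clim_ext with (fun _ => RtoC 0); [apply eventually_filter | | apply Clim_const; apply eventually_filter].
  intros n. induction n as [|n IH]; simpl; [reflexivity|]. rewrite <- IH, Hzero. ring.
Qed.

(** Vanishing propagates along a segment of analyticity: take the last point up to
    which the function vanishes. *)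
Lemma analytic_zero_segment h (z1 z2 : C) (r : R) :
  (forall t : R, (0 <= t <= 1)%R -> analytic_at h (z1 + t * (z2 - z1))) ->
  (0 < r)%R -> (forall z, (Cmod (z - z1) < r)%R -> h z = 0) -> h z2 = 0.
Proof.
intros Ha Hr Hz.
destruct (Req_dec (Cmod (z2 - z1)) 0) as [E|E].
{ apply Hz. rewrite E. exact Hr. }
set (d := Cmod (z2 - z1)) in *. assert (Hd : (0 < d)%R) by (assert (H := Cmod_ge_0 (z2 - z1)); unfold d in *; lra).
set (ga := fun t : R => z1 + t * (z2 - z1)).
assert (Hga : forall s t : R, Cmod (ga s - ga t) = (Rabs (s - t) * d)%R).
{ intros s t. unfold ga. replace (z1 + s * (z2 - z1) - (z1 + t * (z2 - z1))) with ((s - t) * (z2 - z1)) by ring.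
  rewrite Cmod_mult, <- RtoC_minus, Cmod_R. reflexivity. }
assert (Hga1 : ga 1%R = z2) by (unfold ga; ring).
assert (Hga0 : ga 0%R = z1) by (unfold ga; ring).
set (E0 := fun t : R => (0 <= t <= 1)%R /\ forall s : R, (0 <= s <= t)%R -> h (ga s) = 0).
destruct (completeness E0) as [T [HT1 HT2]].
{ exists 1%R. intros t [H _]. lra. }
{ exists 0%R. split; [lra|]. intros s Hs. replace s with 0%R by lra. rewrite Hga0. apply Hz.
  replace (z1 - z1) with (RtoC 0) by ring. rewrite Cmod_0. exact Hr. }
assert (HTp : (0 < T)%R).
{ set (t0 := Rmin 1 (r / d / 2)). assert (Ht0 : (0 < t0)%R).
  { apply Rmin_glb_lt; [lra|]. repeat apply Rdiv_lt_0_compat; lra. }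
  eapply Rlt_le_trans; [exact Ht0|]. apply HT1. split; [split; [lra | apply Rmin_l]|].
  intros s Hs. apply Hz. rewrite <- Hga0, Hga, Rminus_0_r, Rabs_pos_eq by lra.
  assert (t0 <= r / d / 2)%R by apply Rmin_r.
  apply Rle_lt_trans with (r / d / 2 * d)%R; [apply Rmult_le_compat_r; lra|].
  replace (r / d / 2 * d)%R with (r / 2)%R by (field; lra). lra. }
assert (HTle : (T <= 1)%R) by (apply HT2; intros t [H _]; lra).
assert (Hbefore : forall s : R, (0 <= s < T)%R -> h (ga s) = 0).
{ intros s Hs. destruct (classic (exists t, E0 t /\ (s < t)%R)) as [[t [[Ht1 Ht2] Hst]]|Hn].
  - apply Ht2. lra.
  - exfalso. assert (T <= s)%R; [|lra]. apply HT2. intros t Ht. apply Rnot_lt_le. intros h0. apply Hn. exists t. auto. }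
(* The zeros before the last point accumulate there. *)
destruct (analytic_zero_loc h (ga T)) as [r1 [Hr1 Hz1]].
{ apply Ha. lra. }
{ intros e He. set (s := Rmax (T / 2) (T - e / d / 2)).
  assert (0 < e / d / 2)%R by (repeat apply Rdiv_lt_0_compat; lra).
  assert (Hs1 : (s < T)%R) by (unfold s; apply Rmax_lub_lt; lra).
  assert (Hs2 : (T / 2 <= s)%R) by apply Rmax_l. assert (Hs3 : (T - e / d / 2 <= s)%R) by apply Rmax_r.
  assert (Hdist : Cmod (ga s - ga T) = ((T - s) * d)%R).
  { rewrite Hga. f_equal. rewrite Rabs_left by lra. ring. }
  exists (ga s). split; [|split].
  - intros Eq. rewrite Eq in Hdist. replace (ga T - ga T) with (RtoC 0) in Hdist by ring. rewrite Cmod_0 in Hdist. nra.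
  - rewrite Hdist. apply Rle_lt_trans with (e / d / 2 * d)%R; [apply Rmult_le_compat_r; lra|].
    replace (e / d / 2 * d)%R with (e / 2)%R by (field; lra). lra.
  - apply Hbefore. lra. }
destruct (Rle_lt_dec 1 T) as [H1|H1].
{ rewrite <- Hga1. replace 1%R with T by lra. apply Hz1. replace (ga T - ga T) with (RtoC 0) by ring. rewrite Cmod_0. exact Hr1. }
(* Otherwise the vanishing would extend beyond the supremum [T]. *)
exfalso. set (t1 := Rmin 1 (T + r1 / d / 2)).
assert (0 < r1 / d / 2)%R by (repeat apply Rdiv_lt_0_compat; lra).
assert (Ht1 : (T < t1)%R) by (unfold t1; apply Rmin_glb_lt; lra).
assert (t1 <= 1)%R by apply Rmin_l. assert (t1 <= T + r1 / d / 2)%R by apply Rmin_r.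
assert (E0 t1); [|assert (t1 <= T)%R by (now apply HT1); lra].
split; [lra|]. intros s Hs. destruct (Rlt_le_dec s T) as [h1|h1]; [apply Hbefore; lra|].
apply Hz1. rewrite Hga, Rabs_pos_eq by lra.
apply Rle_lt_trans with (r1 / d / 2 * d)%R; [apply Rmult_le_compat_r; lra|].
replace (r1 / d / 2 * d)%R with (r1 / 2)%R by (field; lra). lra.
Qed.

(** The operator that selects a continuation may return any of them; the segment from
    a disc of [U] to [z2] inside [D] makes its value at [z2] unique. *)
Lemma analytic_continuation_eq (U D : C -> Prop) (f g : C -> C) (z1 z2 : C) (r : R) :
  is_analytic_continuation U D f g ->
  (0 < r)%R -> (forall z, (Cmod (z - z1) < r)%R -> U z) ->
  (forall t : R, (0 <= t <= 1)%R -> D (z1 + t * (z2 - z1))) ->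
  analytic_continuation U D f z2 = g z2.
Proof.
intros Hg Hr HU HD.
assert (Hk : is_analytic_continuation U D f (analytic_continuation U D f))
  by (apply (epsilon_spec (inhabits f) (is_analytic_continuation U D f)); now exists g).
set (k := analytic_continuation U D f) in *. destruct Hk as [Hk1 Hk2]. destruct Hg as [Hg1 Hg2].
assert (E : k z2 - g z2 = 0).
{ apply (analytic_zero_segment (fun z => k z - g z) z1 z2 r).
  - intros t Ht. apply analytic_minus; auto.
  - exact Hr.
  - intros z Hz. rewrite Hk1, Hg1 by auto. ring. }
replace (k z2) with (k z2 - g z2 + g z2) by ring. rewrite E. ring.
Qed.

Open Scope R_scope.

(** * Bernoulli polynomials *)

Lemma bernoulli_list_length n : length (bernoulli_list n) = S n.
Proof. induction n as [|n IH]; [reflexivity|]. simpl. rewrite length_app, IH. simpl. lia. Qed.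

Lemma nth_bernoulli_list n k : (k <= n)%nat -> nth k (bernoulli_list n) 0 = bernoulli k.
Proof.
induction n as [|n IH]; intros Hk.
- replace k with 0%nat by lia. reflexivity.
- destruct (Nat.eq_dec k (S n)) as [->|Hne]; [reflexivity|].
  simpl. rewrite app_nth1 by (rewrite bernoulli_list_length; lia). apply IH. lia.
Qed.

Lemma sum_f_R0_ext f g n : (forall k, (k <= n)%nat -> f k = g k) -> sum_f_R0 f n = sum_f_R0 g n.
Proof. apply sum_eq. Qed.

Lemma bernoulli_S m :
  bernoulli (S m) = - / INR (m + 2) * sum_f_R0 (fun k => Binomial.C (m + 2) k * bernoulli k) m.
Proof.
unfold bernoulli at 1. simpl bernoulli_list.
rewrite app_nth2 by (rewrite bernoulli_list_length; lia).
rewrite bernoulli_list_length, Nat.sub_diag. cbn [nth]. f_equal.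
apply sum_f_R0_ext. intros k Hk. now rewrite nth_bernoulli_list.
Qed.

Lemma binom_n_n n : Binomial.C n n = 1.
Proof. unfold Binomial.C. rewrite Nat.sub_diag. simpl. field. apply INR_fact_neq_0. Qed.

Lemma binom_S_n n : Binomial.C (S n) n = INR (S n).
Proof.
unfold Binomial.C. replace (S n - n)%nat with 1%nat by lia.
change (fact (S n)) with (S n * fact n)%nat. rewrite mult_INR. simpl (INR (fact 1)). field.
apply INR_fact_neq_0.
Qed.

Lemma bernoulli_sum n : (2 <= n)%nat -> sum_f_R0 (fun k => Binomial.C n k * bernoulli k) (n - 1) = 0.
Proof.
intros Hn. destruct n as [|[|m]]; [lia|lia|].
replace (S (S m) - 1)%nat with (S m) by lia. rewrite tech5, bernoulli_S.
replace (m + 2)%nat with (S (S m)) by lia. rewrite binom_S_n. field.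
apply not_0_INR. lia.
Qed.

Lemma bernoulli_poly_0 n : bernoulli_poly n 0 = bernoulli n.
Proof.
unfold bernoulli_poly. destruct n as [|n].
- simpl. rewrite binom_n_n. ring.
- rewrite tech5, binom_n_n, Nat.sub_diag.
  rewrite (sum_f_R0_ext _ (fun _ => 0)).
  + rewrite sum_cte. simpl. ring.
  + intros k Hk. rewrite pow_i by lia. ring.
Qed.

Lemma bernoulli_poly_1 n : (2 <= n)%nat -> bernoulli_poly n 1 = bernoulli n.
Proof.
intros Hn. unfold bernoulli_poly.
rewrite (sum_f_R0_ext _ (fun k => Binomial.C n k * bernoulli k)) by (intros; rewrite pow1; ring).
destruct n as [|n]; [lia|]. rewrite tech5, binom_n_n.
assert (H := bernoulli_sum (S n) Hn). replace (S n - 1)%nat with n in H by lia. rewrite H. ring.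
Qed.

Lemma is_derive_sum_f_R0 (f : nat -> R -> R) (f' : nat -> R) n t :
  (forall k, (k <= n)%nat -> is_derive (f k) t (f' k)) ->
  is_derive (fun x => sum_f_R0 (fun k => f k x) n) t (sum_f_R0 f' n).
Proof.
induction n as [|n IH]; intros H; simpl; [apply H; lia|].
apply (is_derive_plus (K := R_AbsRing) (V := R_NormedModule)); [apply IH; intros; apply H; lia | apply H; lia].
Qed.

Lemma is_derive_bernoulli_poly n t :
  is_derive (bernoulli_poly (S n)) t (INR (S n) * bernoulli_poly n t).
Proof.
unfold bernoulli_poly.
replace (INR (S n) * sum_f_R0 (fun k => Binomial.C n k * bernoulli k * t ^ (n - k)) n) with
  (sum_f_R0 (fun k => Binomial.C (S n) k * bernoulli k * (INR (S n - k) * t ^ pred (S n - k))) (S n)).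
- apply is_derive_sum_f_R0. intros k Hk. generalize (S n - k)%nat. intros p.
  auto_derive; [auto|]. ring.
- rewrite tech5, Nat.sub_diag. simpl (INR 0). rewrite scal_sum.
  rewrite !Rmult_0_l, Rmult_0_r, Rplus_0_r.
  apply sum_f_R0_ext. intros k Hk.
  replace (pred (S n - k)) with (n - k)%nat by lia.
  replace (S n - k)%nat with (S (n - k)) by lia. unfold Binomial.C.
  replace (S n - k)%nat with (S (n - k)) by lia.
  change (fact (S n)) with (S n * fact n)%nat. change (fact (S (n - k))) with (S (n - k) * fact (n - k))%nat.
  rewrite !mult_INR. field.
  repeat split; try apply INR_fact_neq_0. apply not_0_INR. lia.
Qed.

Lemma is_derive_zero_const (f : R -> R) :
  (forall t, is_derive f t 0) -> forall x y, f x = f y.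
Proof.
intros H x y. destruct (MVT_gen f y x (fun _ => 0)) as [c [_ E]].
- intros; apply H.
- intros t _. apply continuity_pt_filterlim.
  apply (ex_derive_continuous (K := R_AbsRing) (V := R_NormedModule)). exists 0. apply H.
- lra.
Qed.

Lemma is_derive_reflect (f f' : R -> R) :
  (forall t, is_derive f t (f' t)) -> forall t, is_derive (fun x => f (1 - x)) t (- f' (1 - t)).
Proof.
intros H t. replace (- f' (1 - t)) with (scal (V := R_NormedModule) (-1) (f' (1 - t)))
  by (unfold scal; simpl; unfold mult; simpl; ring).
apply (is_derive_comp f (fun x => 1 - x)); [apply H|]. auto_derive; [auto|]. ring.
Qed.

(** The reflection symmetry climbs two degrees at a time: integrating it once
    leaves a constant, which the equal boundary values in the next even degree
    force to vanish. *)
Lemma bernoulli_reflection_step n :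
  (forall t, bernoulli_poly (2 * n) (1 - t) = bernoulli_poly (2 * n) t) ->
  (forall t, bernoulli_poly (2 * S n) (1 - t) = bernoulli_poly (2 * S n) t) /\
  bernoulli_poly (2 * n + 1) 0 + bernoulli_poly (2 * n + 1) 1 = 0.
Proof.
  intros E.
  replace (2 * S n)%nat with (S (S (2 * n))) by lia. replace (2 * n + 1)%nat with (S (2 * n)) by lia.
  set (m := (2 * n)%nat) in *. set (c := bernoulli_poly (S m) 0 + bernoulli_poly (S m) 1).
  assert (H1 : forall t, bernoulli_poly (S m) t + bernoulli_poly (S m) (1 - t) = c).
  { intros t. unfold c. replace 1 with (1 - 0) at 2 by ring.
    apply (is_derive_zero_const (fun t => bernoulli_poly (S m) t + bernoulli_poly (S m) (1 - t))).
    intros x. assert (D1 := is_derive_bernoulli_poly m x).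
    assert (D2 := is_derive_reflect _ _ (is_derive_bernoulli_poly m) x).
    assert (D := is_derive_plus (K := R_AbsRing) (V := R_NormedModule) _ _ _ _ _ D1 D2).
    replace (plus _ _) with 0 in D; [exact D|].
    change (0 = INR (S m) * bernoulli_poly m x + - (INR (S m) * bernoulli_poly m (1 - x))). rewrite E. ring. }
  assert (H2 : forall t, bernoulli_poly (S (S m)) t - bernoulli_poly (S (S m)) (1 - t) - INR (S (S m)) * c * t = 0).
  { intros t. transitivity (bernoulli_poly (S (S m)) 0 - bernoulli_poly (S (S m)) (1 - 0) - INR (S (S m)) * c * 0).
    - apply (is_derive_zero_const (fun t => bernoulli_poly (S (S m)) t - bernoulli_poly (S (S m)) (1 - t) - INR (S (S m)) * c * t)).
      intros x. assert (D1 := is_derive_bernoulli_poly (S m) x).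
      assert (D2 := is_derive_reflect _ _ (is_derive_bernoulli_poly (S m)) x).
      assert (D3 : is_derive (fun t => INR (S (S m)) * c * t) x (INR (S (S m)) * c)) by (generalize (INR (S (S m)) * c); intros q; auto_derive; [auto|ring]).
      assert (D := is_derive_minus (K := R_AbsRing) (V := R_NormedModule) _ _ _ _ _
        (is_derive_minus (K := R_AbsRing) (V := R_NormedModule) _ _ _ _ _ D1 D2) D3).
      replace (minus _ _) with 0 in D; [exact D|].
      rewrite <- (H1 x).
      change (0 = INR (S (S m)) * bernoulli_poly (S m) x - - (INR (S (S m)) * bernoulli_poly (S m) (1 - x))
        - INR (S (S m)) * (bernoulli_poly (S m) x + bernoulli_poly (S m) (1 - x))). ring.
    - rewrite Rminus_0_r, bernoulli_poly_0, bernoulli_poly_1 by lia. ring. }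
  assert (Hc : c = 0).
  { assert (H3 := H2 1). rewrite Rminus_diag, bernoulli_poly_0, bernoulli_poly_1 in H3 by lia.
    assert (H4 : INR (S (S m)) <> 0) by (apply not_0_INR; lia).
    assert (H5 : INR (S (S m)) * c = 0) by lra. destruct (Rmult_integral _ _ H5); [contradiction|assumption]. }
  split; [|exact Hc]. intros t. specialize (H2 t). rewrite Hc in H2. lra.
Qed.

Lemma bernoulli_even_reflection n t : bernoulli_poly (2 * n) (1 - t) = bernoulli_poly (2 * n) t.
Proof.
revert t. induction n as [|n IH]; [reflexivity | now apply bernoulli_reflection_step].
Qed.

Lemma bernoulli_odd n : (1 <= n)%nat -> bernoulli (2 * n + 1) = 0.
Proof.
intros Hn. destruct (bernoulli_reflection_step n (bernoulli_even_reflection n)) as [_ H].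
rewrite bernoulli_poly_0, bernoulli_poly_1 in H by lia. lra.
Qed.

(** * Fourier series of the even Bernoulli polynomials *)

Lemma R_compare (f f' : R -> R) a b B :
  a <= b -> (forall t, a <= t <= b -> is_derive f t (f' t)) ->
  (forall t, a <= t <= b -> Rabs (f' t) <= B) -> Rabs (f b - f a) <= B * (b - a).
Proof.
intros Hab H HB. destruct (MVT_gen f a b f') as [c [Hc E]].
- intros t Ht. rewrite Rmin_left, Rmax_right in Ht by lra. apply H. lra.
- intros t Ht. rewrite Rmin_left, Rmax_right in Ht by lra. apply continuity_pt_filterlim.
  apply (ex_derive_continuous (K := R_AbsRing) (V := R_NormedModule)). exists (f' t). apply H. lra.
- rewrite Rmin_left, Rmax_right in Hc by lra. rewrite E, Rabs_mult, (Rabs_pos_eq (b - a)) by lra.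
  apply Rmult_le_compat_r; [lra | now apply HB].
Qed.

Lemma Rolle_derive (f f' : R -> R) :
  (forall t, is_derive f t (f' t)) -> f 0 = f 1 -> exists c, 0 <= c <= 1 /\ f' c = 0.
Proof.
intros H E. destruct (MVT_gen f 0 1 f') as [c [Hc E1]].
- intros; apply H.
- intros t _. apply continuity_pt_filterlim.
  apply (ex_derive_continuous (K := R_AbsRing) (V := R_NormedModule)). exists (f' t). apply H.
- exists c. rewrite Rmin_left, Rmax_right in Hc by lra. split; [exact Hc | lra].
Qed.

Lemma Rabs_bound_from_zero (f f' : R -> R) c t B :
  (forall t, 0 <= t <= 1 -> is_derive f t (f' t)) -> (forall t, 0 <= t <= 1 -> Rabs (f' t) <= B) ->
  0 <= c <= 1 -> 0 <= t <= 1 -> Rabs (f t - f c) <= B.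
Proof.
intros H HB Hc Ht. assert (HB0 : 0 <= B) by (eapply Rle_trans; [apply Rabs_pos | apply (HB 0); lra]).
destruct (Rle_lt_dec c t) as [h|h].
- eapply Rle_trans; [apply (R_compare f f' c t B h); intros; [apply H | apply HB]; lra|]. nra.
- rewrite Rabs_minus_sym.
  eapply Rle_trans; [apply (R_compare f f' t c B); intros; try (apply H || apply HB); lra|]. nra.
Qed.

Lemma is_derive_Rsum (f : nat -> R -> R) (f' : nat -> R) n t :
  (forall k, is_derive (f k) t (f' k)) -> is_derive (fun x => Rsum (fun k => f k x) n) t (Rsum f' n).
Proof.
intros H. induction n as [|n IH]; simpl.
- apply (is_derive_const (K := R_AbsRing) (V := R_NormedModule)).
- apply (is_derive_plus (K := R_AbsRing) (V := R_NormedModule)); [exact IH | apply H].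
Qed.

Lemma Rsum_ext u v n : (forall k, (k < n)%nat -> u k = v k) -> Rsum u n = Rsum v n.
Proof. induction n; simpl; intros H; [reflexivity|]. rewrite IHn, H; auto. Qed.

Lemma Rsum_scal c u n : Rsum (fun k => c * u k) n = c * Rsum u n.
Proof. induction n; simpl; [ring|]. rewrite IHn. ring. Qed.

Lemma Rsum_minus u v n : Rsum (fun k => u k - v k) n = Rsum u n - Rsum v n.
Proof. induction n; simpl; [ring|]. rewrite IHn. ring. Qed.

Lemma Rsum_zero n : Rsum (fun _ => 0) n = 0.
Proof. induction n; simpl; [reflexivity|]. rewrite IHn. ring. Qed.

Lemma is_series_telescope : is_series (fun k => / INR (k + 1) - / INR (k + 2)) 1.
Proof.
apply is_series_Rsum.
assert (E : forall n, Rsum (fun k => / INR (k + 1) - / INR (k + 2)) n = 1 - / INR (n + 1)).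
{ induction n as [|n IH]; simpl Rsum; [simpl; field|]. rewrite IH.
  replace (S n + 1)%nat with (n + 2)%nat by lia. ring. }
apply (is_lim_seq_ext (fun n => 1 - / INR (n + 1)) _ 1); [intros; now rewrite E|].
replace (Finite 1) with (Finite (1 - 0)) by (f_equal; ring).
apply (is_lim_seq_minus' (fun _ => 1)); [apply is_lim_seq_const|].
apply (is_lim_seq_ext (fun n => / INR (S n))); [intros; now rewrite Nat.add_1_r|].
apply (is_lim_seq_incr_1 (fun n => / INR n)).
replace (Finite 0) with (Rbar_inv p_infty) by reflexivity.
apply is_lim_seq_inv; [apply is_lim_seq_INR | discriminate].
Qed.

Lemma ex_series_inv_pow m : (2 <= m)%nat -> ex_series (fun k => / INR (k + 1) ^ m).
Proof.
intros Hm. apply (ex_series_le (K := R_AbsRing) (V := R_CompleteNormedModule) _ (fun k => 2 * (/ INR (k + 1) - / INR (k + 2)))).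
- intros k. change (Rabs (/ INR (k + 1) ^ m) <= 2 * (/ INR (k + 1) - / INR (k + 2))).
  assert (H1 : 1 <= INR (k + 1)) by (apply (le_INR 1); lia).
  assert (E2 : INR (k + 2) = INR (k + 1) + 1) by (rewrite <- S_INR; f_equal; lia).
  rewrite E2. set (x := INR (k + 1)) in *.
  rewrite Rabs_pos_eq by (left; apply Rinv_0_lt_compat, pow_lt; lra).
  apply Rle_trans with (/ x ^ 2).
  + apply Rinv_le_contravar; [apply pow_lt; lra | apply Rle_pow; [lra | exact Hm]].
  + apply Rmult_le_reg_r with (x ^ 2 * (x + 1)); [apply Rmult_lt_0_compat; [apply pow_lt|]; lra|].
    field_simplify; lra || nra.
- exists (2 * 1). apply (is_series_scal (V := R_NormedModule) 2). apply is_series_telescope.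
Qed.

Definition freq (k : nat) : R := 2 * PI * INR (k + 1).

Lemma freq_pos k : 0 < freq k.
Proof.
unfold freq. assert (h := PI_RGT_0). assert (H : 0 < INR (k + 1)) by (apply lt_0_INR; lia).
apply Rmult_lt_0_compat; lra.
Qed.

Lemma sin_2PI_INR k : sin (2 * PI * INR k) = 0.
Proof.
induction k as [|k IH]; [simpl; rewrite Rmult_0_r; apply sin_0|].
rewrite S_INR. replace (2 * PI * (INR k + 1)) with (2 * PI * INR k + 2 * PI) by ring.
now rewrite sin_plus, sin_2PI, cos_2PI, IH, Rmult_0_l, Rmult_0_r, Rplus_0_r.
Qed.

Lemma cos_2PI_INR k : cos (2 * PI * INR k) = 1.
Proof.
induction k as [|k IH]; [simpl; rewrite Rmult_0_r; apply cos_0|].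
rewrite S_INR. replace (2 * PI * (INR k + 1)) with (2 * PI * INR k + 2 * PI) by ring.
rewrite cos_plus, sin_2PI, cos_2PI, IH. ring.
Qed.

Lemma ex_series_freq N : (1 <= N)%nat -> ex_series (fun k => / freq k ^ (2 * N)).
Proof.
intros HN. destruct (ex_series_inv_pow (2 * N)) as [l Hl]; [lia|].
exists (/ (2 * PI) ^ (2 * N) * l).
apply (is_series_ext (fun k => / (2 * PI) ^ (2 * N) * / INR (k + 1) ^ (2 * N))).
- intros k. unfold freq. rewrite (Rpow_mult_distr (2 * PI) (INR (k + 1))). rewrite Rinv_mult. reflexivity.
- apply (is_series_scal (V := R_NormedModule) (/ (2 * PI) ^ (2 * N)) (fun k => / INR (k + 1) ^ (2 * N)) l Hl).
Qed.

(** The cosine is subtracted from its value at [t = 0], because the expanded function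
    [B_2N - B_2N (t)] vanishes there; the constant term of the Fourier series then never
    has to be evaluated. *)
Definition cos_gap (N k : nat) (t : R) : R := (1 - cos (freq k * t)) / freq k ^ (2 * N).

Lemma cos_gap_le N k t : Rabs (cos_gap N k t) <= 2 * / freq k ^ (2 * N).
Proof.
unfold cos_gap, Rdiv. assert (H := freq_pos k). assert (Hc := COS_bound (freq k * t)).
assert (Hp : 0 < / freq k ^ (2 * N)) by (apply Rinv_0_lt_compat, pow_lt; exact H).
rewrite Rabs_mult, (Rabs_pos_eq (/ _)) by lra. apply Rmult_le_compat_r; [lra|].
apply Rabs_le. lra.
Qed.

(** The error bound does not depend on [t]; hence the limit is continuous, and the
    estimates pass to it uniformly. *)
Lemma cos_gap_tail N t l n A :
  is_series (fun k => / freq k ^ (2 * N)) A -> is_series (fun k => cos_gap N k t) l ->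
  Rabs (l - Rsum (fun k => cos_gap N k t) n) <= 2 * (A - Rsum (fun k => / freq k ^ (2 * N)) n).
Proof.
intros HA Hl.
assert (HA2 := is_series_scal (V := R_NormedModule) 2 _ _ HA).
assert (HC : is_Cseries (fun k => RtoC (cos_gap N k t)) (RtoC l)).
{ apply is_Cseries_Clim. apply Clim_ext with (fun n => RtoC (Rsum (fun k => cos_gap N k t) n)); [apply eventually_filter | |].
  - clear. intros n. induction n as [|n IH]; simpl; [reflexivity|]. now rewrite RtoC_plus, IH.
  - apply Clim_RtoC; [apply eventually_filter|]. now apply is_series_Rsum. }
destruct (fun H => Cseries_dominated (fun k => RtoC (cos_gap N k t)) _ _ H HA2) as [l' [H1 H2]].
{ intros k. rewrite Cmod_R. apply cos_gap_le. }
rewrite <- (is_Cseries_unique _ _ _ HC H1) in H2. specialize (H2 n).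
replace (Csum (fun k => RtoC (cos_gap N k t)) n) with (RtoC (Rsum (fun k => cos_gap N k t) n)) in H2.
- rewrite <- RtoC_minus, Cmod_R in H2. eapply Rle_trans; [exact H2|].
  change (2 * A - Rsum (fun k => 2 * / freq k ^ (2 * N)) n <= 2 * (A - Rsum (fun k => / freq k ^ (2 * N)) n)).
  rewrite Rsum_scal. lra.
- clear. induction n as [|n IH]; simpl; [reflexivity|]. now rewrite RtoC_plus, IH.
Qed.

Lemma INR_odd n : INR (2 * n + 1) = 2 * INR n + 1.
Proof. rewrite plus_INR, mult_INR. simpl. ring. Qed.

Lemma dirichlet_kernel n t :
  sin (PI * t) * (1 + 2 * Rsum (fun k => cos (freq k * t)) n) = sin (INR (2 * n + 1) * PI * t).
Proof.
induction n as [|n IH]; simpl Rsum.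
- simpl. rewrite Rmult_1_l. ring.
- replace (sin (PI * t) * (1 + 2 * (Rsum (fun k => cos (freq k * t)) n + cos (freq n * t)))) with
    (sin (PI * t) * (1 + 2 * Rsum (fun k => cos (freq k * t)) n) + 2 * (cos (freq n * t) * sin (PI * t))) by ring.
  rewrite IH.
  replace (INR (2 * S n + 1) * PI * t) with (freq n * t + PI * t).
  + replace (INR (2 * n + 1) * PI * t) with (freq n * t - PI * t).
    * rewrite sin_plus, sin_minus. ring.
    * unfold freq. rewrite INR_odd, Nat.add_1_r, S_INR. ring.
  + unfold freq. rewrite INR_odd, Nat.add_1_r, S_INR. ring.
Qed.

Lemma dirichlet_half n : cos (INR (2 * n + 1) * PI * / 2) = 0.
Proof.
induction n as [|n IH].
- simpl. replace (1 * PI * / 2) with (PI / 2) by field. apply cos_PI2.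
- replace (INR (2 * S n + 1) * PI * / 2) with (INR (2 * n + 1) * PI * / 2 + PI).
  + rewrite cos_plus, IH, sin_PI. ring.
  + rewrite !INR_odd, S_INR. field.
Qed.

Lemma sin_freq_half k : sin (freq k * / 2) = 0.
Proof.
unfold freq. replace (2 * PI * INR (k + 1) * / 2) with (INR (k + 1) * PI) by field.
rewrite INR_IZR_INZ. apply sin_eq_0_1. eexists; reflexivity.
Qed.

(** The defect of the partial sums for degree two has second derivative minus
    twice the Dirichlet kernel; away from the integers an integration by parts
    makes its first derivative of order [1 / n]. *)
Lemma fourier_defect_const n t0 :
  0 < t0 <= / 2 ->
  let f := fun t => t - t ^ 2 - 4 * Rsum (fun k => cos_gap 1 k t) n in
  Rabs (f t0 - f (/ 2)) <= (/ sin (PI * t0) ^ 2 + / sin (PI * t0)) * / INR (2 * n + 1).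
Proof.
intros Ht0 f. assert (HPI := PI_RGT_0).
set (m := sin (PI * t0)). set (q := INR (2 * n + 1)).
assert (Hq : 1 <= q) by (unfold q; apply (le_INR 1); lia).
assert (Hsin : forall t, t0 <= t <= / 2 -> m <= sin (PI * t)).
{ intros t Ht. unfold m. destruct (proj1 Ht) as [h|h]; [|rewrite h; lra].
  left. apply sin_increasing_1; nra. }
assert (Hm : 0 < m) by (unfold m; apply sin_gt_0; nra).
set (f1 := fun t => 1 - 2 * t - 4 * Rsum (fun k => sin (freq k * t) / freq k) n).
assert (D1 : forall t, is_derive f t (f1 t)).
{ intros t. unfold f, f1.
  apply (is_derive_minus (K := R_AbsRing) (V := R_NormedModule)); [auto_derive; [auto|ring]|].
  apply (is_derive_scal (fun x => Rsum (fun k => cos_gap 1 k x) n)).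
  apply (is_derive_Rsum (fun k x => cos_gap 1 k x)). intros k. unfold cos_gap.
  assert (H := freq_pos k). auto_derive; [auto|]. simpl. field. lra. }
(* Subtracting the boundary term of the integration by parts leaves a derivative of
   order [1 / q]. *)
set (w := fun t => f1 t - 2 * (cos (q * PI * t) / (q * PI * sin (PI * t)))).
assert (Dw : forall t, t0 <= t <= / 2 -> is_derive w t (2 * (cos (q * PI * t) * cos (PI * t)) / (q * sin (PI * t) ^ 2))).
{ intros t Ht. specialize (Hsin t Ht).
  assert (Dir := dirichlet_kernel n t). fold q in Dir.
  assert (Df1 : is_derive f1 t (- 2 - 4 * Rsum (fun k => cos (freq k * t)) n)).
  { unfold f1. apply (is_derive_minus (K := R_AbsRing) (V := R_NormedModule)); [auto_derive; [auto|ring]|].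
    apply (is_derive_scal (fun x => Rsum (fun k => sin (freq k * x) / freq k) n)).
    apply (is_derive_Rsum (fun k x => sin (freq k * x) / freq k)). intros k.
    assert (H := freq_pos k). auto_derive; [auto|]. field. lra. }
  assert (DA : is_derive (fun t => 2 * (cos (q * PI * t) / (q * PI * sin (PI * t)))) t
     (- 2 * sin (q * PI * t) / sin (PI * t) - 2 * (cos (q * PI * t) * cos (PI * t)) / (q * sin (PI * t) ^ 2))).
  { auto_derive; [apply Rgt_not_eq; apply Rmult_lt_0_compat; [apply Rmult_lt_0_compat|]; lra|].
    field. repeat split; lra. }
  assert (D := is_derive_minus (K := R_AbsRing) (V := R_NormedModule) _ _ _ _ _ Df1 DA).
  replace (2 * (cos (q * PI * t) * cos (PI * t)) / (q * sin (PI * t) ^ 2)) with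
    (minus (- 2 - 4 * Rsum (fun k => cos (freq k * t)) n)
      (- 2 * sin (q * PI * t) / sin (PI * t) - 2 * (cos (q * PI * t) * cos (PI * t)) / (q * sin (PI * t) ^ 2))); [exact D|].
  rewrite <- Dir. unfold minus, plus, opp; simpl. field. split; lra. }
assert (w_half : w (/ 2) = 0).
{ unfold w, f1. unfold q. rewrite dirichlet_half.
  rewrite (Rsum_ext _ (fun _ => 0)) by (intros k _; rewrite sin_freq_half; unfold Rdiv; ring).
  rewrite Rsum_zero. unfold Rdiv. rewrite Rmult_0_l. field. }
assert (Hpm : 0 < m ^ 2) by (now apply pow_lt).
assert (Hw : forall t, t0 <= t <= / 2 -> Rabs (w t) <= / m ^ 2 * / q).
{ intros t Ht. replace (w t) with (- (w (/ 2) - w t)) by (rewrite w_half; ring). rewrite Rabs_Ropp.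
  eapply Rle_trans; [apply (R_compare w (fun t => 2 * (cos (q * PI * t) * cos (PI * t)) / (q * sin (PI * t) ^ 2)) t (/ 2) (2 * (/ m ^ 2 * / q)))|].
  - lra.
  - intros x Hx. apply Dw. lra.
  - intros x Hx. assert (Hs := Hsin x ltac:(lra)).
    assert (Hs2 : m ^ 2 <= sin (PI * x) ^ 2) by (apply pow_incr; lra).
    unfold Rdiv. rewrite Rabs_mult, Rabs_mult, Rabs_mult, (Rabs_pos_eq 2) by lra.
    rewrite Rinv_mult, (Rabs_pos_eq (/ q * _)).
    + assert (A1 : Rabs (cos (q * PI * x)) <= 1) by (apply Rabs_le; apply COS_bound).
      assert (A2 : Rabs (cos (PI * x)) <= 1) by (apply Rabs_le; apply COS_bound).
      assert (A3 := Rabs_pos (cos (q * PI * x))). assert (A4 := Rabs_pos (cos (PI * x))).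
      assert (A5 : / sin (PI * x) ^ 2 <= / m ^ 2) by (apply Rinv_le_contravar; lra).
      assert (A6 : 0 < / q) by (apply Rinv_0_lt_compat; lra).
      assert (A7 : 0 < / sin (PI * x) ^ 2) by (apply Rinv_0_lt_compat; lra).
      assert (A8 : Rabs (cos (q * PI * x)) * Rabs (cos (PI * x)) <= 1) by nra.
      rewrite (Rmult_comm (/ q)), Rmult_assoc. apply Rmult_le_compat_l; [lra|].
      rewrite <- (Rmult_1_l (/ m ^ 2 * / q)). apply Rmult_le_compat; try nra.
    + apply Rmult_le_pos; left; apply Rinv_0_lt_compat; [lra | apply pow_lt; lra].
  - assert (A6 : 0 < / q) by (apply Rinv_0_lt_compat; lra).
    assert (A7 : 0 < / m ^ 2) by (now apply Rinv_0_lt_compat).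
    assert (0 < / m ^ 2 * / q) by (now apply Rmult_lt_0_compat). nra. }
assert (A6 : 0 < / q) by (apply Rinv_0_lt_compat; lra).
assert (A7 : 0 < / m ^ 2) by (now apply Rinv_0_lt_compat).
assert (A8 : 0 < / m) by (now apply Rinv_0_lt_compat).
rewrite Rabs_minus_sym.
eapply Rle_trans; [apply (R_compare f f1 t0 (/ 2) (2 * ((/ m ^ 2 + / m) * / q)))|].
- lra.
- intros; apply D1.
- intros t Ht. replace (f1 t) with (w t + 2 * (cos (q * PI * t) / (q * PI * sin (PI * t)))) by (unfold w; ring).
  eapply Rle_trans; [apply Rabs_triang|]. assert (Hw' := Hw t Ht). assert (Hs := Hsin t Ht).
  assert (A1 : Rabs (cos (q * PI * t)) <= 1) by (apply Rabs_le; apply COS_bound).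
  assert (A2 : Rabs (2 * (cos (q * PI * t) / (q * PI * sin (PI * t)))) <= 2 * (/ m * / q)).
  { unfold Rdiv. rewrite Rabs_mult, Rabs_mult, (Rabs_pos_eq 2) by lra.
    apply Rmult_le_compat_l; [lra|].
    assert (B1 : m * q <= q * PI * sin (PI * t)).
    { assert (h2 := PI2_1). assert (1 <= PI) by lra. assert (m * q <= sin (PI * t) * q) by (apply Rmult_le_compat_r; lra).
      assert (0 < q * sin (PI * t)) by nra. nra. }
    assert (B2 : 0 < m * q) by nra.
    rewrite (Rabs_pos_eq (/ _)) by (left; apply Rinv_0_lt_compat; lra).
    rewrite <- Rinv_mult. rewrite <- (Rmult_1_l (/ (m * q))).
    apply Rmult_le_compat; [apply Rabs_pos | left; apply Rinv_0_lt_compat; lra | exact A1 | apply Rinv_le_contravar; lra]. }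
  assert (0 < / m ^ 2 * / q) by (now apply Rmult_lt_0_compat). lra.
- assert (0 < (/ m ^ 2 + / m) * / q) by (apply Rmult_lt_0_compat; lra). nra.
Qed.

Lemma is_lim_seq_tail (u : nat -> R) A : is_series u A -> is_lim_seq (fun n => A - Rsum u n) 0.
Proof. apply Rsum_tail. Qed.

Lemma is_lim_seq_le_0 (x : R) (u : nat -> R) : (forall n, Rabs x <= u n) -> is_lim_seq u 0 -> x = 0.
Proof.
intros H Hu. assert (h : Rbar_le (Rabs x) 0).
{ apply (is_lim_seq_le (fun _ => Rabs x) u); [exact H | apply is_lim_seq_const | exact Hu]. }
simpl in h. assert (h1 := Rabs_pos x). destruct (Req_dec x 0) as [E|E]; [exact E|].
apply Rabs_pos_lt in E. lra.
Qed.

Lemma is_lim_seq_inv_odd C : is_lim_seq (fun n => C * / INR (2 * n + 1)) 0.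
Proof.
replace (Finite 0) with (Rbar_mult C 0) by (simpl; f_equal; ring).
apply is_lim_seq_scal_l.
replace (Finite 0) with (Rbar_inv p_infty) by reflexivity.
apply is_lim_seq_inv; [|discriminate].
apply (is_lim_seq_le_p_loc INR); [|apply is_lim_seq_INR].
exists 0%nat. intros n _. apply le_INR. lia.
Qed.

Lemma ex_series_cos_gap N t : (1 <= N)%nat -> ex_series (fun k => cos_gap N k t).
Proof.
intros HN. apply (ex_series_le (K := R_AbsRing) (V := R_CompleteNormedModule) _ (fun k => 2 * / freq k ^ (2 * N))).
- intros k. apply cos_gap_le.
- destruct (ex_series_freq N HN) as [A HA]. exists (2 * A). apply (is_series_scal (V := R_NormedModule) 2 _ _ HA).
Qed.

Lemma cos_gap_reflect N k t : cos_gap N k (1 - t) = cos_gap N k t.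
Proof.
unfold cos_gap. replace (freq k * (1 - t)) with (2 * PI * INR (k + 1) - freq k * t) by (unfold freq; ring).
now rewrite cos_minus, cos_2PI_INR, sin_2PI_INR, Rmult_1_l, Rmult_0_l, Rplus_0_r.
Qed.

Lemma cos_gap_0 N k : cos_gap N k 0 = 0.
Proof. unfold cos_gap. rewrite Rmult_0_r, cos_0. unfold Rdiv. ring. Qed.

(** The defect is constant on the open interval and small near [0], so it vanishes. *)
Lemma fourier_deg_2_half t : 0 <= t <= / 2 -> is_series (fun k => cos_gap 1 k t) ((t - t ^ 2) / 4).
Proof.
intros Ht.
destruct (ex_series_freq 1 ltac:(lia)) as [A HA].
set (tau := fun n => A - Rsum (fun k => / freq k ^ (2 * 1)) n).
assert (Htau : is_lim_seq tau 0) by (apply is_lim_seq_tail; exact HA).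
assert (HF : forall t, is_series (fun k => cos_gap 1 k t) (Series (fun k => cos_gap 1 k t)))
  by (intros x; apply Series_correct, ex_series_cos_gap; lia).
set (F := fun t => Series (fun k => cos_gap 1 k t)) in *.
set (f := fun n t => t - t ^ 2 - 4 * Rsum (fun k => cos_gap 1 k t) n).
assert (Htail : forall n t, Rabs ((t - t ^ 2 - 4 * F t) - f n t) <= 8 * tau n).
{ intros n x. assert (h := cos_gap_tail 1 x (F x) n A HA (HF x)).
  unfold f. replace (x - x ^ 2 - 4 * F x - (x - x ^ 2 - 4 * Rsum (fun k => cos_gap 1 k x) n)) with
    (- (4 * (F x - Rsum (fun k => cos_gap 1 k x) n))) by ring.
  rewrite Rabs_Ropp, Rabs_mult, (Rabs_pos_eq 4) by lra. unfold tau. lra. }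
set (c := / 2 - (/ 2) ^ 2 - 4 * F (/ 2)).
(* The defect is constant on (0, 1/2]: compare at a common index [n]. *)
assert (Hconst : forall x, 0 < x <= / 2 -> x - x ^ 2 - 4 * F x = c).
{ intros x Hx. apply Rminus_diag_uniq.
  set (K := / sin (PI * x) ^ 2 + / sin (PI * x)).
  apply (is_lim_seq_le_0 _ (fun n => 16 * tau n + K * / INR (2 * n + 1))).
  - intros n. assert (h1 := Htail n x). assert (h2 := Htail n (/ 2)). assert (h3 := fourier_defect_const n x Hx).
    change (Rabs (f n x - f n (/ 2)) <= K * / INR (2 * n + 1)) in h3.
    change (Rabs (c - f n (/ 2)) <= 8 * tau n) in h2.
    replace (x - x ^ 2 - 4 * F x - c) with ((x - x ^ 2 - 4 * F x - f n x) + ((f n x - f n (/ 2)) + - (c - f n (/ 2)))) by ring.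
    eapply Rle_trans; [apply Rabs_triang|].
    assert (h4 := Rabs_triang (f n x - f n (/ 2)) (- (c - f n (/ 2)))). rewrite Rabs_Ropp in h4. lra.
  - replace (Finite 0) with (Finite (16 * 0 + 0)) by (f_equal; ring).
    apply is_lim_seq_plus'; [apply (is_lim_seq_scal_l tau 16 0 Htau) | apply is_lim_seq_inv_odd]. }
(* For fixed [n] the partial defect tends to zero at the left end. *)
assert (Hc : c = 0).
{ apply (is_lim_seq_le_0 _ (fun n => 8 * tau n)).
  - intros n.
    assert (Hcont : is_lim_seq (fun j => f n (/ INR (j + 2))) (f n 0)).
    { apply (is_lim_seq_continuous (f n)).
      - apply continuity_pt_filterlim. apply (ex_derive_continuous (K := R_AbsRing) (V := R_NormedModule)).
        eexists. unfold f.
        apply (is_derive_minus (K := R_AbsRing) (V := R_NormedModule)); [auto_derive; [auto|reflexivity]|].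
        apply (is_derive_scal (fun x => Rsum (fun k => cos_gap 1 k x) n)).
        apply (is_derive_Rsum (fun k x => cos_gap 1 k x) (fun k => sin (freq k * 0) * freq k / freq k ^ 2)). intros k. unfold cos_gap.
        assert (H := freq_pos k). auto_derive; [auto|]. simpl. field. lra.
      - apply (is_lim_seq_ext (fun j => / INR (S (S j)))); [intros; do 2 f_equal; lia|].
        apply (is_lim_seq_incr_1 (fun j => / INR (S j))). apply (is_lim_seq_incr_1 (fun j => / INR j)).
        replace (Finite 0) with (Rbar_inv p_infty) by reflexivity.
        apply is_lim_seq_inv; [apply is_lim_seq_INR | discriminate]. }
    assert (f0 : f n 0 = 0).
    { unfold f. rewrite (Rsum_ext _ (fun _ => 0)) by (intros; apply cos_gap_0). rewrite Rsum_zero. ring. }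
    rewrite f0 in Hcont.
    assert (h : Rbar_le (Rabs c) (8 * tau n + 0)).
    { apply (is_lim_seq_le (fun _ => Rabs c) (fun j => 8 * tau n + Rabs (f n (/ INR (j + 2))))).
      - intros j. assert (Hj : 2 <= INR (j + 2)) by (apply (le_INR 2); lia).
        assert (Hj2 : 0 < / INR (j + 2) <= / 2).
        { split; [apply Rinv_0_lt_compat; lra | apply Rinv_le_contravar; lra]. }
        assert (h1 := Htail n (/ INR (j + 2))). rewrite (Hconst _ Hj2) in h1.
        assert (h2 := Rabs_triang (c - f n (/ INR (j + 2))) (f n (/ INR (j + 2)))).
        replace (c - f n (/ INR (j + 2)) + f n (/ INR (j + 2))) with c in h2 by ring. lra.
      - apply is_lim_seq_const.
      - apply is_lim_seq_plus'; [apply is_lim_seq_const|].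
        replace 0 with (Rabs 0) by apply Rabs_R0. apply (is_lim_seq_abs _ 0). exact Hcont. }
    simpl in h. lra.
  - replace (Finite 0) with (Finite (8 * 0)) by (f_equal; ring). apply (is_lim_seq_scal_l tau 8 0 Htau). }
assert (HFt : F t = (t - t ^ 2) / 4).
{ destruct (proj1 Ht) as [h|h].
  - assert (E := Hconst t ltac:(lra)). lra.
  - rewrite <- h. unfold F. rewrite (Series_ext _ (fun _ => 0)) by (intros; apply cos_gap_0).
    rewrite (is_series_unique (fun _ => 0) 0); [field|].
    apply is_series_Rsum. apply (is_lim_seq_ext (fun _ => 0) _ 0); [intros; now rewrite Rsum_zero | apply is_lim_seq_const]. }
rewrite <- HFt. apply HF.
Qed.

Definition fourier_const (N : nat) : R := (-1) ^ (N + 1) * 2 * INR (fact (2 * N)).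

Lemma bernoulli_0 : bernoulli 0 = 1.
Proof. reflexivity. Qed.

Lemma bernoulli_1 : bernoulli 1 = - / 2.
Proof. rewrite bernoulli_S. simpl sum_f_R0. rewrite bernoulli_0. unfold Binomial.C. simpl. field. Qed.

Lemma bernoulli_poly_2 t : bernoulli 2 - bernoulli_poly 2 t = t - t ^ 2.
Proof.
unfold bernoulli_poly. simpl sum_f_R0. rewrite bernoulli_0, bernoulli_1.
unfold Binomial.C. simpl. field.
Qed.

Lemma fourier_deg_2 t :
  0 <= t <= 1 -> is_series (fun k => fourier_const 1 * cos_gap 1 k t) (bernoulli (2 * 1) - bernoulli_poly (2 * 1) t).
Proof.
intros Ht. replace (bernoulli (2 * 1) - bernoulli_poly (2 * 1) t) with (fourier_const 1 * ((t - t ^ 2) / 4)).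
- apply (is_series_scal (V := R_NormedModule) (fourier_const 1)).
  destruct (Rle_lt_dec t (/ 2)) as [h|h]; [apply fourier_deg_2_half; lra|].
  apply (is_series_ext (fun k => cos_gap 1 k (1 - t))); [intros; apply cos_gap_reflect|].
  replace (t - t ^ 2) with ((1 - t) - (1 - t) ^ 2) by ring. apply fourier_deg_2_half. lra.
- change (2 * 1)%nat with 2%nat. rewrite bernoulli_poly_2. unfold fourier_const. simpl. field.
Qed.

(** The defect of the partial sums in degree [2 N + 2] has second derivative equal
    to the tail in degree [2 N] up to a constant; the boundary values force that
    constant, and then the defect itself, to be as small as the tail. *)
Lemma fourier_step N :
  (1 <= N)%nat ->
  (forall t, 0 <= t <= 1 -> is_series (fun k => fourier_const N * cos_gap N k t) (bernoulli (2 * N) - bernoulli_poly (2 * N) t)) ->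
  forall t, 0 <= t <= 1 ->
  is_series (fun k => fourier_const (S N) * cos_gap (S N) k t) (bernoulli (2 * S N) - bernoulli_poly (2 * S N) t).
Proof.
intros HN IH t Ht.
set (K := fourier_const N) in *. set (K' := fourier_const (S N)).
set (M := INR (2 * N + 2) * INR (2 * N + 1)).
assert (EK : K' = - M * K).
{ unfold K', K, M, fourier_const. replace (2 * S N)%nat with (S (S (2 * N))) by lia.
  replace (2 * N + 2)%nat with (S (S (2 * N))) by lia. replace (2 * N + 1)%nat with (S (2 * N)) by lia.
  change (fact (S (S (2 * N)))) with (S (S (2 * N)) * (S (2 * N) * fact (2 * N)))%nat.
  rewrite !(mult_INR (S _)). replace (S N + 1)%nat with (S (N + 1)) by lia.
  change ((-1) ^ S (N + 1)) with (-1 * (-1) ^ (N + 1)). ring. }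
destruct (ex_series_freq N HN) as [A HA].
set (a := fun k => / freq k ^ (2 * N)) in *.
set (tau := fun n => A - Rsum a n).
assert (Htau : is_lim_seq tau 0) by (apply is_lim_seq_tail; exact HA).
assert (Htau0 : forall n, 0 <= tau n).
{ intros n. unfold tau. assert (h := Rsum_le_series a A n). 
  assert (forall k, 0 <= a k) by (intros k; left; apply Rinv_0_lt_compat, pow_lt, freq_pos).
  specialize (h H HA). lra. }
set (W := fun n x => bernoulli (2 * S N) - bernoulli_poly (2 * S N) x - K' * Rsum (fun k => cos_gap (S N) k x) n).
set (W1 := fun n x => - (INR (2 * N + 2) * bernoulli_poly (2 * N + 1) x) - K' * Rsum (fun k => sin (freq k * x) / freq k ^ (2 * N + 1)) n).
set (W2 := fun n x => - (M * bernoulli_poly (2 * N) x) - K' * Rsum (fun k => cos (freq k * x) * a k) n).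
assert (DW : forall n x, is_derive (W n) x (W1 n x)).
{ intros n x. unfold W, W1. replace (2 * S N)%nat with (S (2 * N + 1)) by lia.
  apply (is_derive_minus (K := R_AbsRing) (V := R_NormedModule)).
  - replace (- (INR (2 * N + 2) * bernoulli_poly (2 * N + 1) x)) with (minus 0 (INR (S (2 * N + 1)) * bernoulli_poly (2 * N + 1) x)).
    + apply (is_derive_minus (K := R_AbsRing) (V := R_NormedModule)); [apply (is_derive_const (K := R_AbsRing) (V := R_NormedModule)) | apply is_derive_bernoulli_poly].
    + replace (S (2 * N + 1)) with (2 * N + 2)%nat by lia. unfold minus, plus, opp; simpl. ring.
  - apply (is_derive_scal (fun x => Rsum (fun k => cos_gap (S N) k x) n)).
    apply (is_derive_Rsum (fun k x => cos_gap (S N) k x)). intros k. unfold cos_gap.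
    replace (2 * S N)%nat with (S (2 * N + 1)) by lia. generalize (2 * N + 1)%nat. intros p.
    assert (H := freq_pos k). assert (Hp : 0 < freq k ^ p) by (now apply pow_lt).
    change (freq k ^ S p) with (freq k * freq k ^ p).
    auto_derive; [auto|]. field. split; lra. }
assert (DW1 : forall n x, is_derive (W1 n) x (W2 n x)).
{ intros n x. unfold W1, W2.
  apply (is_derive_minus (K := R_AbsRing) (V := R_NormedModule)).
  - replace (- (M * bernoulli_poly (2 * N) x)) with (opp (INR (2 * N + 2) * (INR (S (2 * N)) * bernoulli_poly (2 * N) x))).
    + apply (is_derive_opp (K := R_AbsRing) (V := R_NormedModule)). apply is_derive_scal.
      replace (2 * N + 1)%nat with (S (2 * N)) by lia. apply is_derive_bernoulli_poly.
    + unfold M. replace (2 * N + 1)%nat with (S (2 * N)) by lia. unfold opp; simpl. ring.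
  - apply (is_derive_scal (fun x => Rsum (fun k => sin (freq k * x) / freq k ^ (2 * N + 1)) n)).
    apply (is_derive_Rsum (fun k x => sin (freq k * x) / freq k ^ (2 * N + 1)) (fun k => cos (freq k * x) * a k)). intros k. unfold a.
    replace (2 * N + 1)%nat with (S (2 * N)) by lia. generalize (2 * N)%nat. intros p.
    assert (H := freq_pos k). assert (Hp : 0 < freq k ^ p) by (now apply pow_lt).
    change (freq k ^ S p) with (freq k * freq k ^ p).
    auto_derive; [auto|]. field. split; lra. }
assert (Wb : forall n, W n 0 = 0 /\ W n 1 = 0).
{ intros n. unfold W. rewrite bernoulli_poly_0, bernoulli_poly_1 by lia.
  rewrite (Rsum_ext (fun k => cos_gap (S N) k 1) (fun _ => 0)).
  - rewrite (Rsum_ext _ (fun _ => 0)) by (intros; apply cos_gap_0). rewrite Rsum_zero. split; ring.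
  - intros k _. replace 1 with (1 - 0) by ring. rewrite cos_gap_reflect. apply cos_gap_0. }
(* Equal boundary values give, by the mean value theorem, a zero of [W1] and one of [W2]. *)
assert (W1b : forall n, W1 n 0 = W1 n 1).
{ intros n. unfold W1. rewrite bernoulli_poly_0, bernoulli_poly_1 by lia. do 2 f_equal.
  apply Rsum_ext. intros k _. rewrite Rmult_0_r, sin_0. unfold freq at 2. rewrite Rmult_1_r.
  now rewrite sin_2PI_INR. }
assert (W2b : forall n x y, 0 <= x <= 1 -> 0 <= y <= 1 -> Rabs (W2 n x - W2 n y) <= 4 * M * Rabs K * tau n).
{ assert (HM : 0 < M) by (unfold M; apply Rmult_lt_0_compat; apply lt_0_INR; lia).
  intros n. assert (G : forall x, 0 <= x <= 1 -> exists d, Rabs d <= 2 * M * Rabs K * tau n /\ W2 n x = M * (K * Rsum a n - bernoulli (2 * N)) + d).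
  { intros x Hx. exists (M * ((bernoulli (2 * N) - bernoulli_poly (2 * N) x) - K * Rsum (fun k => cos_gap N k x) n)). split.
    - assert (Hs := Series_correct _ (ex_series_cos_gap N x HN)).
      assert (h := cos_gap_tail N x _ n A HA Hs).
      rewrite <- (is_series_unique _ _ (IH x Hx)), Series_scal_l.
      rewrite <- Rmult_minus_distr_l, !Rabs_mult, (Rabs_pos_eq M) by lra.
      fold a in h. fold (tau n) in h.
      replace (2 * M * Rabs K * tau n) with (M * (Rabs K * (2 * tau n))) by ring.
      apply Rmult_le_compat_l; [lra|]. apply Rmult_le_compat_l; [apply Rabs_pos | exact h].
    - unfold W2. rewrite EK.
      assert (E : Rsum (fun k => cos_gap N k x) n = Rsum a n - Rsum (fun k => cos (freq k * x) * a k) n).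
      { rewrite <- Rsum_minus. apply Rsum_ext. intros k _. unfold cos_gap, a, Rdiv. ring. }
      rewrite E. ring. }
  intros x y Hx Hy. destruct (G x Hx) as [d1 [h1 ->]]. destruct (G y Hy) as [d2 [h2 ->]].
  match goal with |- Rabs ?e <= _ => replace e with (d1 + - d2) by ring end.
  eapply Rle_trans; [apply Rabs_triang|]. rewrite Rabs_Ropp. lra. }
assert (WB : forall n, Rabs (W n t) <= 4 * M * Rabs K * tau n).
{ intros n. set (B := 4 * M * Rabs K * tau n).
  destruct (Rolle_derive (W1 n) (W2 n) (DW1 n) (W1b n)) as [xi [Hxi E2]].
  destruct (Rolle_derive (W n) (W1 n) (DW n) ltac:(destruct (Wb n); lra)) as [eta [Heta E1]].
  assert (B2 : forall x, 0 <= x <= 1 -> Rabs (W2 n x) <= B).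
  { intros x Hx. replace (W2 n x) with (W2 n x - W2 n xi) by lra. now apply W2b. }
  assert (B1 : forall x, 0 <= x <= 1 -> Rabs (W1 n x) <= B).
  { intros x Hx. replace (W1 n x) with (W1 n x - W1 n eta) by lra.
    apply (Rabs_bound_from_zero (W1 n) (W2 n)); auto. }
  replace (W n t) with (W n t - W n 0) by (destruct (Wb n); lra).
  apply (Rabs_bound_from_zero (W n) (W1 n)); auto. lra. }
apply is_series_Rsum.
apply (is_lim_seq_ext (fun n => (bernoulli (2 * S N) - bernoulli_poly (2 * S N) t) - W n t) _
  (bernoulli (2 * S N) - bernoulli_poly (2 * S N) t)).
{ intros n. unfold W. rewrite Rsum_scal. ring. }
replace (Finite (bernoulli (2 * S N) - bernoulli_poly (2 * S N) t)) with
  (Finite ((bernoulli (2 * S N) - bernoulli_poly (2 * S N) t) - 0)) by (f_equal; ring).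
apply is_lim_seq_minus'; [apply is_lim_seq_const|].
apply is_lim_seq_abs_0.
apply (is_lim_seq_le_le (fun _ => 0) _ (fun n => 4 * M * Rabs K * tau n)).
- intros n. split; [apply Rabs_pos | apply WB].
- apply is_lim_seq_const.
- replace (Finite 0) with (Finite (4 * M * Rabs K * 0)) by (f_equal; ring).
  apply (is_lim_seq_scal_l tau _ 0 Htau).
Qed.

Lemma bernoulli_fourier N t :
  (1 <= N)%nat -> 0 <= t <= 1 ->
  is_series (fun k => fourier_const N * cos_gap N k t) (bernoulli (2 * N) - bernoulli_poly (2 * N) t).
Proof.
intros HN. revert t. induction HN as [|N HN IH]; intros t Ht; [now apply fourier_deg_2 | now apply fourier_step].
Qed.

(** Continuous, since the two end values of a period agree; the proof reads the
    continuity off the Fourier series. *)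
Definition bernoulli_gap (N : nat) (t : R) : R :=
  bernoulli (2 * N) - bernoulli_poly (2 * N) (t - IZR (Zfloor t)).

Lemma cos_gap_periodic N k t z : cos_gap N k (t - IZR z) = cos_gap N k t.
Proof.
unfold cos_gap. do 2 f_equal. replace (freq k * (t - IZR z)) with (freq k * t - freq k * IZR z) by ring.
assert (E : forall z, cos (freq k * IZR z) = 1 /\ sin (freq k * IZR z) = 0).
{ assert (E0 : forall j : nat, cos (freq k * INR j) = 1 /\ sin (freq k * INR j) = 0).
  { intros j. unfold freq. replace (2 * PI * INR (k + 1) * INR j) with (2 * PI * INR ((k + 1) * j)) by (rewrite mult_INR; ring).
    split; [apply cos_2PI_INR | apply sin_2PI_INR]. }
  intros [|p|p].
  - destruct (E0 0%nat) as [e1 e2]. now split.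
  - change (IZR (Zpos p)) with (IPR p). rewrite <- INR_IPR. apply E0.
  - change (IZR (Zneg p)) with (- IPR p). rewrite <- INR_IPR.
    rewrite Ropp_mult_distr_r_reverse, cos_neg, sin_neg.
    destruct (E0 (Pos.to_nat p)) as [e1 e2]. rewrite e1, e2. split; ring. }
destruct (E z) as [e1 e2]. rewrite cos_minus, e1, e2. ring.
Qed.

Lemma bernoulli_gap_series N t :
  (1 <= N)%nat -> is_series (fun k => fourier_const N * cos_gap N k t) (bernoulli_gap N t).
Proof.
intros HN. unfold bernoulli_gap. destruct (Zfloor_bound t) as [h1 h2].
apply (is_series_ext (fun k => fourier_const N * cos_gap N k (t - IZR (Zfloor t)))).
- intros k. now rewrite cos_gap_periodic.
- apply bernoulli_fourier; [exact HN | lra].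
Qed.

Open Scope C_scope.

(** * Decay of complex powers along a horizontal ray *)

Lemma slit_shift_lower a : slit a ->
  exists d : R, (0 < d)%R /\ forall t : R, (0 <= t)%R -> (d <= Cmod (t + a))%R.
Proof.
intros Ha. destruct (Rle_lt_dec (Re a) 0) as [h|h].
- assert (Hi : Im a <> 0%R) by (destruct Ha; [lra | assumption]).
  exists (Rabs (Im a)). split; [now apply Rabs_pos_lt|]. intros t _.
  replace (Im a) with (Im (t + a)) by (destruct a; simpl; ring). apply im_le_Cmod.
- exists (Re a). split; [exact h|]. intros t Ht.
  apply Rle_trans with (Re (t + a)); [destruct a; simpl in *; lra|].
  eapply Rle_trans; [apply Rle_abs | apply re_le_Cmod].
Qed.

(** The distance to the origin grows linearly along the ray: it is bounded below
    near the start and exceeds [t - |a|] far out. *)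
Lemma slit_shift_linear a : slit a ->
  exists d : R, (0 < d)%R /\ forall t : R, (0 <= t)%R -> (d * (1 + t) <= Cmod (t + a))%R.
Proof.
intros Ha. destruct (slit_shift_lower a Ha) as [d [Hd H]].
assert (Hm := Cmod_ge_0 a).
exists (d / (1 + d + Cmod a))%R. split; [apply Rdiv_lt_0_compat; lra|]. intros t Ht.
specialize (H t Ht).
assert (H2 : (t - Cmod a <= Cmod (t + a))%R).
{ assert (h := Cmod_triangle_rev t a). rewrite Cmod_R, Rabs_pos_eq in h by exact Ht. exact h. }
apply Rmult_le_reg_r with (1 + d + Cmod a)%R; [lra|].
replace (d / (1 + d + Cmod a) * (1 + t) * (1 + d + Cmod a))%R with (d * (1 + t))%R by (field; lra).
assert (h1 : (d * (t - Cmod a) <= d * Cmod (t + a))%R) by (apply Rmult_le_compat_l; lra).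
assert (h2 : ((1 + Cmod a) * d <= (1 + Cmod a) * Cmod (t + a))%R) by (apply Rmult_le_compat_l; lra).
lra.
Qed.

Lemma Rpower_antitone x y q : (0 < x)%R -> (x <= y)%R -> (0 <= q)%R -> (Rpower y (- q) <= Rpower x (- q))%R.
Proof.
intros Hx Hxy Hq. unfold Rpower.
assert (h : (ln x <= ln y)%R) by (destruct Hxy as [h|h]; [left; now apply ln_increasing | rewrite h; lra]).
assert (h1 : (- q * ln y <= - q * ln x)%R) by nra.
destruct h1 as [h1|h1]; [left; now apply exp_increasing | rewrite h1; lra].
Qed.

Lemma Cpower_shift_le a w : slit a -> (0 <= Re w)%R ->
  exists B : R, (0 < B)%R /\ forall t : R, (0 <= t)%R ->
    (Cmod (Cpower (t + a) (- w)) <= B * Rpower (1 + t) (- Re w))%R.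
Proof.
intros Ha Hw. destruct (slit_shift_linear a Ha) as [d [Hd H]].
exists (exp (PI * Rabs (Im (- w))) * Rpower d (- Re w))%R.
split; [apply Rmult_lt_0_compat; apply exp_pos|]. intros t Ht.
assert (Hs := slit_shift a t Ha Ht).
eapply Rle_trans; [apply Cmod_Cpower_le; now apply slit_neq_0|].
rewrite Rmult_assoc. apply Rmult_le_compat_l; [left; apply exp_pos|].
rewrite Rpower_mult_distr by lra. apply Rpower_antitone; [nra | now apply H | exact Hw].
Qed.

Lemma Rpower_lim_infty q : (0 < q)%R ->
  filterlim (fun t => Rpower (1 + t) (- q)) (Rbar_locally p_infty) (locally 0%R).
Proof.
intros Hq. apply filterlim_locally. intros eps.
exists (Rmax 0 (exp (- ln eps / q))). intros t Ht.
assert (H0 : (0 < t)%R) by (eapply Rle_lt_trans; [apply Rmax_l | exact Ht]).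
assert (H1 : (exp (- ln eps / q) < 1 + t)%R).
{ assert (exp (- ln eps / q) < t)%R by (eapply Rle_lt_trans; [apply Rmax_r | exact Ht]). lra. }
change (Rabs (Rpower (1 + t) (- q) - 0) < eps)%R. rewrite Rminus_0_r.
unfold Rpower. rewrite Rabs_pos_eq by (left; apply exp_pos).
rewrite <- (exp_ln eps) by apply cond_pos. apply exp_increasing.
apply ln_increasing in H1; [|apply exp_pos]. rewrite ln_exp in H1.
apply (Rmult_lt_compat_l q) in H1; [|exact Hq].
replace (q * (- ln eps / q))%R with (- ln eps)%R in H1 by (field; lra). lra.
Qed.

Lemma Cpower_shift_lim a w : slit a -> (0 < Re w)%R ->
  Clim (Rbar_locally p_infty) (fun t : R => Cpower (t + a) (- w)) 0.
Proof.
intros Ha Hw. destruct (Cpower_shift_le a w Ha ltac:(lra)) as [B [HB H]].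
apply (Clim_squeeze0 (Rbar_locally p_infty) _ (fun t => (B * Rpower (1 + t) (- Re w))%R)).
- exists 0%R. intros t Ht. apply H. lra.
- replace 0%R with (B * 0)%R by ring.
  apply (filterlim_comp _ _ _ (fun t => Rpower (1 + t) (- Re w)) (fun y => (B * y)%R) _ (locally 0%R)).
  + now apply Rpower_lim_infty.
  + apply (filterlim_scal_r (K := R_AbsRing) (V := R_NormedModule) B 0%R).
Qed.

Lemma INR_lim_infty : filterlim INR eventually (Rbar_locally p_infty).
Proof. apply is_lim_seq_INR. Qed.

Lemma Rder_Rpower_shift q t : (0 <= t)%R ->
  Rder (fun x => RtoC (Rpower (1 + x) (- q))) t (RtoC (- q * Rpower (1 + t) (- q - 1))).
Proof.
intros Ht. apply Rder_RtoC. unfold Rpower. auto_derive; [lra|].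
replace ((- q - 1) * ln (1 + t))%R with (- q * ln (1 + t) + - ln (1 + t))%R by ring.
rewrite exp_plus, exp_Ropp, exp_ln by lra. field. lra.
Qed.

Lemma Ccont_Rpower_shift q t : (0 <= t)%R -> Ccont (fun x => RtoC (Rpower (1 + x) (- q))) t.
Proof. intros Ht. exact (Rder_Ccont _ _ _ (Rder_Rpower_shift q t Ht)). Qed.

Lemma Cint_Rpower_shift q : (1 < q)%R ->
  is_CRInt_gen (fun t => RtoC (Rpower (1 + t) (- q))) (at_point 0%R) (Rbar_locally p_infty) (RtoC (/ (q - 1))).
Proof.
intros Hq. set (c := RtoC (- / (q - 1))).
replace (RtoC (/ (q - 1))) with (c * 0 - c * RtoC (Rpower (1 + 0) (- (q - 1)))).
- apply (Cint_FTC _ _ _ int_range_0_infty (fun t => c * RtoC (Rpower (1 + t) (- (q - 1))))).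
  + intros t Ht. replace (RtoC (Rpower (1 + t) (- q))) with (c * RtoC (- (q - 1) * Rpower (1 + t) (- (q - 1) - 1))).
    * apply Rder_scal. now apply Rder_Rpower_shift.
    * unfold c. rewrite <- RtoC_mult. f_equal.
      replace (- (q - 1) - 1)%R with (- q)%R by ring. field. lra.
  + intros t Ht. now apply Ccont_Rpower_shift.
  + intros e He. unfold at_point. 
    match goal with |- (Cmod (?x - ?x) < e)%R => replace (x - x) with (RtoC 0) by ring end. rewrite Cmod_0. exact He.
  + apply Clim_scal; [typeclasses eauto|]. apply Clim_RtoC; [typeclasses eauto|]. apply Rpower_lim_infty. lra.
- unfold c. rewrite Rplus_0_r. unfold Rpower. rewrite ln_1, Rmult_0_r, exp_0.
  rewrite RtoC_opp. ring.
Qed.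

(** * The Euler-Maclaurin formula *)

Section EulerMaclaurin.
Context (a : C) (Ha : slit a).

Definition pw (s : C) (k : nat) (t : R) : C := Cpower (t + a) (- (s + INR k)).

Lemma Rder_pw s k t : (0 <= t)%R -> Rder (pw s k) t (- (s + INR k) * pw s (S k) t).
Proof.
intros Ht. unfold pw. rewrite S_INR, RtoC_plus.
replace (- (s + (INR k + 1))) with (- (s + INR k) - 1) by ring.
apply Rder_Cpower_shift. now apply slit_shift.
Qed.

Lemma Ccont_pw s k t : (0 <= t)%R -> Ccont (pw s k) t.
Proof. intros Ht. exact (Rder_Ccont _ _ _ (Rder_pw s k t Ht)). Qed.

Lemma pw_le s k : (0 <= Re s + INR k)%R ->
  exists B : R, (0 < B)%R /\ forall t : R, (0 <= t)%R -> (Cmod (pw s k t) <= B * Rpower (1 + t) (- (Re s + INR k)))%R.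
Proof.
intros H. destruct (Cpower_shift_le a (s + INR k) Ha) as [B [HB HB2]].
- destruct s. simpl in *. lra.
- exists B. split; [exact HB|]. intros t Ht. unfold pw.
  replace (Re s + INR k)%R with (Re (s + INR k)) by (destruct s; reflexivity). now apply HB2.
Qed.

Lemma pw_lim s k : (0 < Re s + INR k)%R -> Clim eventually (fun n => pw s k (INR n)) 0.
Proof.
intros H. apply (Clim_comp eventually (Rbar_locally p_infty) INR (pw s k)); [apply INR_lim_infty|].
apply Cpower_shift_lim; [exact Ha|]. destruct s. simpl in *. lra.
Qed.

Lemma bernoulli_gap_cont N t : (1 <= N)%nat -> Ccont (fun x => RtoC (bernoulli_gap N x)) t.
Proof.
intros HN. intros e He.
destruct (ex_series_freq N HN) as [A HA].
set (K := fourier_const N). set (u := fun k => (/ freq k ^ (2 * N))%R) in *.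
assert (Htl := Rsum_tail u A HA).
assert (HK := Rabs_pos K).
assert (He1 : (0 < e / 8 / (Rabs K + 1))%R) by (repeat apply Rdiv_lt_0_compat; lra).
destruct (proj1 (filterlim_locally _ _) Htl (mkposreal _ He1)) as [n Hn]. specialize (Hn n ltac:(lia)).
change (Rabs (A - Rsum u n - 0) < e / 8 / (Rabs K + 1))%R in Hn. rewrite Rminus_0_r in Hn. apply Rabs_def2 in Hn.
set (S := fun x => (K * Rsum (fun k => cos_gap N k x) n)%R).
assert (HS : forall x, (Rabs (bernoulli_gap N x - S x) <= e / 4)%R).
{ intros x. assert (Hs := Series_correct _ (ex_series_cos_gap N x HN)).
  assert (h := cos_gap_tail N x _ n A HA Hs).
  rewrite <- (is_series_unique _ _ (bernoulli_gap_series N x HN)), Series_scal_l. unfold S.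
  fold K. rewrite <- Rmult_minus_distr_l, Rabs_mult. fold u in h.
  apply Rle_trans with (Rabs K * (2 * (A - Rsum u n)))%R; [apply Rmult_le_compat_l; assumption|].
  apply Rle_trans with (Rabs K * (2 * (e / 8 / (Rabs K + 1))))%R; [apply Rmult_le_compat_l; lra|].
  apply Rle_trans with ((Rabs K + 1) * (2 * (e / 8 / (Rabs K + 1))))%R; [apply Rmult_le_compat_r; lra|].
  right. field. lra. }
assert (HSc : Ccont (fun x => RtoC (S x)) t).
{ apply Ccont_RtoC. apply (ex_derive_continuous (K := R_AbsRing) (V := R_NormedModule)).
  eexists. unfold S. apply (is_derive_scal (fun x => Rsum (fun k => cos_gap N k x) n)).
  apply (is_derive_Rsum (fun k x => cos_gap N k x) (fun k => (sin (freq k * t) * freq k / freq k ^ (2 * N))%R)).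
  intros k. unfold cos_gap. assert (H := freq_pos k).
  assert (Hp : (0 < freq k ^ (2 * N))%R) by (now apply pow_lt).
  revert Hp. generalize (freq k ^ (2 * N))%R. intros q Hq. auto_derive; [auto|]. field. lra. }
generalize (HSc (e / 4)%R ltac:(lra)). apply filter_imp. intros x Hx.
rewrite <- RtoC_minus, Cmod_R in *.
replace (bernoulli_gap N x - bernoulli_gap N t)%R with
  ((bernoulli_gap N x - S x) + ((S x - S t) + - (bernoulli_gap N t - S t)))%R by ring.
eapply Rle_lt_trans; [apply Rabs_triang|].
assert (h := Rabs_triang (S x - S t) (- (bernoulli_gap N t - S t))). rewrite Rabs_Ropp in h.
assert (h1 := HS x). assert (h2 := HS t). lra.
Qed.

Lemma bernoulli_gap_bound N : (1 <= N)%nat -> exists B : R, (0 < B)%R /\ forall t, (Rabs (bernoulli_gap N t) <= B)%R.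
Proof.
intros HN. destruct (ex_series_freq N HN) as [A HA].
assert (HA0 : (0 <= A)%R).
{ apply (Rsum_le_series (fun k => (/ freq k ^ (2 * N))%R) A 0); [|exact HA]. intros k. left. apply Rinv_0_lt_compat, pow_lt, freq_pos. }
assert (HK := Rabs_pos (fourier_const N)).
exists (Rabs (fourier_const N) * (2 * A) + 1)%R. split; [nra|]. intros t.
assert (Hs := Series_correct _ (ex_series_cos_gap N t HN)).
assert (h := cos_gap_tail N t _ 0 A HA Hs). simpl in h. rewrite !Rminus_0_r in h.
rewrite <- (is_series_unique _ _ (bernoulli_gap_series N t HN)), Series_scal_l, Rabs_mult. nra.
Qed.

Lemma bernoulli_gap_on N (n : nat) t : (1 <= N)%nat ->
  (INR n <= t <= INR n + 1)%R -> bernoulli_gap N t = (bernoulli (2 * N) - bernoulli_poly (2 * N) (t - INR n))%R.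
Proof.
intros HN Ht. unfold bernoulli_gap. rewrite INR_IZR_INZ in *.
destruct (proj2 Ht) as [h|h].
- rewrite (Zfloor_eq (Z.of_nat n) t) by lra. reflexivity.
(* At the right end the floor jumps, but the polynomial takes equal values at [0] and [1]. *)
- rewrite h. replace (IZR (Z.of_nat n) + 1)%R with (IZR (Z.of_nat n + 1)) by (rewrite plus_IZR; ring).
  rewrite ZfloorZ, Rminus_diag, plus_IZR.
  replace (IZR (Z.of_nat n) + 1 - IZR (Z.of_nat n))%R with 1%R by ring.
  rewrite bernoulli_poly_0, bernoulli_poly_1 by lia. reflexivity.
Qed.

Definition em_coef (s : C) (N : nat) : C := pochhammer s (2 * N) / INR (fact (2 * N)).

Definition em_integrand (s : C) (N : nat) (t : R) : C := bernoulli_gap N t * pw s (2 * N) t.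

(** The boundary terms of the formula.  At [z = a] they form the truncated
    asymptotic expansion, at [z = n + a] the correction to the [n]-th partial sum. *)
Definition em_main (s : C) (N : nat) (z : C) : C :=
  / 2 * Cpower z (- s) + Cpower z (1 - s) / (s - 1) + Cpower z (1 - s) * hurwitz_sum N s z.

Lemma em_main_S s N t : (1 <= N)%nat -> (0 <= t)%R ->
  em_main s (S N) (t + a) = em_main s N (t + a)
    + RtoC (bernoulli (2 * N) / INR (fact (2 * N))) * pochhammer s (2 * N - 1) * pw s (2 * N - 1) t.
Proof.
intros HN Ht. assert (Hz := slit_neq_0 _ (slit_shift a t Ha Ht)).
unfold em_main, hurwitz_sum. destruct N as [|N]; [lia|].
replace (S (S N) - 1)%nat with (S N) by lia. replace (S N - 1)%nat with N by lia.
rewrite (sum_n_Sm (G := C_AbelianMonoid)) by lia.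
set (q := sum_n_m _ _ _). unfold pw.
set (x := RtoC (bernoulli (2 * S N) / INR (fact (2 * S N)))).
replace (- (s + INR (2 * S N - 1))) with ((1 - s) - INR (2 * S N)).
- rewrite (Cpower_minus _ (1 - s)), Cpower_INR by exact Hz.
  change (plus q (x * (pochhammer s (2 * S N - 1) / (t + a) ^ (2 * S N)))) with
    (q + x * (pochhammer s (2 * S N - 1) / (t + a) ^ (2 * S N))).
  unfold Cdiv. ring.
- replace (INR (2 * S N)) with (INR (2 * S N - 1) + 1)%R; [rewrite RtoC_plus; ring|].
  rewrite <- S_INR. f_equal. lia.
Qed.

Lemma C2_neq_0 : RtoC 2 <> 0.
Proof. apply RtoC_neq_0. lra. Qed.

(** For [N = 1] the numerator is [u - u^2] with [u = t - n]; the primitive [A] is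
    the result of integrating by parts twice. *)
Lemma em_interval_1 (s : C) (n : nat) : s <> 1 ->
  is_CInt (fun t => em_coef s 1 * em_integrand s 1 t) (INR n) (INR n + 1)
    (Cpower (INR n + a) (- s) - em_main s 1 (INR n + a) + em_main s 1 (RtoC (INR n + 1) + a)).
Proof.
intros Hs. assert (Hs1 : s - 1 <> 0).
{ intros E. apply Hs. replace s with (s - 1 + 1) by ring. rewrite E. ring. }
assert (Hn := pos_INR n).
set (A := fun t : R => / 2 * (RtoC ((t - INR n) - (t - INR n) ^ 2) * (- s * pw s 1 t) - RtoC (1 - 2 * (t - INR n)) * pw s 0 t)
   + / (s - 1) * Cpower (t + a) (1 - s)).
assert (EA : A (INR n + 1)%R - A (INR n) =
  Cpower (INR n + a) (- s) - em_main s 1 (INR n + a) + em_main s 1 (RtoC (INR n + 1) + a)).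
{ unfold A, em_main, hurwitz_sum.
  rewrite !(sum_n_m_zero (G := C_AbelianMonoid)) by lia.
  replace (INR n + 1 - INR n)%R with 1%R by ring. rewrite Rminus_diag.
  replace (1 - 1 ^ 2)%R with 0%R by ring. replace (0 - 0 ^ 2)%R with 0%R by ring.
  replace (1 - 2 * 1)%R with (-1)%R by ring. replace (1 - 2 * 0)%R with 1%R by ring.
  unfold pw. simpl INR. replace (- (s + 0)) with (- s) by ring.
  change (@zero C_AbelianMonoid) with (RtoC 0). field. exact Hs1. }
rewrite <- EA.
apply (is_RInt_ext (V := C_R_NormedModule) (fun t => em_coef s 1 * (RtoC ((t - INR n) - (t - INR n) ^ 2) * pw s 2 t))).
{ intros t Ht. rewrite Rmin_left, Rmax_right in Ht by lra. unfold em_integrand.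
  rewrite (bernoulli_gap_on 1 n t) by (lia || lra). change (2 * 1)%nat with 2%nat. now rewrite bernoulli_poly_2. }
apply is_CInt_derive; [lra | |].
- intros t Ht. unfold A.
  assert (D1 : Rder (fun t => RtoC ((t - INR n) - (t - INR n) ^ 2)) t (RtoC (1 - 2 * (t - INR n)))).
  { apply Rder_RtoC. auto_derive; [auto|]. ring. }
  assert (D2 : Rder (fun t => RtoC (1 - 2 * (t - INR n))) t (RtoC (-2))).
  { apply Rder_RtoC. auto_derive; [auto|]. ring. }
  assert (D3 := Rder_mult _ _ _ _ _ D1 (Rder_scal (- s) _ _ _ (Rder_pw s 1 t ltac:(lra)))).
  assert (D4 := Rder_mult _ _ _ _ _ D2 (Rder_pw s 0 t ltac:(lra))).
  assert (D5 := Rder_Cpower_shift a (1 - s) t (slit_shift a t Ha ltac:(lra))).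
  assert (D := Rder_plus _ _ _ _ _ (Rder_scal (/ 2) _ _ _ (Rder_minus _ _ _ _ _ D3 D4)) (Rder_scal (/ (s - 1)) _ _ _ D5)).
  cbv beta in D.
  match type of D with Rder _ _ ?l => replace (em_coef s 1 * (RtoC ((t - INR n) - (t - INR n) ^ 2) * pw s 2 t)) with l; [exact D|] end.
  unfold em_coef. simpl pochhammer. simpl INR. change (fact (2 * 1)) with 2%nat.
  replace (Cpower (t + a) (1 - s - 1)) with (pw s 0 t) by (unfold pw; f_equal; simpl; ring).
  simpl INR. rewrite ?RtoC_minus, ?RtoC_mult, ?RtoC_minus, ?RtoC_opp, ?RtoC_plus.
  field. exact Hs1.
- intros t Ht. apply Ccont_scal. apply Ccont_mult; [|apply Ccont_pw; lra].
  apply (Rder_Ccont _ _ (RtoC (1 - 2 * (t - INR n)))). apply Rder_RtoC. auto_derive; [auto|]. ring.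
Qed.

(** Two integrations by parts raise [N] by one.  The vanishing of the odd Bernoulli
    numbers makes the first-order boundary terms disappear. *)
Lemma em_interval_step (s : C) (N n : nat) : (1 <= N)%nat ->
  is_CInt (fun t => em_coef s (S N) * em_integrand s (S N) t - em_coef s N * em_integrand s N t) (INR n) (INR n + 1)
    ((em_main s (S N) (RtoC (INR n + 1) + a) - em_main s N (RtoC (INR n + 1) + a))
      - (em_main s (S N) (INR n + a) - em_main s N (INR n + a))).
Proof.
intros HN. assert (Hn := pos_INR n).
set (psi := fun t => (bernoulli (2 * S N) - bernoulli_poly (2 * S N) (t - INR n))%R).
set (psi1 := fun t => (- (INR (2 * N + 2) * bernoulli_poly (2 * N + 1) (t - INR n)))%R).
set (b := bernoulli (2 * N)).
set (psiN := fun t => (b - bernoulli_poly (2 * N) (t - INR n))%R).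
assert (D1 : forall t, Rder (fun t => RtoC (psi t)) t (RtoC (psi1 t))).
{ intros t. apply Rder_RtoC. unfold psi, psi1. replace (2 * S N)%nat with (S (2 * N + 1)) by lia.
  replace (2 * N + 2)%nat with (S (2 * N + 1)) by lia.
  replace (- (INR (S (2 * N + 1)) * bernoulli_poly (2 * N + 1) (t - INR n)))%R with
    (minus 0 (scal (V := R_NormedModule) 1 (INR (S (2 * N + 1)) * bernoulli_poly (2 * N + 1) (t - INR n))))%R
    by (unfold minus, plus, opp, scal; simpl; unfold mult; simpl; ring).
  apply (is_derive_minus (K := R_AbsRing) (V := R_NormedModule)); [apply (is_derive_const (K := R_AbsRing) (V := R_NormedModule))|].
  apply (is_derive_comp (bernoulli_poly (S (2 * N + 1))) (fun t => (t - INR n)%R)); [apply is_derive_bernoulli_poly|].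
  auto_derive; [auto|ring]. }
set (M := (INR (2 * N + 2) * INR (2 * N + 1))%R).
assert (D2 : forall t, Rder (fun t => RtoC (psi1 t)) t (RtoC (M * (psiN t - b)))).
{ intros t. apply Rder_RtoC. unfold psiN, psi1, M. replace (2 * N + 1)%nat with (S (2 * N)) by lia.
  replace (INR (2 * N + 2) * INR (S (2 * N)) * (b - bernoulli_poly (2 * N) (t - INR n) - b))%R with
    (opp (INR (2 * N + 2) * scal (V := R_NormedModule) 1 (INR (S (2 * N)) * bernoulli_poly (2 * N) (t - INR n))))%R
    by (unfold opp, scal; simpl; unfold mult; simpl; ring).
  apply (is_derive_opp (K := R_AbsRing) (V := R_NormedModule)). apply is_derive_scal.
  apply (is_derive_comp (bernoulli_poly (S (2 * N))) (fun t => (t - INR n)%R)); [apply is_derive_bernoulli_poly|].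
  auto_derive; [auto|ring]. }
set (k0 := pochhammer s (2 * N)).
set (cf := k0 / INR (fact (2 * S N))).
set (h := fun t => RtoC (b / INR (fact (2 * N))) * pochhammer s (2 * N - 1) * pw s (2 * N - 1) t).
set (A := fun t : R => cf * (RtoC (psi t) * (- (s + INR (2 * N)) * pw s (S (2 * N)) t) - RtoC (psi1 t) * pw s (2 * N) t) + h t).
(* The numerator and its derivative vanish at both ends; only [h] contributes. *)
assert (Hends : psi (INR n) = 0%R /\ psi (INR n + 1)%R = 0%R /\ psi1 (INR n) = 0%R /\ psi1 (INR n + 1)%R = 0%R).
{ unfold psi, psi1. replace (INR n + 1 - INR n)%R with 1%R by ring. rewrite Rminus_diag.
  rewrite !bernoulli_poly_0, !bernoulli_poly_1, bernoulli_odd by lia. repeat split; ring. }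
destruct Hends as [e1 [e2 [e3 e4]]].
replace (em_main s (S N) (RtoC (INR n + 1) + a) - em_main s N (RtoC (INR n + 1) + a)
      - (em_main s (S N) (INR n + a) - em_main s N (INR n + a))) with (A (INR n + 1)%R - A (INR n)).
2:{ rewrite !em_main_S by (lia || lra). unfold A, h. rewrite e1, e2, e3, e4. fold b. ring. }
apply (is_RInt_ext (V := C_R_NormedModule) (fun t => em_coef s (S N) * (RtoC (psi t) * pw s (2 * S N) t) - em_coef s N * (RtoC (psiN t) * pw s (2 * N) t))).
{ intros t Ht. rewrite Rmin_left, Rmax_right in Ht by lra. unfold em_integrand.
  rewrite !(bernoulli_gap_on _ n t) by (lia || lra). reflexivity. }
apply is_CInt_derive; [lra | |].
- intros t Ht. unfold A.
  assert (D3 := Rder_mult _ _ _ _ _ (D1 t) (Rder_scal (- (s + INR (2 * N))) _ _ _ (Rder_pw s (S (2 * N)) t ltac:(lra)))).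
  assert (D4 := Rder_mult _ _ _ _ _ (D2 t) (Rder_pw s (2 * N) t ltac:(lra))).
  assert (D5 := Rder_scal (RtoC (b / INR (fact (2 * N))) * pochhammer s (2 * N - 1)) _ _ _ (Rder_pw s (2 * N - 1) t ltac:(lra))).
  assert (D := Rder_plus _ _ _ _ _ (Rder_scal cf _ _ _ (Rder_minus _ _ _ _ _ D3 D4)) D5).
  cbv beta in D.
  match type of D with Rder _ _ ?l => 
    replace (em_coef s (S N) * (RtoC (psi t) * pw s (2 * S N) t) - em_coef s N * (RtoC (psiN t) * pw s (2 * N) t)) with l; [exact D|] end.
  replace (S (2 * N - 1)) with (2 * N)%nat by lia.
  replace (2 * S N)%nat with (S (S (2 * N))) by lia.
  assert (Ek : k0 = pochhammer s (2 * N - 1) * (s + INR (2 * N - 1))).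
  { unfold k0. replace (2 * N)%nat with (S (2 * N - 1)) at 1 by lia. reflexivity. }
  assert (Ec : em_coef s (S N) = cf * ((s + INR (2 * N)) * (s + INR (S (2 * N))))).
  { unfold em_coef, cf. replace (2 * S N)%nat with (S (S (2 * N))) by lia.
    change (pochhammer s (S (S (2 * N)))) with (k0 * (s + INR (2 * N)) * (s + INR (S (2 * N)))). unfold Cdiv. ring. }
  assert (EM : cf * RtoC M = k0 / INR (fact (2 * N))).
  { unfold cf, M. replace (2 * S N)%nat with (S (S (2 * N))) by lia.
    change (fact (S (S (2 * N)))) with (S (S (2 * N)) * (S (2 * N) * fact (2 * N)))%nat.
    replace (2 * N + 2)%nat with (S (S (2 * N))) by lia. replace (2 * N + 1)%nat with (S (2 * N)) by lia.
    rewrite !(mult_INR (S _)), !RtoC_mult. field.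
    split; [apply INR_fact_C|]. split; apply RtoC_neq_0, not_0_INR; lia. }
  rewrite Ec. unfold em_coef at 1. fold k0. rewrite <- EM, RtoC_mult, RtoC_minus.
  replace (RtoC (b / INR (fact (2 * N))) * pochhammer s (2 * N - 1) * (- (s + INR (2 * N - 1)) * pw s (2 * N) t))
    with (- (RtoC b * (k0 / INR (fact (2 * N))) * pw s (2 * N) t)).
  + rewrite <- EM. ring.
  + rewrite Ek, RtoC_div by apply INR_fact_neq_0. unfold Cdiv. ring.
- intros t Ht. apply Ccont_minus; apply Ccont_scal; apply Ccont_mult; try (apply Ccont_pw; lra).
  + apply (Rder_Ccont _ _ _ (D1 t)).
  + apply Ccont_RtoC. apply (ex_derive_continuous (K := R_AbsRing) (V := R_NormedModule)). eexists.
    unfold psiN. replace (2 * N)%nat with (S (2 * N - 1)) by lia.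
    apply (is_derive_minus (K := R_AbsRing) (V := R_NormedModule)); [apply (is_derive_const (K := R_AbsRing) (V := R_NormedModule))|].
    apply (is_derive_comp (bernoulli_poly (S (2 * N - 1))) (fun t => (t - INR n)%R) t (INR (S (2 * N - 1)) * bernoulli_poly (2 * N - 1) (t - INR n))%R 1%R); [apply is_derive_bernoulli_poly|].
    auto_derive; [auto|ring].
Qed.

Lemma em_interval (s : C) (N n : nat) : (1 <= N)%nat -> s <> 1 ->
  is_CInt (fun t => em_coef s N * em_integrand s N t) (INR n) (INR n + 1)
    (Cpower (INR n + a) (- s) - em_main s N (INR n + a) + em_main s N (RtoC (INR n + 1) + a)).
Proof.
intros HN Hs. induction HN as [|N HN IH]; [now apply em_interval_1|].
assert (H := is_RInt_plus (V := C_R_NormedModule) _ _ _ _ _ _ IH (em_interval_step s N n HN)).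
match type of H with is_RInt _ _ _ ?l => replace l with
  (Cpower (INR n + a) (- s) - em_main s (S N) (INR n + a) + em_main s (S N) (RtoC (INR n + 1) + a)) in H end.
- revert H. apply (is_RInt_ext (V := C_R_NormedModule)). intros t _.
  match goal with |- plus ?x (?y - ?x') = _ => change (x + (y - x) = y) end. ring.
- match goal with |- _ = plus ?x ?y => change (plus x y) with (x + y) end. ring.
Qed.

Lemma Ccont_em_integrand s N t : (1 <= N)%nat -> (0 <= t)%R -> Ccont (em_integrand s N) t.
Proof. intros HN Ht. apply Ccont_mult; [now apply bernoulli_gap_cont | now apply Ccont_pw]. Qed.

Lemma em_segment (s : C) (N n : nat) : (1 <= N)%nat -> s <> 1 ->
  em_coef s N * CInt (em_integrand s N) 0 (INR n) =
    Csum (fun j => Cpower (INR j + a) (- s)) n - em_main s N a + em_main s N (INR n + a).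
Proof.
intros HN Hs. induction n as [|n IH].
- simpl. replace (0 + a) with a by ring.
  unfold CInt. rewrite (RInt_point (V := C_R_CompleteNormedModule)).
  change (@zero C_R_CompleteNormedModule) with (RtoC 0). ring.
- assert (Hn := pos_INR n). rewrite S_INR. simpl Csum.
  assert (Hc : forall t, (0 <= t <= INR n + 1)%R -> Ccont (em_integrand s N) t)
    by (intros t Ht; apply Ccont_em_integrand; [exact HN | apply Ht]).
  rewrite <- (CInt_Chasles (em_integrand s N) 0 (INR n) (INR n + 1) Hn ltac:(lra) Hc).
  replace (em_coef s N * (CInt (em_integrand s N) 0 (INR n) + CInt (em_integrand s N) (INR n) (INR n + 1)))
    with (em_coef s N * CInt (em_integrand s N) 0 (INR n) + em_coef s N * CInt (em_integrand s N) (INR n) (INR n + 1)) by ring.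
  rewrite IH.
  assert (H1 := em_interval s N n HN Hs).
  assert (H2 : is_CInt (em_integrand s N) (INR n) (INR n + 1) (CInt (em_integrand s N) (INR n) (INR n + 1))).
  { apply CInt_correct; [lra|]. intros t Ht. apply Ccont_em_integrand; [exact HN | lra]. }
  apply is_CInt_scal with (c := em_coef s N) in H2.
  assert (E := is_CInt_unique _ _ _ _ H2). rewrite (is_CInt_unique _ _ _ _ H1) in E.
  rewrite <- E. ring.
Qed.

Lemma em_integral (s : C) (N : nat) : (1 <= N)%nat -> (1 - 2 * INR N < Re s)%R ->
  exists I, is_CRInt_gen (em_integrand s N) (at_point 0%R) (Rbar_locally p_infty) I.
Proof.
intros HN Hs.
assert (E2N : INR (2 * N) = (2 * INR N)%R) by (rewrite mult_INR; reflexivity).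
destruct (pw_le s (2 * N)) as [B [HB HB2]]; [lra|].
destruct (bernoulli_gap_bound N HN) as [K [HK HK2]].
set (q := (Re s + INR (2 * N))%R) in *. assert (Hq : (1 < q)%R) by (unfold q; lra).
destruct (Cint_dominated _ _ _ int_range_0_infty (em_integrand s N) (fun t => (K * B * Rpower (1 + t) (- q))%R) (K * B * / (q - 1))%R)
  as [I [HI _]].
- intros t Ht. now apply Ccont_em_integrand.
- intros t Ht. apply Ccont_ext with (fun x => RtoC (K * B) * RtoC (Rpower (1 + x) (- q))); [intros; now rewrite <- RtoC_mult|].
  apply Ccont_scal. now apply Ccont_Rpower_shift.
- intros t Ht. unfold em_integrand. rewrite Cmod_mult, Cmod_R, Rmult_assoc.
  apply Rmult_le_compat; [apply Rabs_pos | apply Cmod_ge_0 | apply HK2 | now apply HB2].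
- apply (Cint_ext _ _ _ int_range_0_infty (fun t => RtoC (K * B) * RtoC (Rpower (1 + t) (- q)))); [intros; now rewrite <- RtoC_mult|].
  rewrite (RtoC_mult (K * B)). apply Cint_scal; try typeclasses eauto. now apply Cint_Rpower_shift.
- now exists I.
Qed.

Definition em_I (s : C) (N : nat) : C := CRInt_gen (em_integrand s N) (at_point 0%R) (Rbar_locally p_infty).

Lemma em_I_correct (s : C) (N : nat) : (1 <= N)%nat -> (1 - 2 * INR N < Re s)%R ->
  is_CRInt_gen (em_integrand s N) (at_point 0%R) (Rbar_locally p_infty) (em_I s N).
Proof.
intros HN Hs. apply (RInt_gen_correct (V := C_R_CompleteNormedModule)). now apply em_integral.
Qed.

(** The candidate for the value of zeta at [s] furnished by the formula of order
    [N]. *)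
Definition em_value (s : C) (N : nat) : C := em_main s N a + em_coef s N * em_I s N.

(** The partial sums themselves diverge for [Re s <= 1]; corrected by the boundary
    terms they converge. *)
Lemma em_limit (s : C) (N : nat) : (1 <= N)%nat -> s <> 1 -> (1 - 2 * INR N < Re s)%R ->
  Clim eventually (fun n => Csum (fun j => Cpower (INR j + a) (- s)) n + em_main s N (INR n + a)) (em_value s N).
Proof.
intros HN Hs1 Hs.
assert (H := proj1 (is_CRInt_gen_Clim _ _ _ int_range_0_infty _ _ (fun t Ht => Ccont_em_integrand s N t HN Ht)) (em_I_correct s N HN Hs)).
assert (H1 : Clim eventually (fun n => CInt (em_integrand s N) 0 (INR n)) (em_I s N)).
{ apply (Clim_comp eventually (filter_prod (at_point 0%R) (Rbar_locally p_infty)) (fun n => (0%R, INR n))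
    (fun ab => CInt (em_integrand s N) (fst ab) (snd ab))); [|exact H].
  apply filterlim_pair; [|apply INR_lim_infty]. intros P HP. exists 0%nat. intros n _. exact HP. }
apply Clim_ext with (fun n => em_main s N a + em_coef s N * CInt (em_integrand s N) 0 (INR n)); [typeclasses eauto | |].
- intros n. rewrite em_segment by assumption. ring.
- apply Clim_plus; [typeclasses eauto | apply Clim_const; typeclasses eauto | apply Clim_scal; [typeclasses eauto | exact H1]].
Qed.

(** The limits for [N] and [N + 1] differ by a multiple of
    [(n + a)^(-(s + 2 N - 1))], which tends to zero. *)
Lemma em_value_S (s : C) (N : nat) : (1 <= N)%nat -> s <> 1 -> (1 - 2 * INR N < Re s)%R ->
  em_value s (S N) = em_value s N.
Proof.
intros HN Hs1 Hs.
assert (H1 := em_limit s N HN Hs1 Hs).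
assert (H2 := em_limit s (S N) ltac:(lia) Hs1 ltac:(rewrite S_INR; lra)).
apply (Clim_unique eventually _ _ _ H2).
set (c := RtoC (bernoulli (2 * N) / INR (fact (2 * N))) * pochhammer s (2 * N - 1)).
replace (em_value s N) with (em_value s N + c * 0) by ring.
apply Clim_ext with (fun n => Csum (fun j => Cpower (INR j + a) (- s)) n + em_main s N (INR n + a) + c * pw s (2 * N - 1) (INR n)); [typeclasses eauto | |].
- intros n. rewrite em_main_S by (exact HN || apply pos_INR). fold c. ring.
- apply Clim_plus; [typeclasses eauto | exact H1 | apply Clim_scal; [typeclasses eauto|]].
  apply pw_lim. assert (E : INR (2 * N) = (INR (2 * N - 1) + 1)%R) by (rewrite <- S_INR; f_equal; lia).
  rewrite mult_INR in E. simpl (INR 2) in E. lra.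
Qed.

Lemma em_value_indep (s : C) (N N' : nat) : (1 <= N)%nat -> (N <= N')%nat -> s <> 1 -> (1 - 2 * INR N < Re s)%R ->
  em_value s N' = em_value s N.
Proof.
intros HN H Hs1 Hs. induction H as [|N' H IH]; [reflexivity|].
rewrite em_value_S, IH; auto; [lia|]. apply le_INR in H. lra.
Qed.

Lemma em_main_lim (s : C) : (1 < Re s)%R -> Clim eventually (fun n => em_main s 1 (INR n + a)) 0.
Proof.
intros Hs.
assert (H1 : Clim eventually (fun n => pw s 0 (INR n)) 0) by (apply pw_lim; simpl; lra).
assert (H2 : Clim eventually (fun n => pw (s - 1) 0 (INR n)) 0) by (apply pw_lim; destruct s; simpl in *; lra).
replace (RtoC 0) with (/ 2 * 0 + / (s - 1) * 0) by ring.
apply Clim_ext with (fun n => / 2 * pw s 0 (INR n) + / (s - 1) * pw (s - 1) 0 (INR n)); [typeclasses eauto | |].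
- intros n. unfold em_main, hurwitz_sum, pw.
  rewrite (sum_n_m_zero (G := C_AbelianMonoid)) by lia. change (@zero C_AbelianMonoid) with (RtoC 0).
  simpl INR. replace (- (s + 0)) with (- s) by ring. replace (- (s - 1 + 0)) with (1 - s) by ring. unfold Cdiv. ring.
- apply Clim_plus; [typeclasses eauto | |]; (apply Clim_scal; [typeclasses eauto | assumption]).
Qed.

Lemma hurwitz_series_em (s : C) : (1 < Re s)%R -> hurwitz_series a s = em_value s 1.
Proof.
intros Hs. apply Cseries_correct. apply is_Cseries_Clim.
assert (Hs1 : s <> 1) by (intros E; rewrite E in Hs; simpl in Hs; lra).
assert (H := em_limit s 1 ltac:(lia) Hs1 ltac:(simpl; lra)).
assert (H' := Clim_minus eventually _ _ _ _ H (em_main_lim s Hs)).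
replace (em_value s 1 - 0) with (em_value s 1) in H' by ring.
revert H'. apply Clim_ext; [typeclasses eauto|]. intros n. ring.
Qed.

End EulerMaclaurin.

(** * Analytic continuation of the Hurwitz zeta function *)

Lemma analytic_Cexp_linear (b z0 : C) : analytic_at (fun z => Cexp (z * b)) z0.
Proof.
apply (analytic_of_bound _ z0 (fun m => Cexp (z0 * b) * exp_term b m) 1 (Cmod (Cexp (z0 * b)) * exp (Cmod b * 1))); [lra|].
intros h k M Hk Hh.
replace (Cexp ((z0 + h) * b) - Csum (fun m => (Cexp (z0 * b) * exp_term b m * h ^ m)%C) M) with
  (Cexp (z0 * b) * (Cexp (h * b) - Csum (fun m => (exp_term b m * h ^ m)%C) M)).
- rewrite Cmod_mult, Rmult_assoc. apply Rmult_le_compat_l; [apply Cmod_ge_0|].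
  now apply Cexp_taylor_scaled.
- replace ((z0 + h) * b) with (z0 * b + h * b) by ring. rewrite Cexp_plus.
  rewrite (Csum_ext (fun m => (Cexp (z0 * b) * exp_term b m * h ^ m)%C) (fun m => (Cexp (z0 * b) * (exp_term b m * h ^ m))%C)) by (intros; ring).
  rewrite Csum_scal. ring.
Qed.

Lemma analytic_Cpower_affine (a c s0 : C) : analytic_at (fun s => Cpower a (c - s)) s0.
Proof.
apply analytic_ext with (fun s => Cpower a c * Cexp (s * (- Clog a))).
- intros s. rewrite Cpower_minus. unfold Cdiv. f_equal. unfold Cpower. rewrite <- Cexp_opp. f_equal. ring.
- apply analytic_scal. apply analytic_Cexp_linear.
Qed.

(** The pole is split off: the quotient [(a^(1-s) - 1) / (1 - s)] is an integral of
    exponentials over [0, 1], hence analytic even at [1]. *)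
Lemma analytic_power_pole (a s0 : C) : s0 <> 1 -> analytic_at (fun s => Cpower a (1 - s) / (s - 1)) s0.
Proof.
intros Hs0. set (lam := Clog a).
assert (Hne : s0 - 1 <> 0) by (intros E; apply Hs0; replace s0 with (s0 - 1 + 1) by ring; rewrite E; ring).
set (r := (Cmod (s0 - 1) / 2)%R).
assert (Hr0 : (0 < Cmod (s0 - 1))%R) by (apply (proj1 (Cmod_gt_0 (s0 - 1))); exact Hne).
assert (Hr : (0 < r)%R) by (unfold r; lra).
assert (Hnear : forall s, (Cmod (s - s0) <= r)%R -> s - 1 <> 0).
{ intros s Hs E. assert (h := Cmod_triangle_rev (s0 - 1) (s - s0)).
  replace (s0 - 1 + (s - s0)) with (s - 1) in h by ring. rewrite E, Cmod_0 in h. unfold r in *. lra. }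
set (f := fun s => (Cexp ((1 - s) * lam) - 1) / (1 - s)).
assert (Hf : analytic_at f s0).
{ set (B := (Cmod lam * exp (Cmod lam) * exp (Cmod s0 * Cmod lam) * exp (Cmod lam * r))%R).
  assert (Hlin : forall b t, Ccont (fun x : R => x * b) t).
  { intros b t. apply Ccont_mult; [apply (Rder_Ccont _ _ 1), Rder_id | apply Ccont_const]. }
  apply (analytic_exp_integral (at_point 0%R) (at_point 1%R) (fun t => (0 <= t <= 1)%R)
    (fun t : R => lam * Cexp (t * lam)) (fun t : R => t * (- lam)) (fun _ => B) f s0 r B int_range_0_1 Hr).
  - intros t _. apply Ccont_scal. apply (Rder_Ccont _ _ (lam * Cexp (t * lam))). apply Rder_Cexp_line.
  - intros t _. apply Hlin.
  - intros t _. apply Ccont_const.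
  - intros t Ht. rewrite !Cmod_mult, !Cmod_Cexp, Cmod_opp, Cmod_R, Rabs_pos_eq by lra.
    assert (Hl := Cmod_ge_0 lam).
    assert (mono : forall x y, (x <= y)%R -> (exp x <= exp y)%R).
    { intros x y [h|h]; [left; now apply exp_increasing | rewrite h; lra]. }
    assert (A1 : (exp (Re (t * lam)) <= exp (Cmod lam))%R).
    { apply mono. eapply Rle_trans; [apply Rle_abs|]. eapply Rle_trans; [apply re_le_Cmod|].
      rewrite Cmod_mult, Cmod_R, Rabs_pos_eq by lra. nra. }
    assert (A2 : (exp (Re (s0 * (t * - lam))) <= exp (Cmod s0 * Cmod lam))%R).
    { apply mono. eapply Rle_trans; [apply Rle_abs|]. eapply Rle_trans; [apply re_le_Cmod|].
      rewrite !Cmod_mult, Cmod_R, Cmod_opp, Rabs_pos_eq by lra. apply Rmult_le_compat_l; [apply Cmod_ge_0 | nra]. }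
    assert (A3 : (exp (t * Cmod lam * r) <= exp (Cmod lam * r))%R).
    { apply mono. apply Rmult_le_compat_r; [lra | nra]. }
    assert (P1 := exp_pos (Re (t * lam))). assert (P2 := exp_pos (Re (s0 * (t * - lam)))). assert (P3 := exp_pos (t * Cmod lam * r)).
    unfold B. apply Rmult_le_compat; [|lra| |exact A3].
    + apply Rmult_le_pos; [apply Rmult_le_pos|]; lra.
    + apply Rmult_le_compat; [|lra| |exact A2]; [apply Rmult_le_pos; lra|]. apply Rmult_le_compat_l; assumption.
  - apply (is_RInt_gen_at_point (V := C_R_NormedModule)).
    assert (E := is_RInt_const (V := C_R_NormedModule) 0 1 (RtoC B)).
    rewrite scal_C_R in E.
    assert (E1 : RtoC (1 - 0) * RtoC B = RtoC B) by (rewrite Rminus_0_r; ring).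
    rewrite E1 in E. exact E.
  - intros s Hs. assert (Hs1 := Hnear s Hs).
    assert (Hs2 : 1 - s <> 0) by (intros E; apply Hs1; replace (s - 1) with (- (1 - s)) by ring; rewrite E; ring).
    apply (is_RInt_gen_at_point (V := C_R_NormedModule)).
    apply (is_RInt_ext (V := C_R_NormedModule) (fun t : R => / (1 - s) * ((1 - s) * lam * Cexp (t * ((1 - s) * lam))))).
    + intros t _. replace (t * ((1 - s) * lam)) with (t * lam + s * (t * - lam)) by ring.
      rewrite Cexp_plus. match goal with |- ?x = ?y => change (@eq C x y) end. field. exact Hs2.
    + replace (f s) with (/ (1 - s) * Cexp (RtoC 1 * ((1 - s) * lam)) - / (1 - s) * Cexp (RtoC 0 * ((1 - s) * lam))).
      * apply (is_CInt_derive 0 1 ltac:(lra) (fun t : R => / (1 - s) * Cexp (t * ((1 - s) * lam)))).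
        -- intros t _. apply Rder_scal. apply Rder_Cexp_line.
        -- intros t _. apply Ccont_scal, Ccont_scal. eapply Rder_Ccont. apply Rder_Cexp_line.
      * unfold f. replace (RtoC 1 * ((1 - s) * lam)) with ((1 - s) * lam) by ring.
        replace (RtoC 0 * ((1 - s) * lam)) with (RtoC 0) by ring. rewrite Cexp_0. field. exact Hs2. }
apply (analytic_ext_loc (fun s => / (s - 1) - f s) _ s0 r Hr).
- intros s Hs. assert (Hs1 := Hnear s ltac:(lra)).
  assert (Hs2 : 1 - s <> 0) by (intros E; apply Hs1; replace (s - 1) with (- (1 - s)) by ring; rewrite E; ring).
  unfold f, Cpower. fold lam. field. split; assumption.
- apply analytic_minus; [now apply analytic_inv_linear | exact Hf].
Qed.

Section HurwitzContinuation.
Context (a : C) (Ha : slit a).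

Lemma em_coef_analytic f N s0 : analytic_at f s0 -> analytic_at (fun s => em_coef s N * f s) s0.
Proof.
intros H. apply analytic_ext with (fun s => / INR (fact (2 * N)) * (f s * pochhammer s (2 * N))).
- intros s. unfold em_coef, Cdiv. ring.
- apply analytic_scal. now apply analytic_pochhammer.
Qed.

Lemma em_main_analytic N (s0 : C) : (1 <= N)%nat -> s0 <> 1 -> analytic_at (fun s => em_main s N a) s0.
Proof.
intros HN Hs0. assert (Hz := slit_neq_0 a Ha). induction HN as [|N HN IH].
- apply analytic_ext with (fun s => / 2 * Cpower a (0 - s) + Cpower a (1 - s) / (s - 1)).
  + intros s. unfold em_main, hurwitz_sum. rewrite (sum_n_m_zero (G := C_AbelianMonoid)) by lia.
    change (@zero C_AbelianMonoid) with (RtoC 0). replace (0 - s) with (- s) by ring. ring.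
  + apply analytic_plus; [apply analytic_scal, analytic_Cpower_affine | now apply analytic_power_pole].
- set (c := RtoC (bernoulli (2 * N) / INR (fact (2 * N))) * / a ^ (2 * N)).
  apply analytic_ext with (fun s => em_main s N a + c * (Cpower a (1 - s) * pochhammer s (2 * N - 1))).
  + intros s. assert (E := em_main_S a Ha s N 0 HN ltac:(lra)).
    replace (RtoC 0 + a) with a in E by ring. rewrite E. unfold pw.
    replace (RtoC 0 + a) with a by ring.
    replace (- (s + INR (2 * N - 1))) with (1 - s - INR (2 * N)).
    * rewrite (Cpower_minus _ (1 - s)), Cpower_INR by exact Hz. unfold c, Cdiv. ring.
    * replace (INR (2 * N)) with (INR (2 * N - 1) + 1)%R; [rewrite RtoC_plus; ring|].
      rewrite <- S_INR. f_equal. lia.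
  + apply analytic_plus; [exact IH|]. apply analytic_scal. apply analytic_pochhammer. apply analytic_Cpower_affine.
Qed.

(** When [s] moves in a disc of radius [r], the modulus of [(t + a)^(-s)] changes by at
    most the exponential of [r] times this logarithm, that is by a factor of the order of
    [(1 + t)^r]. *)
Lemma Cmod_Clog_shift_le : exists B : R, (0 < B)%R /\
  forall t : R, (0 <= t)%R -> (Cmod (Clog (t + a)) <= ln (1 + t) + B)%R.
Proof.
destruct (slit_shift_linear a Ha) as [d [Hd H]].
assert (Hm := Cmod_ge_0 a).
set (B1 := Rabs (ln d)). set (B2 := ln (1 + Cmod a)).
assert (HB2 : (0 <= B2)%R).
{ unfold B2. rewrite <- ln_1. destruct (Req_dec (Cmod a) 0) as [E|E].
  - rewrite E, Rplus_0_r. lra.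
  - left. apply ln_increasing; lra. }
assert (HB1 : (0 <= B1)%R) by apply Rabs_pos.
assert (HPI := PI_RGT_0).
exists (B1 + B2 + PI)%R. split; [lra|]. intros t Ht.
assert (Hs := slit_neq_0 _ (slit_shift a t Ha Ht)).
assert (Hp : (0 < Cmod (t + a))%R) by (apply (proj1 (Cmod_gt_0 (t + a))); exact Hs).
eapply Rle_trans; [apply Cmod_le_sum|].
change (Re (Clog (t + a))) with (ln (Cmod (t + a))). change (Im (Clog (t + a))) with (Carg (t + a)).
assert (C1 : (Rabs (Carg (t + a)) <= PI)%R) by (apply Rabs_le; apply Carg_bound).
assert (Hln : (0 <= ln (1 + t))%R).
{ rewrite <- ln_1. destruct (Req_dec t 0) as [E|E]; [rewrite E, Rplus_0_r; lra | left; apply ln_increasing; lra]. }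
assert (mono : forall x y, (0 < x)%R -> (x <= y)%R -> (ln x <= ln y)%R).
{ intros x y Hx [h|h]; [left; now apply ln_increasing | rewrite h; lra]. }
assert (U : (ln (Cmod (t + a)) <= B2 + ln (1 + t))%R).
{ unfold B2. rewrite <- ln_mult by lra. apply mono; [exact Hp|].
  eapply Rle_trans; [apply Cmod_triangle|]. rewrite Cmod_R, Rabs_pos_eq by exact Ht. nra. }
assert (L : (ln d + ln (1 + t) <= ln (Cmod (t + a)))%R).
{ rewrite <- ln_mult by lra. apply mono; [nra | now apply H]. }
assert (Hd1 : (- B1 <= ln d)%R) by (unfold B1; assert (h := Rle_abs (- ln d)); rewrite Rabs_Ropp in h; lra).
assert (Rabs (ln (Cmod (t + a))) <= ln (1 + t) + B1 + B2)%R by (apply Rabs_le; lra). lra.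
Qed.

(** Half of the margin in [Re s > 1 - 2 N] is spent on the disc around [s0], and
    the other half keeps the majorant integrable. *)
Lemma em_I_analytic N s0 : (1 <= N)%nat -> (1 - 2 * INR N < Re s0)%R -> analytic_at (fun s => em_I a s N) s0.
Proof.
intros HN Hs0.
assert (E2N : INR (2 * N) = (2 * INR N)%R) by (rewrite mult_INR; reflexivity).
set (q := (Re s0 + INR (2 * N))%R). assert (Hq : (1 < q)%R) by (unfold q; lra).
set (r := ((q - 1) / 2)%R). assert (Hr : (0 < r)%R) by (unfold r; lra).
destruct (pw_le a Ha s0 (2 * N)) as [B [HB HB2]]; [unfold q in *; lra|].
destruct (bernoulli_gap_bound N HN) as [K [HK HK2]].
destruct Cmod_Clog_shift_le as [L [HL HL2]].
set (Q := (K * B * exp (L * r))%R).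
apply (analytic_exp_integral (at_point 0%R) (Rbar_locally p_infty) (fun t => (0 <= t)%R)
  (fun t : R => bernoulli_gap N t * Cpower (t + a) (- INR (2 * N))) (fun t : R => - Clog (t + a))
  (fun t => (Q * Rpower (1 + t) (- (q - r)))%R) _ s0 r (Q * / (q - r - 1))%R int_range_0_infty Hr).
- intros t Ht. apply Ccont_mult; [now apply bernoulli_gap_cont|].
  eapply Rder_Ccont. apply Rder_Cpower_shift. now apply slit_shift.
- intros t Ht. apply (Rder_Ccont _ _ (- (/ (t + a) * 1))). apply Rder_opp.
  apply (Rder_Cder Clog (fun x : R => x + a)); [apply Cder_Clog; now apply slit_shift | apply Rder_shift].
- intros t Ht. apply Ccont_ext with (fun x => RtoC Q * RtoC (Rpower (1 + x) (- (q - r)))); [intros; now rewrite <- RtoC_mult|].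
  apply Ccont_scal. now apply Ccont_Rpower_shift.
- intros t Ht.
  replace (bernoulli_gap N t * Cpower (t + a) (- INR (2 * N)) * Cexp (s0 * - Clog (t + a)))
    with (bernoulli_gap N t * pw a s0 (2 * N) t).
  + rewrite Cmod_mult, Cmod_R, Cmod_opp.
    assert (H1 := HB2 t Ht). fold q in H1. assert (H2 := HL2 t Ht). assert (H3 := HK2 t).
    assert (H4 : (exp (Cmod (Clog (t + a)) * r) <= exp (L * r) * Rpower (1 + t) r)%R).
    { unfold Rpower. rewrite <- exp_plus.
      assert (h : (Cmod (Clog (t + a)) * r <= L * r + r * ln (1 + t))%R) by nra.
      destruct h as [h|h]; [left; now apply exp_increasing | rewrite h; lra]. }
    replace (Q * Rpower (1 + t) (- (q - r)))%R with ((K * (B * Rpower (1 + t) (- q))) * (exp (L * r) * Rpower (1 + t) r))%R.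
    * apply Rmult_le_compat; [|left; apply exp_pos| |exact H4].
      -- apply Rmult_le_pos; [apply Rabs_pos | apply Cmod_ge_0].
      -- apply Rmult_le_compat; [apply Rabs_pos | apply Cmod_ge_0 | exact H3 | exact H1].
    * unfold Q. replace (- (q - r))%R with (- q + r)%R by ring. rewrite Rpower_plus. ring.
  + unfold pw. rewrite <- (Cmult_assoc (RtoC (bernoulli_gap N t))). f_equal. unfold Cpower. rewrite <- Cexp_plus. f_equal. ring.
- apply (Cint_ext _ _ _ int_range_0_infty (fun t => RtoC Q * RtoC (Rpower (1 + t) (- (q - r))))); [intros; now rewrite <- RtoC_mult|].
  rewrite (RtoC_mult Q). apply Cint_scal; try typeclasses eauto. apply Cint_Rpower_shift. unfold r. lra.
- intros s Hs.
  apply (Cint_ext _ _ _ int_range_0_infty (em_integrand a s N)).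
  + intros t Ht. unfold em_integrand, pw. rewrite <- Cmult_assoc. f_equal. unfold Cpower. rewrite <- Cexp_plus. f_equal. ring.
  + apply em_I_correct; [exact Ha | exact HN|].
    assert (h := re_le_Cmod (s - s0)). assert (h2 := Rle_abs (- Re (s - s0))). rewrite Rabs_Ropp in h2.
    replace (Re (s - s0)) with (Re s - Re s0)%R in * by (destruct s, s0; simpl; ring).
    unfold r, q in *. lra.
Qed.

Lemma em_value_analytic N (s0 : C) : (1 <= N)%nat -> s0 <> 1 -> (1 - 2 * INR N < Re s0)%R ->
  analytic_at (fun s => em_value a s N) s0.
Proof.
intros HN H1 H2. apply analytic_plus; [now apply em_main_analytic|].
apply em_coef_analytic. now apply em_I_analytic.
Qed.

(** An order for which the formula holds at [s]; its successor serves the whole unit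
    disc around [s], so that the values glue to an analytic function. *)
Definition em_order (s : C) : nat := S (Z.to_nat (up (Cmod s))).

Lemma em_order_spec s : (1 <= em_order s)%nat /\ (Cmod s < INR (em_order s))%R.
Proof.
unfold em_order. split; [lia|]. rewrite S_INR.
destruct (archimed (Cmod s)) as [h _].
assert (IZR (up (Cmod s)) <= INR (Z.to_nat (up (Cmod s))))%R; [|lra].
rewrite INR_IZR_INZ. apply IZR_le. lia.
Qed.

Lemma em_order_Re (s s' : C) : (Cmod (s' - s) < 1)%R -> (1 - 2 * INR (S (em_order s)) < Re s')%R.
Proof.
intros H. destruct (em_order_spec s) as [_ h2]. rewrite S_INR. assert (h1 := pos_INR (em_order s)).
assert (h3 := Cmod_triangle s (s' - s)). replace (s + (s' - s)) with s' in h3 by ring.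
assert (h4 := re_le_Cmod s'). assert (h5 := Rle_abs (- Re s')). rewrite Rabs_Ropp in h5. lra.
Qed.

Lemma em_value_any (s : C) N N' : (1 <= N)%nat -> (1 <= N')%nat -> s <> 1 ->
  (1 - 2 * INR N < Re s)%R -> (1 - 2 * INR N' < Re s)%R -> em_value a s N = em_value a s N'.
Proof.
intros H1 H2 Hs h1 h2. destruct (Nat.le_ge_cases N N') as [h|h].
- symmetry. now apply em_value_indep.
- now apply em_value_indep.
Qed.

(** The values [em_value] with the order depending on the point form an analytic
    continuation of the Dirichlet series, and the identity theorem makes it the only
    one. *)
Lemma hurwitz_zeta_em (s : C) (N : nat) :
  (1 <= N)%nat -> s <> 1 -> (1 - 2 * INR N < Re s)%R -> hurwitz_zeta s a = em_value a s N.
Proof.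
intros HN Hs1 Hs.
set (g := fun z => em_value a z (S (em_order z))).
assert (Hself : forall z, (1 - 2 * INR (S (em_order z)) < Re z)%R).
{ intros z. apply em_order_Re. replace (z - z) with (RtoC 0) by ring. rewrite Cmod_0. lra. }
assert (Hg : is_analytic_continuation (fun z => (1 < Re z)%R) (fun z => z <> 1) (hurwitz_series a) g).
{ split.
  - intros z Hz. rewrite (hurwitz_series_em a Ha z Hz). apply em_value_any; [lia | lia | | apply Hself | simpl; lra].
    intros E. rewrite E in Hz. simpl in Hz. lra.
  - intros z Hz. set (r := Rmin 1 (Cmod (z - 1))).
    assert (Hz1 : (0 < Cmod (z - 1))%R).
    { apply (proj1 (Cmod_gt_0 (z - 1))). intros E. apply Hz. replace z with (z - 1 + 1) by ring. rewrite E. ring. }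
    apply (analytic_ext_loc (fun y => em_value a y (S (em_order z))) g z r).
    + apply Rmin_glb_lt; [lra | exact Hz1].
    + intros y Hy. assert (h1 : (Cmod (y - z) < 1)%R) by (eapply Rlt_le_trans; [exact Hy | apply Rmin_l]).
      assert (h2 : (Cmod (y - z) < Cmod (z - 1))%R) by (eapply Rlt_le_trans; [exact Hy | apply Rmin_r]).
      apply em_value_any; [lia | lia | | now apply em_order_Re | apply Hself].
      intros E. rewrite E, Cmod_minus_sym in h2. lra.
    + apply em_value_analytic; [lia | exact Hz | apply Hself]. }
assert (Hgs : g s = em_value a s N) by (apply em_value_any; [lia | exact HN | exact Hs1 | apply Hself | exact Hs]).
rewrite <- Hgs.
(* The segment has to avoid the pole: for real [s] it starts at [2 + i] and meets the real
   axis only at [s]; otherwise it is horizontal. *)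
destruct (Req_dec (Im s) 0) as [E|E].
- apply (analytic_continuation_eq _ _ _ g (2, 1)%R s (/ 2) Hg); [lra | |].
  + intros z Hz. assert (h := re_le_Cmod (z - (2, 1)%R)). assert (h2 := Rle_abs (- Re (z - (2, 1)%R))).
    rewrite Rabs_Ropp in h2. replace (Re (z - (2, 1)%R)) with (Re z - 2)%R in * by (destruct z; simpl; ring). lra.
  + intros t Ht Eq. assert (E1 := f_equal Im Eq). assert (E2 := f_equal Re Eq).
    destruct s as [x y]. simpl in *. subst y.
    assert (t = 1%R) by lra. subst t. apply Hs1. apply Ceq; simpl; lra.
- apply (analytic_continuation_eq _ _ _ g (2, Im s)%R s (/ 2) Hg); [lra | |].
  + intros z Hz. assert (h := re_le_Cmod (z - (2, Im s)%R)). assert (h2 := Rle_abs (- Re (z - (2, Im s)%R))).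
    rewrite Rabs_Ropp in h2. replace (Re (z - (2, Im s)%R)) with (Re z - 2)%R in * by (destruct z; simpl; ring). lra.
  + intros t Ht Eq. assert (E1 := f_equal Im Eq). destruct s as [x y]. simpl in *. lra.
Qed.

End HurwitzContinuation.

(** * Euler's integral for the Gamma function *)

Lemma exp_le x y : (x <= y)%R -> (exp x <= exp y)%R.
Proof. intros [h|h]; [left; now apply exp_increasing | rewrite h; lra]. Qed.

Lemma ln_le_sub_1 x : (0 < x)%R -> (ln x <= x - 1)%R.
Proof. intros H. assert (h := exp_ineq1_le (ln x)). rewrite exp_ln in h by exact H. lra. Qed.

Lemma Rpower_exp_bound y : (0 < y)%R -> exists B : R, (0 < B)%R /\
  forall t : R, (0 < t)%R -> (Rpower t y * exp (- t) <= B)%R.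
Proof.
intros Hy. exists (exp (y * ln y)). split; [apply exp_pos|]. intros t Ht.
unfold Rpower. rewrite <- exp_plus. apply exp_le.
assert (h := ln_le_sub_1 (t / y) ltac:(now apply Rdiv_lt_0_compat)).
unfold Rdiv in h. rewrite ln_mult, ln_Rinv in h by (try apply Rinv_0_lt_compat; lra).
apply (Rmult_le_compat_l y) in h; [|lra].
replace (y * (t * / y - 1))%R with (t - y)%R in h by (field; lra). lra.
Qed.

Lemma Rpower_lim_0 y : (0 < y)%R -> filterlim (fun t => Rpower t y) (at_right 0%R) (locally 0%R).
Proof.
intros Hy. apply filterlim_locally. intros eps.
apply locally_R with (Rpower eps (/ y)); [apply exp_pos|]. intros t Ht Ht0.
rewrite Rminus_0_r, Rabs_pos_eq in Ht by lra.
change (Rabs (Rpower t y - 0) < eps)%R. rewrite Rminus_0_r, Rabs_pos_eq by (left; apply exp_pos).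
replace (pos eps) with (Rpower (Rpower eps (/ y)) y).
- unfold Rpower at 1 2. apply exp_increasing. apply Rmult_lt_compat_l; [exact Hy|].
  apply ln_increasing; [exact Ht0 | exact Ht].
- rewrite Rpower_mult, Rinv_l, Rpower_1 by (try apply cond_pos; lra). reflexivity.
Qed.

Lemma Rpower_exp_lim_infty y : (0 < y)%R ->
  filterlim (fun t => (Rpower t y * exp (- t))%R) (Rbar_locally p_infty) (locally 0%R).
Proof.
intros Hy. destruct (Rpower_exp_bound (y + 1) ltac:(lra)) as [B [HB H]].
apply filterlim_locally. intros eps. exists (Rmax 0 (B / eps)). intros t Ht.
assert (H0 : (0 < t)%R) by (eapply Rle_lt_trans; [apply Rmax_l | exact Ht]).
assert (H1 : (B / eps < t)%R) by (eapply Rle_lt_trans; [apply Rmax_r | exact Ht]).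
change (Rabs (Rpower t y * exp (- t) - 0) < eps)%R. rewrite Rminus_0_r.
assert (Hp : (0 < Rpower t y * exp (- t))%R) by (apply Rmult_lt_0_compat; apply exp_pos).
rewrite Rabs_pos_eq by lra. specialize (H t H0). rewrite Rpower_plus, Rpower_1 in H by exact H0.
apply (Rmult_lt_compat_l eps) in H1; [|apply cond_pos].
replace (eps * (B / eps))%R with B in H1 by (field; apply Rgt_not_eq, cond_pos).
apply Rmult_lt_reg_r with t; [exact H0|]. nra.
Qed.

Lemma Re_plus_R (p : C) (x : R) : Re (p + x) = (Re p + x)%R.
Proof. destruct p. reflexivity. Qed.

Definition gamma_weight (p : C) (t : R) : C := Cpower t (p - 1) * Cexp (- t).

Definition gamma_abs (sg : R) (t : R) : R := (Rpower t (sg - 1) * exp (- t))%R.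

Lemma Cmod_gamma_weight p t : (0 < t)%R -> Cmod (gamma_weight p t) = gamma_abs (Re p) t.
Proof.
intros Ht. unfold gamma_weight, gamma_abs.
rewrite Cmod_mult, Cmod_Cpower_pos, Cmod_Cexp by exact Ht.
destruct p. reflexivity.
Qed.

Lemma Rder_Cexp_opp t : Rder (fun x : R => Cexp (- x)) t (- Cexp (- t)).
Proof.
replace (- Cexp (- t)) with (Cexp (- t) * - (1)) by ring.
apply (Rder_Cexp (fun x : R => - x)). apply Rder_opp, Rder_id.
Qed.

Lemma Ccont_gamma_weight p t : (0 < t)%R -> Ccont (gamma_weight p) t.
Proof.
intros Ht. apply Ccont_mult.
- eapply Rder_Ccont. now apply Rder_Cpower_real.
- eapply Rder_Ccont. apply Rder_Cexp_opp.
Qed.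

Lemma Ccont_gamma_abs sg t : (0 < t)%R -> Ccont (fun x => RtoC (gamma_abs sg x)) t.
Proof.
intros Ht. apply Ccont_RtoC. apply (ex_derive_continuous (K := R_AbsRing) (V := R_NormedModule)).
unfold gamma_abs, Rpower. auto_derive. lra.
Qed.

Lemma Cint_real Fa Fb {FFa : ProperFilter Fa} {FFb : ProperFilter Fb} (D : R -> Prop) (HD : int_range Fa Fb D) (g : R -> R) (l : C) :
  (forall t, D t -> Ccont (fun x => RtoC (g x)) t) ->
  is_CRInt_gen (fun x => RtoC (g x)) Fa Fb l -> is_CRInt_gen (fun x => RtoC (g x)) Fa Fb (RtoC (Re l)).
Proof.
intros Hg H. replace (RtoC (Re l)) with l; [exact H|].
assert (H' := proj1 (is_CRInt_gen_Clim Fa Fb D HD _ _ Hg) H).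
apply Ceq; [reflexivity|]. simpl.
destruct (Req_dec (Im l) 0) as [E|E]; [exact E|]. exfalso.
apply Rabs_pos_lt in E.
destruct (filter_ex (F := filter_prod Fa Fb) _ (filter_and (F := filter_prod Fa Fb) _ _ (proj1 HD) (H' _ E))) as [[x y] [[h1 h2] h3]].
simpl in *. rewrite CInt_RtoC in h3 by auto.
assert (h4 := im_le_Cmod (RtoC (RI g x y) - l)).
replace (Im (RtoC (RI g x y) - l)) with (- Im l)%R in h4 by (destruct l; simpl; ring).
rewrite Rabs_Ropp in h4. lra.
Qed.

(** The density [t^(sg-1) e^(-t)] is compared with the derivative of the bounded
    function [- 1 / (1 + t^sg)], which handles both endpoints at once. *)
Lemma Cint_gamma_abs sg : (0 < sg)%R ->
  exists m : R, is_CRInt_gen (fun t => RtoC (gamma_abs sg t)) (at_right 0%R) (Rbar_locally p_infty) (RtoC m).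
Proof.
intros Hsg. destruct (Rpower_exp_bound (2 * sg) ltac:(lra)) as [B [HB HB2]].
set (K := (2 * (1 + B) / sg)%R).
assert (HK : (0 < K)%R) by (unfold K; apply Rdiv_lt_0_compat; lra).
set (U := fun t => (- K * / (1 + Rpower t sg))%R).
set (u := fun t => (K * (sg * Rpower t (sg - 1)) / (1 + Rpower t sg) ^ 2)%R).
assert (Hpos : forall t, (0 < 1 + Rpower t sg)%R) by (intros t; assert (h := exp_pos (sg * ln t)); unfold Rpower; lra).
assert (DU : forall t, (0 < t)%R -> is_derive U t (u t)).
{ intros t Ht. unfold U, u, Rpower. specialize (Hpos t). unfold Rpower in Hpos.
  auto_derive; [lra|]. replace ((sg - 1) * ln t)%R with (sg * ln t + - ln t)%R by ring.
  rewrite exp_plus, exp_Ropp, exp_ln by exact Ht. field. split; lra. }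
assert (Cu : forall t, (0 < t)%R -> Ccont (fun x => RtoC (u x)) t).
{ intros t Ht. apply Ccont_RtoC. apply (ex_derive_continuous (K := R_AbsRing) (V := R_NormedModule)).
  specialize (Hpos t). unfold u, Rpower in *. auto_derive. split; [exact Ht|]. split; [exact Ht|].
  split; [|exact I]. rewrite Rmult_1_r. nra. }
assert (Lu : is_CRInt_gen (fun t => RtoC (u t)) (at_right 0%R) (Rbar_locally p_infty) (RtoC 0 - RtoC (- K))).
{ apply (Cint_FTC _ _ _ int_range_0p_infty (fun t => RtoC (U t))).
  - intros t Ht. apply Rder_RtoC. now apply DU.
  - exact Cu.
  - apply Clim_RtoC; [typeclasses eauto|]. unfold U.
    assert (L : filterlim (fun t => (- K * / (1 + Rpower t sg))%R) (at_right 0%R) (locally (- K * / (1 + 0))%R)).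
    { apply (filterlim_comp _ _ _ (fun t => Rpower t sg) (fun y => (- K * / (1 + y))%R) _ (locally 0%R)).
      + now apply Rpower_lim_0.
      + apply (ex_derive_continuous (K := R_AbsRing) (V := R_NormedModule) (fun y => (- K * / (1 + y))%R) 0%R). auto_derive. lra. }
    replace (- K * / (1 + 0))%R with (- K)%R in L by field. exact L.
  - apply Clim_RtoC; [typeclasses eauto|].
    apply filterlim_locally. intros eps. exists (Rmax 1 (Rpower (K / eps) (/ sg))). intros t Ht.
    assert (H0 : (1 < t)%R) by (eapply Rle_lt_trans; [apply Rmax_l | exact Ht]).
    assert (H1 : (Rpower (K / eps) (/ sg) < t)%R) by (eapply Rle_lt_trans; [apply Rmax_r | exact Ht]).
    assert (He := cond_pos eps).
    assert (H2 : (K / eps < Rpower t sg)%R).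
    { replace (K / eps)%R with (Rpower (Rpower (K / eps) (/ sg)) sg).
      - unfold Rpower at 1 3. apply exp_increasing, Rmult_lt_compat_l; [exact Hsg|].
        apply ln_increasing; [apply exp_pos | exact H1].
      - rewrite Rpower_mult, Rinv_l, Rpower_1 by (try apply Rdiv_lt_0_compat; lra). reflexivity. }
    change (Rabs (U t - 0) < eps)%R. unfold U. rewrite Rminus_0_r, Rabs_mult, Rabs_Ropp, (Rabs_pos_eq K) by lra.
    rewrite Rabs_pos_eq by (left; apply Rinv_0_lt_compat, Hpos).
    apply (Rmult_lt_compat_l eps) in H2; [|exact He].
    replace (eps * (K / eps))%R with K in H2 by (field; lra).
    apply Rmult_lt_reg_r with (1 + Rpower t sg)%R; [apply Hpos|]. rewrite Rmult_assoc, Rinv_l by (apply Rgt_not_eq, Hpos). nra. }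
replace (RtoC 0 - RtoC (- K)) with (RtoC K) in Lu by (rewrite RtoC_opp; ring).
destruct (Cint_dominated _ _ _ int_range_0p_infty (fun t => RtoC (gamma_abs sg t)) u K) as [l [Hl _]].
- intros t Ht. now apply Ccont_gamma_abs.
- exact Cu.
- intros t Ht. rewrite Cmod_R. unfold gamma_abs.
  assert (h1 := exp_pos (sg * ln t)). fold (Rpower t sg) in h1.
  assert (h2 : (0 < Rpower t (sg - 1))%R) by apply exp_pos. assert (h3 := exp_pos (- t)).
  rewrite Rabs_pos_eq by (apply Rmult_le_pos; lra).
  assert (h4 := HB2 t Ht). replace (2 * sg)%R with (sg + sg)%R in h4 by ring. rewrite Rpower_plus in h4.
  assert (h5 : (exp (- t) <= 1)%R) by (rewrite <- exp_0; apply exp_le; lra).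
  assert (h6 : (exp (- t) * (1 + Rpower t sg) ^ 2 <= 2 * (1 + B))%R).
  { assert (h7 : ((1 + Rpower t sg) ^ 2 <= 2 * (1 + Rpower t sg * Rpower t sg))%R).
    { assert (hq := pow2_ge_0 (1 - Rpower t sg)).
      replace ((1 + Rpower t sg) ^ 2)%R with (2 * (1 + Rpower t sg * Rpower t sg) - (1 - Rpower t sg) ^ 2)%R by ring. lra. }
    apply Rle_trans with (exp (- t) * (2 * (1 + Rpower t sg * Rpower t sg)))%R; [apply Rmult_le_compat_l; lra|].
    replace (exp (- t) * (2 * (1 + Rpower t sg * Rpower t sg)))%R with
      (2 * exp (- t) + 2 * (Rpower t sg * Rpower t sg * exp (- t)))%R by ring. lra. }
  unfold u. replace (K * (sg * Rpower t (sg - 1)) / (1 + Rpower t sg) ^ 2)%R with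
    (Rpower t (sg - 1) * (2 * (1 + B) / (1 + Rpower t sg) ^ 2))%R.
  + apply Rmult_le_compat_l; [lra|]. assert (hp : (0 < (1 + Rpower t sg) ^ 2)%R) by (apply pow_lt, Hpos).
    apply Rmult_le_reg_r with ((1 + Rpower t sg) ^ 2)%R; [exact hp|].
    replace (2 * (1 + B) / (1 + Rpower t sg) ^ 2 * (1 + Rpower t sg) ^ 2)%R with (2 * (1 + B))%R by (field; apply Rgt_not_eq, Hpos).
    exact h6.
  + unfold K. field. split; first [lra | apply Rgt_not_eq, Hpos].
- exact Lu.
- exists (Re l). apply (Cint_real _ _ _ int_range_0p_infty); [intros; now apply Ccont_gamma_abs | exact Hl].
Qed.

Definition Gamma_abs (sg : R) : R := Re (CRInt_gen (fun t => RtoC (gamma_abs sg t)) (at_right 0%R) (Rbar_locally p_infty)).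

Lemma Gamma_abs_correct sg : (0 < sg)%R ->
  is_CRInt_gen (fun t => RtoC (gamma_abs sg t)) (at_right 0%R) (Rbar_locally p_infty) (RtoC (Gamma_abs sg)).
Proof.
intros H. destruct (Cint_gamma_abs sg H) as [m Hm].
unfold Gamma_abs, CRInt_gen. rewrite (is_RInt_gen_unique (V := C_R_CompleteNormedModule) _ _ Hm). exact Hm.
Qed.

Definition Gamma (p : C) : C := CRInt_gen (gamma_weight p) (at_right 0%R) (Rbar_locally p_infty).

Lemma Gamma_correct p : (0 < Re p)%R ->
  is_CRInt_gen (gamma_weight p) (at_right 0%R) (Rbar_locally p_infty) (Gamma p).
Proof.
intros H. apply (RInt_gen_correct (V := C_R_CompleteNormedModule)).
destruct (Cint_dominated _ _ _ int_range_0p_infty (gamma_weight p) (gamma_abs (Re p)) (Gamma_abs (Re p))) as [l [Hl _]].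
- intros; now apply Ccont_gamma_weight.
- intros; now apply Ccont_gamma_abs.
- intros t Ht. rewrite Cmod_gamma_weight by exact Ht. lra.
- now apply Gamma_abs_correct.
- now exists l.
Qed.

Lemma gamma_boundary_0 p : (0 < Re p)%R -> Clim (at_right 0%R) (fun t : R => Cpower t p * Cexp (- t)) 0.
Proof.
intros H. apply (Clim_squeeze0 _ _ (fun t => Rpower t (Re p))).
- apply locally_R with 1%R; [lra|]. intros t _ Ht. rewrite Cmod_mult, Cmod_Cpower_pos, Cmod_Cexp by exact Ht.
  assert (h : (exp (Re (- t)) <= 1)%R) by (rewrite <- exp_0; apply exp_le; simpl; lra).
  assert (h1 : (0 < Rpower t (Re p))%R) by apply exp_pos. nra.
- now apply Rpower_lim_0.
Qed.

Lemma gamma_boundary_infty p : (0 < Re p)%R -> Clim (Rbar_locally p_infty) (fun t : R => Cpower t p * Cexp (- t)) 0.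
Proof.
intros H. apply (Clim_squeeze0 _ _ (fun t => (Rpower t (Re p) * exp (- t))%R)).
- exists 0%R. intros t Ht. rewrite Cmod_mult, Cmod_Cpower_pos, Cmod_Cexp by exact Ht. simpl Re. lra.
- now apply Rpower_exp_lim_infty.
Qed.

Lemma Gamma_S p : (0 < Re p)%R -> Gamma (p + 1) = p * Gamma p.
Proof.
intros H.
assert (H1 : (0 < Re (p + 1))%R) by (destruct p; simpl in *; lra).
assert (F : is_CRInt_gen (fun t => p * gamma_weight p t - gamma_weight (p + 1) t) (at_right 0%R) (Rbar_locally p_infty) (0 - 0)).
{ apply (Cint_FTC _ _ _ int_range_0p_infty (fun t : R => Cpower t p * Cexp (- t))).
  - intros t Ht. unfold gamma_weight. replace (p + 1 - 1) with p by ring.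
    replace (p * (Cpower t (p - 1) * Cexp (- t)) - Cpower t p * Cexp (- t)) with
      (p * Cpower t (p - 1) * Cexp (- t) + Cpower t p * - Cexp (- t)) by ring.
    apply Rder_mult; [now apply Rder_Cpower_real | apply Rder_Cexp_opp].
  - intros t Ht. apply Ccont_minus; [apply Ccont_scal|]; now apply Ccont_gamma_weight.
  - now apply gamma_boundary_0.
  - now apply gamma_boundary_infty. }
assert (F2 : is_CRInt_gen (fun t => p * gamma_weight p t - gamma_weight (p + 1) t) (at_right 0%R) (Rbar_locally p_infty) (p * Gamma p - Gamma (p + 1))).
{ apply Cint_minus; try typeclasses eauto; [apply Cint_scal; try typeclasses eauto|]; now apply Gamma_correct. }
assert (E := Cint_unique _ _ _ _ _ F F2).
replace (Gamma (p + 1)) with (p * Gamma p - (p * Gamma p - Gamma (p + 1))) by ring. rewrite <- E. ring.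
Qed.

Lemma Gamma_1 : Gamma 1 = 1.
Proof.
apply (Cint_unique (at_right 0%R) (Rbar_locally p_infty) (gamma_weight 1)); [apply Gamma_correct; simpl; lra|].
replace (RtoC 1) with (0 - (- Cexp (- 0))) at 2 by (replace (- 0) with (RtoC 0) by ring; rewrite Cexp_0; ring).
apply (Cint_FTC _ _ _ int_range_0p_infty (fun t : R => - Cexp (- t))).
- intros t Ht. unfold gamma_weight. replace (1 - 1) with (RtoC 0) by ring. rewrite Cpower_0.
  replace (1 * Cexp (- t)) with (- - Cexp (- t)) by ring. apply Rder_opp, Rder_Cexp_opp.
- intros t Ht. now apply Ccont_gamma_weight.
- assert (Hc := Rder_cont _ _ _ (Rder_opp _ _ _ (Rder_Cexp_opp 0))).
  intros e He. generalize (Hc e He). apply filter_le_within.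
- replace (RtoC 0) with (- RtoC 0) by ring. apply Clim_opp; [typeclasses eauto|].
  apply (Clim_squeeze0 _ _ (fun t => (Rpower t 1 * exp (- t))%R)); [|apply Rpower_exp_lim_infty; lra].
  exists 1%R. intros t Ht. rewrite Cmod_Cexp, Rpower_1 by lra. simpl Re. assert (h := exp_pos (- t)). nra.
Qed.

Lemma Gamma_pochhammer p n : (0 < Re p)%R -> Gamma (p + INR n) = pochhammer p n * Gamma p.
Proof.
intros H. induction n as [|n IH].
- simpl. replace (p + 0) with p by ring. ring.
- rewrite S_INR, RtoC_plus. replace (p + (INR n + 1)) with (p + INR n + 1) by ring.
  rewrite Gamma_S, IH.
  + simpl. ring.
  + assert (h := pos_INR n). destruct p. simpl in *. lra.
Qed.

Lemma pochhammer_1 n : pochhammer 1 n = INR (fact n).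
Proof.
induction n as [|n IH]; [reflexivity|].
change (fact (S n)) with (S n * fact n)%nat. rewrite mult_INR, RtoC_mult, S_INR, RtoC_plus. simpl. rewrite IH. ring.
Qed.

Lemma Gamma_INR n : Gamma (INR (S n)) = INR (fact n).
Proof.
replace (RtoC (INR (S n))) with (1 + INR n) by (rewrite S_INR, RtoC_plus; ring).
rewrite Gamma_pochhammer, Gamma_1, pochhammer_1 by (simpl; lra). ring.
Qed.

Lemma gamma_moment n : is_CRInt_gen (fun t => RtoC (t ^ n * exp (- t))) (at_right 0%R) (Rbar_locally p_infty) (RtoC (INR (fact n))).
Proof.
rewrite <- Gamma_INR.
apply (Cint_ext _ _ _ int_range_0p_infty (gamma_weight (INR (S n)))).
- intros t Ht. unfold gamma_weight.
  replace (INR (S n) - 1) with (RtoC (INR n)) by (rewrite S_INR, RtoC_plus; ring).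
  rewrite Cpower_INR by (apply RtoC_neq_0; lra). rewrite <- RtoC_opp, Cexp_RtoC, <- RtoC_pow, <- RtoC_mult. reflexivity.
- apply Gamma_correct. change (0 < INR (S n))%R. apply lt_0_INR. lia.
Qed.

(** Away from [1] a power is dominated by a quadratic weight; this is the
    deterministic half of the concentration argument. *)
Lemma power_near_1 p (e : R) : (0 < Re p)%R -> (0 < e)%R ->
  exists (B : R) (m : nat), (0 < B)%R /\
  forall x : R, (0 < x)%R -> (Cmod (Cpower x p - 1) <= e + B * ((x - 1) ^ 2 * (2 + x ^ m)))%R.
Proof.
intros Hp He.
assert (Hc := Rder_cont _ _ _ (Rder_Cpower_real p 1 ltac:(lra))).
destruct (Hc e He) as [d Hd].
assert (E1 : Cpower 1 p = 1).
{ unfold Cpower. rewrite Clog_pos, ln_1 by lra. replace (p * 0) with (RtoC 0) by ring. apply Cexp_0. }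
rewrite E1 in Hd.
destruct (archimed (Re p)) as [Ha _].
set (m := Z.to_nat (up (Re p))).
assert (Hm : (Re p <= INR m)%R).
{ unfold m. rewrite INR_IZR_INZ. apply Rle_trans with (IZR (up (Re p))); [lra|]. apply IZR_le. lia. }
assert (Hdp := cond_pos d).
exists (/ (d * d))%R, m. split; [apply Rinv_0_lt_compat; nra|]. intros x Hx.
assert (Hxm : (0 < x ^ m)%R) by (now apply pow_lt).
assert (Hq : (0 <= (x - 1) ^ 2)%R) by (apply pow2_ge_0).
assert (Hi : (0 < / (d * d))%R) by (apply Rinv_0_lt_compat; nra).
assert (Hn : (0 <= / (d * d) * ((x - 1) ^ 2 * (2 + x ^ m)))%R).
{ apply Rmult_le_pos; [lra|]. apply Rmult_le_pos; lra. }
destruct (Rlt_le_dec (Rabs (x - 1)) d) as [h|h].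
- assert (h1 : (Cmod (Cpower x p - 1) < e)%R) by (apply Hd; exact h). lra.
- assert (h1 : (Cmod (Cpower x p - 1) <= 2 + x ^ m)%R).
  { eapply Rle_trans; [apply (Cmod_triangle _ (- (1)))|]. rewrite Cmod_opp, Cmod_1, Cmod_Cpower_pos by exact Hx.
    assert (Rpower x (Re p) <= 1 + x ^ m)%R; [|lra].
    destruct (Rle_lt_dec x 1) as [h2|h2].
    - assert (Rpower x (Re p) <= 1)%R; [|lra]. unfold Rpower. rewrite <- exp_0. apply exp_le.
      assert (ln x <= 0)%R; [|nra]. rewrite <- ln_1. destruct h2 as [h2|h2]; [left; now apply ln_increasing | rewrite h2; lra].
    - assert (Rpower x (Re p) <= x ^ m)%R; [|lra]. rewrite <- Rpower_pow by exact Hx. now apply Rle_Rpower; [lra|]. }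
  assert (h2 : (1 <= / (d * d) * (x - 1) ^ 2)%R).
  { apply Rmult_le_reg_l with (d * d)%R; [nra|]. rewrite <- Rmult_assoc, Rinv_r, Rmult_1_l, Rmult_1_r by nra.
    replace ((x - 1) ^ 2)%R with (Rabs (x - 1) * Rabs (x - 1))%R by (rewrite <- Rabs_mult, Rabs_pos_eq by nra; ring). nra. }
  rewrite <- Rmult_assoc. nra.
Qed.

(** The [j]-th moment of [X / n], where [X] has density [t^n e^(-t) / n!], tends to [1]. *)
Lemma fact_ratio_lim j : is_lim_seq (fun n => (INR (fact (S n + j)) / (INR (fact (S n)) * INR (S n) ^ j))%R) 1.
Proof.
induction j as [|j IH].
- apply is_lim_seq_ext with (fun _ => 1%R); [|apply is_lim_seq_const]. intros n. rewrite Nat.add_0_r. rewrite pow_O, Rmult_1_r.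
  field. apply INR_fact_neq_0.
- assert (L : is_lim_seq (fun n => 1 + INR (S j) * / INR (S n))%R 1%R).
  { replace (Finite 1) with (Finite (1 + INR (S j) * 0)) by (f_equal; ring).
    apply is_lim_seq_plus'; [apply is_lim_seq_const|]. apply (is_lim_seq_scal_l (fun n => (/ INR (S n))%R) (INR (S j)) 0).
    apply (is_lim_seq_incr_1 (fun n => (/ INR n)%R)). replace (Finite 0) with (Rbar_inv p_infty) by reflexivity.
    apply is_lim_seq_inv; [apply is_lim_seq_INR | discriminate]. }
  assert (H := is_lim_seq_mult' _ _ _ _ IH L). rewrite Rmult_1_r in H. revert H. apply is_lim_seq_ext.
  intros n. replace (S n + S j)%nat with (S (S n + j)) by lia.
  change (fact (S (S n + j))) with (S (S n + j) * fact (S n + j))%nat. rewrite mult_INR.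
  replace (INR (S (S n + j))) with (INR (S n) + INR (S j))%R by (rewrite <- plus_INR; f_equal; lia).
  change (INR (S n) ^ S j)%R with (INR (S n) * INR (S n) ^ j)%R. field.
  assert (h : INR (S n) <> 0%R) by (apply not_0_INR; lia).
  repeat split; first [exact h | now apply pow_nonzero | apply INR_fact_neq_0].
Qed.

(** If [X] has density [t^n e^(-t) / n!] then [X / n] concentrates at [1], so the
    mean of [(X / n)^p] tends to [1].  This is Gauss's limit, and it shows at the
    same time that [Gamma p] is not zero. *)
Lemma Gamma_gauss p : (0 < Re p)%R ->
  Clim eventually (fun n => Gamma (p + INR (S (S n))) / (INR (fact (S n)) * Cpower (INR (S n)) p)) 1.
Proof.
intros Hp e He.
destruct (power_near_1 p (e / 2) Hp ltac:(lra)) as [B [m [HB Hm]]].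
set (mu := fun j n => (INR (fact (S n + j)) / (INR (fact (S n)) * INR (S n) ^ j))%R).
set (V := fun n => (e / 2 + B * (2 * mu 2%nat n - 4 * mu 1%nat n + 2 * mu 0%nat n + mu (m + 2)%nat n - 2 * mu (m + 1)%nat n + mu m n))%R).
assert (HV : is_lim_seq V (e / 2)%R).
{ unfold V. replace (Finite (e / 2)) with (Finite (e / 2 + B * (2 * 1 - 4 * 1 + 2 * 1 + 1 - 2 * 1 + 1))) by (f_equal; ring).
  assert (S1 : forall j, is_lim_seq (fun n => mu j n) 1%R) by (intros j; apply fact_ratio_lim).
  assert (S : forall c j, is_lim_seq (fun n => c * mu j n)%R (c * 1)%R) by (intros c j; apply (is_lim_seq_scal_l (mu j) c 1); apply fact_ratio_lim).
  apply is_lim_seq_plus'; [apply is_lim_seq_const|].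
  apply (is_lim_seq_scal_l (fun n => (2 * mu 2%nat n - 4 * mu 1%nat n + 2 * mu 0%nat n + mu (m + 2)%nat n - 2 * mu (m + 1)%nat n + mu m n)%R) B (Finite (2 * 1 - 4 * 1 + 2 * 1 + 1 - 2 * 1 + 1)%R)).
  repeat first [apply is_lim_seq_minus' | apply is_lim_seq_plus' | apply S | apply S1]. }
destruct (proj1 (filterlim_locally _ _) HV (mkposreal (e / 2) ltac:(lra))) as [n0 Hn0].
exists n0. intros n Hn. specialize (Hn0 n Hn).
change (Rabs (V n - e / 2) < e / 2)%R in Hn0. apply Rabs_def2 in Hn0.
set (x := INR (S n)). assert (Hx : (0 < x)%R) by (unfold x; apply lt_0_INR; lia).
set (F := INR (fact (S n))). assert (HF : (0 < F)%R) by (unfold F; apply INR_fact_lt_0).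
assert (HFC : RtoC F <> 0) by (apply RtoC_neq_0; lra).
assert (HxC : RtoC x <> 0) by (apply RtoC_neq_0; lra).
assert (Hpx := Cpower_neq_0 x p).
set (f := fun t : R => / F * ((Cpower (t / x)%R p - 1) * RtoC (t ^ S n * exp (- t)))).
(* The majorant from [power_near_1] has an integral that is a combination of moments. *)
set (g := fun t : R => (/ F * ((e / 2 + B * ((t / x - 1) ^ 2 * (2 + (t / x) ^ m))) * (t ^ S n * exp (- t))))%R).
assert (If : is_CRInt_gen f (at_right 0%R) (Rbar_locally p_infty) (Gamma (p + INR (S (S n))) / (F * Cpower x p) - 1)).
{ assert (Hre : (0 < Re (p + INR (S (S n))))%R).
  { rewrite Re_plus_R. assert (h := pos_INR (S (S n))). lra. }
  assert (I1 := Cint_scal _ _ (/ (F * Cpower x p)) _ _ (Gamma_correct _ Hre)).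
  assert (I2 := Cint_scal _ _ (/ F) _ _ (gamma_moment (S n))).
  assert (I3 := Cint_minus _ _ _ _ _ _ I1 I2).
  replace (Gamma (p + INR (S (S n))) / (F * Cpower x p) - 1) with (/ (F * Cpower x p) * Gamma (p + INR (S (S n))) - / F * INR (fact (S n))).
  - revert I3. apply (Cint_ext _ _ _ int_range_0p_infty). intros t Ht. unfold f, gamma_weight.
    assert (Et : Cpower t p = Cpower x p * Cpower (t / x)%R p).
    { rewrite <- Cpower_scale; [|exact Hx | apply RtoC_neq_0, Rgt_not_eq, Rdiv_lt_0_compat; lra].
      f_equal. rewrite <- RtoC_mult. f_equal. field. lra. }
    replace (p + INR (S (S n)) - 1) with (p + INR (S n)) by (rewrite (S_INR (S n)), RtoC_plus; ring).
    rewrite Cpower_plus, Cpower_INR, Et by (apply RtoC_neq_0; lra).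
    rewrite <- (RtoC_opp t), Cexp_RtoC, RtoC_mult, RtoC_pow. field. split; assumption.
  - fold F. field. split; assumption. }
assert (Ig : is_CRInt_gen (fun t => RtoC (g t)) (at_right 0%R) (Rbar_locally p_infty) (RtoC (V n))).
{ assert (I := fun j => Cint_scal _ _ (RtoC (/ (F * x ^ j))) _ _ (gamma_moment (S n + j))).
  assert (J := Cint_plus _ _ _ _ _ _ (Cint_scal _ _ (RtoC (e / 2)) _ _ (I 0%nat))
    (Cint_scal _ _ (RtoC B) _ _
      (Cint_plus _ _ _ _ _ _ (Cint_plus _ _ _ _ _ _ (Cint_scal _ _ (RtoC 2) _ _ (I 2%nat)) (Cint_scal _ _ (RtoC (-4)) _ _ (I 1%nat)))
        (Cint_plus _ _ _ _ _ _ (Cint_plus _ _ _ _ _ _ (Cint_scal _ _ (RtoC 2) _ _ (I 0%nat)) (I (m + 2)%nat))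
           (Cint_plus _ _ _ _ _ _ (Cint_scal _ _ (RtoC (-2)) _ _ (I (m + 1)%nat)) (I m)))))).
  match type of J with is_CRInt_gen _ _ _ ?l => replace (RtoC (V n)) with l end.
  - revert J. apply (Cint_ext _ _ _ int_range_0p_infty). intros t Ht. unfold g.
    repeat rewrite <- ?RtoC_mult, <- ?RtoC_plus. f_equal.
    rewrite !pow_add. unfold Rdiv. rewrite Rpow_mult_distr, pow_inv. field.
    repeat split; try lra; try (apply pow_nonzero; lra).
  - unfold V, mu. fold F x.
    repeat rewrite <- ?RtoC_mult, <- ?RtoC_plus. f_equal.
    rewrite (Nat.add_0_r (S n)). fold F. rewrite !pow_add. simpl (x ^ 0)%R. field.
    repeat split; try lra; try (apply pow_nonzero; lra). }
fold F x. apply Rle_lt_trans with (V n); [|lra].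
apply (Cint_le _ _ _ int_range_0p_infty f g) with (m := V n); try assumption.
- intros t Ht. apply Ccont_scal, Ccont_mult.
  + apply Ccont_minus; [|apply Ccont_const].
    eapply Rder_Ccont. apply (Rder_Cder (fun z => Cpower z p) (fun y : R => RtoC (y / x)) t (p * Cpower (RtoC (t / x)) (p - 1)) (RtoC (/ x))).
    * apply Cder_Cpower, slit_pos, Rdiv_lt_0_compat; lra.
    * apply Rder_RtoC. auto_derive; [auto | field; lra].
  + apply Ccont_RtoC. apply (ex_derive_continuous (K := R_AbsRing) (V := R_NormedModule)).
    generalize (S n). intros k. auto_derive. auto.
- intros t Ht. apply Ccont_RtoC. apply (ex_derive_continuous (K := R_AbsRing) (V := R_NormedModule)).
  unfold g. generalize (S n). intros k. auto_derive. auto.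
- intros t Ht. unfold f, g. rewrite !Cmod_mult.
  assert (Hte : (0 < t ^ S n * exp (- t))%R) by (apply Rmult_lt_0_compat; [now apply pow_lt | apply exp_pos]).
  rewrite (Cmod_R (t ^ S n * exp (- t))), (Rabs_pos_eq (t ^ S n * exp (- t))) by lra.
  rewrite Cmod_inv, Cmod_R, (Rabs_pos_eq F) by (assumption || lra).
  apply Rmult_le_compat_l; [left; now apply Rinv_0_lt_compat|]. apply Rmult_le_compat_r; [lra|].
  apply Hm. now apply Rdiv_lt_0_compat.
Qed.

Lemma Gamma_neq_0_lim p : (0 < Re p)%R -> Gamma p <> 0 /\
  Clim eventually (fun n => pochhammer p (S n) / (INR (fact n) * Cpower (INR n) p)) (/ Gamma p).
Proof.
intros Hp. set (u := fun n => pochhammer p (S n) / (INR (fact n) * Cpower (INR n) p)).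
assert (H : Clim eventually (fun n => Gamma p * u n) 1).
{ intros e He. apply eventually_S. generalize (Gamma_gauss p Hp e He). apply filter_imp. intros n Hn.
  rewrite Gamma_pochhammer in Hn by exact Hp.
  replace (Gamma p * u (S n)) with (pochhammer p (S (S n)) * Gamma p / (INR (fact (S n)) * Cpower (INR (S n)) p)); [exact Hn|].
  unfold u, Cdiv. ring. }
assert (Hne : Gamma p <> 0).
{ intros E. assert (H0 : Clim eventually (fun n => Gamma p * u n) 0).
  { apply Clim_ext with (fun _ => RtoC 0); [typeclasses eauto | intros n; rewrite E; ring | apply Clim_const; typeclasses eauto]. }
  assert (H1 := Clim_unique eventually _ _ _ H H0). apply (f_equal Re) in H1. simpl in H1. lra. }
split; [exact Hne|].
assert (H2 := Clim_scal eventually (/ Gamma p) _ _ H). replace (/ Gamma p * 1) with (/ Gamma p) in H2 by ring.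
revert H2. apply Clim_ext; [typeclasses eauto|]. intros n. field. exact Hne.
Qed.

Lemma pochhammer_add s m n : pochhammer s (m + n) = pochhammer s m * pochhammer (s + INR m) n.
Proof.
induction n as [|n IH].
- rewrite Nat.add_0_r. simpl. ring.
- rewrite Nat.add_succ_r. simpl. rewrite IH, plus_INR, RtoC_plus. ring.
Qed.

Lemma inv_INR_lim : Clim eventually (fun n => RtoC (/ INR n)) 0.
Proof.
apply Clim_RtoC; [typeclasses eauto|].
change (is_lim_seq (fun n => (/ INR n)%R) 0%R). replace (Finite 0) with (Rbar_inv p_infty) by reflexivity.
apply is_lim_seq_inv; [apply is_lim_seq_INR | discriminate].
Qed.

Lemma pochhammer_ratio_lim s m :
  Clim eventually (fun n => pochhammer (s + INR (S n)) m / INR n ^ m) 1.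
Proof.
induction m as [|m IH].
- apply Clim_ext with (fun _ => RtoC 1); [typeclasses eauto | intros n; simpl; field | apply Clim_const; typeclasses eauto].
- assert (L : Clim eventually (fun n => 1 + (s + 1 + INR m) * RtoC (/ INR n)) 1).
  { replace (RtoC 1) with (1 + (s + 1 + INR m) * 0) at 1 by ring.
    apply Clim_plus; [typeclasses eauto | apply Clim_const; typeclasses eauto | apply Clim_scal; [typeclasses eauto | apply inv_INR_lim]]. }
  assert (H := Clim_mult eventually _ _ _ _ IH L). replace (1 * 1) with (RtoC 1) in H by ring.
  revert H. apply Clim_ext_loc; [typeclasses eauto|]. exists 1%nat. intros n Hn.
  assert (Hn0 : INR n <> 0%R) by (apply not_0_INR; lia).
  assert (HnC : RtoC (INR n) <> 0) by (now apply RtoC_neq_0).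
  rewrite RtoC_inv by exact Hn0. rewrite S_INR, RtoC_plus. simpl. field. split; first [exact HnC | now apply Cpow_nz].
Qed.

(** Both sides are limits of Gauss's product; shifting the argument by [m] changes
    the [n]-th product by the factor [(s)_m] up to a ratio that tends to [1]. *)
Lemma rGamma_shift s m : (0 < Re (s + INR m))%R -> rGamma s = pochhammer s m / Gamma (s + INR m).
Proof.
intros Hs. destruct (Gamma_neq_0_lim _ Hs) as [Hne Hl].
set (u := fun n => pochhammer s (S n) / (INR (fact n) * Cpower (INR n) s)).
assert (Hu : Clim eventually u (pochhammer s m / Gamma (s + INR m))).
{ assert (B := pochhammer_ratio_lim s m).
  assert (C1 : RtoC 1 <> 0) by (apply RtoC_neq_0; lra).
  assert (H := Clim_mult eventually _ _ _ _ (Clim_scal eventually (pochhammer s m) _ _ Hl) (Clim_inv eventually _ _ C1 B)).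
  replace (pochhammer s m * / Gamma (s + INR m) * / 1) with (pochhammer s m / Gamma (s + INR m)) in H by (field; exact Hne).
  assert (Hb : eventually (fun n => pochhammer (s + INR (S n)) m / INR n ^ m <> 0)).
  { generalize (B 1%R ltac:(lra)). apply filter_imp. intros n h E. rewrite E in h.
    replace (0 - 1) with (- (1)) in h by ring. rewrite Cmod_opp, Cmod_1 in h. lra. }
  revert H. apply Clim_ext_loc; [typeclasses eauto|].
  destruct Hb as [n0 Hb]. exists (S n0). intros n Hn. specialize (Hb n ltac:(lia)).
  assert (HnC : RtoC (INR n) <> 0) by (apply RtoC_neq_0, not_0_INR; lia).
  assert (Hnm : RtoC (INR n) ^ m <> 0) by (now apply Cpow_nz).
  assert (Hp : pochhammer (s + INR (S n)) m <> 0) by (intros E; apply Hb; rewrite E; unfold Cdiv; ring).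
  assert (E := pochhammer_add s m (S n)). rewrite Nat.add_comm, (pochhammer_add s (S n) m) in E.
  unfold u. rewrite Cpower_plus, Cpower_INR by exact HnC.
  assert (Hf := INR_fact_C n). assert (Hpw := Cpower_neq_0 (INR n) s).
  replace (pochhammer s m * (pochhammer (s + INR m) (S n) / (INR (fact n) * (Cpower (INR n) s * INR n ^ m))) * / (pochhammer (s + INR (S n)) m / INR n ^ m))
    with (pochhammer s m * pochhammer (s + INR m) (S n) * / (INR (fact n) * Cpower (INR n) s * pochhammer (s + INR (S n)) m))
    by (field; repeat split; assumption).
  rewrite <- E. field. repeat split; assumption. }
assert (Hf : filterlim u eventually (locally (pochhammer s m / Gamma (s + INR m)))) by (apply Clim_filterlim; [typeclasses eauto | exact Hu]).
assert (Hr : filterlim u eventually (locally (rGamma s))).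
{ apply (iota_correct (V := C_CompleteNormedModule) (fun l : C => filterlim u eventually (locally l))).
  exists (pochhammer s m / Gamma (s + INR m)). split; [exact Hf|]. intros l Hl'.
  apply (Clim_unique eventually u); [exact Hu | apply Clim_filterlim; [typeclasses eauto | exact Hl']]. }
apply (Clim_unique eventually u); [apply Clim_filterlim; [typeclasses eauto | exact Hr] | exact Hu].
Qed.

(** * The incomplete gamma function and its continuation *)

Lemma Cint_gamma_bounded p (k : R -> C) (B : R) : (0 < Re p)%R ->
  (forall t, (0 < t)%R -> Ccont k t) -> (forall t, (0 < t)%R -> (Cmod (k t) <= B)%R) ->
  exists l, is_CRInt_gen (fun t => gamma_weight p t * k t) (at_right 0%R) (Rbar_locally p_infty) l /\
    (Cmod l <= B * Gamma_abs (Re p))%R.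
Proof.
intros Hp Hk HB.
apply (Cint_dominated _ _ _ int_range_0p_infty (fun t => gamma_weight p t * k t) (fun t => (B * gamma_abs (Re p) t)%R)).
- intros t Ht. apply Ccont_mult; [now apply Ccont_gamma_weight | now apply Hk].
- intros t Ht. apply Ccont_ext with (fun x => RtoC B * RtoC (gamma_abs (Re p) x)); [intros; now rewrite RtoC_mult|].
  apply Ccont_scal. now apply Ccont_gamma_abs.
- intros t Ht. rewrite Cmod_mult, Cmod_gamma_weight, Rmult_comm by exact Ht.
  apply Rmult_le_compat_r; [|now apply HB]. apply Rmult_le_pos; left; apply exp_pos.
- apply (Cint_ext _ _ _ int_range_0p_infty (fun t => RtoC B * RtoC (gamma_abs (Re p) t))); [intros; now rewrite RtoC_mult|].
  rewrite RtoC_mult. apply Cint_scal; try typeclasses eauto. now apply Gamma_abs_correct.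
Qed.

Lemma Cmod_lower_neq_0 (z : C) (d : R) : (0 < d)%R -> (d <= Cmod z)%R -> z <> 0.
Proof. intros H1 H2 E. rewrite E, Cmod_0 in H2. lra. Qed.

Lemma Cmod_inv_le (z : C) (d : R) : (0 < d)%R -> (d <= Cmod z)%R -> (Cmod (/ z) <= / d)%R.
Proof.
intros H1 H2. rewrite Cmod_inv by (now apply (Cmod_lower_neq_0 z d)).
now apply Rinv_le_contravar.
Qed.

Lemma Ccont_inv_shift z t : RtoC t + z <> 0 -> Ccont (fun x : R => / (x + z)) t.
Proof. intros H. apply (Ccont_inv (fun x : R => x + z)); [exact H|]. eapply Rder_Ccont. apply Rder_shift. Qed.

Lemma Cder_inv (z : C) : z <> 0 -> Cder (fun x => / x) z (- / (z * z)).
Proof.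
intros Hz e He.
assert (Hm : (0 < Cmod z)%R) by (apply (proj1 (Cmod_gt_0 z)); exact Hz).
set (B := (2 / (Cmod z * Cmod z * Cmod z))%R).
assert (HB : (0 < B)%R) by (unfold B; apply Rdiv_lt_0_compat; [lra | repeat apply Rmult_lt_0_compat; lra]).
exists (Rmin (Cmod z / 2) (e / B)). split; [apply Rmin_glb_lt; [lra | now apply Rdiv_lt_0_compat]|].
intros h Hh.
assert (H1 : (Cmod h < Cmod z / 2)%R) by (eapply Rlt_le_trans; [exact Hh | apply Rmin_l]).
assert (H2 : (Cmod h < e / B)%R) by (eapply Rlt_le_trans; [exact Hh | apply Rmin_r]).
assert (H3 : (Cmod z / 2 <= Cmod (z + h))%R).
{ assert (T := Cmod_triangle_rev z h). lra. }
assert (Hm2 : (0 < Cmod z / 2)%R) by lra.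
assert (Hzh := Cmod_lower_neq_0 _ _ Hm2 H3).
replace (/ (z + h) - / z - - / (z * z) * h) with (h * h * (/ (z * z) * / (z + h))) by (field; split; assumption).
rewrite !Cmod_mult, Cmod_inv, Cmod_mult by (now apply Cmult_neq_0).
assert (H4 := Cmod_inv_le _ _ Hm2 H3).
assert (H5 := Cmod_ge_0 h). assert (H6 : (0 < / (Cmod z * Cmod z))%R) by (apply Rinv_0_lt_compat; nra).
assert (H7 : (/ (Cmod z * Cmod z) * Cmod (/ (z + h)) <= B)%R).
{ replace B with (/ (Cmod z * Cmod z) * / (Cmod z / 2))%R by (unfold B; field; lra).
  apply Rmult_le_compat_l; lra. }
apply Rle_trans with (Cmod h * Cmod h * B)%R; [apply Rmult_le_compat_l; nra|].
apply (Rmult_lt_compat_l B) in H2; [|exact HB]. replace (B * (e / B))%R with e in H2 by (field; lra). nra.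
Qed.

Section Incomplete.
Context (p : C) (Hp : (0 < Re p)%R).

Definition stieltjes (z : C) : C :=
  CRInt_gen (fun t => gamma_weight p t * / (t + z)) (at_right 0%R) (Rbar_locally p_infty).

Lemma stieltjes_bound z (d : R) : (0 < d)%R -> (forall t : R, (0 < t)%R -> (d <= Cmod (t + z))%R) ->
  is_CRInt_gen (fun t => gamma_weight p t * / (t + z)) (at_right 0%R) (Rbar_locally p_infty) (stieltjes z) /\
  (Cmod (stieltjes z) <= / d * Gamma_abs (Re p))%R.
Proof.
intros Hd H.
destruct (Cint_gamma_bounded p (fun t : R => / (t + z)) (/ d)%R Hp) as [l [Hl Hb]].
- intros t Ht. apply Ccont_inv_shift. now apply (Cmod_lower_neq_0 _ d); [|apply H].
- intros t Ht. apply Cmod_inv_le; auto.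
- unfold stieltjes, CRInt_gen. rewrite (is_RInt_gen_unique (V := C_R_CompleteNormedModule) _ _ Hl). split; assumption.
Qed.

Lemma stieltjes_slit z : slit z ->
  is_CRInt_gen (fun t => gamma_weight p t * / (t + z)) (at_right 0%R) (Rbar_locally p_infty) (stieltjes z).
Proof.
intros Hz. destruct (slit_shift_lower z Hz) as [d [Hd H]].
apply (stieltjes_bound z d Hd). intros t Ht. apply H. lra.
Qed.

(** The derivative is identified by integrating [d (t^p e^(-t) / (t + z))]. *)
Lemma Cder_stieltjes z : slit z -> Cder stieltjes z (((p + z - 1) * stieltjes z - Gamma p) / z).
Proof.
intros Hz. destruct (slit_shift_lower z Hz) as [d [Hd H]].
assert (Hz0 := slit_neq_0 z Hz).
assert (Hne : forall t : R, (0 < t)%R -> RtoC t + z <> 0)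
  by (intros t Ht; apply (Cmod_lower_neq_0 _ d Hd), H; lra).
assert (HM := stieltjes_slit z Hz).
destruct (Cint_gamma_bounded p (fun t : R => / (t + z) * / (t + z)) (/ d * / d)%R Hp) as [M2 [HM2 _]].
{ intros t Ht. apply Ccont_mult; apply Ccont_inv_shift; auto. }
{ intros t Ht. rewrite Cmod_mult. assert (h := Cmod_inv_le _ d Hd (H t ltac:(lra))). assert (h2 := Cmod_ge_0 (/ (t + z))).
  apply Rmult_le_compat; assumption. }
(* The derivative under the integral sign is [- M2]; integrating the derivative of
   [t^p e^(-t) / (t + z)] expresses [M2] by the transform itself. *)
assert (E : ((p + z - 1) * stieltjes z - Gamma p) / z = - M2).
{ assert (I1 : is_CRInt_gen (fun t => (p + z - 1) * (gamma_weight p t * / (t + z)) - gamma_weight p t + z * (gamma_weight p t * (/ (t + z) * / (t + z))))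
     (at_right 0%R) (Rbar_locally p_infty) ((p + z - 1) * stieltjes z - Gamma p + z * M2)).
  { apply Cint_plus; try typeclasses eauto; [apply Cint_minus; try typeclasses eauto|].
    - apply Cint_scal; try typeclasses eauto. exact HM.
    - now apply Gamma_correct.
    - apply Cint_scal; try typeclasses eauto. exact HM2. }
  assert (I2 : is_CRInt_gen (fun t => (p + z - 1) * (gamma_weight p t * / (t + z)) - gamma_weight p t + z * (gamma_weight p t * (/ (t + z) * / (t + z))))
     (at_right 0%R) (Rbar_locally p_infty) (0 - 0)).
  { assert (Hinv : forall F, Filter F -> F (fun t : R => (0 < t)%R) -> Clim F (fun t : R => Cpower t p * Cexp (- t)) 0 ->
      Clim F (fun t : R => Cpower t p * Cexp (- t) * / (t + z)) 0).
    { intros F FF HF HL e He. assert (He2 : (0 < e * d)%R) by nra.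
      generalize (filter_and (F := F) _ _ HF (HL _ He2)). apply filter_imp. intros t [h1 h2].
      replace (Cpower t p * Cexp (- t) * / (t + z) - 0) with ((Cpower t p * Cexp (- t) - 0) * / (t + z)) by ring.
      rewrite Cmod_mult. assert (h3 := Cmod_inv_le _ d Hd (H t ltac:(lra))).
      apply Rle_lt_trans with (Cmod (Cpower t p * Cexp (- t) - 0) * / d)%R; [apply Rmult_le_compat_l; [apply Cmod_ge_0 | exact h3]|].
      apply Rmult_lt_reg_r with d; [exact Hd|]. rewrite Rmult_assoc, Rinv_l, Rmult_1_r by lra. exact h2. }
    apply (Cint_FTC _ _ _ int_range_0p_infty (fun t : R => Cpower t p * Cexp (- t) * / (t + z))).
    - intros t Ht. assert (Hn := Hne t Ht).
      assert (D1 := Rder_mult _ _ _ _ _ (Rder_Cpower_real p t Ht) (Rder_Cexp_opp t)).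
      assert (D2 := Rder_Cder (fun x => / x) (fun x : R => x + z) t _ _ (Cder_inv _ Hn) (Rder_shift z t)).
      assert (D := Rder_mult _ _ _ _ _ D1 D2). cbv beta in D.
      match type of D with Rder _ _ ?l =>
        replace ((p + z - 1) * (gamma_weight p t * / (t + z)) - gamma_weight p t + z * (gamma_weight p t * (/ (t + z) * / (t + z)))) with l; [exact D|] end.
      unfold gamma_weight.
      assert (Et : Cpower t p = t * Cpower t (p - 1)).
      { rewrite Cpower_minus, Cpower_1 by (apply RtoC_neq_0; lra). field. apply RtoC_neq_0. lra. }
      rewrite Et. field. exact Hn.
    - intros t Ht. assert (Hg := Ccont_gamma_weight p t Ht). assert (Hi := Ccont_inv_shift z t (Hne t Ht)).
      apply Ccont_plus; [apply Ccont_minus; [apply Ccont_scal, Ccont_mult; assumption | exact Hg]|].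
      apply Ccont_scal, Ccont_mult; [exact Hg | now apply Ccont_mult].
    - apply Hinv; [typeclasses eauto | | now apply gamma_boundary_0].
      apply locally_R with 1%R; [lra|]. auto.
    - apply Hinv; [typeclasses eauto | | now apply gamma_boundary_infty]. exists 0%R. auto. }
  assert (E := Cint_unique _ _ _ _ _ I1 I2).
  replace ((p + z - 1) * stieltjes z - Gamma p) with ((p + z - 1) * stieltjes z - Gamma p + z * M2 - z * M2) by ring.
  rewrite E. field. exact Hz0. }
rewrite E. clear E.
set (A := Gamma_abs (Re p)). set (K := (2 / (d * d * d) * Rabs A + 1)%R).
assert (HK : (0 < K)%R).
{ unfold K. assert (0 <= 2 / (d * d * d) * Rabs A)%R; [|lra]. apply Rmult_le_pos; [|apply Rabs_pos].
  left. apply Rdiv_lt_0_compat; [lra|]. repeat apply Rmult_lt_0_compat; lra. }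
intros e He. exists (Rmin (d / 2) (e / K)). split; [apply Rmin_glb_lt; [lra | now apply Rdiv_lt_0_compat]|].
intros h Hh.
assert (H1 : (Cmod h < d / 2)%R) by (eapply Rlt_le_trans; [exact Hh | apply Rmin_l]).
assert (H2 : (Cmod h < e / K)%R) by (eapply Rlt_le_trans; [exact Hh | apply Rmin_r]).
assert (H3 : forall t : R, (0 < t)%R -> (d / 2 <= Cmod (t + (z + h)))%R).
{ intros t Ht. assert (T := Cmod_triangle_rev (t + z) h). assert (T2 := H t ltac:(lra)).
  replace (t + (z + h)) with (t + z + h) by ring. lra. }
destruct (stieltjes_bound (z + h) (d / 2) ltac:(lra) H3) as [HMh _].
assert (Hneh : forall t : R, (0 < t)%R -> RtoC t + (z + h) <> 0)
  by (intros t Ht; apply (Cmod_lower_neq_0 _ (d / 2)%R); [lra | now apply H3]).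
destruct (Cint_gamma_bounded p (fun t : R => h * h * (/ (t + z) * / (t + z) * / (t + (z + h)))) (Cmod h * Cmod h * (2 / (d * d * d)))%R Hp) as [l [Hl Hb]].
{ intros t Ht. apply Ccont_scal. apply Ccont_mult; [apply Ccont_mult|]; apply Ccont_inv_shift; auto. }
{ intros t Ht. rewrite !Cmod_mult. apply Rmult_le_compat_l; [apply Rmult_le_pos; apply Cmod_ge_0|].
  assert (h1 := Cmod_inv_le _ d Hd (H t ltac:(lra))). assert (h2 := Cmod_inv_le _ (d / 2)%R ltac:(lra) (H3 t Ht)).
  assert (h3 := Cmod_ge_0 (/ (t + z))). assert (h4 := Cmod_ge_0 (/ (t + (z + h)))).
  replace (2 / (d * d * d))%R with (/ d * / d * / (d / 2))%R by (field; lra).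
  apply Rmult_le_compat; [now apply Rmult_le_pos | exact h4 | now apply Rmult_le_compat | exact h2]. }
(* [l] is the integral of the exact second-order remainder of [1 / (t + z)]. *)
replace (stieltjes (z + h) - stieltjes z - - M2 * h) with l.
- eapply Rle_trans; [exact Hb|]. fold A.
  assert (h5 := Cmod_ge_0 h). assert (h6 := Rle_abs A).
  apply Rle_trans with (Cmod h * Cmod h * K)%R.
  + rewrite Rmult_assoc. apply Rmult_le_compat_l; [nra|]. unfold K.
    assert (0 < 2 / (d * d * d))%R by (apply Rdiv_lt_0_compat; [lra|]; repeat apply Rmult_lt_0_compat; lra). nra.
  + apply (Rmult_lt_compat_l K) in H2; [|exact HK]. replace (K * (e / K))%R with e in H2 by (field; lra). nra.
- apply (Cint_unique (at_right 0%R) (Rbar_locally p_infty) _ _ _ Hl).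
  assert (I1 := Cint_plus _ _ _ _ _ _ (Cint_minus _ _ _ _ _ _ HMh HM) (Cint_scal _ _ h _ _ HM2)).
  replace (stieltjes (z + h) - stieltjes z - - M2 * h) with (stieltjes (z + h) - stieltjes z + h * M2) by ring.
  revert I1. apply (Cint_ext _ _ _ int_range_0p_infty). intros t Ht.
  assert (n1 := Hne t Ht). assert (n2 := Hneh t Ht). field. split; assumption.
Qed.

(** The incomplete gamma function [Gamma (1 - p, z)], as [e^(-z) z^(1-p)] times a
    Stieltjes transform; this form exhibits its decay. *)
Definition inc_gamma_stieltjes (z : C) : C := Cexp (- z) * Cpower z (1 - p) * stieltjes z / Gamma p.

Lemma Cder_inc_gamma_stieltjes z : slit z ->
  Cder inc_gamma_stieltjes z (- (Cexp (- z) * Cpower z (- p))).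
Proof.
intros Hz. assert (Hz0 := slit_neq_0 z Hz). destruct (Gamma_neq_0_lim p Hp) as [HG _].
assert (D1 : Cder (fun x => Cexp (- x)) z (Cexp (- z) * - (1))).
{ apply (Cder_comp Cexp (fun x => - x)); [apply Cder_Cexp|].
  apply Cder_ext with (fun x => - (1) * x); [intros; ring | apply Cder_scal]. }
assert (D := Cder_comp (fun x => / Gamma p * x) _ z _ _ (Cder_scal (/ Gamma p) _)
  (Cder_mult _ _ _ _ _ (Cder_mult _ _ _ _ _ D1 (Cder_Cpower z (1 - p) Hz)) (Cder_stieltjes z Hz))).
cbv beta in D.
match type of D with Cder _ _ ?l => replace (- (Cexp (- z) * Cpower z (- p))) with l end.
- revert D. apply Cder_ext. intros x. unfold inc_gamma_stieltjes, Cdiv. ring.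
- replace (1 - p - 1) with (- p) by ring.
  replace (Cpower z (1 - p)) with (z * Cpower z (- p)).
  + field. split; assumption.
  + unfold Cminus. rewrite Cpower_plus, Cpower_1 by exact Hz0. reflexivity.
Qed.

(** The hypothesis keeps [z] in a sector away from the negative axis, where the
    Stieltjes transform is of order [1 / |z|]. *)
Lemma inc_gamma_stieltjes_bound : exists B : R, (0 < B)%R /\ forall z : C, z <> 0 ->
  (forall t : R, (0 < t)%R -> (Cmod z / 2 <= Cmod (t + z))%R) ->
  (Cmod (inc_gamma_stieltjes z) <= B * (exp (- Re z) * Rpower (Cmod z) (- Re p)))%R.
Proof.
destruct (Gamma_neq_0_lim p Hp) as [HG _].
assert (HG0 : (0 < Cmod (Gamma p))%R) by (apply (proj1 (Cmod_gt_0 _)); exact HG).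
set (A := Rabs (Gamma_abs (Re p))). assert (HA : (0 <= A)%R) by apply Rabs_pos.
set (E := exp (PI * Rabs (Im (1 - p)))). assert (HE : (0 < E)%R) by apply exp_pos.
exists (E * (2 * A + 1) / Cmod (Gamma p))%R. split; [apply Rdiv_lt_0_compat; [nra | exact HG0]|].
intros z Hz Hlow. assert (Hm : (0 < Cmod z)%R) by (apply (proj1 (Cmod_gt_0 z)); exact Hz).
unfold inc_gamma_stieltjes. rewrite Cmod_div, !Cmod_mult, Cmod_Cexp by exact HG.
destruct (stieltjes_bound z (Cmod z / 2) ltac:(lra) Hlow) as [_ Hs].
assert (H1 := Cmod_Cpower_le z (1 - p) Hz). fold E in H1.
replace (Re (- z)) with (- Re z)%R by (destruct z; reflexivity).
replace (Re (1 - p)) with (1 + - Re p)%R in H1 by (destruct p; reflexivity).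
rewrite Rpower_plus, Rpower_1 in H1 by exact Hm.
set (P := Rpower (Cmod z) (- Re p)) in *. assert (HP : (0 < P)%R) by apply exp_pos.
assert (H2 : (Cmod (stieltjes z) <= / (Cmod z / 2) * (A + / 2))%R).
{ eapply Rle_trans; [exact Hs|]. apply Rmult_le_compat_l; [left; apply Rinv_0_lt_compat; lra|].
  assert (h := Rle_abs (Gamma_abs (Re p))). unfold A. lra. }
replace (E * (2 * A + 1) / Cmod (Gamma p) * (exp (- Re z) * P))%R with
  (exp (- Re z) * (E * (Cmod z * P)) * (/ (Cmod z / 2) * (A + / 2)) / Cmod (Gamma p))%R by (field; lra).
apply Rmult_le_compat_r; [left; now apply Rinv_0_lt_compat|].
assert (h3 := exp_pos (- Re z)). assert (h4 := Cmod_ge_0 (Cpower z (1 - p))).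
apply Rmult_le_compat; [apply Rmult_le_pos; lra | apply Cmod_ge_0 | | exact H2].
apply Rmult_le_compat_l; lra.
Qed.

(** The integrand is minus the derivative of the Stieltjes form along the ray [z + t],
    and the latter decays exponentially, so the integral is its value at [z]. *)
Lemma inc_gamma_eq z : slit z -> inc_gamma (1 - p) z = inc_gamma_stieltjes z.
Proof.
intros Hz. set (Y := inc_gamma_stieltjes).
assert (Hsl : forall t : R, (0 <= t)%R -> slit (z + t)) by (intros t Ht; rewrite Cplus_comm; now apply slit_shift).
assert (Dl : forall t : R, Rder (fun x : R => z + x) t 1).
{ intros t. apply Rder_ext with (fun x : R => x + z); [intros; ring | apply Rder_shift]. }
assert (I : is_CRInt_gen (fun t : R => Cpower (z + t) (1 - p - 1) * Cexp (- (z + t))) (at_point 0%R) (Rbar_locally p_infty) (0 - - Y z)).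
{ apply (Cint_FTC _ _ _ int_range_0_infty (fun t : R => - Y (z + t))).
  - intros t Ht.
    assert (D := Rder_opp _ _ _ (Rder_Cder Y (fun x : R => z + x) t _ _ (Cder_inc_gamma_stieltjes _ (Hsl t Ht)) (Dl t))).
    replace (Cpower (z + t) (1 - p - 1) * Cexp (- (z + t))) with (- (- (Cexp (- (z + t)) * Cpower (z + t) (- p)) * 1)); [exact D|].
    replace (1 - p - 1) with (- p) by ring. ring.
  - intros t Ht. apply Ccont_mult; eapply Rder_Ccont.
    + apply (Rder_Cder (fun y => Cpower y (1 - p - 1)) (fun x : R => z + x)); [apply Cder_Cpower; now apply Hsl | apply Dl].
    + apply (Rder_Cexp (fun x : R => - (z + x))). apply Rder_opp. apply Dl.
  - intros e He. unfold at_point. replace (z + 0) with z by ring.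
    replace (- Y z - - Y z) with (RtoC 0) by ring. rewrite Cmod_0. exact He.
  - replace (RtoC 0) with (- RtoC 0) by ring. apply Clim_opp; [typeclasses eauto|].
    destruct inc_gamma_stieltjes_bound as [B [HB HB2]].
    apply (Clim_squeeze0 _ _ (fun t => (B * exp (Cmod z) * (Rpower t 1 * exp (- t)))%R)).
    + exists (Cmod z + 1)%R. intros t Ht. assert (Hz0 := Cmod_ge_0 z).
      assert (Hre : (1 <= Re (z + t))%R).
      { rewrite Re_plus_R. assert (h := re_le_Cmod z). assert (h1 := Rle_abs (- Re z)). rewrite Rabs_Ropp in h1. lra. }
      assert (Hmod : (1 <= Cmod (z + t))%R).
      { eapply Rle_trans; [exact Hre|]. eapply Rle_trans; [apply Rle_abs | apply re_le_Cmod]. }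
      eapply Rle_trans; [apply HB2|].
      * apply slit_neq_0, Hsl. lra.
      * intros t' Ht'. apply Rle_trans with (Cmod (z + t)); [lra|].
        apply Rsqr_incr_0_var; [|apply Cmod_ge_0]. unfold Rsqr. rewrite !Cmod_sqr.
        replace (Re (t' + (z + t))) with (Re (z + t) + t')%R by (destruct z; simpl; ring).
        replace (Im (t' + (z + t))) with (Im (z + t)) by (destruct z; simpl; ring). nra.
      * rewrite Rmult_assoc. apply Rmult_le_compat_l; [lra|]. rewrite Rpower_1 by lra.
        assert (h1 : (exp (- Re (z + t)) <= exp (Cmod z) * exp (- t))%R).
        { rewrite <- exp_plus. apply exp_le. rewrite Re_plus_R.
          assert (h := re_le_Cmod z). assert (h1 := Rle_abs (- Re z)). rewrite Rabs_Ropp in h1. lra. }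
        assert (h2 : (Rpower (Cmod (z + t)) (- Re p) <= 1)%R).
        { replace 1%R with (Rpower 1 (- Re p)) by (unfold Rpower; now rewrite ln_1, Rmult_0_r, exp_0).
          apply Rpower_antitone; lra. }
        assert (h3 := exp_pos (- Re (z + t))). assert (h4 := exp_pos (Cmod z)). assert (h5 := exp_pos (- t)).
        assert (h6 : (0 < Rpower (Cmod (z + t)) (- Re p))%R) by apply exp_pos.
        apply Rle_trans with (exp (Cmod z) * exp (- t) * 1)%R; [apply Rmult_le_compat; lra|].
        assert (0 < exp (Cmod z) * exp (- t))%R by nra. nra.
    + replace 0%R with (B * exp (Cmod z) * 0)%R by ring.
      apply (filterlim_comp _ _ _ (fun t => (Rpower t 1 * exp (- t))%R) (fun y => (B * exp (Cmod z) * y)%R) _ (locally 0%R)).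
      * apply Rpower_exp_lim_infty. lra.
      * apply (filterlim_scal_r (K := R_AbsRing) (V := R_NormedModule) (B * exp (Cmod z))%R 0%R). }
replace (0 - - Y z) with (Y z) in I by ring.
apply (is_RInt_gen_unique (V := C_R_CompleteNormedModule) _ _ I).
Qed.

(** ** The entire function of the logarithm *)

Definition ig_beta (k : nat) : C := 1 - p + INR k.
(** Expanding [e^(- e^L)] in powers of [e^L] and integrating termwise divides by
    the exponents [ig_beta k].  An exponent may be zero; its coefficient is then zero,
    since [/ 0 = 0], and its term is supplied separately. *)
Definition ig_coef (k : nat) : C := exp_term (- (1)) k * / ig_beta k.

Lemma ig_summable (R0 : R) : (0 <= R0)%R -> ex_series (fun k => (Cmod (ig_coef k) * (2 * exp (Cmod (ig_beta k) * R0)))%R).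
Proof.
intros HR. set (al := 1 - p).
destruct (archimed (Cmod al + 1)) as [Ha _].
set (k0 := Z.to_nat (up (Cmod al + 1))).
assert (Hk0 : (Cmod al + 1 <= INR k0)%R).
{ unfold k0. rewrite INR_IZR_INZ. apply Rle_trans with (IZR (up (Cmod al + 1))); [lra|]. apply IZR_le. lia. }
apply (ex_series_incr_n _ k0).
apply (ex_series_le (K := R_AbsRing) (V := R_CompleteNormedModule) _ (fun k => (2 * exp (Cmod al * R0) * (/ INR (fact (k0 + k)) * exp R0 ^ (k0 + k)))%R)).
- intros k. set (n := (k0 + k)%nat).
  change (Rabs (Cmod (ig_coef n) * (2 * exp (Cmod (ig_beta n) * R0))) <= 2 * exp (Cmod al * R0) * (/ INR (fact n) * exp R0 ^ n))%R.
  assert (Hn : (Cmod al + 1 <= INR n)%R).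
  { eapply Rle_trans; [exact Hk0|]. apply le_INR. unfold n. lia. }
  assert (Hn0 := pos_INR n).
  assert (Hlow : (1 <= Cmod (ig_beta n))%R).
  { unfold ig_beta. fold al. assert (h := Cmod_triangle_rev (INR n) al). rewrite Cmod_R, Rabs_pos_eq in h by exact Hn0.
    rewrite Cplus_comm. lra. }
  assert (Hup : (Cmod (ig_beta n) <= Cmod al + INR n)%R).
  { unfold ig_beta. fold al. eapply Rle_trans; [apply Cmod_triangle|]. rewrite Cmod_R, Rabs_pos_eq by exact Hn0. lra. }
  assert (Hf : (0 < / INR (fact n))%R) by (apply Rinv_0_lt_compat, INR_fact_lt_0).
  assert (Hc : (Cmod (ig_coef n) <= / INR (fact n))%R).
  { unfold ig_coef. rewrite Cmod_mult. assert (h := Cmod_inv_le _ 1%R ltac:(lra) Hlow). rewrite Rinv_1 in h.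
    unfold exp_term. rewrite Cmod_div, Cmod_pow, Cmod_opp, Cmod_1, pow1, Cmod_R by apply INR_fact_C.
    rewrite (Rabs_pos_eq (INR (fact n))) by apply pos_INR. unfold Rdiv. rewrite Rmult_1_l.
    assert (h2 := Cmod_ge_0 (/ ig_beta n)). nra. }
  assert (He : (exp (Cmod (ig_beta n) * R0) <= exp (Cmod al * R0) * exp R0 ^ n)%R).
  { replace (exp R0 ^ n)%R with (exp (INR n * R0)).
    - rewrite <- exp_plus. apply exp_le. nra.
    - clear. induction n as [|n IH]; [simpl; rewrite Rmult_0_l; apply exp_0|].
      rewrite S_INR, Rmult_plus_distr_r, Rmult_1_l, exp_plus, IH. simpl. ring. }
  assert (hp := exp_pos (Cmod (ig_beta n) * R0)). assert (hc := Cmod_ge_0 (ig_coef n)).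
  rewrite Rabs_pos_eq by (apply Rmult_le_pos; lra).
  replace (2 * exp (Cmod al * R0) * (/ INR (fact n) * exp R0 ^ n))%R with
    (/ INR (fact n) * (2 * (exp (Cmod al * R0) * exp R0 ^ n)))%R by ring.
  apply Rmult_le_compat; lra.
- apply (ex_series_incr_n (fun k => (2 * exp (Cmod al * R0) * (/ INR (fact k) * exp R0 ^ k))%R) k0).
  exists (2 * exp (Cmod al * R0) * exp (exp R0))%R.
  apply (is_series_scal (V := R_NormedModule) (2 * exp (Cmod al * R0))%R).
  assert (h := is_exp_Reals (exp R0)). revert h. apply is_series_ext. intros n.
  change (pow_n (K := R_AbsRing) (exp R0) n * / INR (fact n) = / INR (fact n) * exp R0 ^ n)%R.
  rewrite <- pow_n_pow. apply Rmult_comm.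
Qed.

Lemma ig_term_bound (z0 : C) r k : (0 <= r)%R ->
  (Cmod (ig_coef k * Cexp (z0 * ig_beta k)) * (2 * exp (Cmod (ig_beta k) * r))
    <= Cmod (ig_coef k) * (2 * exp (Cmod (ig_beta k) * (Cmod z0 + r))))%R.
Proof.
intros Hr. rewrite Cmod_mult, Cmod_Cexp, Rmult_assoc. apply Rmult_le_compat_l; [apply Cmod_ge_0|].
replace (exp (Cmod (ig_beta k) * (Cmod z0 + r)))%R with (exp (Cmod z0 * Cmod (ig_beta k)) * exp (Cmod (ig_beta k) * r))%R
  by (rewrite <- exp_plus; f_equal; ring).
assert (h : (exp (Re (z0 * ig_beta k)) <= exp (Cmod z0 * Cmod (ig_beta k)))%R).
{ apply exp_le. rewrite <- Cmod_mult. eapply Rle_trans; [apply Rle_abs | apply re_le_Cmod]. }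
assert (h2 := exp_pos (Cmod (ig_beta k) * r)). nra.
Qed.

Definition ig_sum (z : C) : C := Cseries (fun k => ig_coef k * Cexp (z * ig_beta k)).

Lemma ig_sum_analytic (z0 : C) : exists S',
  is_Cseries (fun k => ig_coef k * ig_beta k * Cexp (z0 * ig_beta k)) S' /\
  analytic_at ig_sum z0 /\ Cder ig_sum z0 S'.
Proof.
assert (Hz := Cmod_ge_0 z0).
assert (Hle : forall k, (norm (V := R_NormedModule) (Cmod (ig_coef k * Cexp (z0 * ig_beta k)) * (2 * exp (Cmod (ig_beta k) * 1)))%R
  <= Cmod (ig_coef k) * (2 * exp (Cmod (ig_beta k) * (Cmod z0 + 1))))%R).
{ intros k. match goal with |- (norm ?x <= _)%R => change (norm x) with (Rabs x) end.
  rewrite Rabs_pos_eq; [apply ig_term_bound; lra|].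
  apply Rmult_le_pos; [apply Cmod_ge_0|]. assert (h := exp_pos (Cmod (ig_beta k) * 1)). lra. }
destruct (ex_series_le (K := R_AbsRing) (V := R_CompleteNormedModule) _ _ Hle (ig_summable (Cmod z0 + 1) ltac:(lra))) as [K HK].
apply (analytic_exp_series ig_coef ig_beta ig_sum z0 1 K); [lra | exact HK|].
intros z. assert (Hz' := Cmod_ge_0 z).
destruct (ig_summable (Cmod z) Hz') as [V HV].
destruct (Cseries_dominated (fun k => ig_coef k * Cexp (z * ig_beta k)) (fun k => (Cmod (ig_coef k) * (2 * exp (Cmod (ig_beta k) * Cmod z)))%R) V) as [l [Hl _]].
- intros k. assert (h := ig_term_bound z 0 k ltac:(lra)). rewrite Rmult_0_r, exp_0, Rplus_0_r in h.
  assert (h2 := Cmod_ge_0 (ig_coef k * Cexp (z * ig_beta k))). lra.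
- exact HV.
- unfold ig_sum. now rewrite (Cseries_correct _ _ Hl).
Qed.

Lemma is_Cseries_exp z : is_Cseries (exp_term z) (Cexp z).
Proof.
apply is_Cseries_Clim. apply (Clim_seq_bound _ _ (exp (Cmod z / / 2)) (/ 2)); [lra|].
intros n. rewrite Rmult_comm. apply Cexp_taylor. lra.
Qed.

(** The termwise primitive misses at most one term, that with exponent zero, which
    occurs when [1 - p] is a nonpositive integer; it contributes the linear term
    [- d L], where [d] is its coefficient. *)
Lemma ig_primitive : exists G : C -> C,
  G 0 = inc_gamma_stieltjes 1 /\ (forall L, analytic_at G L) /\
  (forall L, Cder G L (- Cexp ((1 - p) * L - Cexp L))).
Proof.
destruct (ig_sum_analytic 0) as [S0 [HS0 _]].
assert (Hd : is_Cseries (fun k => exp_term (- (1)) k - ig_coef k * ig_beta k) (Cexp (- (1)) - S0)).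
{ apply is_Cseries_ext with (fun k => exp_term (- (1)) k + - (1) * (ig_coef k * ig_beta k * Cexp (0 * ig_beta k))).
  - intros k. replace (0 * ig_beta k) with (RtoC 0) by ring. rewrite Cexp_0. ring.
  - replace (Cexp (- (1)) - S0) with (Cexp (- (1)) + - (1) * S0) by ring.
    apply is_Cseries_plus; [apply is_Cseries_exp | now apply is_Cseries_scal]. }
set (d := Cexp (- (1)) - S0) in *.
set (K := inc_gamma_stieltjes 1 + ig_sum 0).
exists (fun L => K + (- d * L + - (1) * ig_sum L)). split; [unfold K; ring|]. split.
- intros L. destruct (ig_sum_analytic L) as [S' [_ [HA _]]].
  apply analytic_plus; [apply analytic_const|]. apply analytic_plus; [|now apply analytic_scal].
  apply analytic_scal. apply analytic_ext with (fun z => 1 * (z + 0)); [intros; ring|].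
  apply analytic_mul_linear, analytic_const.
- intros L. destruct (ig_sum_analytic L) as [S' [HS' [_ HD]]].
  assert (E : d + S' = Cexp ((1 - p) * L - Cexp L)).
  { apply (is_Cseries_unique (fun k => exp_term (- (1)) k * Cexp (L * ig_beta k))).
    - apply is_Cseries_ext with (fun k => (exp_term (- (1)) k - ig_coef k * ig_beta k) + ig_coef k * ig_beta k * Cexp (L * ig_beta k)).
      + intros k. destruct (classic (ig_beta k = 0)) as [E|E].
        * rewrite E. replace (L * 0) with (RtoC 0) by ring. rewrite Cexp_0. ring.
        * replace (ig_coef k * ig_beta k) with (exp_term (- (1)) k) by (unfold ig_coef; field; exact E). ring.
      + now apply is_Cseries_plus.
    - unfold Cminus. rewrite Cexp_plus.
      apply is_Cseries_ext with (fun k => Cexp ((1 + - p) * L) * exp_term (- Cexp L) k).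
      + intros k. replace (- Cexp L) with (Cexp L * - (1)) by ring. rewrite exp_term_pow, Cexp_pow.
        replace (L * ig_beta k) with ((1 + - p) * L + INR k * L) by (unfold ig_beta; ring). rewrite Cexp_plus. ring.
      + apply is_Cseries_scal. apply is_Cseries_exp. }
  rewrite <- E.
  assert (D := Cder_plus _ _ _ _ _ (Cder_const K L) (Cder_plus _ _ _ _ _ (Cder_scal (- d) L) (Cder_comp (fun x => - (1) * x) ig_sum L _ _ (Cder_scal (- (1)) _) HD))).
  cbv beta in D. replace (- (d + S')) with (0 + (- d + - (1) * S')) by ring. exact D.
Qed.

Lemma slit_Cexp L : (Rabs (Im L) < PI)%R -> slit (Cexp L).
Proof.
intros H. apply Carg_slit; [apply Cexp_neq_0|].
assert (E := Clog_Cexp L ltac:(apply Rabs_def2 in H; lra)). apply (f_equal Im) in E.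
change (Carg (Cexp L) = Im L) in E. now rewrite E.
Qed.

(** The entire primitive agrees with the Stieltjes form on the principal strip, because
    they have the same derivative and the same value at [L = 0]; so it is the analytic
    continuation. *)
Lemma inc_gamma_log_spec :
  (forall L, Cder (inc_gamma_log (1 - p)) L (- Cexp ((1 - p) * L - Cexp L))) /\
  (forall L, (Rabs (Im L) < PI)%R -> inc_gamma_log (1 - p) L = inc_gamma_stieltjes (Cexp L)).
Proof.
destruct ig_primitive as [G [G0 [GA GD]]].
assert (HPI := PI_RGT_0).
assert (Gs : forall L, (Rabs (Im L) < PI)%R -> G L = inc_gamma_stieltjes (Cexp L)).
{ intros L HL.
  assert (Z : forall t, (0 <= t <= 1)%R -> Rder (fun t : R => G (t * L) - inc_gamma_stieltjes (Cexp (t * L))) t 0).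
  { intros t Ht.
    assert (HtL : (Rabs (Im (t * L)) < PI)%R).
    { replace (Im (t * L)) with (t * Im L)%R by (destruct L; simpl; ring).
      rewrite Rabs_mult, (Rabs_pos_eq t) by lra. assert (h := Rabs_pos (Im L)). nra. }
    assert (DL : Rder (fun t : R => t * L) t L).
    { apply Rder_ext with (fun x : R => L * x); [intros; ring|].
      assert (H := Rder_scal L _ _ _ (Rder_id t)). now replace (L * 1) with L in H by ring. }
    assert (D1 := Rder_Cder G _ t _ _ (GD (t * L)) DL).
    assert (D2 := Rder_Cder inc_gamma_stieltjes (fun x : R => Cexp (x * L)) t _ _ (Cder_inc_gamma_stieltjes _ (slit_Cexp _ HtL)) (Rder_Cexp _ _ _ DL)).
    assert (D := Rder_minus _ _ _ _ _ D1 D2). cbv beta in D.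
    match type of D with Rder _ _ ?l => replace (RtoC 0) with l; [exact D|] end.
    unfold Cpower. rewrite Clog_Cexp by (apply Rabs_def2 in HtL; lra).
    replace ((1 - p) * (t * L) - Cexp (t * L)) with (t * L + (- p * (t * L) + - Cexp (t * L))) by ring.
    rewrite !Cexp_plus. ring. }
  assert (E := Rder_zero_const _ 0 1 ltac:(lra) Z). cbv beta in E.
  replace (RtoC 1 * L) with L in E by ring. replace (RtoC 0 * L) with (RtoC 0) in E by ring.
  rewrite G0, Cexp_0 in E.
  replace (G L) with (G L - inc_gamma_stieltjes (Cexp L) + inc_gamma_stieltjes (Cexp L)) by ring. rewrite E. ring. }
assert (E : forall L, inc_gamma_log (1 - p) L = G L).
{ intros L. apply (analytic_continuation_eq _ _ _ G 0 L PI).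
  - split; [|intros; apply GA]. intros z Hz. rewrite Gs by exact Hz. symmetry. apply inc_gamma_eq. now apply slit_Cexp.
  - exact HPI.
  - intros z Hz. replace (z - 0) with z in Hz by ring. eapply Rle_lt_trans; [apply im_le_Cmod | exact Hz].
  - auto. }
split.
- intros L. apply Cder_ext with G; [intros; now rewrite E | apply GD].
- intros L HL. rewrite E. now apply Gs.
Qed.

End Incomplete.

(** * The basic terminant *)

Definition quarter_turn : C := Ci * (PI / 2)%R.

Lemma Cexp_quarter_turn : Cexp quarter_turn = Ci.
Proof.
unfold quarter_turn, Cexp. simpl.
replace (0 * (PI / 2) - 1 * 0)%R with 0%R by ring. replace (0 * 0 + 1 * (PI / 2))%R with (PI / 2)%R by ring.
rewrite exp_0, cos_PI2, sin_PI2. apply Ceq; simpl; ring.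
Qed.

Lemma Cexp_quarter_turn_opp : Cexp (- quarter_turn) = - Ci.
Proof.
rewrite Cexp_opp, Cexp_quarter_turn. apply Ceq; simpl; field.
Qed.

Lemma RtoC_m1 : RtoC (-1) = - (1).
Proof. apply Ceq; simpl; ring. Qed.

Lemma Im_quarter_turn : Im quarter_turn = (PI / 2)%R.
Proof. unfold quarter_turn. simpl. ring. Qed.

Lemma Carg_right z : (0 < Re z)%R -> (Rabs (Carg z) < PI / 2)%R.
Proof.
intros H. assert (Hz : z <> 0) by (intros E; rewrite E in H; simpl in H; lra).
assert (Hm : (0 < Cmod z)%R) by (apply (proj1 (Cmod_gt_0 z)); exact Hz).
assert (E := f_equal Re (Cexp_Clog z Hz)). unfold Cexp, Clog in E. simpl in E. rewrite exp_ln in E by exact Hm.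
assert (Hc : (0 < cos (Carg z))%R) by nra.
assert (Hs := slit_Carg z (or_introl H)). apply Rabs_def2 in Hs.
apply Rabs_def1; apply Rnot_le_lt; intros h.
- assert (cos (Carg z) <= 0)%R by (apply cos_le_0; lra). lra.
- assert (cos (- Carg z) <= 0)%R by (apply cos_le_0; lra). rewrite cos_neg in *. lra.
Qed.

Lemma Carg_right_inv (z : C) : z <> 0 -> (Rabs (Carg z) < PI / 2)%R -> (0 < Re z)%R.
Proof.
intros Hz H. assert (Hm : (0 < Cmod z)%R) by (apply (proj1 (Cmod_gt_0 z)); exact Hz).
assert (E := f_equal Re (Cexp_Clog z Hz)). unfold Cexp, Clog in E. simpl in E. rewrite exp_ln in E by exact Hm.
rewrite <- E. apply Rabs_def2 in H. apply Rmult_lt_0_compat; [exact Hm | apply cos_gt_0; lra].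
Qed.

Section Terminant.
Context (p : C) (Hp : (0 < Re p)%R).

(** [e] is [1] or [-1] and selects one of the two terms of the terminant, which
    are treated alike. *)
Definition sgn_i (e : R) : C := Ci * e.

Lemma Cexp_sgn_quarter e : (e = 1 \/ e = -1)%R -> Cexp (e * quarter_turn) = sgn_i e.
Proof.
unfold sgn_i. intros [-> | ->].
- replace (1 * quarter_turn) with quarter_turn by ring. rewrite Cexp_quarter_turn. ring.
- replace (RtoC (-1) * quarter_turn) with (- quarter_turn) by (rewrite RtoC_m1; ring).
  rewrite Cexp_quarter_turn_opp, RtoC_m1. ring.
Qed.

Lemma Im_sgn_quarter L e : (e = 1 \/ e = -1)%R -> (Rabs (Im L) < PI / 2)%R -> (Rabs (Im (L + e * quarter_turn)) < PI)%R.
Proof.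
intros He H. replace (Im (L + e * quarter_turn)) with (Im L + e * (PI / 2))%R.
- apply Rabs_def2 in H. apply Rabs_def1; destruct He as [-> | ->]; lra.
- rewrite <- Im_quarter_turn. destruct L, quarter_turn. simpl. ring.
Qed.

Lemma terminant_sgn (w : C) : w <> 0 ->
  terminant p w = Cpower w p / 2 *
    (Cexp (RtoC 1 * quarter_turn * p) * Cexp (sgn_i 1 * w) * inc_gamma_log (1 - p) (Clog w + RtoC 1 * quarter_turn)
   + Cexp (RtoC (-1) * quarter_turn * p) * Cexp (sgn_i (-1) * w) * inc_gamma_log (1 - p) (Clog w + RtoC (-1) * quarter_turn)).
Proof.
intros Hw. unfold terminant, terminant_log. cbv zeta. rewrite Cexp_Clog by exact Hw.
fold quarter_turn. unfold sgn_i. rewrite !RtoC_m1.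
replace (RtoC 1 * quarter_turn) with quarter_turn by ring. replace (- (1) * quarter_turn) with (- quarter_turn) by ring.
replace (Ci * RtoC 1) with Ci by ring. replace (Ci * - (1)) with (- Ci) by ring.
reflexivity.
Qed.

Section Ray.
Context (a : C) (Ha : slit a) (om : R) (Hom : (0 < om)%R).

Definition ray (t : R) : C := om * (t + a).

Lemma ray_slit t : (0 <= t)%R -> slit (ray t).
Proof.
intros Ht. unfold ray. destruct (slit_shift a t Ha Ht) as [h|h].
- left. destruct (t + a) as [x y]. simpl in *. nra.
- right. destruct (t + a) as [x y]. simpl in *. intros E. apply h. nra.
Qed.

Lemma Rder_ray t : Rder ray t om.
Proof.
assert (H := Rder_scal om _ _ _ (Rder_shift a t)). now replace (om * 1) with (RtoC om) in H by ring.
Qed.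

(** One of the two terms of the terminant at the point [ray t] of the ray, up to a
    power of that point; the exponential factor is kept at [t = 0], so that the
    derivative is elementary. *)
Definition ray_branch (e : R) (t : R) : C :=
  Cexp (e * quarter_turn * p) * Cexp (sgn_i e * ray 0) * inc_gamma_log (1 - p) (Clog (ray t) + e * quarter_turn).

Lemma Rder_ray_branch e t : (e = 1 \/ e = -1)%R -> (0 <= t)%R ->
  Rder (ray_branch e) t (- (sgn_i e * om * Cpower (ray t) (- p) * Cexp (- (sgn_i e * (om * t))))).
Proof.
intros He Ht. destruct (inc_gamma_log_spec p Hp) as [HD _].
assert (Hs := ray_slit t Ht). assert (Hr0 := slit_neq_0 _ Hs).
assert (D1 := Rder_plus _ _ _ _ _ (Rder_Cder Clog ray t _ _ (Cder_Clog _ Hs) (Rder_ray t)) (Rder_const (e * quarter_turn) t)).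
assert (D2 := Rder_Cder (inc_gamma_log (1 - p)) (fun x : R => Clog (ray x) + e * quarter_turn) t _ _ (HD _) D1).
assert (D := Rder_scal (Cexp (e * quarter_turn * p) * Cexp (sgn_i e * ray 0)) _ _ _ D2).
match type of D with Rder _ _ ?l =>
  replace (- (sgn_i e * om * Cpower (ray t) (- p) * Cexp (- (sgn_i e * (om * t))))) with l; [exact D|] end.
rewrite (Cexp_plus (Clog (ray t))), Cexp_Clog, (Cexp_sgn_quarter e He) by exact Hr0.
transitivity (- (om * / ray t * (Cexp (e * quarter_turn * p) * Cexp (sgn_i e * ray 0) * Cexp ((1 - p) * (Clog (ray t) + e * quarter_turn) - ray t * sgn_i e)))); [ring|].
rewrite <- !Cexp_plus.
replace (e * quarter_turn * p + sgn_i e * ray 0 + ((1 - p) * (Clog (ray t) + e * quarter_turn) - ray t * sgn_i e)) with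
  (Clog (ray t) + - p * Clog (ray t) + e * quarter_turn + - (sgn_i e * (om * t))).
- rewrite !Cexp_plus, Cexp_Clog, (Cexp_sgn_quarter e He) by exact Hr0.
  change (Cexp (- p * Clog (ray t))) with (Cpower (ray t) (- p)). field. exact Hr0.
- unfold ray. ring.
Qed.

(** Far out the ray lies in the right half-plane, where both branches are on the
    principal sheet and the Stieltjes form gives the decay [t^(- Re p)]. *)
Lemma ray_branch_lim e : (e = 1 \/ e = -1)%R -> Clim (Rbar_locally p_infty) (ray_branch e) 0.
Proof.
intros He. destruct (inc_gamma_log_spec p Hp) as [_ HS].
destruct (inc_gamma_stieltjes_bound p Hp) as [B [HB HB2]].
destruct (slit_shift_linear a Ha) as [d [Hd Hd2]].
set (c := Cexp (e * quarter_turn * p) * Cexp (sgn_i e * ray 0)).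
replace (RtoC 0) with (c * 0) by ring.
apply (Clim_scal (Rbar_locally p_infty) c (fun t => inc_gamma_log (1 - p) (Clog (ray t) + e * quarter_turn))).
set (K := (B * (exp (om * Cmod a) * Rpower (om * d) (- Re p)))%R).
apply (Clim_squeeze0 _ _ (fun t => (K * Rpower (1 + t) (- Re p))%R)).
(* Beyond this point [Re (t + a)] is positive and at least half of [t + |a|]. *)
- exists (3 * Cmod a + 1)%R. intros t Ht. assert (Hm := Cmod_ge_0 a).
  assert (HRe : (Rabs (Re a) <= Cmod a)%R) by apply re_le_Cmod. apply Rabs_le_between in HRe.
  assert (HIm : (Rabs (Im a) <= Cmod a)%R) by apply im_le_Cmod.
  assert (Hta : (0 < Re (t + a))%R) by (destruct a; simpl in *; lra).
  assert (Hr : (0 < Re (ray t))%R) by (unfold ray; destruct (t + a) as [x y]; simpl in *; nra).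
  assert (Hr0 := slit_neq_0 _ (or_introl Hr)).
  rewrite HS by (apply Im_sgn_quarter; [exact He | apply (Carg_right _ Hr)]).
  rewrite Cexp_plus, Cexp_Clog, (Cexp_sgn_quarter e He) by exact Hr0.
  set (z := ray t * sgn_i e).
  assert (Emod : Cmod z = (om * Cmod (t + a))%R).
  { unfold z, ray, sgn_i. rewrite !Cmod_mult, Cmod_Ci, !Cmod_R, (Rabs_pos_eq om) by lra.
    replace (Rabs e) with 1%R; [ring|]. destruct He as [-> | ->]; [now rewrite Rabs_R1 | rewrite Rabs_left; lra]. }
  assert (EIm : Im z = (om * e * (t + Re a))%R) by (unfold z, ray, sgn_i; destruct a; simpl; ring).
  assert (ERe : Re z = (- (om * e * Im a))%R) by (unfold z, ray, sgn_i; destruct a; simpl; ring).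
  assert (Hpos : (0 < Cmod (t + a))%R).
  { apply (proj1 (Cmod_gt_0 (t + a))). apply (slit_neq_0 _ (or_introl Hta)). }
  eapply Rle_trans; [apply HB2|].
  + intros E. rewrite E, Cmod_0 in Emod. nra.
  + intros t' Ht'. apply Rle_trans with (Rabs (Im (t' + z))); [|apply im_le_Cmod].
    replace (Im (t' + z)) with (Im z) by (destruct z; simpl; ring). rewrite EIm, Emod, !Rabs_mult, (Rabs_pos_eq om) by lra.
    replace (Rabs e) with 1%R by (destruct He as [-> | ->]; [now rewrite Rabs_R1 | rewrite Rabs_left; lra]).
    assert (T := Cmod_triangle t a). rewrite Cmod_R, Rabs_pos_eq in T by lra.
    rewrite Rabs_pos_eq by lra.
    assert (om * Cmod (t + a) <= om * (t + Cmod a))%R by (apply Rmult_le_compat_l; lra).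
    assert (om * (t + Cmod a) <= om * (2 * (t + Re a)))%R by (apply Rmult_le_compat_l; lra). lra.
  + unfold K. rewrite !Rmult_assoc. apply Rmult_le_compat_l; [lra|].
    apply Rmult_le_compat; [left; apply exp_pos | left; apply exp_pos | |].
    * apply exp_le. rewrite ERe, Ropp_involutive. assert (h := Rle_abs (e * Im a)).
      rewrite Rabs_mult in h. replace (Rabs e) with 1%R in h by (destruct He as [-> | ->]; [now rewrite Rabs_R1 | rewrite Rabs_left; lra]).
      rewrite Rmult_assoc. apply Rmult_le_compat_l; lra.
    * rewrite Rpower_mult_distr by nra. rewrite Emod. apply Rpower_antitone; [repeat apply Rmult_lt_0_compat; lra | | lra].
      rewrite Rmult_assoc. apply Rmult_le_compat_l; [lra | apply Hd2; lra].
- replace 0%R with (K * 0)%R by ring.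
  apply (filterlim_comp _ _ _ (fun t => Rpower (1 + t) (- Re p)) (fun y => (K * y)%R) _ (locally 0%R)).
  + now apply Rpower_lim_infty.
  + apply (filterlim_scal_r (K := R_AbsRing) (V := R_NormedModule) K 0%R).
Qed.

Lemma sgn_i_exp e (th : R) : Cexp (- (sgn_i e * RtoC th)) = (cos (e * th), (- sin (e * th))%R).
Proof.
unfold Cexp, sgn_i. simpl.
replace (- ((0 * e - 1 * 0) * th - (0 * 0 + 1 * e) * 0))%R with 0%R by ring.
replace (- ((0 * e - 1 * 0) * 0 + (0 * 0 + 1 * e) * th))%R with (- (e * th))%R by ring.
rewrite exp_0, cos_neg, sin_neg. apply Ceq; simpl; ring.
Qed.

(** Differentiating [(1 - cos (om t)) (om (t + a))^(-p)] gives the wanted integrand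
    and the term [om sin (om t) (om (t + a))^(-p)], which decays too slowly; half the sum
    of the derivatives of the two branches cancels it. *)
Lemma terminant_ray :
  is_CRInt_gen (fun t => RtoC (1 - cos (om * t)) * Cpower (t + a) (- (p + 1))) (at_point 0%R) (Rbar_locally p_infty)
    (terminant p (om * a) / (p * Cpower a p)).
Proof.
assert (Hp0 : p <> 0) by (intros E; rewrite E in Hp; simpl in Hp; lra).
assert (Ha0 := slit_neq_0 a Ha).
assert (HomC : RtoC om <> 0) by (apply RtoC_neq_0; lra).
assert (H2 := C2_neq_0).
set (A := fun t : R => RtoC (1 - cos (om * t)) * Cpower (ray t) (- p) + / 2 * (ray_branch 1 t + ray_branch (-1) t)).
assert (Hder : forall t, (0 <= t)%R -> Rder A t (- p * Cpower om (- p) * (RtoC (1 - cos (om * t)) * Cpower (t + a) (- (p + 1))))).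
{ intros t Ht. assert (Hs := ray_slit t Ht). assert (Hr0 := slit_neq_0 _ Hs).
  assert (Hta := slit_neq_0 _ (slit_shift a t Ha Ht)).
  assert (D1 : Rder (fun t => RtoC (1 - cos (om * t))) t (RtoC (om * sin (om * t)))).
  { apply Rder_RtoC. auto_derive; [auto|ring]. }
  assert (D2 := Rder_Cder (fun y => Cpower y (- p)) ray t _ _ (Cder_Cpower _ (- p) Hs) (Rder_ray t)).
  assert (D := Rder_plus _ _ _ _ _ (Rder_mult _ _ _ _ _ D1 D2)
    (Rder_scal (/ 2) _ _ _ (Rder_plus _ _ _ _ _ (Rder_ray_branch 1 t (or_introl eq_refl) Ht) (Rder_ray_branch (-1) t (or_intror eq_refl) Ht)))).
  cbv beta in D.
  match type of D with Rder _ _ ?l =>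
    replace (- p * Cpower om (- p) * (RtoC (1 - cos (om * t)) * Cpower (t + a) (- (p + 1)))) with l; [exact D|] end.
  rewrite <- (RtoC_mult om t), !sgn_i_exp.
  assert (Ew : Cpower (ray t) (- p) = Cpower om (- p) * Cpower (t + a) (- p)) by (unfold ray; now apply Cpower_scale).
  assert (Ew1 : Cpower (ray t) (- p - 1) = Cpower om (- p) * Cpower (t + a) (- p) / (om * (t + a))).
  { rewrite Cpower_minus, Cpower_1 by exact Hr0. now rewrite Ew. }
  rewrite Ew, Ew1.
  replace (- (p + 1)) with (- p - 1) by ring. rewrite (Cpower_minus (t + a)), Cpower_1 by exact Hta.
  set (X := Cpower om (- p)). set (Y := Cpower (t + a) (- p)).
  assert (Esin : - (sgn_i 1 * om * (X * Y) * ((cos (1 * (om * t)), (- sin (1 * (om * t)))%R) : C)) +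
     - (sgn_i (-1) * om * (X * Y) * ((cos (-1 * (om * t)), (- sin (-1 * (om * t)))%R) : C)) = - (2) * RtoC (om * sin (om * t)) * (X * Y)).
  { replace (-1 * (om * t))%R with (- (om * t))%R by ring. rewrite Rmult_1_l, cos_neg, sin_neg, Ropp_involutive.
    replace (- (sgn_i 1 * om * (X * Y) * ((cos (om * t), (- sin (om * t))%R) : C)) + - (sgn_i (-1) * om * (X * Y) * ((cos (om * t), sin (om * t)) : C)))
      with ((- (sgn_i 1 * om * ((cos (om * t), (- sin (om * t))%R) : C)) + - (sgn_i (-1) * om * ((cos (om * t), sin (om * t)) : C))) * (X * Y)) by ring.
    f_equal. unfold sgn_i. apply Ceq; simpl; ring. }
  rewrite Esin. field. split; assumption. }
assert (I : is_CRInt_gen (fun t => - p * Cpower om (- p) * (RtoC (1 - cos (om * t)) * Cpower (t + a) (- (p + 1)))) (at_point 0%R) (Rbar_locally p_infty) (0 - A 0%R)).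
{ apply (Cint_FTC _ _ _ int_range_0_infty A).
  - exact Hder.
  - intros t Ht. apply Ccont_scal, Ccont_mult.
    + apply Ccont_RtoC. apply (ex_derive_continuous (K := R_AbsRing) (V := R_NormedModule)). auto_derive. auto.
    + eapply Rder_Ccont. apply Rder_Cpower_shift. now apply slit_shift.
  - intros e He. unfold at_point. replace (A 0%R - A 0%R) with (RtoC 0) by ring. rewrite Cmod_0. exact He.
  - unfold A. replace (RtoC 0) with (0 + / 2 * (0 + 0)) by ring.
    apply Clim_plus; [typeclasses eauto | |].
    + replace (RtoC 0) with (Cpower om (- p) * 0) by ring.
      assert (HK := Cpower_shift_lim a p Ha Hp).
      assert (Hb : Clim (Rbar_locally p_infty) (fun t : R => RtoC (1 - cos (om * t)) * Cpower (t + a) (- p)) 0).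
      { intros e He. generalize (HK (e / 3)%R ltac:(lra)). apply filter_imp. intros t Ht.
        replace (RtoC (1 - cos (om * t)) * Cpower (t + a) (- p) - 0) with (RtoC (1 - cos (om * t)) * (Cpower (t + a) (- p) - 0)) by ring.
        rewrite Cmod_mult, Cmod_R. assert (Hc := COS_bound (om * t)). rewrite Rabs_pos_eq by lra.
        assert (h := Cmod_ge_0 (Cpower (t + a) (- p) - 0)). nra. }
      assert (Hb2 := Clim_scal (Rbar_locally p_infty) (Cpower om (- p)) _ _ Hb).
      revert Hb2. apply Clim_ext_loc; [typeclasses eauto|]. exists 0%R. intros t Ht.
      assert (Hta := slit_neq_0 _ (slit_shift a t Ha ltac:(lra))).
      unfold ray. rewrite Cpower_scale by assumption. ring.
    + apply Clim_scal; [typeclasses eauto|]. apply Clim_plus; [typeclasses eauto | |]; apply ray_branch_lim; auto. }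
assert (I2 := Cint_scal _ _ (/ (- p * Cpower om (- p))) _ _ I).
assert (Hpw := Cpower_neq_0 om (- p)). assert (Hpa := Cpower_neq_0 a p). assert (Hpo := Cpower_neq_0 om p).
replace (terminant p (om * a) / (p * Cpower a p)) with (/ (- p * Cpower om (- p)) * (0 - A 0%R)).
- revert I2. apply (Cint_ext _ _ _ int_range_0_infty). intros t Ht. field. split; assumption.
- rewrite terminant_sgn by (now apply Cmult_neq_0). rewrite Cpower_scale by assumption.
  unfold A, ray_branch. rewrite Rmult_0_r, cos_0, Rminus_diag.
  replace (ray 0) with (om * a) by (unfold ray; ring). rewrite Cpower_opp. field. repeat split; assumption.
Qed.

End Ray.

(** Both points [w e^(+-i pi/2)] lie on the principal sheet, so each term is a
    Stieltjes transform, and [1 / (1 + (t/w)^2)] is the sum of the two partial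
    fractions. *)
Lemma terminant_right (w : C) : (0 < Re w)%R ->
  is_CRInt_gen (fun t => gamma_weight p t / (1 + (t / w) ^ 2)) (at_right 0%R) (Rbar_locally p_infty) (Gamma p * terminant p w).
Proof.
intros Hw. assert (Hw0 := slit_neq_0 _ (or_introl Hw : slit w)).
destruct (Gamma_neq_0_lim p Hp) as [HG _].
destruct (inc_gamma_log_spec p Hp) as [_ HS].
assert (H2 := C2_neq_0).
assert (Hsl : forall e, (e = 1 \/ e = -1)%R -> slit (sgn_i e * w)).
{ intros e He. right. unfold sgn_i. destruct w as [x y]. simpl in *. destruct He as [-> | ->]; lra. }
assert (Hbr : forall e, (e = 1 \/ e = -1)%R ->
  Cpower w p * (Cexp (e * quarter_turn * p) * Cexp (sgn_i e * w) * inc_gamma_log (1 - p) (Clog w + e * quarter_turn)) = sgn_i e * w * stieltjes p (sgn_i e * w) / Gamma p).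
{ intros e He. assert (HI : (Rabs (Im (Clog w + e * quarter_turn)) < PI)%R) by (apply Im_sgn_quarter; [exact He | now apply Carg_right]).
  rewrite HS by exact HI. unfold inc_gamma_stieltjes.
  assert (E : Cexp (Clog w + e * quarter_turn) = sgn_i e * w).
  { rewrite Cexp_plus, Cexp_Clog, (Cexp_sgn_quarter e He) by exact Hw0. ring. }
  unfold Cpower at 2. rewrite Clog_Cexp by (apply Rabs_def2 in HI; lra). rewrite !E.
  transitivity (Cpower w p * Cexp (e * quarter_turn * p) * Cexp (sgn_i e * w) * Cexp (- (sgn_i e * w)) * Cexp ((1 - p) * (Clog w + e * quarter_turn)) * stieltjes p (sgn_i e * w) / Gamma p).
  { unfold Cdiv. ring. }
  unfold Cdiv. do 2 f_equal. unfold Cpower. rewrite <- !Cexp_plus, <- E. f_equal. ring. }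
assert (S1 := stieltjes_slit p Hp _ (Hsl 1%R (or_introl eq_refl))).
assert (S2 := stieltjes_slit p Hp _ (Hsl (-1)%R (or_intror eq_refl))).
assert (I := Cint_plus _ _ _ _ _ _ (Cint_scal _ _ (/ 2 * (sgn_i 1 * w)) _ _ S1) (Cint_scal _ _ (/ 2 * (sgn_i (-1) * w)) _ _ S2)).
replace (Gamma p * terminant p w) with (/ 2 * (sgn_i 1 * w) * stieltjes p (sgn_i 1 * w) + / 2 * (sgn_i (-1) * w) * stieltjes p (sgn_i (-1) * w)).
- revert I. apply (Cint_ext _ _ _ int_range_0p_infty). intros t Ht.
  assert (n1 := slit_neq_0 _ (slit_shift _ t (Hsl 1%R (or_introl eq_refl)) ltac:(lra))).
  assert (n2 := slit_neq_0 _ (slit_shift _ t (Hsl (-1)%R (or_intror eq_refl)) ltac:(lra))).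
  unfold sgn_i in n1, n2 |- *. rewrite RtoC_m1 in n2 |- *.
  replace (Ci * 1 * w) with (Ci * w) in n1 |- * by ring. replace (Ci * - (1) * w) with (- (Ci * w)) in n2 |- * by ring.
  assert (Ei : Ci * Ci = - (1)) by (apply Ceq; simpl; ring).
  assert (Eq : (t + Ci * w) * (t + - (Ci * w)) = t * t + w * w).
  { replace ((t + Ci * w) * (t + - (Ci * w))) with (t * t - Ci * Ci * (w * w)) by ring. rewrite Ei. ring. }
  assert (n3 : t * t + w * w <> 0) by (rewrite <- Eq; now apply Cmult_neq_0).
  transitivity (gamma_weight p t * (/ 2 * (Ci * w) * (t + - (Ci * w) - (t + Ci * w)) / ((t + Ci * w) * (t + - (Ci * w))))).
  { field. repeat split; assumption. }
  rewrite Eq. unfold Cdiv at 2. f_equal.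
  replace (/ 2 * (Ci * w) * (t + - (Ci * w) - (t + Ci * w))) with (- (Ci * Ci) * (w * w)) by (field; exact H2).
  rewrite Ei. simpl. field.
  split; first [exact Hw0 | intros E; apply n3; rewrite <- E; ring].
- rewrite terminant_sgn by exact Hw0.
  assert (B1 := Hbr 1%R (or_introl eq_refl)). assert (B2 := Hbr (-1)%R (or_intror eq_refl)).
  set (b1 := Cexp (RtoC 1 * quarter_turn * p) * Cexp (sgn_i 1 * w) * inc_gamma_log (1 - p) (Clog w + RtoC 1 * quarter_turn)) in *.
  set (b2 := Cexp (RtoC (-1) * quarter_turn * p) * Cexp (sgn_i (-1) * w) * inc_gamma_log (1 - p) (Clog w + RtoC (-1) * quarter_turn)) in *.
  transitivity (Gamma p * / 2 * (Cpower w p * b1 + Cpower w p * b2)).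
  + rewrite B1, B2. field; repeat split; assumption.
  + unfold Cdiv. ring.
Qed.

End Terminant.

(** * The three representations of the remainder *)

Lemma Re_mult_R (z : C) (x : R) : Re (z * x) = (Re z * x)%R.
Proof. destruct z as [y w]. unfold Re, Cmult, RtoC, fst, snd. ring. Qed.

Lemma Cdiv_neq_0 (x y : C) : x <> 0 -> y <> 0 -> x / y <> 0.
Proof.
intros Hx Hy E. apply Hx. replace x with (x / y * y) by (field; exact Hy). rewrite E. ring.
Qed.

Lemma C2PI_neq_0 : RtoC 2 * RtoC PI <> 0.
Proof. rewrite <- RtoC_mult. apply RtoC_neq_0. assert (h := PI_RGT_0). lra. Qed.

Lemma RtoC_INR_double N : RtoC (INR (2 * N)) = 2 * INR N.
Proof. rewrite mult_INR, RtoC_mult. reflexivity. Qed.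

Lemma freq_eq k : RtoC (freq k) = 2 * PI * INR (k + 1).
Proof. unfold freq. now rewrite !RtoC_mult. Qed.

Lemma is_Cseries_scal_inv (c : C) u l : c <> 0 -> is_Cseries (fun n => c * u n) l -> is_Cseries u (/ c * l).
Proof.
intros Hc H. apply is_Cseries_ext with (fun n => / c * (c * u n)); [intros n; field; exact Hc|].
now apply is_Cseries_scal.
Qed.

(** Termwise integration of the Fourier series: every term is at most
    [2 / (2 pi k)^(2N)] times the integrable function [|pw a s (2 N)|]. *)
Lemma em_I_terminant (a s : C) (N : nat) :
  slit a -> (1 <= N)%nat -> (1 - 2 * INR N < Re s)%R ->
  exists T : C,
    is_Cseries (fun n : nat => let k := INR (n + 1) in
       terminant (s + 2 * INR N - 1) (2 * PI * a * k) / k ^ (2 * N)) T /\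
    em_I a s N = fourier_const N / ((2 * PI) ^ (2 * N) * ((s + 2 * INR N - 1) * Cpower a (s + 2 * INR N - 1))) * T.
Proof.
intros Ha HN Hs. set (p := s + 2 * INR N - 1).
assert (E2 := RtoC_INR_double N). assert (E2R : INR (2 * N) = (2 * INR N)%R) by (rewrite mult_INR; reflexivity).
assert (Ep : p + 1 = s + INR (2 * N)) by (unfold p; rewrite E2; ring).
assert (Hp : (0 < Re p)%R).
{ assert (E := f_equal Re Ep). rewrite !Re_plus_R in E. lra. }
assert (Hp0 : p <> 0) by (intros E; rewrite E in Hp; simpl in Hp; lra).
assert (Hpa := Cpower_neq_0 a p). assert (HPI := C2PI_neq_0).
set (K := fourier_const N).
assert (HK0 : RtoC K <> 0).
{ apply RtoC_neq_0. unfold K, fourier_const. apply Rmult_integral_contrapositive. split; [|apply INR_fact_neq_0].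
  apply Rmult_integral_contrapositive. split; [apply pow_nonzero; lra | lra]. }
set (q := (Re s + INR (2 * N))%R). assert (Hq : (1 < q)%R) by (unfold q; lra).
destruct (pw_le a Ha s (2 * N)) as [B [HB HB2]]; [unfold q in *; lra|]. fold q in HB2.
assert (Habs : exists W : R, is_CRInt_gen (fun t => RtoC (Cmod (pw a s (2 * N) t))) (at_point 0%R) (Rbar_locally p_infty) (RtoC W)).
{ destruct (Cint_dominated _ _ _ int_range_0_infty (fun t => RtoC (Cmod (pw a s (2 * N) t))) (fun t => (B * Rpower (1 + t) (- q))%R) (B * / (q - 1))%R) as [l [Hl _]].
  - intros t Ht. apply Ccont_Cmod. now apply Ccont_pw.
  - intros t Ht. apply Ccont_ext with (fun x => RtoC B * RtoC (Rpower (1 + x) (- q))); [intros; now rewrite <- RtoC_mult|].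
    apply Ccont_scal. now apply Ccont_Rpower_shift.
  - intros t Ht. rewrite Cmod_R, Rabs_pos_eq by apply Cmod_ge_0. now apply HB2.
  - apply (Cint_ext _ _ _ int_range_0_infty (fun t => RtoC B * RtoC (Rpower (1 + t) (- q)))); [intros; now rewrite <- RtoC_mult|].
    rewrite (RtoC_mult B). apply Cint_scal; try typeclasses eauto. now apply Cint_Rpower_shift.
  - exists (Re l). apply (Cint_real _ _ _ int_range_0_infty); [|exact Hl].
    intros t Ht. apply Ccont_Cmod. now apply Ccont_pw. }
destruct Habs as [W HW].
destruct (ex_series_freq N HN) as [A HA].
set (v := fun k => (2 * Rabs K * / freq k ^ (2 * N))%R).
set (l := fun k => RtoC (K / freq k ^ (2 * N)) * (terminant p (freq k * a) / (p * Cpower a p))).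
assert (Hv0 : forall k, (0 <= v k)%R).
{ intros k. unfold v. assert (h := Rabs_pos K). assert (0 < / freq k ^ (2 * N))%R by (apply Rinv_0_lt_compat, pow_lt, freq_pos).
  apply Rmult_le_pos; lra. }
assert (Hub : forall k t, (Cmod (RtoC (K * cos_gap N k t) * pw a s (2 * N) t) <= v k * Cmod (pw a s (2 * N) t))%R).
{ intros k t. rewrite Cmod_mult, Cmod_R, Rabs_mult. apply Rmult_le_compat_r; [apply Cmod_ge_0|].
  unfold v. assert (h := cos_gap_le N k t). assert (h2 := Rabs_pos K).
  replace (2 * Rabs K * / freq k ^ (2 * N))%R with (Rabs K * (2 * / freq k ^ (2 * N)))%R by ring.
  now apply Rmult_le_compat_l. }
destruct (Cint_series (at_point 0%R) (Rbar_locally p_infty) (fun t => (0 <= t)%R) int_range_0_infty (fun _ => True)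
  (em_integrand a s N) (fun k t => RtoC (K * cos_gap N k t) * pw a s (2 * N) t) l v (2 * Rabs K * A)%R W
  (fun t => Cmod (pw a s (2 * N) t)) (fun k t => (v k * Cmod (pw a s (2 * N) t))%R) (fun k => (v k * W)%R)) as [L [HL1 HL2]].
- intros t _. apply filter_forall. auto.
- intros k t Ht. apply Ccont_mult; [|now apply Ccont_pw].
  apply Ccont_RtoC. apply (ex_derive_continuous (K := R_AbsRing) (V := R_NormedModule)).
  unfold cos_gap. auto_derive. auto.
- intros k t _. apply Hub.
- intros t Ht. apply Ccont_Cmod. now apply Ccont_pw.
- exact Hv0.
- apply (is_series_scal (V := R_NormedModule) (2 * Rabs K)%R _ _ HA).
- intros k t _. apply Hub.
- intros k t Ht. apply Ccont_ext with (fun x => RtoC (v k) * RtoC (Cmod (pw a s (2 * N) x))); [intros; now rewrite <- RtoC_mult|].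
  apply Ccont_scal, Ccont_Cmod. now apply Ccont_pw.
- intros k. apply (Cint_ext _ _ _ int_range_0_infty (fun t => RtoC (v k) * RtoC (Cmod (pw a s (2 * N) t)))); [intros; now rewrite <- RtoC_mult|].
  rewrite RtoC_mult. apply Cint_scal; try typeclasses eauto. exact HW.
- intros k. right. apply Rmult_comm.
- intros k.
  assert (I := Cint_scal _ _ (RtoC (K / freq k ^ (2 * N))) _ _ (terminant_ray p Hp a Ha (freq k) (freq_pos k))).
  revert I. apply (Cint_ext _ _ _ int_range_0_infty). intros t Ht. unfold pw. rewrite <- Ep, Cmult_assoc, <- RtoC_mult.
  do 2 f_equal. unfold cos_gap. field. apply pow_nonzero, Rgt_not_eq, freq_pos.
- intros t _. unfold em_integrand. rewrite Cmult_comm.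
  apply is_Cseries_ext with (fun k => pw a s (2 * N) t * RtoC (K * cos_gap N k t)); [intros; apply Cmult_comm|].
  apply is_Cseries_scal. apply is_Cseries_Clim.
  apply Clim_ext with (fun n => RtoC (Rsum (fun k => (K * cos_gap N k t)%R) n)); [typeclasses eauto | |].
  + intros n. clear. induction n as [|n IH]; simpl; [reflexivity|]. now rewrite RtoC_plus, IH.
  + apply Clim_RtoC; [typeclasses eauto|]. apply is_series_Rsum. now apply bernoulli_gap_series.
- assert (EL : em_I a s N = L) by (exact (Cint_unique _ _ _ _ _ (em_I_correct a Ha s N HN Hs) HL2)).
  set (c := K / ((2 * PI) ^ (2 * N) * (p * Cpower a p))).
  assert (Hc : c <> 0).
  { apply Cdiv_neq_0; [exact HK0|]. apply Cmult_neq_0; [now apply Cpow_nz | now apply Cmult_neq_0]. }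
  exists (/ c * L). split.
  + apply is_Cseries_scal_inv; [exact Hc|]. apply is_Cseries_ext with (2 := HL1). intros n. cbv zeta. unfold l, c.
    assert (Hk : RtoC (INR (n + 1)) <> 0) by (apply RtoC_neq_0, not_0_INR; lia).
    rewrite RtoC_div by (apply pow_nonzero, Rgt_not_eq, freq_pos). rewrite RtoC_pow, freq_eq, Cpow_mult_l.
    replace (2 * PI * INR (n + 1) * a) with (2 * PI * a * INR (n + 1)) by ring.
    field. repeat split; try assumption; now apply Cpow_nz.
  + rewrite EL. fold p K c. field. exact Hc.
Qed.

(** The two factors [t +- i b] of [t^2 + b^2] stay away from zero, as [+- i b] are off
    the negative real axis. *)
Lemma Cmod_polylog_factor (b : C) : (0 < Re b)%R ->
  exists B : R, (0 < B)%R /\ forall t : R, (0 < t)%R ->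
    1 + (t / b) ^ 2 <> 0 /\ (Cmod (/ (1 + (t / b) ^ 2)) <= B)%R.
Proof.
intros Hb. assert (Hb0 := slit_neq_0 _ (or_introl Hb : slit b)).
assert (Hsl : forall e, (e = 1 \/ e = -1)%R -> slit (sgn_i e * b)).
{ intros e He. right. unfold sgn_i. destruct b as [x y]. simpl in *. destruct He as [-> | ->]; lra. }
destruct (slit_shift_lower _ (Hsl 1%R (or_introl eq_refl))) as [d1 [Hd1 H1]].
destruct (slit_shift_lower _ (Hsl (-1)%R (or_intror eq_refl))) as [d2 [Hd2 H2]].
assert (Hm : (0 < Cmod b)%R) by (apply (proj1 (Cmod_gt_0 b)); exact Hb0).
exists (Cmod b * Cmod b * (/ d1 * / d2))%R. split.
{ repeat apply Rmult_lt_0_compat; try apply Rinv_0_lt_compat; lra. }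
intros t Ht. specialize (H1 t ltac:(lra)). specialize (H2 t ltac:(lra)).
assert (n1 := Cmod_lower_neq_0 _ _ Hd1 H1). assert (n2 := Cmod_lower_neq_0 _ _ Hd2 H2).
assert (i1 := Cmod_inv_le _ _ Hd1 H1). assert (i2 := Cmod_inv_le _ _ Hd2 H2).
set (z1 := t + sgn_i 1 * b) in *. set (z2 := t + sgn_i (-1) * b) in *.
assert (Ei : Ci * Ci = - (1)) by (apply Ceq; simpl; ring).
assert (E : (b * b) * (1 + (t / b) ^ 2) = z1 * z2).
{ unfold z1, z2, sgn_i. rewrite RtoC_m1.
  transitivity (t * t - Ci * Ci * (b * b)); [rewrite Ei; simpl; field; exact Hb0 | ring]. }
assert (n3 : 1 + (t / b) ^ 2 <> 0).
{ intros E0. rewrite E0 in E. apply (Cmult_neq_0 z1 z2 n1 n2). rewrite <- E. ring. }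
split; [exact n3|].
replace (/ (1 + (t / b) ^ 2)) with (b * b * (/ z1 * / z2)).
- rewrite !Cmod_mult. apply Rmult_le_compat_l; [nra|]. apply Rmult_le_compat; try apply Cmod_ge_0; assumption.
- transitivity (b * b * / (z1 * z2)); [field; split; assumption|]. rewrite <- E. 
  set (x := 1 + (t / b) ^ 2) in *. field. split; assumption.
Qed.

Lemma ex_series_inv_pow_S m : (2 <= m)%nat -> ex_series (fun k => (/ INR (S k) ^ m)%R).
Proof.
intros Hm. destruct (ex_series_inv_pow m Hm) as [l Hl]. exists l. revert Hl. apply is_series_ext.
intros k. now rewrite Nat.add_1_r.
Qed.

(** Replacing [t] by [k t] in the integral for [Gamma p * Pi_p (2 pi a k)] makes the
    rational factor independent of [k]; the sum of the other factors over [k] is the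
    polylogarithm.  Interchange is justified by [int |t^(p-1) e^(-t)| dt]. *)
Lemma polylog_integral (a s : C) (N : nat) (T : C) :
  (0 < Re a)%R -> (1 <= N)%nat -> (1 - 2 * INR N < Re s)%R ->
  is_Cseries (fun n : nat => let k := INR (n + 1) in
       terminant (s + 2 * INR N - 1) (2 * PI * a * k) / k ^ (2 * N)) T ->
  is_CRInt_gen
    (fun t : R => Cpower t (s + 2 * INR N - 2) / (1 + (t / (2 * PI * a)) ^ 2) * polylog (1 - s) (exp (- t))%R)
    (at_right 0%R) (Rbar_locally p_infty) (Gamma (s + 2 * INR N - 1) * T).
Proof.
intros Ha HN Hs HT. set (p := s + 2 * INR N - 1) in *. set (b := 2 * PI * a) in *.
assert (E2 := RtoC_INR_double N). assert (E2R : INR (2 * N) = (2 * INR N)%R) by (rewrite mult_INR; reflexivity).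
assert (Ep : p + 1 = s + INR (2 * N)) by (unfold p; rewrite E2; ring).
assert (Hp : (0 < Re p)%R).
{ assert (E := f_equal Re Ep). rewrite !Re_plus_R in E. lra. }
assert (Hb : (0 < Re b)%R).
{ unfold b. assert (h := PI_RGT_0). destruct a as [x y]. simpl in *. nra. }
destruct (Cmod_polylog_factor b Hb) as [B [HB HB2]].
destruct (Rpower_exp_bound (Re p) Hp) as [Q [HQ HQ2]].
destruct (ex_series_inv_pow_S (2 * N)) as [V HV]; [lia|].
set (v := fun k => (/ INR (S k) ^ (2 * N))%R) in *.
assert (Hkp : forall k, (0 < INR (S k))%R) by (intros k; apply lt_0_INR; lia).
assert (Hv0 : forall k, (0 < v k)%R) by (intros k; apply Rinv_0_lt_compat, pow_lt, Hkp).
(* The [k]-th term, in the scaled variable [k t]. *)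
set (u := fun (k : nat) (t : R) => RtoC (v k) * (INR (S k) * (gamma_weight p (INR (S k) * t)%R / (1 + (t / b) ^ 2)))).
set (g := fun (k : nat) (t : R) => (B * v k * (INR (S k) * gamma_abs (Re p) (INR (S k) * t)))%R).
(* [g k] is the integrable majorant; the cruder bound by [1 / t] that follows it gives
   the locally uniform convergence. *)
assert (Hug : forall k t, (0 < t)%R -> (Cmod (u k t) <= g k t)%R).
{ intros k t Ht. unfold u, g, Cdiv. specialize (Hkp k). specialize (Hv0 k). destruct (HB2 t Ht) as [_ h].
  rewrite !Cmod_mult, !Cmod_R, (Rabs_pos_eq (v k)), (Rabs_pos_eq (INR (S k))), Cmod_gamma_weight by (try nra; lra).
  assert (h2 : (0 <= gamma_abs (Re p) (INR (S k) * t))%R) by (apply Rmult_le_pos; left; apply exp_pos).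
  replace (B * v k * (INR (S k) * gamma_abs (Re p) (INR (S k) * t)))%R with (v k * (INR (S k) * (gamma_abs (Re p) (INR (S k) * t) * B)))%R by ring.
  apply Rmult_le_compat_l; [lra|]. apply Rmult_le_compat_l; [lra|]. now apply Rmult_le_compat_l. }
assert (Huv : forall k t, (0 < t)%R -> (Cmod (u k t) <= v k * (B * Q * / t))%R).
{ intros k t Ht. eapply Rle_trans; [now apply Hug|]. unfold g, gamma_abs. specialize (Hkp k). specialize (Hv0 k).
  assert (h := HQ2 (INR (S k) * t)%R ltac:(nra)).
  replace (Re p - 1)%R with (Re p + - (1))%R by ring. rewrite Rpower_plus, Rpower_Ropp, Rpower_1 by nra.
  replace (B * v k * (INR (S k) * (Rpower (INR (S k) * t) (Re p) * / (INR (S k) * t) * exp (- (INR (S k) * t)))))%R with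
    (v k * (B * (Rpower (INR (S k) * t) (Re p) * exp (- (INR (S k) * t))) * / t))%R by (field; lra).
  apply Rmult_le_compat_l; [lra|]. apply Rmult_le_compat_r; [left; now apply Rinv_0_lt_compat|]. apply Rmult_le_compat_l; lra. }
assert (Hterm : forall k t, (0 < t)%R ->
  Cpower t (s + 2 * INR N - 2) / (1 + (t / b) ^ 2) * (RtoC (exp (- t)) ^ S k / Cpower (INR (S k)) (1 - s)) = u k t).
{ intros k t Ht. destruct (HB2 t Ht) as [n3 _]. specialize (Hkp k).
  assert (HkC : RtoC (INR (S k)) <> 0) by (apply RtoC_neq_0; lra). assert (HtC : RtoC t <> 0) by (apply RtoC_neq_0; lra).
  unfold u, gamma_weight, v.
  replace (s + 2 * INR N - 2) with (p - 1) by (unfold p; ring).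
  rewrite (RtoC_mult (INR (S k)) t), Cpower_scale by (lra || exact HtC).
  replace (1 - s) with (INR (2 * N) - p) by (unfold p; rewrite E2; ring).
  rewrite (Cpower_minus (INR (S k)) (INR (2 * N))), Cpower_INR by exact HkC.
  rewrite (Cpower_minus (INR (S k)) p 1), Cpower_1 by exact HkC.
  rewrite RtoC_inv, RtoC_pow by (apply pow_nonzero; lra).
  rewrite <- Cexp_RtoC, Cexp_pow.
  replace (INR (S k) * RtoC (- t)) with (- (INR (S k) * t)) by (rewrite RtoC_opp; ring).
  assert (Hkn : RtoC (INR (S k)) ^ (2 * N) <> 0) by (now apply Cpow_nz). assert (Hkq := Cpower_neq_0 (INR (S k)) p).
  set (den := 1 + (t / b) ^ 2) in *. set (kk := RtoC (INR (S k))) in *. set (kn := kk ^ (2 * N)) in *.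
  set (E := Cexp (- (kk * t))). field. repeat split; assumption. }
set (l := fun k => RtoC (v k) * (Gamma p * terminant p (b * INR (S k)))).
destruct (Cint_series (at_right 0%R) (Rbar_locally p_infty) (fun t => (0 < t)%R) int_range_0p_infty (fun t => (0 < t)%R)
  (fun t : R => Cpower t (s + 2 * INR N - 2) / (1 + (t / b) ^ 2) * polylog (1 - s) (exp (- t))%R)
  u l v V (B * Gamma_abs (Re p))%R (fun t => (B * Q * / t)%R) g (fun k => (B * v k * Gamma_abs (Re p))%R)) as [L [HL1 HL2]].
- intros t Ht. apply locally_R with t; [exact Ht|]. intros y Hy. apply Rabs_def2 in Hy. lra.
- intros k t Ht. specialize (Hkp k). unfold u, Cdiv. apply Ccont_scal, Ccont_scal, Ccont_mult.
  + apply (Clim_comp (locally t) (locally (INR (S k) * t)%R) (fun x => (INR (S k) * x)%R) (gamma_weight p)).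
    * apply (filterlim_scal_r (K := R_AbsRing) (V := R_NormedModule) (INR (S k)) t).
    * apply Ccont_gamma_weight. nra.
  + apply (Ccont_inv (fun x : R => 1 + (x / b) ^ 2)); [now apply HB2|].
    apply Ccont_plus; [apply Ccont_const|]. simpl.
    assert (Hl : Ccont (fun x : R => x / b) t) by (apply Ccont_mult; [eapply Rder_Ccont; apply Rder_id | apply Ccont_const]).
    apply Ccont_mult; [exact Hl|]. apply Ccont_mult; [exact Hl | apply Ccont_const].
- intros k t Ht. now apply Huv.
- intros t Ht. apply Ccont_RtoC. apply (ex_derive_continuous (K := R_AbsRing) (V := R_NormedModule)). auto_derive. lra.
- intros k. left. apply Hv0.
- exact HV.
- intros k t Ht. now apply Hug.
- intros k t Ht. specialize (Hkp k). apply Ccont_RtoC. apply (ex_derive_continuous (K := R_AbsRing) (V := R_NormedModule)).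
  unfold g, gamma_abs, Rpower. revert Hkp. generalize (INR (S k)). intros x Hx. auto_derive. repeat split; nra.
- intros k. assert (I := Cint_scal _ _ (RtoC (B * v k)) _ _ (Cint_scale _ _ _ (Hkp k) (Gamma_abs_correct (Re p) Hp))).
  rewrite <- RtoC_mult in I. revert I. apply (Cint_ext _ _ _ int_range_0p_infty). intros t Ht. unfold g. now rewrite <- !RtoC_mult.
- intros k. right. ring.
- intros k. specialize (Hkp k). assert (Hbk : (0 < Re (b * INR (S k)))%R).
  { rewrite Re_mult_R. nra. }
  assert (I := Cint_scal _ _ (RtoC (v k)) _ _ (Cint_scale _ _ _ Hkp (terminant_right p Hp _ Hbk))).
  revert I. apply (Cint_ext _ _ _ int_range_0p_infty). intros t Ht. unfold u. do 5 f_equal.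
  rewrite RtoC_mult. assert (Hb0 := slit_neq_0 _ (or_introl Hb : slit b)). 
  assert (HkC : RtoC (INR (S k)) <> 0) by (apply RtoC_neq_0; lra). field. split; assumption.
- intros t Ht.
  set (c := Cpower t (s + 2 * INR N - 2) / (1 + (t / b) ^ 2)).
  destruct (HB2 t Ht) as [n3 _].
  assert (Hc : c <> 0).
  { apply Cdiv_neq_0; [apply Cpower_neq_0 | exact n3]. }
  assert (HVt : is_series (fun k => (v k * (B * Q * / t))%R) (V * (B * Q * / t))%R) by (apply is_series_scal_r; exact HV).
  destruct (Cseries_dominated (fun k => u k t) _ _ (fun k => Huv k t Ht) HVt) as [F [HF _]].
  assert (HF2 : is_Cseries (fun k => RtoC (exp (- t)) ^ S k / Cpower (INR (S k)) (1 - s)) (/ c * F)).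
  { apply is_Cseries_scal_inv; [exact Hc|]. apply is_Cseries_ext with (2 := HF). intros k. symmetry. now apply Hterm. }
  unfold polylog. rewrite (Cseries_correct _ _ HF2).
  replace (c * (/ c * F)) with F by (field; exact Hc). exact HF.
- replace (Gamma p * T) with L; [exact HL2|].
  apply (is_Cseries_unique l); [exact HL1|].
  apply is_Cseries_ext with (2 := is_Cseries_scal (Gamma p) _ _ HT). intros n. unfold l, v. cbv zeta.
  rewrite Nat.add_1_r. rewrite RtoC_inv, RtoC_pow by (apply pow_nonzero, Rgt_not_eq, Hkp). fold b. unfold Cdiv. ring.
Qed.

Lemma hurwitz_remainder_em (a s : C) (N : nat) :
  slit a -> (1 <= N)%nat -> s <> 1 -> (1 - 2 * INR N < Re s)%R ->
  hurwitz_remainder N s a = em_coef s N * Cpower a (s - 1) * em_I a s N.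
Proof.
intros Ha HN Hs1 Hs. unfold hurwitz_remainder.
rewrite (hurwitz_zeta_em a Ha s N HN Hs1 Hs). unfold em_value, em_main.
assert (Hq := Cpower_neq_0 a (1 - s)).
replace (s - 1) with (- (1 - s)) at 3 by ring. rewrite (Cpower_opp a (1 - s)).
set (x := Cpower a (1 - s) / (s - 1)). field. exact Hq.
Qed.

Theorem theorem1p1 (N : nat) (s a : C)
  (hN : (1 <= N)%nat) (hs1 : s <> 1) (hs : (1 - 2 * INR N < Re s)%R) (ha : a <> 0) :
  ((Rabs (Carg a) < PI / 2)%R ->
    exists I : C,
      is_CRInt_gen
        (fun t : R =>
           Cpower t (s + 2 * INR N - 2) / (1 + (t / (2 * PI * a)) ^ 2)
           * polylog (1 - s) (exp (- t))%R)
        (at_right 0%R) (Rbar_locally p_infty) I /\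
      hurwitz_remainder N s a =
        (- (1)) ^ (N + 1) * (2 * rGamma s) * / (2 * PI * a) ^ (2 * N) * I)
  /\
  ((Rabs (Carg a) < PI)%R ->
    (exists T : C,
      is_Cseries
        (fun n : nat =>
           let k := INR (n + 1) in
           terminant (s + 2 * INR N - 1) (2 * PI * a * k) / k ^ (2 * N)) T /\
      hurwitz_remainder N s a =
        (- (1)) ^ (N + 1) * 2
        * (pochhammer s (2 * N - 1) / (2 * PI * a) ^ (2 * N)) * T)
    /\
    (exists I : C,
      is_CRInt_gen
        (fun t : R =>
           (bernoulli (2 * N) - bernoulli_poly (2 * N) (t - IZR (Zfloor t)))%R
           / Cpower (t + a) (s + 2 * INR N))
        (at_point 0%R) (Rbar_locally p_infty) I /\
      hurwitz_remainder N s a =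
        pochhammer s (2 * N) / INR (fact (2 * N)) * Cpower a (s - 1) * I)).
Proof.
set (p := s + 2 * INR N - 1).
assert (E2 := RtoC_INR_double N).
assert (E1 : p = s + INR (2 * N - 1)).
{ unfold p. rewrite <- E2. replace (INR (2 * N)) with (INR (2 * N - 1) + 1)%R by (rewrite <- S_INR; f_equal; lia).
  rewrite RtoC_plus. ring. }
assert (Hp : (0 < Re p)%R).
{ rewrite E1, Re_plus_R. assert (h : (INR (2 * N - 1) + 1 = 2 * INR N)%R).
  { rewrite <- S_INR. replace (S (2 * N - 1)) with (2 * N)%nat by lia. now rewrite mult_INR. }
  lra. }
assert (Hp0 : p <> 0) by (intros E; rewrite E in Hp; simpl in Hp; lra).
assert (HPI := C2PI_neq_0).
assert (Main : slit a -> exists T : C,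
  is_Cseries (fun n : nat => let k := INR (n + 1) in terminant p (2 * PI * a * k) / k ^ (2 * N)) T /\
  hurwitz_remainder N s a = (- (1)) ^ (N + 1) * 2 * (pochhammer s (2 * N - 1) / (2 * PI * a) ^ (2 * N)) * T).
{ intros Ha. destruct (em_I_terminant a s N Ha hN hs) as [T [HT ET]]. exists T. split; [exact HT|].
  rewrite (hurwitz_remainder_em a s N Ha hN hs1 hs), ET. fold p.
  unfold em_coef. replace (pochhammer s (2 * N)) with (pochhammer s (2 * N - 1) * p).
  - unfold fourier_const. rewrite !RtoC_mult, RtoC_pow, RtoC_m1.
    replace (s - 1) with (p - INR (2 * N)) by (unfold p; rewrite E2; ring).
    rewrite (Cpower_minus a p), Cpower_INR by exact ha. rewrite (Cpow_mult_l (2 * PI) a).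
    assert (Hpa := Cpower_neq_0 a p). assert (Hf := INR_fact_C (2 * N)).
    assert (Han : a ^ (2 * N) <> 0) by (now apply Cpow_nz). assert (Hpn : (2 * PI) ^ (2 * N) <> 0) by (now apply Cpow_nz).
    field. repeat split; assumption.
  - rewrite E1. replace (2 * N)%nat with (S (2 * N - 1)) at 3 by lia. reflexivity. }
split.
- intros Harg. assert (Hre := Carg_right_inv a ha Harg).
  destruct (Main (or_introl Hre)) as [T [HT ET]].
  exists (Gamma p * T). split; [now apply polylog_integral|].
  rewrite ET. rewrite (rGamma_shift s (2 * N - 1)) by (now rewrite <- E1). rewrite <- E1.
  destruct (Gamma_neq_0_lim p Hp) as [HG _].
  assert (Hb : (2 * PI * a) ^ (2 * N) <> 0) by (apply Cpow_nz; now apply Cmult_neq_0).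
  field. split; assumption.
- intros Harg. assert (Ha := Carg_slit a ha Harg). split; [exact (Main Ha)|].
  exists (em_I a s N). split.
  + apply (Cint_ext _ _ _ int_range_0_infty (em_integrand a s N)); [|now apply em_I_correct].
    intros t _. unfold em_integrand, pw. rewrite Cpower_opp, E2. reflexivity.
  + now apply hurwitz_remainder_em.
Qed.
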